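(* Let $l\ge 1$, let $I\subset\mathbb{R}$ be a compact interval, $\epsilon_0>0$, and let $a_0,\dots,a_l: I\times[0,\epsilon_0]\to\mathbb{C}$ satisfy the standing assumptions (S1)–(S3) of the context. Let $\lambda_1(x),\dots,\lambda_l(x)$ be the roots of the characteristic polynomial $$\sum_{j=0}^l a_j(x,0)\lambda^j=0,$$ and assume they are simple throughout $I$, i.e. (with the $\lambda_m$ chosen to be $C^\infty$ functions on $I$) $$\inf_{x\in I}|\lambda_m(x)-\lambda_n(x)|>0\quad\text{if } m\ne n .$$ Suppose also that $I=\bigcup_{p=1}^P I_p$ is a finite union of closed intervals such that for each $p\le P$ there is a permutation $(i_1,\dots,i_l)$ of $(1,\dots,l)$ with $$|\lambda_{i_1}(x)|\le|\lambda_{i_2}(x)|\le\dots\le|\lambda_{i_l}(x)|\quad\text{for all }x\in I_p .$$ Then there exist $\epsilon'\in(0,\epsilon_0]$ and $l$ functions $F_1,\dots,F_l: I\times[0,\epsilon']\to\mathbb{C}$, $C^\infty$ in each variable, such that for each $\epsilon\in(0,\epsilon']$ the sequences $\{\exp(\epsilon^{-1}F_m(k\epsilon,\epsilon))\}_{m=1,\dots,l}$ form a fundamental set of solutions of $$\sum_{j=0}^l a_j(k\epsilon,\epsilon)\,y_{k+j}=0$$ in the sense that for any solution $y_{k,\epsilon}$ of this recurrence there exist constants $C_1^{(p)},\dots,C_l^{(p)}$ ($p=1,\dots,P$; independent of $k$) such that for each $p$ and all $k$ with $k\epsilon\in I_p$ $$y_{k,\epsilon}=\sum_{m=1}^l 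C_m^{(p)}\exp[\epsilon^{-1}F_m(k\epsilon,\epsilon)].$$
   Context: Standing assumptions. (S1) Each $a_j(x,\epsilon)$ is $C^\infty$ in $x$ and $C^\infty$ in $\epsilon$ on $I\times[0,\epsilon_0]$. (S2) There are $a_{j,s}\in C^\infty(I)$ such that for every $t\in\mathbb{N}$ there is a constant $M_{j,t}$ with $|a_j(x,\epsilon)-\sum_{s=0}^t a_{j,s}(x)\epsilon^s|<M_{j,t}\,\epsilon^{t+1}$ for all $x\in I$ and $\epsilon\in(0,\epsilon_0]$. (S3) $\inf_{x\in I}|a_0(x,0)|>0$ and $\inf_{x\in I}|a_l(x,0)|>0$. For fixed $\epsilon>0$, a solution of the recurrence on an interval $J\subseteq I$ is a complex sequence $y_k$, indexed by the integers $k$ with $k\epsilon\in J$, satisfying the recurrence for every $k$ such that $k\epsilon,(k+1)\epsilon,\dots,(k+l)\epsilon$ all lie in $J$. ''Solution'' without further specification means solution on $I$.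
   Formalization: The intervals I_p are assumed to form a subdivision (two different ones share at most one point), since the claim fails for certain overlapping ones; ''C^∞ in x and in ε'' is read as all mixed partial derivatives existing and being continuous on the closed rectangle. *)

(* Defs.v *)
From Stdlib Require Import Reals ZArith List Permutation.
From Coquelicot Require Import Coquelicot.

Open Scope R_scope.

(* Derivative relative to [lo, hi]: two-sided inside, one-sided at the ends;
   only the values of f on [lo, hi] matter. *)
Definition is_derive_on (lo hi : R) (f : R -> C) (x : R) (d : C) : Prop :=
  filterdiff (K := R_AbsRing) (U := R_NormedModule) (V := C_R_NormedModule)
    f (within (fun t : R => lo <= t <= hi) (locally x))
    (fun h : R => scal h (d : C_R_NormedModule)).

Definition smooth_on (lo hi : R) (f : R -> C) : Prop :=
  exists D : nat -> R -> C,
    (forall x, lo <= x <= hi -> D 0%nat x = f x) /\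
    (forall n x, lo <= x <= hi -> is_derive_on lo hi (D n) x (D (S n) x)).

(* C^infinity on the closed rectangle [lo, hi] x [0, e0]: D i j is the partial
   derivative of order i in x and j in eps; all of them exist and are continuous
   on the rectangle (boundary included, with one-sided derivatives there). *)
Definition smooth_on_rect (lo hi e0 : R) (f : R -> R -> C) : Prop :=
  exists D : nat -> nat -> R -> R -> C,
    (forall x eps, lo <= x <= hi -> 0 <= eps <= e0 -> D 0%nat 0%nat x eps = f x eps) /\
    (forall i j x eps, lo <= x <= hi -> 0 <= eps <= e0 ->
       is_derive_on lo hi (fun t => D i j t eps) x (D (S i) j x eps) /\
       is_derive_on 0 e0 (fun t => D i j x t) eps (D i (S j) x eps) /\
       filterlim (fun q : R * R => D i j (fst q) (snd q))
         (within (fun q : R * R => lo <= fst q <= hi /\ 0 <= snd q <= e0)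
                 (locally ((x, eps) : R * R)))
         (locally (D i j x eps : C_R_NormedModule))).

Definition inf_on (lo hi : R) (g : R -> R) : Rbar :=
  Glb_Rbar (fun r => exists x, lo <= x <= hi /\ r = g x).

(* The last three conjuncts are the uniform asymptotic expansion of each
   coefficient as eps -> 0 and the non-vanishing of the extreme coefficients. *)
Definition standing_assumptions (l : nat) (lo hi e0 : R)
    (a : nat -> R -> R -> C) : Prop :=
  (forall j, (j <= l)%nat -> smooth_on_rect lo hi e0 (a j)) /\
  (forall j, (j <= l)%nat ->
     exists as_ : nat -> R -> C,
       (forall s, smooth_on lo hi (as_ s)) /\
       (forall t : nat, exists M : R, forall x eps,
          lo <= x <= hi -> 0 < eps <= e0 ->
          Cmod (a j x eps - sum_n (fun s => as_ s x * RtoC (eps ^ s))%C t)%C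
            < M * eps ^ (t + 1))) /\
  Rbar_lt 0 (inf_on lo hi (fun x => Cmod (a 0%nat x 0))) /\
  Rbar_lt 0 (inf_on lo hi (fun x => Cmod (a l x 0))).

Definition char_poly (l : nat) (a : nat -> R -> R -> C) (x : R) (z : C) : C :=
  sum_n (fun j => a j x 0 * Cpow z j)%C l.

Definition Cexp (z : C) : C := (exp (fst z) * cos (snd z), exp (fst z) * sin (snd z)).

(* A sequence is a total function on Z; only its values at the k with
   k * eps in [lo, hi] are constrained. *)
Definition solution_on (l : nat) (a : nat -> R -> R -> C) (eps lo hi : R)
    (y : Z -> C) : Prop :=
  forall k : Z,
    (forall j, (j <= l)%nat -> lo <= IZR (k + Z.of_nat j) * eps <= hi) ->
    sum_n (fun j => a j (IZR k * eps)%R eps * y (k + Z.of_nat j)%Z)%C l = RtoC 0.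

Definition wkb_seq (F : R -> R -> C) (eps : R) (k : Z) : C :=
  Cexp (RtoC (/ eps) * F (IZR k * eps)%R eps)%C.

(* The Y m (1 <= m <= l) are a fundamental set relative to the pieces
   [lft p, rgt p], 1 <= p <= P, of [lo, hi]: each Y m solves the recurrence on
   every piece, and every solution on [lo, hi] is on each piece a combination
   of the Y m, with coefficients that may depend on the piece. *)
Definition fundamental_set (l : nat) (a : nat -> R -> R -> C) (eps lo hi : R)
    (P : nat) (lft rgt : nat -> R) (Y : nat -> Z -> C) : Prop :=
  (forall m p, (1 <= m <= l)%nat -> (1 <= p <= P)%nat ->
     solution_on l a eps (lft p) (rgt p) (Y m)) /\
  (forall y : Z -> C, solution_on l a eps lo hi y ->
     exists K : nat -> nat -> C,
       forall (p : nat) (k : Z), (1 <= p <= P)%nat ->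
         lft p <= IZR k * eps <= rgt p ->
         y k = sum_n_m (fun m => K p m * Y m k)%C 1 l).

(* Main.v *)
Require Import Defs.
From Stdlib Require Import Reals ZArith List Permutation.
From Coquelicot Require Import Coquelicot.
From Stdlib Require Import Lra Lia FunctionalExtensionality ClassicalEpsilon.

Open Scope R_scope.

(* Formal solutions: substituting exp(F(k eps, eps)/eps) turns the recurrence into
   sum_j a_j exp((F(x + j eps, eps) - F(x, eps))/eps) = 0, which is solved to all orders in eps
   with F_x(x, 0) = log lambda_m(x); Borel summation gives a smooth F_m whose residual is flat at
   eps = 0.  On a piece where the moduli |lambda_n| are ordered, an exact solution
   exp(F_m/eps) (1 + delta) is found by a contraction: delta solves a discrete Green equation, the
   mode n being summed from the left end of the piece if |lambda_n| <= |lambda_m| there and from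
   the right end otherwise, so that the kernel stays bounded; delta inherits the flatness of the
   residual.  The set of lattice points in a piece changes with eps, so this is done separately on
   overlapping windows |kap/eps - i| < 2 in which the lattice shifts by less than one point; the
   corrections of different pieces are multiplied, and those of different windows and lattice
   points are joined by bump functions in kap/eps and x/eps.  Derivatives cost only powers of
   1/eps, which flatness absorbs, so the result is a smooth function, and its logarithm times eps
   is added to F_m.  The l sequences span the solutions on each piece because at l consecutive
   lattice points they form a perturbed Vandermonde matrix. *)

(** * Families of functions with all derivatives polynomially bounded or flat *)

(** Moduli may coincide, so no gap separates the modes: mode n relative to mode m is weighted by
    exp(Re(phase difference)/eps), and only monotonicity of that real part, true up to O(eps) along
    a piece, bounds it. The equation for delta is a contraction because its kernel has row sums
    O(eps): the part near the diagonal vanishes at eps = 0 by Lagrange's identity, the sum over n of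
    P(z) / ((z - lambda_n) P'(lambda_n)) being 1, and the rest contains the flat residuals. A change
    of ordering reverses directions of summation, so the pieces cannot be treated at once; instead
    each correction is continued by a constant past the ends of its piece, which a linear recurrence
    does not notice. Linearity is also the reason to interpolate 1 + delta and not its logarithm
    between windows: weights depending on eps alone turn solutions into solutions. All derivatives
    must be controlled uniformly over sets of lattice points that grow like 1/eps; hence families
    indexed by window and lattice number, in classes closed under products, under sums of O(1/eps)
    terms and under exponentials whose exponent has real part bounded above. *)

Lemma is_derive_Rplus (f g : R -> R) x a b :
  is_derive f x a -> is_derive g x b -> is_derive (fun t => f t + g t) x (a + b).
Proof. exact (is_derive_plus f g x a b). Qed.

Lemma is_derive_Rmult (f g : R -> R) x a b :
  is_derive f x a -> is_derive g x b ->
  is_derive (fun t => f t * g t) x (a * g x + f x * b).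
Proof. intros F G. exact (is_derive_mult f g x a b F G Rmult_comm). Qed.

Lemma is_derive_Rconst (c x : R) : is_derive (fun _ : R => c) x 0.
Proof. exact (is_derive_const c x). Qed.

Lemma is_derive_Rid (x : R) : is_derive (fun t : R => t) x 1.
Proof. exact (is_derive_id x). Qed.

Lemma is_derive_Rcomp (f g : R -> R) x a b :
  is_derive f (g x) a -> is_derive g x b -> is_derive (fun t => f (g t)) x (a * b).
Proof. intros F G. rewrite Rmult_comm. exact (is_derive_comp f g x a b F G). Qed.

Lemma locally_far A (x : R) : A < Rabs x -> locally x (fun t => A < Rabs t).
Proof.
  intros h. assert (e0 : 0 < Rabs x - A) by lra. exists (mkposreal _ e0).
  assert (E : forall t : R, Rabs (t - x) < Rabs x - A -> A < Rabs t).
  { intros t Ht. pose proof (Rabs_triang_inv x (x - t)) as T.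
    rewrite Rabs_minus_sym in Ht. replace (x - (x - t)) with t in T by ring. lra. }
  intros t Ht. apply E, Ht.
Qed.

(* A family f i x y, with x ranging over R and y over the open set Om i, is measured against a
   weight W i >= 1 that stands for 1/eps: the flag false means bounded by some power of W, true
   means flat, i.e. smaller than every negative power. *)
Section Families.
Context {I : Type}.

Definition dx (f : I -> R -> R -> R) : I -> R -> R -> R :=
  fun i x y => Derive (fun t => f i t y) x.
Definition dy (f : I -> R -> R -> R) : I -> R -> R -> R :=
  fun i x y => Derive (fun t => f i x t) y.

Variables (W : I -> R) (Om : I -> R -> Prop).

Definition bnd (fl : bool) (f : I -> R -> R -> R) : Prop :=
  if fl
  then forall q : nat, exists C, forall i x y, Om i y -> Rabs (f i x y) * W i ^ q <= C
  else exists (q : nat) (C : R), forall i x y, Om i y -> Rabs (f i x y) <= C * W i ^ q.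

(** All words in [dx] and [dy] of length at most n are controlled, so mixed derivatives never have
    to be commuted here. [Derive] is total, so membership is a property of f alone and carries no
    derivative data. The order n is explicit because most closure proofs are inductions on it. *)
Fixpoint Sm (fl : bool) (n : nat) (f : I -> R -> R -> R) : Prop :=
  bnd fl f /\
  match n with
  | O => True
  | S n' => (forall i x y, Om i y ->
               ex_derive (fun t => f i t y) x /\ ex_derive (fun t => f i x t) y) /\
            Sm fl n' (dx f) /\ Sm fl n' (dy f)
  end.

Definition CF (fl : bool) (f : I -> R -> R -> R) : Prop := forall n, Sm fl n f.

(** Openness in y makes [dy] depend only on the values over [Om i]; x ranges over all of R and needs
    no such condition. The lower bound makes powers of W increasing, so growth exponents can be
    added. *)
Class frame : Prop := {
  W1 : forall i, 1 <= W i;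
  Oop : forall i y, Om i y -> locally y (Om i) }.

End Families.

Arguments W1 {I W Om _} i.
Arguments Oop {I W Om _} i y _.

Section Classes.
Context {I : Type} {W : I -> R} {Om : I -> R -> Prop} {FR : frame W Om}.

Local Notation bnd := (bnd W Om).
Local Notation Sm := (Sm W Om).
Local Notation CF := (CF W Om).

Lemma Wpow_ge1 i q : 1 <= W i ^ q.
Proof. apply pow_R1_Rle, W1. Qed.

Lemma bnd_ext fl f g :
  (forall i x y, Om i y -> f i x y = g i x y) -> bnd fl f -> bnd fl g.
Proof.
  intros E. destruct fl; simpl.
  - intros H q. destruct (H q) as [C HC]. exists C. intros i x y O. rewrite <- E by exact O. auto.
  - intros (q & C & HC). exists q, C. intros i x y O. rewrite <- E by exact O. auto.
Qed.

Lemma locally_eq_y (f g : I -> R -> R -> R) i x y :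
  (forall i x y, Om i y -> f i x y = g i x y) -> Om i y ->
  locally y (fun t => f i x t = g i x t).
Proof.
  intros E O. generalize (Oop i y O). apply filter_imp. intros t Ht. apply E, Ht.
Qed.

Lemma dx_ext f g :
  (forall i x y, Om i y -> f i x y = g i x y) ->
  (forall i x y, Om i y -> dx f i x y = dx g i x y).
Proof.
  intros E i x y O. unfold dx. apply Derive_ext. intros t. now apply E.
Qed.

Lemma dy_ext f g :
  (forall i x y, Om i y -> f i x y = g i x y) ->
  (forall i x y, Om i y -> dy f i x y = dy g i x y).
Proof.
  intros E i x y O. unfold dy. apply Derive_ext_loc. now apply locally_eq_y.
Qed.

Lemma Sm_ext fl n f g :
  (forall i x y, Om i y -> f i x y = g i x y) -> Sm fl n f -> Sm fl n g.
Proof.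
  revert f g. induction n as [|n IH]; intros f g E; simpl.
  - intros [H _]. split; [eapply bnd_ext; eauto|exact Logic.I].
  - intros (H & D & X & Y). split; [eapply bnd_ext; eauto|]. split; [|split].
    + intros i x y O. destruct (D i x y O) as [D1 D2]. split.
      * eapply ex_derive_ext; [|exact D1]. intros t. now apply E.
      * eapply ex_derive_ext_loc; [|exact D2]. now apply locally_eq_y.
    + eapply IH; [|exact X]. now apply dx_ext.
    + eapply IH; [|exact Y]. now apply dy_ext.
Qed.

Lemma Sm_bnd fl n f : Sm fl n f -> bnd fl f.
Proof. destruct n; simpl; tauto. Qed.

Lemma Sm_pred fl n f : Sm fl (S n) f -> Sm fl n f.
Proof.
  revert f. induction n as [|n IH]; intros f H.
  - destruct H as [H _]. split; [exact H|exact Logic.I].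
  - destruct H as (H & D & X & Y). split; [exact H|]. split; [exact D|].
    split; apply IH; assumption.
Qed.

Lemma CF_ext fl f g :
  (forall i x y, Om i y -> f i x y = g i x y) -> CF fl f -> CF fl g.
Proof. intros E H n. eapply Sm_ext; eauto. Qed.

(** Derivatives are supplied by a formula and identified with [dx] and [dy] by uniqueness; most
    closure properties below go through this lemma. *)
Lemma Sm_intro fl n h hx hy :
  bnd fl h ->
  (forall i x y, Om i y ->
     is_derive (fun t => h i t y) x (hx i x y) /\ is_derive (fun t => h i x t) y (hy i x y)) ->
  Sm fl n hx -> Sm fl n hy -> Sm fl (S n) h.
Proof.
  intros B D X Y. simpl. split; [exact B|]. split; [|split].
  - intros i x y O. destruct (D i x y O). split; eexists; eassumption.
  - eapply Sm_ext; [|exact X]. intros i x y O. destruct (D i x y O) as [D1 _].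
    symmetry. unfold dx. now apply is_derive_unique.
  - eapply Sm_ext; [|exact Y]. intros i x y O. destruct (D i x y O) as [_ D1].
    symmetry. unfold dy. now apply is_derive_unique.
Qed.

Lemma CF_bnd fl f : CF fl f -> bnd fl f.
Proof. intros H. exact (Sm_bnd _ _ _ (H O)). Qed.

Lemma CF_dx fl f : CF fl f -> CF fl (dx f).
Proof. intros H n. destruct (H (S n)) as (_ & _ & X & _). exact X. Qed.

Lemma CF_dy fl f : CF fl f -> CF fl (dy f).
Proof. intros H n. destruct (H (S n)) as (_ & _ & _ & X). exact X. Qed.

Lemma Sm_is_derive fl n f : Sm fl (S n) f -> forall i x y, Om i y ->
  is_derive (fun t => f i t y) x (dx f i x y) /\ is_derive (fun t => f i x t) y (dy f i x y).
Proof.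
  intros (_ & D & _) i x y O. destruct (D i x y O). split; now apply Derive_correct.
Qed.

Lemma CF_is_derive fl f : CF fl f -> forall i x y, Om i y ->
  is_derive (fun t => f i t y) x (dx f i x y) /\ is_derive (fun t => f i x t) y (dy f i x y).
Proof. intros H. exact (Sm_is_derive _ _ _ (H 1%nat)). Qed.

Lemma bnd_const_false c : bnd false (fun _ _ _ => c).
Proof.
  exists O, (Rabs c). intros. simpl. lra.
Qed.

Lemma Sm_zero fl n : Sm fl n (fun _ _ _ => 0).
Proof.
  induction n.
  - simpl. split; [|exact Logic.I]. destruct fl.
    + intros q. exists 0. intros. rewrite Rabs_R0. lra.
    + apply bnd_const_false.
  - eapply (Sm_intro fl n _ (fun _ _ _ => 0) (fun _ _ _ => 0)); try assumption.
    + exact (Sm_bnd _ _ _ IHn).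
    + intros. split; apply is_derive_Rconst.
Qed.

Lemma CF_const c : CF false (fun _ _ _ => c).
Proof.
  intros n. destruct n.
  - simpl. split; [apply bnd_const_false|exact Logic.I].
  - eapply (Sm_intro false n _ (fun _ _ _ => 0) (fun _ _ _ => 0)); try apply Sm_zero.
    + apply bnd_const_false.
    + intros. split; apply is_derive_Rconst.
Qed.

Lemma bnd_plus fl f g : bnd fl f -> bnd fl g -> bnd fl (fun i x y => f i x y + g i x y).
Proof.
  destruct fl; simpl.
  - intros F G q. destruct (F q) as [C HC], (G q) as [D HD]. exists (C + D).
    intros i x y O. specialize (HC i x y O). specialize (HD i x y O).
    pose proof (Wpow_ge1 i q). pose proof (Rabs_triang (f i x y) (g i x y)). nra.
  - intros (q & C & HC) (p & D & HD). exists (q + p)%nat, (Rabs C + Rabs D).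
    intros i x y O. specialize (HC i x y O). specialize (HD i x y O).
    pose proof (Wpow_ge1 i q). pose proof (Wpow_ge1 i p).
    pose proof (Rabs_triang (f i x y) (g i x y)). rewrite pow_add.
    pose proof (Rle_abs C). pose proof (Rle_abs D).
    pose proof (Rabs_pos C). pose proof (Rabs_pos D).
    assert (C * W i ^ q <= Rabs C * (W i ^ q * W i ^ p)).
    { apply Rle_trans with (Rabs C * W i ^ q); [nra|].
      apply Rmult_le_compat_l; [lra|]. nra. }
    assert (D * W i ^ p <= Rabs D * (W i ^ q * W i ^ p)).
    { apply Rle_trans with (Rabs D * W i ^ p); [nra|].
      apply Rmult_le_compat_l; [lra|]. nra. }
    nra.
Qed.

Lemma Sm_plus fl n f g : Sm fl n f -> Sm fl n g -> Sm fl n (fun i x y => f i x y + g i x y).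
Proof.
  revert f g. induction n as [|n IH]; intros f g F G.
  - destruct F, G. split; [now apply bnd_plus|exact Logic.I].
  - apply (Sm_intro fl n _ (fun i x y => dx f i x y + dx g i x y)
             (fun i x y => dy f i x y + dy g i x y)).
    + apply bnd_plus; eapply Sm_bnd; eassumption.
    + intros i x y O. destruct (Sm_is_derive _ _ _ F i x y O), (Sm_is_derive _ _ _ G i x y O).
      split; apply is_derive_Rplus; assumption.
    + apply IH; [apply F|apply G].
    + apply IH; [apply F|apply G].
Qed.

Lemma CF_plus fl f g : CF fl f -> CF fl g -> CF fl (fun i x y => f i x y + g i x y).
Proof. intros F G n. apply Sm_plus; auto. Qed.

(** In the flat case the bound of f for the exponent q + p is spent: p powers of W absorb the growth
    of g and q remain. *)
Lemma bnd_mult fl f g : bnd fl f -> bnd false g -> bnd fl (fun i x y => f i x y * g i x y).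
Proof.
  destruct fl; simpl.
  - intros F (p & D & HD) q. destruct (F (q + p)%nat) as [C HC]. exists (C * Rabs D).
    intros i x y O. specialize (HC i x y O). specialize (HD i x y O).
    rewrite Rabs_mult. rewrite pow_add in HC.
    pose proof (Wpow_ge1 i q). pose proof (Wpow_ge1 i p).
    pose proof (Rabs_pos (f i x y)). pose proof (Rle_abs D). pose proof (Rabs_pos D).
    apply Rle_trans with (Rabs (f i x y) * (Rabs D * W i ^ p) * W i ^ q).
    { apply Rmult_le_compat_r; [lra|]. apply Rmult_le_compat_l; [lra|]. nra. }
    apply Rle_trans with ((Rabs (f i x y) * (W i ^ q * W i ^ p)) * Rabs D); [right; ring|].
    apply Rmult_le_compat_r; lra.
  - intros (q & C & HC) (p & D & HD). exists (q + p)%nat, (C * D).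
    intros i x y O. specialize (HC i x y O). specialize (HD i x y O).
    rewrite Rabs_mult, pow_add.
    replace (C * D * (W i ^ q * W i ^ p)) with ((C * W i ^ q) * (D * W i ^ p)) by ring.
    apply Rmult_le_compat; auto using Rabs_pos.
Qed.

(** Stated at a fixed order, since the bootstrapping proofs for exponentials, inverses and
    compositions know one factor only to the order reached so far. *)
Lemma Sm_mult fl n f g : Sm fl n f -> Sm false n g -> Sm fl n (fun i x y => f i x y * g i x y).
Proof.
  revert f g. induction n as [|n IH]; intros f g F G.
  - destruct F, G. split; [now apply bnd_mult|exact Logic.I].
  - apply (Sm_intro fl n _ (fun i x y => dx f i x y * g i x y + f i x y * dx g i x y)
             (fun i x y => dy f i x y * g i x y + f i x y * dy g i x y)).
    + apply bnd_mult; eapply Sm_bnd; eassumption.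
    + intros i x y O. destruct (Sm_is_derive _ _ _ F i x y O), (Sm_is_derive _ _ _ G i x y O).
      split;
        [apply (is_derive_Rmult (fun t => f i t y) (fun t => g i t y))
        |apply (is_derive_Rmult (fun t => f i x t) (fun t => g i x t))]; assumption.
    + apply Sm_plus; apply IH; try apply F; try apply G; now apply Sm_pred.
    + apply Sm_plus; apply IH; try apply F; try apply G; now apply Sm_pred.
Qed.

Lemma CF_mult fl f g : CF fl f -> CF false g -> CF fl (fun i x y => f i x y * g i x y).
Proof. intros F G n. apply Sm_mult; auto. Qed.

Lemma CF_scal fl c f : CF fl f -> CF fl (fun i x y => c * f i x y).
Proof.
  intros F. eapply CF_ext; [|apply (CF_mult fl f (fun _ _ _ => c) F), CF_const].
  intros; simpl; ring.
Qed.

Lemma CF_opp fl f : CF fl f -> CF fl (fun i x y => - f i x y).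
Proof.
  intros F. eapply CF_ext; [|apply (CF_scal fl (-1) f F)]. intros; simpl; ring.
Qed.

Lemma CF_minus fl f g : CF fl f -> CF fl g -> CF fl (fun i x y => f i x y - g i x y).
Proof. intros F G. apply (CF_plus fl f _ F), CF_opp, G. Qed.

Lemma CF_pow f n : CF false f -> CF false (fun i x y => f i x y ^ n).
Proof.
  intros F. induction n; simpl.
  - apply CF_const.
  - now apply CF_mult.
Qed.

Lemma bnd_weaken f : bnd true f -> bnd false f.
Proof.
  intros H. destruct (H O) as [C HC]. exists O, C. intros i x y O.
  specialize (HC i x y O). simpl in *. lra.
Qed.

Lemma CF_weaken f : CF true f -> CF false f.
Proof.
  intros H n. specialize (H n). revert f H. induction n as [|n IH]; intros f.
  - intros [H _]. split; [now apply bnd_weaken|exact Logic.I].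
  - intros (H & D & X & Y). split; [now apply bnd_weaken|]. split; [exact D|].
    split; now apply IH.
Qed.

Lemma CF_mult_r fl f g : CF false f -> CF fl g -> CF fl (fun i x y => f i x y * g i x y).
Proof.
  intros F G. eapply CF_ext; [|apply (CF_mult fl g f G F)]. intros; simpl; ring.
Qed.

Lemma CF_of_derivs fl h hx hy :
  bnd fl h ->
  (forall i x y, Om i y ->
     is_derive (fun t => h i t y) x (hx i x y) /\ is_derive (fun t => h i x t) y (hy i x y)) ->
  CF fl hx -> CF fl hy -> CF fl h.
Proof.
  intros B D X Y n. destruct n.
  - split; [exact B|exact Logic.I].
  - eapply Sm_intro; eauto.
Qed.

(** A bootstrap: the derivative of exp f is exp f times that of f, so order n gives order n + 1.
    Only an upper bound on f is needed; f itself may grow like a power of W, as phases divided by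
    eps do. *)
Lemma CF_exp f M : CF false f -> (forall i x y, Om i y -> f i x y <= M) ->
  CF false (fun i x y => exp (f i x y)).
Proof.
  intros F HM.
  assert (B : bnd false (fun i x y => exp (f i x y))).
  { exists O, (exp M). intros i x y O. rewrite Rabs_pos_eq by (left; apply exp_pos).
    simpl. rewrite Rmult_1_r. destruct (Rle_lt_or_eq_dec _ _ (HM i x y O)) as [h|h].
    - left. now apply exp_increasing.
    - right. now rewrite h. }
  intros n. induction n as [|n IH].
  - split; [exact B|exact Logic.I].
  - apply (Sm_intro false n _ (fun i x y => exp (f i x y) * dx f i x y)
             (fun i x y => exp (f i x y) * dy f i x y)); try assumption.
    + intros i x y O. destruct (CF_is_derive _ _ F i x y O) as [D1 D2].
      split; [apply (is_derive_Rcomp exp (fun t => f i t y))|apply (is_derive_Rcomp exp (fun t => f i x t))];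
        try assumption; apply is_derive_exp.
    + apply Sm_mult; [exact IH|]. apply CF_dx, F.
    + apply Sm_mult; [exact IH|]. apply CF_dy, F.
Qed.

(** The same bootstrap with (1/f)' = - (1/f)^2 f'. The bound on 1/f may grow with W, which covers f
    = y, where 1/y is at most of the order of W. *)
Lemma CF_inv_gen f : CF false f -> (forall i x y, Om i y -> f i x y <> 0) ->
  bnd false (fun i x y => / f i x y) -> CF false (fun i x y => / f i x y).
Proof.
  intros F N B n. induction n as [|n IH].
  - split; [exact B|exact Logic.I].
  - apply (Sm_intro false n _ (fun i x y => (/ f i x y * / f i x y) * (-1 * dx f i x y))
             (fun i x y => (/ f i x y * / f i x y) * (-1 * dy f i x y))); try assumption.
    + intros i x y O. destruct (CF_is_derive _ _ F i x y O) as [D1 D2].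
      specialize (N i x y O).
      split.
      * replace (/ f i x y * / f i x y * (-1 * dx f i x y)) with (- dx f i x y / f i x y ^ 2)
          by (field; exact N).
        apply (is_derive_inv (fun t => f i t y)); assumption.
      * replace (/ f i x y * / f i x y * (-1 * dy f i x y)) with (- dy f i x y / f i x y ^ 2)
          by (field; exact N).
        apply (is_derive_inv (fun t => f i x t)); assumption.
    + apply Sm_mult; [apply Sm_mult; exact IH|]. apply CF_scal, CF_dx, F.
    + apply Sm_mult; [apply Sm_mult; exact IH|]. apply CF_scal, CF_dy, F.
Qed.

Lemma CF_inv f c : 0 < c -> CF false f -> (forall i x y, Om i y -> c <= Rabs (f i x y)) ->
  CF false (fun i x y => / f i x y).
Proof.
  intros c0 F HM. apply CF_inv_gen; [assumption| |].
  - intros i x y O E. specialize (HM i x y O). rewrite E, Rabs_R0 in HM. lra.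
  - exists O, (/ c). intros i x y O. rewrite Rabs_inv.
    simpl. rewrite Rmult_1_r. apply Rinv_le_contravar; auto.
Qed.

Lemma CF_ln_flat fl f c : 0 < c -> CF false f -> (forall i x y, Om i y -> c <= f i x y) ->
  bnd fl (fun i x y => ln (f i x y)) -> CF fl (dx f) -> CF fl (dy f) ->
  CF fl (fun i x y => ln (f i x y)).
Proof.
  intros c0 F HM B X Y.
  assert (V : CF false (fun i x y => / f i x y)).
  { apply (CF_inv f c c0 F). intros i x y O. specialize (HM i x y O). rewrite Rabs_pos_eq; lra. }
  apply (CF_of_derivs fl _ (fun i x y => dx f i x y * / f i x y)
           (fun i x y => dy f i x y * / f i x y)); try assumption.
  - intros i x y O. destruct (CF_is_derive _ _ F i x y O) as [D1 D2].
    specialize (HM i x y O).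
    rewrite (Rmult_comm (dx f i x y)), (Rmult_comm (dy f i x y)).
    split; [apply (is_derive_Rcomp ln (fun t => f i t y))|apply (is_derive_Rcomp ln (fun t => f i x t))];
      try assumption; apply is_derive_ln; lra.
  - now apply CF_mult.
  - now apply CF_mult.
Qed.

Lemma CF_ln f c : 0 < c -> CF false f -> (forall i x y, Om i y -> c <= f i x y) ->
  CF false (fun i x y => ln (f i x y)).
Proof.
  intros c0 F HM. apply (CF_ln_flat false f c); try assumption.
  - destruct (CF_bnd _ _ F) as (q & C & HC).
    exists q, (Rabs (ln c) + Rabs C). intros i x y O.
    specialize (HM i x y O). specialize (HC i x y O). pose proof (Wpow_ge1 i q).
    (* ln f lies between the constant ln c and f itself, since exp t >= 1 + t. *)
    assert (L1 : ln c <= ln (f i x y)).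
    { destruct (Rle_lt_or_eq_dec _ _ HM) as [h|h]; [left; apply ln_increasing; lra|right; now rewrite h]. }
    assert (L2 : ln (f i x y) <= f i x y).
    { pose proof (exp_ineq1_le (ln (f i x y))) as E. rewrite exp_ln in E by lra. lra. }
    rewrite Rabs_pos_eq in HC by lra.
    pose proof (Rle_abs C). pose proof (Rabs_pos C). pose proof (Rabs_pos (ln c)).
    pose proof (Rabs_maj2 (ln c)).
    apply Rabs_le. split; nra.
  - now apply CF_dx.
  - now apply CF_dy.
Qed.

Lemma CF_atan_flat fl f : CF fl f -> CF fl (fun i x y => atan (f i x y)).
Proof.
  intros F0. assert (F : CF false f) by (destruct fl; [now apply CF_weaken|assumption]).
  assert (V : CF false (fun i x y => / (1 + f i x y ^ 2))).
  { apply (CF_inv _ 1); [lra| |].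
    - apply CF_plus; [apply CF_const|now apply CF_pow].
    - intros i x y O. pose proof (pow2_ge_0 (f i x y)). rewrite Rabs_pos_eq; lra. }
  (* Because atan 0 = 0, this keeps flatness, which the bound by pi/2 would lose. *)
  assert (A : forall u, Rabs (atan u) <= Rabs u).
  { intros u. destruct (MVT_gen atan 0 u (fun t => / (1 + t ^ 2))) as (s & _ & Hs).
    - intros t _. apply is_derive_Reals, derivable_pt_lim_atan.
    - intros t _. apply derivable_continuous_pt, derivable_pt_atan.
    - rewrite atan_0, !Rminus_0_r in Hs. rewrite Hs, Rabs_mult.
      pose proof (pow2_ge_0 s). pose proof (Rabs_pos u).
      assert (Rabs (/ (1 + s ^ 2)) <= 1).
      { rewrite Rabs_inv, Rabs_pos_eq by lra. rewrite <- Rinv_1. apply Rinv_le_contravar; lra. }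
      nra. }
  assert (B : bnd fl (fun i x y => atan (f i x y))).
  { destruct fl.
    - intros q. destruct (CF_bnd _ _ F0 q) as [C HC]. exists C. intros i x y O.
      specialize (HC i x y O). pose proof (Wpow_ge1 i q). pose proof (A (f i x y)). nra.
    - destruct (CF_bnd _ _ F0) as (q & C & HC). exists q, C. intros i x y O.
      eapply Rle_trans; [apply A|auto]. }
  apply (CF_of_derivs fl _ (fun i x y => dx f i x y * / (1 + f i x y ^ 2))
           (fun i x y => dy f i x y * / (1 + f i x y ^ 2))); try assumption.
  - intros i x y O. destruct (CF_is_derive _ _ F i x y O) as [D1 D2].
    rewrite (Rmult_comm (dx f i x y)), (Rmult_comm (dy f i x y)).
    split; [apply (is_derive_Rcomp atan (fun t => f i t y))|apply (is_derive_Rcomp atan (fun t => f i x t))];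
      try assumption; apply is_derive_Reals, derivable_pt_lim_atan.
  - apply CF_mult; [now apply CF_dx|assumption].
  - apply CF_mult; [now apply CF_dy|assumption].
Qed.

Lemma bnd_le1 f : (forall i x y, Rabs (f i x y) <= 1) -> bnd false f.
Proof. intros H. exists O, 1. intros. simpl. rewrite Rmult_1_r. apply H. Qed.

Lemma CF_cos_sin f : CF false f ->
  CF false (fun i x y => cos (f i x y)) /\ CF false (fun i x y => sin (f i x y)).
Proof.
  intros F.
  assert (Bc : bnd false (fun i x y => cos (f i x y))).
  { apply bnd_le1. intros. apply Rabs_le, COS_bound. }
  assert (Bs : bnd false (fun i x y => sin (f i x y))).
  { apply bnd_le1. intros. apply Rabs_le, SIN_bound. }
  assert (A : forall n, Sm false n (fun i x y => cos (f i x y)) /\ Sm false n (fun i x y => sin (f i x y))).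
  { intros n. induction n as [|n [IH1 IH2]].
    - split; split; try assumption; exact Logic.I.
    - assert (S1 : Sm false n (fun i x y => - sin (f i x y))).
      { eapply Sm_ext; [|apply (Sm_mult false n _ (fun _ _ _ => -1) IH2), CF_const]. intros; simpl; ring. }
      split.
      + apply (Sm_intro false n _ (fun i x y => - sin (f i x y) * dx f i x y)
                 (fun i x y => - sin (f i x y) * dy f i x y)); try assumption.
        * intros i x y O. destruct (CF_is_derive _ _ F i x y O) as [D1 D2].
          split; [apply (is_derive_Rcomp cos (fun t => f i t y))|apply (is_derive_Rcomp cos (fun t => f i x t))];
            try assumption; apply is_derive_cos.
        * apply Sm_mult; [assumption|apply CF_dx, F].
        * apply Sm_mult; [assumption|apply CF_dy, F].
      + apply (Sm_intro false n _ (fun i x y => cos (f i x y) * dx f i x y)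
                 (fun i x y => cos (f i x y) * dy f i x y)); try assumption.
        * intros i x y O. destruct (CF_is_derive _ _ F i x y O) as [D1 D2].
          split; [apply (is_derive_Rcomp sin (fun t => f i t y))|apply (is_derive_Rcomp sin (fun t => f i x t))];
            try assumption; apply is_derive_sin.
        * apply Sm_mult; [assumption|apply CF_dx, F].
        * apply Sm_mult; [assumption|apply CF_dy, F]. }
  split; intros n; apply A.
Qed.

Lemma CF_index (c : I -> R) q C : (forall i y, Om i y -> Rabs (c i) <= C * W i ^ q) ->
  CF false (fun i _ _ => c i).
Proof.
  intros H. apply (CF_of_derivs false _ (fun _ _ _ => 0) (fun _ _ _ => 0)); try apply CF_const.
  - exists q, C. intros i x y O. eauto.
  - intros. split; apply is_derive_Rconst.
Qed.

Lemma CF_y C : (forall i y, Om i y -> Rabs y <= C) -> CF false (fun _ _ y => y).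
Proof.
  intros H. apply (CF_of_derivs false _ (fun _ _ _ => 0) (fun _ _ _ => 1)); try apply CF_const.
  - exists O, C. intros i x y O. simpl. rewrite Rmult_1_r. eauto.
  - intros. split; [apply is_derive_Rconst|apply is_derive_Rid].
Qed.

(** The coordinate x is unbounded and so not in the class; a factor supported in |x| <= A repairs
    this. The support condition passes to derivatives because |x| > A is open. *)
Lemma CF_xmul f A : CF false f -> (forall i x y, Om i y -> A < Rabs x -> f i x y = 0) ->
  CF false (fun i x y => x * f i x y).
Proof.
  intros F H n. revert f F H. induction n as [|n IH]; intros f F H.
  all: assert (B : bnd false (fun i x y => x * f i x y)) by
    (destruct (CF_bnd _ _ F) as (q & C & HC); exists q, (Rabs A * C); intros i x y O;
     rewrite Rabs_mult; specialize (HC i x y O); pose proof (Wpow_ge1 i q);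
     destruct (Rlt_or_le A (Rabs x)) as [h|h];
     [rewrite (H i x y O h), Rabs_R0, Rmult_0_r;
      rewrite (H i x y O h), Rabs_R0 in HC; pose proof (Rabs_pos A); nra
     |pose proof (Rle_abs A); pose proof (Rabs_pos (f i x y)); pose proof (Rabs_pos x);
      rewrite Rmult_assoc; apply Rmult_le_compat; lra]).
  - split; [exact B|exact Logic.I].
  - assert (Z : forall i x y, Om i y -> A < Rabs x -> locally x (fun t => f i t y = 0)).
    { intros i x y O h. generalize (locally_far A x h). apply filter_imp. intros t Ht. now apply H. }
    apply (Sm_intro false n _ (fun i x y => f i x y + x * dx f i x y)
             (fun i x y => x * dy f i x y)); try assumption.
    + intros i x y O. destruct (CF_is_derive _ _ F i x y O) as [D1 D2]. split.
      * replace (f i x y + x * dx f i x y) with (1 * f i x y + x * dx f i x y) by ring.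
        apply (is_derive_Rmult (fun t => t) (fun t => f i t y)); [apply is_derive_Rid|assumption].
      * replace (x * dy f i x y) with (0 * f i x y + x * dy f i x y) by ring.
        apply (is_derive_Rmult (fun t => x) (fun t => f i x t)); [apply is_derive_Rconst|assumption].
    + apply Sm_plus; [apply F|]. apply IH; [now apply CF_dx|].
      intros i x y O h. unfold dx. rewrite (Derive_ext_loc _ (fun _ => 0)); [apply Derive_const|].
      now apply Z.
    + apply IH; [now apply CF_dy|].
      intros i x y O h. unfold dy. rewrite (Derive_ext_loc _ (fun _ => 0)); [apply Derive_const|].
      generalize (Oop i y O). apply filter_imp. intros t Ht. now apply H.
Qed.

End Classes.

Lemma CF_reindex {I J} {WI : I -> R} {OI : I -> R -> Prop} {WJ : J -> R} {OJ : J -> R -> Prop}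
  (r : I -> J) fl f :
  (forall i y, OI i y -> OJ (r i) y) -> (forall i, WI i = WJ (r i)) ->
  CF WJ OJ fl f -> CF WI OI fl (fun i => f (r i)).
Proof.
  intros HO HW F n. specialize (F n). revert f F. induction n as [|n IH]; intros f F.
  all: assert (B : bnd WI OI fl (fun i => f (r i))) by
    (destruct fl;
     [intros q; destruct (Sm_bnd _ _ _ F q) as [C HC]; exists C; intros i x y O; rewrite HW; auto
     |destruct (Sm_bnd _ _ _ F) as (q & C & HC); exists q, C; intros i x y O; rewrite HW; auto]).
  - split; [exact B|exact Logic.I].
  - destruct F as (_ & D & X & Y). split; [exact B|]. split; [|split].
    + intros i x y O. apply D, HO, O.
    + exact (IH _ X).
    + exact (IH _ Y).
Qed.

(** Each branch is controlled only on the indices that select it. This serves the Green kernels,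
    whose exponentials are bounded on one side of the diagonal only. *)
Lemma CF_if {I} {W : I -> R} {Om : I -> R -> Prop} {FR : frame W Om} (b : I -> bool) fl f g :
  CF W (fun i y => Om i y /\ b i = true) fl f ->
  CF W (fun i y => Om i y /\ b i = false) fl g ->
  CF W Om fl (fun i x y => if b i then f i x y else g i x y).
Proof.
  intros F G n. specialize (F n). specialize (G n). revert f g F G.
  induction n as [|n IH]; intros f g F G.
  all: assert (B : bnd W Om fl (fun i x y => if b i then f i x y else g i x y)) by
   (apply Sm_bnd in F; apply Sm_bnd in G; destruct fl;
    [intros q; destruct (F q) as [C HC], (G q) as [D HD]; exists (Rmax C D); intros i x y O;
     specialize (HC i x y); specialize (HD i x y); destruct (b i);
     [eapply Rle_trans; [apply HC; auto|apply Rmax_l]|eapply Rle_trans; [apply HD; auto|apply Rmax_r]]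
    |destruct F as (q & C & HC), G as (p & D & HD); exists (q + p)%nat, (Rmax (Rabs C) (Rabs D));
     intros i x y O; specialize (HC i x y); specialize (HD i x y); rewrite pow_add;
     pose proof (Wpow_ge1 i q); pose proof (Wpow_ge1 i p);
     pose proof (Rmax_l (Rabs C) (Rabs D)); pose proof (Rmax_r (Rabs C) (Rabs D));
     pose proof (Rle_abs C); pose proof (Rle_abs D); pose proof (Rabs_pos C);
     destruct (b i);
     [eapply Rle_trans; [apply HC; auto|]; apply Rle_trans with (Rmax (Rabs C) (Rabs D) * W i ^ q);
        [nra|]; apply Rmult_le_compat_l; nra
     |eapply Rle_trans; [apply HD; auto|]; apply Rle_trans with (Rmax (Rabs C) (Rabs D) * W i ^ p);
        [nra|]; apply Rmult_le_compat_l; nra]]).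
  - split; [exact B|exact Logic.I].
  - destruct F as (_ & D & X & Y), G as (_ & D' & X' & Y'). split; [exact B|]. split; [|split].
    + intros i x y O. specialize (D i x y). specialize (D' i x y). destruct (b i); auto.
    + replace (dx (fun i x y => if b i then f i x y else g i x y))
        with (fun i x y => if b i then dx f i x y else dx g i x y).
      * exact (IH _ _ X X').
      * apply functional_extensionality; intros i; unfold dx; now destruct (b i).
    + replace (dy (fun i x y => if b i then f i x y else g i x y))
        with (fun i x y => if b i then dy f i x y else dy g i x y).
      * exact (IH _ _ Y Y').
      * apply functional_extensionality; intros i; unfold dy; now destruct (b i).
Qed.

(** * Finite sums whose length varies with the index *)

Fixpoint rsum (n : nat) (f : nat -> R) : R :=
  match n with O => 0 | S n' => rsum n' f + f n' end.

Lemma rsum_ext n f g : (forall j, (j < n)%nat -> f j = g j) -> rsum n f = rsum n g.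
Proof. induction n; simpl; intros H; [reflexivity|]. rewrite IHn, H; auto. Qed.

Lemma rsum_le n f g : (forall j, (j < n)%nat -> f j <= g j) -> rsum n f <= rsum n g.
Proof. induction n; simpl; intros H; [lra|]. apply Rplus_le_compat; auto. Qed.

Lemma rsum_const n c : rsum n (fun _ => c) = INR n * c.
Proof. induction n; [simpl; ring|]. rewrite S_INR. simpl rsum. rewrite IHn. ring. Qed.

Lemma rsum_abs n f : Rabs (rsum n f) <= rsum n (fun j => Rabs (f j)).
Proof.
  induction n; simpl; [rewrite Rabs_R0; lra|].
  eapply Rle_trans; [apply Rabs_triang|]. lra.
Qed.

Lemma rsum_mult_l n c f : c * rsum n f = rsum n (fun j => c * f j).
Proof. induction n; simpl; [ring|]. rewrite <- IHn; ring. Qed.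

Lemma is_derive_rsum n (f : nat -> R -> R) (f' : nat -> R) x :
  (forall j, (j < n)%nat -> is_derive (f j) x (f' j)) ->
  is_derive (fun t => rsum n (fun j => f j t)) x (rsum n f').
Proof.
  induction n; simpl; intros H.
  - apply is_derive_Rconst.
  - apply (is_derive_Rplus (fun t => rsum n (fun j => f j t)) (f n)); auto.
Qed.

(** The number of terms may grow like W^q; this costs q powers of W, harmless for both flags. The
    summation index joins the index of the family, so that one constant serves all terms. *)
Lemma Sm_rsum {I} {W : I -> R} {Om : I -> R -> Prop} {FR : frame W Om} (n : I -> nat) fl N (f : I * nat -> R -> R -> R) q C :
  (forall i y, Om i y -> INR (n i) <= C * W i ^ q) ->
  Sm (fun p : I * nat => W (fst p)) (fun p y => Om (fst p) y /\ (snd p < n (fst p))%nat) fl N f ->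
  Sm W Om fl N (fun i x y => rsum (n i) (fun j => f (i, j) x y)).
Proof.
  intros Hn F. revert f F.
  induction N as [|N IH]; intros f F.
  all: assert (B : bnd W Om fl (fun i x y => rsum (n i) (fun j => f (i, j) x y))).
  1,3: apply Sm_bnd in F; destruct fl.
  (* Flat case: the bound for q + p makes every term at most |D| W^(-q) after multiplication by W^p,
     and there are at most C W^q terms. *)
  1,3: intros p; destruct (F (q + p)%nat) as [D HD]; exists (C * Rabs D); intros i x y O;
    pose proof (Wpow_ge1 i p) as Wp; pose proof (Wpow_ge1 i q) as Wq;
    specialize (Hn i y O);
    apply Rle_trans with (rsum (n i) (fun j => Rabs D * / W i ^ q));
    [eapply Rle_trans; [apply Rmult_le_compat_r; [lra|apply rsum_abs]|];
     rewrite Rmult_comm, rsum_mult_l; apply rsum_le; intros j Hj;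
     specialize (HD (i, j) x y (conj O Hj)); simpl in HD; rewrite pow_add in HD;
     apply Rmult_le_reg_r with (W i ^ q); [lra|];
     rewrite (Rmult_assoc (Rabs D)), Rinv_l by lra;
     pose proof (Rle_abs D);
     replace (W i ^ p * Rabs (f (i, j) x y) * W i ^ q) with (Rabs (f (i, j) x y) * (W i ^ q * W i ^ p)) by ring; lra
    |rewrite rsum_const; apply Rle_trans with ((C * W i ^ q) * (Rabs D * / W i ^ q));
     [apply Rmult_le_compat_r; [|exact Hn]; apply Rmult_le_pos; [apply Rabs_pos|left; apply Rinv_0_lt_compat; lra]
     |right; field; lra]].
  1,2: destruct F as (p & D & HD); exists (q + p)%nat, (C * Rabs D); intros i x y O;
    pose proof (Wpow_ge1 i p) as Wp; pose proof (Wpow_ge1 i q) as Wq;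
    specialize (Hn i y O);
    apply Rle_trans with (rsum (n i) (fun j => Rabs D * W i ^ p));
    [eapply Rle_trans; [apply rsum_abs|]; apply rsum_le; intros j Hj;
     specialize (HD (i, j) x y (conj O Hj)); simpl in HD;
     pose proof (Rle_abs D); nra
    |rewrite rsum_const, pow_add; pose proof (Rabs_pos D);
     replace (C * Rabs D * (W i ^ q * W i ^ p)) with ((C * W i ^ q) * (Rabs D * W i ^ p)) by ring;
     apply Rmult_le_compat_r; [nra|exact Hn]].
  - split; [exact B|exact Logic.I].
  - apply (Sm_intro fl N _ (fun i x y => rsum (n i) (fun j => dx f (i, j) x y))
             (fun i x y => rsum (n i) (fun j => dy f (i, j) x y))); try assumption.
    + intros i x y O. split.
      * apply (is_derive_rsum (n i) (fun j t => f (i, j) t y)). intros j Hj.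
        apply (Sm_is_derive _ _ _ F (i, j) x y (conj O Hj)).
      * apply (is_derive_rsum (n i) (fun j t => f (i, j) x t)). intros j Hj.
        apply (Sm_is_derive _ _ _ F (i, j) x y (conj O Hj)).
    + apply IH, F.
    + apply IH, F.
Qed.

Lemma CF_rsum {I} {W : I -> R} {Om : I -> R -> Prop} {FR : frame W Om} (n : I -> nat) fl (f : I * nat -> R -> R -> R) q C :
  (forall i y, Om i y -> INR (n i) <= C * W i ^ q) ->
  CF (fun p : I * nat => W (fst p)) (fun p y => Om (fst p) y /\ (snd p < n (fst p))%nat) fl f ->
  CF W Om fl (fun i x y => rsum (n i) (fun j => f (i, j) x y)).
Proof. intros Hn F N. now apply (Sm_rsum n fl N f q C). Qed.

Definition strip (_ : unit) (y : R) : Prop := -1 < y < 1.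
Definition W0 (_ : unit) : R := 1.
Definition sm (f : R -> R -> R) : Prop := CF W0 strip false (fun _ => f).

Lemma W0_ge1 i : 1 <= W0 i. Proof. unfold W0; lra. Qed.

Lemma open_interval_loc a b y : a < y < b -> locally y (fun t => a < t < b).
Proof.
  intros [h1 h2]. apply filter_and; [now apply open_gt|now apply open_lt].
Qed.

Lemma strip_open i y : strip i y -> locally y (strip i).
Proof. apply open_interval_loc. Qed.

#[global] Instance strip_frame : frame W0 strip.
Proof. split; [apply W0_ge1|apply strip_open]. Qed.

Lemma sm_bound f : sm f -> exists C, 0 <= C /\ forall x y, -1 < y < 1 -> Rabs (f x y) <= C.
Proof.
  intros F. destruct (CF_bnd _ _ F) as (q & C & HC). exists (Rmax 0 C). split; [apply Rmax_l|].
  intros x y Hy. specialize (HC tt x y Hy). unfold W0 in HC. rewrite pow1, Rmult_1_r in HC.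
  eapply Rle_trans; [exact HC|apply Rmax_r].
Qed.

Definition Dx (f : R -> R -> R) : R -> R -> R := fun x y => Derive (fun t => f t y) x.
Definition Dy (f : R -> R -> R) : R -> R -> R := fun x y => Derive (fun t => f x t) y.

Lemma sm_Dx f : sm f -> sm (Dx f).
Proof. exact (CF_dx false (fun _ => f)). Qed.
Lemma sm_Dy f : sm f -> sm (Dy f).
Proof. exact (CF_dy false (fun _ => f)). Qed.

Lemma sm_is_derive f : sm f -> forall x y, -1 < y < 1 ->
  is_derive (fun t => f t y) x (Dx f x y) /\ is_derive (fun t => f x t) y (Dy f x y).
Proof. intros F x y. exact (CF_is_derive false (fun _ => f) F tt x y). Qed.

Lemma derive_bound_lip (f f' : R -> R) a b M :
  (forall t, Rmin a b <= t <= Rmax a b -> is_derive f t (f' t)) ->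
  (forall t, Rmin a b <= t <= Rmax a b -> Rabs (f' t) <= M) ->
  Rabs (f b - f a) <= M * Rabs (b - a).
Proof.
  intros D B. destruct (MVT_gen f a b f') as (c & Hc & E).
  - intros t Ht. apply D. lra.
  - intros t Ht. apply continuity_pt_filterlim, (ex_derive_continuous f t). eexists. now apply D.
  - rewrite E, Rabs_mult. apply Rmult_le_compat_r; [apply Rabs_pos|]. now apply B.
Qed.

Lemma between_open a b t lo hi : lo < a < hi -> lo < b < hi -> Rmin a b <= t <= Rmax a b -> lo < t < hi.
Proof. unfold Rmin, Rmax. destruct (Rle_dec a b); lra. Qed.

Lemma sm_lip f : sm f -> exists M, 0 <= M /\ forall x y x' y', -1 < y < 1 -> -1 < y' < 1 ->
  Rabs (f x' y' - f x y) <= M * (Rabs (x' - x) + Rabs (y' - y)).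
Proof.
  intros F. destruct (sm_bound _ (sm_Dx f F)) as (M1 & M10 & H1).
  destruct (sm_bound _ (sm_Dy f F)) as (M2 & M20 & H2).
  exists (M1 + M2). split; [lra|]. intros x y x' y' Hy Hy'.
  assert (A : Rabs (f x' y' - f x y') <= M1 * Rabs (x' - x)).
  { apply (derive_bound_lip (fun t => f t y') (fun t => Dx f t y')).
    - intros t _. now apply sm_is_derive.
    - intros t _. now apply H1. }
  assert (B : Rabs (f x y' - f x y) <= M2 * Rabs (y' - y)).
  { apply (derive_bound_lip (fun t => f x t) (fun t => Dy f x t)).
    - intros t Ht. apply sm_is_derive; [assumption|]. eapply between_open; [| |exact Ht]; assumption.
    - intros t Ht. apply H2. eapply between_open; [| |exact Ht]; assumption. }
  replace (f x' y' - f x y) with ((f x' y' - f x y') + (f x y' - f x y)) by ring.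
  eapply Rle_trans; [apply Rabs_triang|].
  pose proof (Rabs_pos (x' - x)). pose proof (Rabs_pos (y' - y)). nra.
Qed.

Lemma sm_continuity_2d f : sm f -> forall x y, -1 < y < 1 -> continuity_2d_pt f x y.
Proof.
  intros F x y Hy eps. destruct (sm_lip f F) as (M & M0 & H).
  destruct (open_interval_loc _ _ _ Hy) as [d Hd].
  assert (e0 : 0 < Rmin d (eps / (2 * (M + 1)))).
  { apply Rmin_pos; [apply cond_pos|]. apply Rdiv_lt_0_compat; [apply cond_pos|lra]. }
  exists (mkposreal _ e0). intros u v Hu Hv. simpl in Hu, Hv.
  pose proof (Rmin_l d (eps / (2 * (M + 1)))). pose proof (Rmin_r d (eps / (2 * (M + 1)))).
  eapply Rle_lt_trans; [apply H; [assumption|]|].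
  - apply Hd. change (Rabs (v - y) < d). lra.
  - assert (E : eps = (M + 1) * (2 * (eps / (2 * (M + 1)))) :> R) by (field; lra).
    assert (P : 0 < eps / (2 * (M + 1))) by lra.
    apply Rle_lt_trans with (M * (2 * (eps / (2 * (M + 1))))); [apply Rmult_le_compat_l; lra|].
    rewrite E at 2. apply Rmult_lt_compat_r; lra.
Qed.

(** The partial derivatives exist near the point and [Dx f] is Lipschitz, hence continuous, which is
    enough for total differentiability. *)
Lemma sm_chain f (u v : R -> R) t u' v' : sm f -> -1 < v t < 1 ->
  is_derive u t u' -> is_derive v t v' ->
  is_derive (fun s => f (u s) (v s)) t (Dx f (u t) (v t) * u' + Dy f (u t) (v t) * v').
Proof.
  intros F Hv Du Dv. apply is_derive_Reals. apply derivable_pt_lim_comp_2d;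
    try (now apply is_derive_Reals).
  apply (filterdiff_differentiable_pt_lim f (u t) (v t)).
  eapply filterdiff_ext_lin.
  - apply (is_derive_filterdiff f (u t) (v t) (Dx f) (Dy f (u t) (v t))).
    + assert (L : locally (v t) (fun s => -1 < s < 1)) by now apply open_interval_loc.
      destruct L as [d Hd]. exists d. intros [p q] [_ Hq]. apply (sm_is_derive f F). apply Hd, Hq.
    + now apply sm_is_derive.
    + apply (continuity_2d_pt_filterlim (Dx f)). apply sm_continuity_2d; [now apply sm_Dx|assumption].
  - intros [p q]. reflexivity.
Qed.

(* Unlike [CF], this does not bound [f] itself, so that it holds for coordinates. *)
Definition PF {I} (W : I -> R) Om (f : I -> R -> R -> R) : Prop :=
  (forall i x y, Om i y ->
     is_derive (fun t => f i t y) x (dx f i x y) /\ is_derive (fun t => f i x t) y (dy f i x y)) /\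
  CF W Om false (dx f) /\ CF W Om false (dy f).

Section PFs.
Context {I : Type} {W : I -> R} {Om : I -> R -> Prop} {FR : frame W Om}.

Lemma PF_CF f : CF W Om false f -> PF W Om f.
Proof.
  intros F. split; [|split].
  - exact (CF_is_derive false f F).
  - now apply CF_dx.
  - now apply CF_dy.
Qed.

Lemma PF_intro f fx fy :
  (forall i x y, Om i y ->
     is_derive (fun t => f i t y) x (fx i x y) /\ is_derive (fun t => f i x t) y (fy i x y)) ->
  CF W Om false fx -> CF W Om false fy -> PF W Om f.
Proof.
  intros D X Y.
  assert (Ex : forall i x y, Om i y -> fx i x y = dx f i x y).
  { intros i x y O. symmetry. apply is_derive_unique, D, O. }
  assert (Ey : forall i x y, Om i y -> fy i x y = dy f i x y).
  { intros i x y O. symmetry. apply is_derive_unique, D, O. }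
  split; [|split].
  - intros i x y O. rewrite <- Ex, <- Ey by exact O. now apply D.
  - eapply CF_ext; eauto.
  - eapply CF_ext; eauto.
Qed.

Lemma PF_affine f a b : PF W Om f -> PF W Om (fun i x y => a + b * f i x y).
Proof.
  intros (D & X & Y).
  apply (PF_intro _ (fun i x y => b * dx f i x y) (fun i x y => b * dy f i x y)).
  - intros i x y O. destruct (D i x y O) as [D1 D2]. split.
    + replace (b * dx f i x y) with (0 + (0 * f i x y + b * dx f i x y)) by ring.
      apply (is_derive_Rplus (fun _ => a) (fun t => b * f i t y)); [apply is_derive_Rconst|].
      apply (is_derive_Rmult (fun _ => b) (fun t => f i t y)); [apply is_derive_Rconst|assumption].
    + replace (b * dy f i x y) with (0 + (0 * f i x y + b * dy f i x y)) by ring.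
      apply (is_derive_Rplus (fun _ => a) (fun t => b * f i x t)); [apply is_derive_Rconst|].
      apply (is_derive_Rmult (fun _ => b) (fun t => f i x t)); [apply is_derive_Rconst|assumption].
  - now apply CF_scal.
  - now apply CF_scal.
Qed.

Lemma PF_x : PF W Om (fun _ x _ => x).
Proof.
  apply (PF_intro _ (fun _ _ _ => 1) (fun _ _ _ => 0)); try now apply CF_const.
  intros. split; [apply is_derive_Rid|apply is_derive_Rconst].
Qed.

Lemma PF_ext f g : (forall i x y, f i x y = g i x y) -> PF W Om f -> PF W Om g.
Proof.
  intros E. replace g with f; [trivial|].
  do 3 (apply functional_extensionality; intro). apply E.
Qed.

End PFs.

(** All derivatives of f are bounded by constants, so only the derivatives of u and v matter; the
    values of u may be unbounded, as those of a coordinate are. *)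
Lemma CF_comp {I} {W : I -> R} {Om : I -> R -> Prop} {FR : frame W Om} (f : R -> R -> R) (u v : I -> R -> R -> R) :
  sm f -> PF W Om u -> PF W Om v -> (forall i x y, Om i y -> -1 < v i x y < 1) ->
  CF W Om false (fun i x y => f (u i x y) (v i x y)).
Proof.
  intros F (UD & UX & UY) (VD & VX & VY) HV n. revert f F. induction n as [|n IH]; intros f F.
  all: assert (B : bnd W Om false (fun i x y => f (u i x y) (v i x y))) by
    (destruct (sm_bound f F) as (C & _ & HC); exists O, C; intros i x y O; simpl;
     rewrite Rmult_1_r; apply HC, (HV i x y O)).
  - split; [exact B|exact Logic.I].
  - apply (Sm_intro false n _
      (fun i x y => Dx f (u i x y) (v i x y) * dx u i x y + Dy f (u i x y) (v i x y) * dx v i x y)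
      (fun i x y => Dx f (u i x y) (v i x y) * dy u i x y + Dy f (u i x y) (v i x y) * dy v i x y)).
    + exact B.
    + intros i x y O. destruct (UD i x y O), (VD i x y O).
      split; [apply (sm_chain f (fun t => u i t y) (fun t => v i t y))
             |apply (sm_chain f (fun t => u i x t) (fun t => v i x t))]; auto.
    + apply Sm_plus; try assumption; apply Sm_mult; try assumption;
        try (apply IH; first [now apply sm_Dx|now apply sm_Dy]); first [apply UX|apply VX].
    + apply Sm_plus; try assumption; apply Sm_mult; try assumption;
        try (apply IH; first [now apply sm_Dx|now apply sm_Dy]); first [apply UY|apply VY].
Qed.

(** * Bump functions *)

(** x^(-m) exp(-1/x) for x > 0, continued by 0. The whole family in m is introduced because
    differentiating exp(-1/x) repeatedly stays inside its span. *)
Definition flatexp (m : nat) (x : R) : R :=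
  if Rlt_dec 0 x then (/ x) ^ m * exp (- / x) else 0.

Lemma exp_pow t n : exp t ^ n = exp (INR n * t).
Proof.
  induction n.
  - simpl. now rewrite Rmult_0_l, exp_0.
  - rewrite S_INR. simpl. rewrite IHn, <- exp_plus. f_equal. ring.
Qed.

Lemma flatexp_bound m : exists C, 0 < C /\ forall x, 0 <= flatexp m x <= C.
Proof.
  set (k := INR (S m)).
  assert (k0 : 1 <= k) by (unfold k; rewrite S_INR; pose proof (pos_INR m); lra).
  exists (k ^ m). split; [apply pow_lt; lra|]. intros x. unfold flatexp.
  destruct (Rlt_dec 0 x) as [h|h].
  2:{ split; [lra|]. apply pow_le; lra. }
  assert (t0 : 0 < / x) by now apply Rinv_0_lt_compat.
  set (t := / x) in *.
  split; [apply Rmult_le_pos; [apply pow_le; lra|left; apply exp_pos]|].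
  (* From u <= exp u at u = t / k with k = m + 1: (t/k)^m <= exp(t/k)^m <= exp(t/k)^(m+1) = exp
     t. *)
  assert (E : (t / k) ^ m <= exp t).
  { assert (u0 : 0 < t / k) by (apply Rdiv_lt_0_compat; lra).
    apply Rle_trans with (exp (t / k) ^ m).
    - apply pow_incr. split; [lra|]. pose proof (exp_ineq1_le (t / k)). lra.
    - apply Rle_trans with (exp (t / k) ^ S m).
      + apply Rle_pow; [|lia]. pose proof (exp_ineq1_le (t / k)). lra.
      + rewrite exp_pow. right. f_equal. fold k. field. lra. }
  unfold Rdiv in E. rewrite Rpow_mult_distr, pow_inv in E.
  assert (0 < k ^ m) by (apply pow_lt; lra).
  rewrite exp_Ropp.
  apply Rmult_le_reg_r with (exp t); [apply exp_pos|].
  rewrite Rmult_assoc, Rinv_l by (apply Rgt_not_eq, exp_pos). rewrite Rmult_1_r.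
  apply Rmult_le_reg_r with (/ k ^ m); [now apply Rinv_0_lt_compat|].
  replace (k ^ m * exp t * / k ^ m) with (exp t) by (field; lra). exact E.
Qed.

Lemma flatexp_succ m x : 0 < x -> flatexp m x = x * flatexp (S m) x.
Proof.
  intros h. unfold flatexp. destruct (Rlt_dec 0 x); [|lra]. simpl. field. lra.
Qed.

Lemma flatexp_nonpos m x : x <= 0 -> flatexp m x = 0.
Proof. intros h. unfold flatexp. destruct (Rlt_dec 0 x); [lra|reflexivity]. Qed.

Lemma flatexp_derive m x :
  is_derive (flatexp m) x (- INR m * flatexp (S m) x + flatexp (S (S m)) x).
Proof.
  destruct (Rtotal_order x 0) as [h|[h|h]].
  - rewrite !flatexp_nonpos by lra.
    apply is_derive_ext_loc with (fun _ => 0).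
    + generalize (open_lt 0 x h). apply filter_imp. intros t Ht. rewrite flatexp_nonpos; lra.
    + replace (- INR m * 0 + 0) with 0 by ring. apply is_derive_Rconst.
  (* At 0 two factors h can be extracted, flatexp m h = h^2 flatexp (m+2) h for h > 0, so the
     difference quotient is O(h). *)
  - subst x. rewrite !flatexp_nonpos by lra. replace (- INR m * 0 + 0) with 0 by ring.
    apply is_derive_Reals. intros eps He.
    destruct (flatexp_bound (S (S m))) as (C & C0 & HC).
    assert (d0 : 0 < eps / C) by now apply Rdiv_lt_0_compat.
    exists (mkposreal _ d0). intros h h0 Hh. simpl in Hh.
    rewrite Rplus_0_l, (flatexp_nonpos m 0), !Rminus_0_r by lra.
    destruct (Rlt_or_le 0 h) as [hp|hn].
    + rewrite (flatexp_succ m h hp), (flatexp_succ (S m) h hp).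
      replace (h * (h * flatexp (S (S m)) h) / h) with (h * flatexp (S (S m)) h) by (field; lra).
      specialize (HC h). rewrite Rabs_mult, (Rabs_pos_eq (flatexp _ _)) by lra.
      apply Rle_lt_trans with (Rabs h * C); [apply Rmult_le_compat_l; [apply Rabs_pos|lra]|].
      apply Rmult_lt_reg_r with (/ C); [now apply Rinv_0_lt_compat|].
      rewrite Rmult_assoc, Rinv_r by lra. unfold Rdiv in Hh. lra.
    + rewrite flatexp_nonpos by lra. unfold Rdiv. rewrite Rmult_0_l, Rabs_R0. exact He.
  - apply is_derive_ext_loc with (fun x => (/ x) ^ m * exp (- / x)).
    + generalize (open_gt 0 x h). apply filter_imp. intros t Ht. unfold flatexp.
      destruct (Rlt_dec 0 t); [reflexivity|contradiction].
    + unfold flatexp. destruct (Rlt_dec 0 x); [|lra].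
      destruct m as [|m]; auto_derive; try (repeat split; lra).
      * simpl. field. lra.
      * replace (match m with O => 1 | S _ => INR m + 1 end) with (INR (S m)) by reflexivity.
        generalize (INR (S m)). intros k. simpl. field. lra.
Qed.

Section Bump.
Context {I : Type} {W : I -> R} {Om : I -> R -> Prop} {FR : frame W Om}.

Lemma CF_flatexp f m : PF W Om f -> CF W Om false (fun i x y => flatexp m (f i x y)).
Proof.
  intros (FD & FX & FY) n. revert m. induction n as [|n IH]; intros m.
  all: assert (B : bnd W Om false (fun i x y => flatexp m (f i x y))) by
    (destruct (flatexp_bound m) as (C & C0 & HC); exists O, C; intros i x y O;
     specialize (HC (f i x y)); rewrite Rabs_pos_eq; simpl; lra).
  - split; [exact B|exact Logic.I].
  - set (k := fun i x y => - INR m * flatexp (S m) (f i x y) + flatexp (S (S m)) (f i x y)).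
    assert (K : Sm W Om false n k).
    { apply Sm_plus; try assumption; [|apply IH].
      eapply Sm_ext; [|apply (Sm_mult false n _ (fun _ _ _ => - INR m) (IH (S m)))].
      - intros; simpl; ring.
      - apply CF_const; assumption. }
    apply (Sm_intro false n _ (fun i x y => k i x y * dx f i x y)
             (fun i x y => k i x y * dy f i x y)); try assumption.
    + intros i x y O. destruct (FD i x y O) as [D1 D2].
      split; [apply (is_derive_Rcomp (flatexp m) (fun t => f i t y))
             |apply (is_derive_Rcomp (flatexp m) (fun t => f i x t))];
        try assumption; apply flatexp_derive.
    + apply Sm_mult; try assumption. apply FX.
    + apply Sm_mult; try assumption. apply FY.
Qed.

End Bump.

Definition step (x : R) : R := flatexp 0 x / (flatexp 0 x + flatexp 0 (1 - x)).

(** One of x and 1 - x is at least 1/2, and exp(-1/u) >= exp(-2) for u >= 1/2. *)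
Lemma step_den x : exp (-2) <= flatexp 0 x + flatexp 0 (1 - x).
Proof.
  assert (A : forall u, 1 / 2 <= u -> exp (-2) <= flatexp 0 u).
  { intros u Hu. unfold flatexp. destruct (Rlt_dec 0 u); [|lra]. simpl. rewrite Rmult_1_l.
    assert (/ u <= 2).
    { replace 2 with (/ (1 / 2)) by field. apply Rinv_le_contravar; lra. }
    destruct (Rle_lt_or_eq_dec (-2) (- / u)) as [h|h]; [lra| |].
    - left. now apply exp_increasing.
    - right. now rewrite h. }
  destruct (flatexp_bound 0) as (C & _ & HC). pose proof (HC x). pose proof (HC (1 - x)).
  destruct (Rle_lt_dec (1 / 2) x) as [h|h].
  - pose proof (A x h). lra.
  - pose proof (A (1 - x)). lra.
Qed.

Lemma step_den_pos x : 0 < flatexp 0 x + flatexp 0 (1 - x).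
Proof. pose proof (step_den x). pose proof (exp_pos (-2)). lra. Qed.

Lemma step_0 x : x <= 0 -> step x = 0.
Proof. intros h. unfold step. rewrite (flatexp_nonpos 0 x h). unfold Rdiv. ring. Qed.

Lemma step_1 x : 1 <= x -> step x = 1.
Proof.
  intros h. unfold step. pose proof (step_den_pos x) as P.
  rewrite (flatexp_nonpos 0 (1 - x)) in * by lra. field. lra.
Qed.

Lemma step_range x : 0 <= step x <= 1.
Proof.
  unfold step. pose proof (step_den_pos x) as P.
  destruct (flatexp_bound 0) as (C & _ & HC). pose proof (HC x). pose proof (HC (1 - x)).
  split.
  - apply Rdiv_le_0_compat; lra.
  - apply Rle_div_l; lra.
Qed.

Section Bump2.
Context {I : Type} {W : I -> R} {Om : I -> R -> Prop} {FR : frame W Om}.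

Lemma CF_step f : PF W Om f -> CF W Om false (fun i x y => step (f i x y)).
Proof.
  intros F. unfold step.
  assert (A : CF W Om false (fun i x y => flatexp 0 (f i x y))) by now apply CF_flatexp.
  assert (B : CF W Om false (fun i x y => flatexp 0 (1 - f i x y))).
  { apply (CF_flatexp (fun i x y => 1 - f i x y)).
    apply (PF_ext (fun i x y => 1 + (-1) * f i x y)); [intros; ring|now apply PF_affine]. }
  apply (CF_mult false _ (fun i x y => / (flatexp 0 (f i x y) + flatexp 0 (1 - f i x y)))); [assumption|].
  apply (CF_inv _ (exp (-2))).
  - apply exp_pos.
  - now apply CF_plus.
  - intros i x y _. pose proof (step_den (f i x y)). pose proof (step_den_pos (f i x y)).
    rewrite Rabs_pos_eq; lra.
Qed.

End Bump2.

(** Smooth truncation from below: equal to t for t >= c, to the constant c for t <= c/2, and a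
    convex combination of c and t in between. It permits division everywhere while changing nothing
    where t is large. *)
Definition floorat (c t : R) : R := c + step (2 * t / c - 1) * (t - c).

Lemma floorat_id c t : 0 < c -> c <= t -> floorat c t = t.
Proof.
  intros c0 h. unfold floorat. rewrite step_1; [ring|].
  assert (1 <= t / c) by (apply Rle_div_r; lra). unfold Rdiv in *. lra.
Qed.

Lemma floorat_ge c t : 0 < c -> c / 2 <= floorat c t.
Proof.
  intros c0. unfold floorat. destruct (Rle_lt_dec (c / 2) t) as [h|h].
  - pose proof (step_range (2 * t / c - 1)). nra.
  - rewrite step_0; [lra|].
    assert (2 * t / c <= 1) by (apply Rle_div_l; lra). lra.
Qed.

Lemma CF_floorat {I} {W : I -> R} {Om} {FR : frame W Om} c f :
  CF W Om false f -> CF W Om false (fun i x y => floorat c (f i x y)).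
Proof.
  intros F. unfold floorat.
  apply CF_plus; try assumption; [now apply CF_const|].
  apply CF_mult; try assumption.
  - apply (CF_step (fun i x y => 2 * f i x y / c - 1)).
    apply (PF_ext (fun i x y => -1 + (2 / c) * f i x y)); [intros; unfold Rdiv; ring|].
    apply PF_affine; try assumption. now apply PF_CF.
  - apply CF_minus; try assumption. now apply CF_const.
Qed.

Definition plateau (x : R) : R := step (2 - x) * step (2 + x).

Lemma plateau_1 x : -1 <= x <= 1 -> plateau x = 1.
Proof. intros h. unfold plateau. rewrite !step_1; lra. Qed.

Lemma plateau_0 x : 2 <= Rabs x -> plateau x = 0.
Proof.
  intros h. unfold plateau. unfold Rabs in h. destruct (Rcase_abs x).
  - rewrite (step_0 (2 + x)) by lra. ring.
  - rewrite (step_0 (2 - x)) by lra. ring.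
Qed.

Definition spike (x : R) : R := step (1 - 2 * x) * step (1 + 2 * x).

Lemma spike_at_0 : spike 0 = 1.
Proof. unfold spike. rewrite !step_1; lra. Qed.

Lemma spike_0 x : 1 / 2 <= Rabs x -> spike x = 0.
Proof.
  intros h. unfold spike. unfold Rabs in h. destruct (Rcase_abs x).
  - rewrite (step_0 (1 + 2 * x)) by lra. ring.
  - rewrite (step_0 (1 - 2 * x)) by lra. ring.
Qed.

(** Integer translates telescope, so they form a partition of unity with at most two nonzero members
    at each point. *)
Definition hat (x : R) : R := step (x + 1) - step x.

Lemma hat_0 x : 1 <= Rabs x -> hat x = 0.
Proof.
  intros h. unfold hat. unfold Rabs in h. destruct (Rcase_abs x).
  - rewrite !step_0; lra.
  - rewrite !step_1; lra.
Qed.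

Lemma CF_bumps {I} {W : I -> R} {Om} {FR : frame W Om} f : PF W Om f ->
  CF W Om false (fun i x y => plateau (f i x y)) /\
  CF W Om false (fun i x y => spike (f i x y)) /\
  CF W Om false (fun i x y => hat (f i x y)).
Proof.
  intros F. unfold plateau, spike, hat.
  assert (A : forall a b, CF W Om false (fun i x y => step (a + b * f i x y))).
  { intros a b. apply (CF_step (fun i x y => a + b * f i x y)). now apply PF_affine. }
  split; [|split].
  - apply CF_mult; try assumption.
    + eapply CF_ext; [|apply (A 2 (-1))]. intros; simpl; f_equal; ring.
    + eapply CF_ext; [|apply (A 2 1)]. intros; simpl; f_equal; ring.
  - apply CF_mult; try assumption.
    + eapply CF_ext; [|apply (A 1 (-2))]. intros; simpl; f_equal; ring.
    + apply (A 1 2).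
  - apply CF_minus; try assumption.
    + eapply CF_ext; [|apply (A 1 1)]. intros; simpl; f_equal; ring.
    + eapply CF_ext; [|apply (A 0 1)]. intros; simpl; f_equal; ring.
Qed.

(** * Extension of smooth functions and the Borel lemma *)

(* The derivative relative to X, one-sided at a boundary point. *)
Definition dw (X : R -> Prop) (f : R -> R) (x l : R) : Prop :=
  forall eps, 0 < eps -> exists d, 0 < d /\
    forall x', X x' -> Rabs (x' - x) < d -> Rabs (f x' - f x - l * (x' - x)) <= eps * Rabs (x' - x).

Definition convex (X : R -> Prop) := forall a b t, X a -> X b -> a <= t <= b -> X t.

Lemma dw_sub (X X' : R -> Prop) f x l : (forall t, X' t -> X t) -> dw X f x l -> dw X' f x l.
Proof. intros S H eps He. destruct (H eps He) as (d & d0 & Hd). exists d. auto. Qed.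

Lemma dw_is_derive (X : R -> Prop) f x l : locally x X -> dw X f x l -> is_derive f x l.
Proof.
  intros [e He] H. apply is_derive_Reals. intros eps Heps.
  destruct (H (eps / 2)) as (d & d0 & Hd); [lra|].
  assert (m0 : 0 < Rmin e d) by (apply Rmin_pos; [apply cond_pos|assumption]).
  exists (mkposreal _ m0). intros h h0 Hh. simpl in Hh.
  pose proof (Rmin_l e d). pose proof (Rmin_r e d).
  assert (A : Rabs (f (x + h) - f x - l * (x + h - x)) <= eps / 2 * Rabs (x + h - x)).
  { apply Hd.
    - apply He. change (Rabs (x + h - x) < e). replace (x + h - x) with h by ring. lra.
    - replace (x + h - x) with h by ring. lra. }
  replace (x + h - x) with h in A by ring.
  replace ((f (x + h) - f x) / h - l) with ((f (x + h) - f x - l * h) / h) by (field; exact h0).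
  unfold Rdiv at 1. rewrite Rabs_mult, Rabs_inv.
  assert (0 < Rabs h) by now apply Rabs_pos_lt.
  apply Rle_lt_trans with (eps / 2 * Rabs h * / Rabs h).
  - apply Rmult_le_compat_r; [left; now apply Rinv_0_lt_compat|exact A].
  - rewrite Rmult_assoc, Rinv_r by lra. lra.
Qed.

Lemma is_derive_dw (X : R -> Prop) f x l : is_derive f x l -> dw X f x l.
Proof.
  intros H. apply is_derive_Reals in H. intros eps Heps.
  destruct (H eps Heps) as [d Hd]. exists d. split; [apply cond_pos|].
  intros x' _ Hx'. destruct (Req_dec x' x) as [->|n].
  - replace (f x - f x - l * (x - x)) with 0 by ring. rewrite Rabs_R0.
    apply Rmult_le_pos; [lra|apply Rabs_pos].
  - assert (n0 : x' - x <> 0) by lra. specialize (Hd (x' - x) n0 Hx').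
    replace (x + (x' - x)) with x' in Hd by ring.
    replace (f x' - f x - l * (x' - x)) with (((f x' - f x) / (x' - x) - l) * (x' - x)) by (field; exact n0).
    rewrite Rabs_mult. apply Rmult_le_compat_r; [apply Rabs_pos|lra].
Qed.

Lemma dw_ext (X : R -> Prop) f g x l : X x -> (forall t, X t -> f t = g t) -> dw X f x l -> dw X g x l.
Proof.
  intros Xx E H eps He. destruct (H eps He) as (d & d0 & Hd). exists d. split; [exact d0|].
  intros x' Hx' Hd'. rewrite <- !E by assumption. auto.
Qed.

Lemma dw_local (X : R -> Prop) (f g : R -> R) x l d : 0 < d -> f x = g x ->
  (forall t, X t -> Rabs (t - x) < d -> f t = g t) -> dw X f x l -> dw X g x l.
Proof.
  intros d0 E0 E H eps He. destruct (H eps He) as (d' & d0' & Hd). exists (Rmin d d').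
  split; [now apply Rmin_pos|]. pose proof (Rmin_l d d'). pose proof (Rmin_r d d').
  intros x' Hx' Hd'. rewrite <- E0, <- E by (auto; lra). apply Hd; auto; lra.
Qed.

Definition clamp (a b t : R) : R := Rmax a (Rmin b t).

Lemma clamp_in a b t : a <= b -> a <= clamp a b t <= b.
Proof. unfold clamp, Rmax, Rmin. intros. destruct (Rle_dec b t), (Rle_dec a _); lra. Qed.

Lemma clamp_id a b t : a <= t <= b -> clamp a b t = t.
Proof. unfold clamp, Rmax, Rmin. intros. destruct (Rle_dec b t), (Rle_dec a _); lra. Qed.

Lemma clamp_lip a b t t' : a <= b -> Rabs (clamp a b t' - clamp a b t) <= Rabs (t' - t).
Proof.
  unfold clamp, Rmax, Rmin, Rabs. intros.
  destruct (Rle_dec b t), (Rle_dec b t');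
    repeat match goal with
    | |- context [Rle_dec ?p ?q] => destruct (Rle_dec p q)
    | |- context [Rcase_abs ?p] => destruct (Rcase_abs p)
    end; lra.
Qed.

(** Composition with [clamp] prolongs f by constants past both ends and gives a continuous function
    on R, to which the usual mean value theorem applies. *)
Lemma dw_continuous_clamp (X : R -> Prop) f f' a b : a <= b -> (forall t, a <= t <= b -> X t) ->
  (forall x, X x -> dw X f x (f' x)) -> forall t, continuity_pt (fun t => f (clamp a b t)) t.
Proof.
  intros ab HX D t eps Heps.
  pose proof (clamp_in a b t ab) as C.
  destruct (D (clamp a b t) (HX _ C) 1) as (d & d0 & Hd); [lra|].
  set (L := 1 + Rabs (f' (clamp a b t))).
  assert (L0 : 0 < L) by (unfold L; pose proof (Rabs_pos (f' (clamp a b t))); lra).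
  exists (Rmin d (eps / L)). split; [apply Rmin_pos; [assumption|now apply Rdiv_lt_0_compat]|].
  intros u [_ Hu]. simpl in *. unfold Rdist in *.
  pose proof (Rmin_l d (eps / L)). pose proof (Rmin_r d (eps / L)).
  pose proof (clamp_lip a b t u ab) as CL.
  specialize (Hd (clamp a b u) (HX _ (clamp_in a b u ab))).
  assert (A : Rabs (clamp a b u - clamp a b t) < d) by lra. specialize (Hd A).
  apply Rle_lt_trans with (L * Rabs (clamp a b u - clamp a b t)).
  - replace (f (clamp a b u) - f (clamp a b t)) with
      ((f (clamp a b u) - f (clamp a b t) - f' (clamp a b t) * (clamp a b u - clamp a b t))
       + f' (clamp a b t) * (clamp a b u - clamp a b t)) by ring.
    eapply Rle_trans; [apply Rabs_triang|]. rewrite (Rabs_mult (f' _)). unfold L. lra.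
  - apply Rle_lt_trans with (L * Rabs (u - t)); [apply Rmult_le_compat_l; lra|].
    apply Rmult_lt_reg_r with (/ L); [now apply Rinv_0_lt_compat|].
    replace (L * Rabs (u - t) * / L) with (Rabs (u - t)) by (field; lra). unfold Rdiv in *. lra.
Qed.

Lemma dw_lip (X : R -> Prop) f f' M : convex X -> (forall x, X x -> dw X f x (f' x)) ->
  (forall x, X x -> Rabs (f' x) <= M) ->
  forall x x', X x -> X x' -> Rabs (f x' - f x) <= M * Rabs (x' - x).
Proof.
  intros CX D B.
  assert (A : forall a b, X a -> X b -> a < b -> Rabs (f b - f a) <= M * Rabs (b - a)).
  { intros a b Xa Xb ab.
    assert (HX : forall t, a <= t <= b -> X t) by (intros; now apply (CX a b)).
    set (g := fun t => f (clamp a b t)).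
    destruct (MVT_gen g a b f') as (c & Hc & E).
    - rewrite Rmin_left, Rmax_right by lra. intros t Ht.
      apply dw_is_derive with (fun t => a < t < b).
      + now apply open_interval_loc.
      + apply dw_ext with f; [assumption| |].
        * intros u Hu. unfold g. rewrite clamp_id; lra.
        * apply dw_sub with X; [intros u Hu; apply HX; lra|]. apply D, HX; lra.
    - intros t _. apply (dw_continuous_clamp X f f'); auto; lra.
    - unfold g in E. rewrite !clamp_id in E by lra. rewrite E, Rabs_mult.
      apply Rmult_le_compat_r; [apply Rabs_pos|]. rewrite Rmin_left, Rmax_right in Hc by lra.
      apply B, HX, Hc. }
  intros x x' Xx Xx'. destruct (Rtotal_order x x') as [h|[h|h]].
  - auto.
  - subst. replace (f x' - f x') with 0 by ring. replace (x' - x') with 0 by ring. rewrite Rabs_R0. lra.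
  - rewrite Rabs_minus_sym, (Rabs_minus_sym x'). auto.
Qed.

Lemma dw_linear (X : R -> Prop) f x l k : dw X f x l -> dw X (fun t => f t - k * t) x (l - k).
Proof.
  intros H eps He. destruct (H eps He) as (d & d0 & Hd). exists d. split; [exact d0|].
  intros x' Hx' Hd'. replace (f x' - k * x' - (f x - k * x) - (l - k) * (x' - x))
    with (f x' - f x - l * (x' - x)) by ring. auto.
Qed.

(** The mean value bound is applied to t -> f t - f' x * t, whose derivative is itself at most M |t
    - x|. A quadratic remainder with an explicit constant is what allows series and integrals to be
    differentiated below. *)
Lemma dw_taylor (X : R -> Prop) f f' f'' M : convex X ->
  (forall x, X x -> dw X f x (f' x)) -> (forall x, X x -> dw X f' x (f'' x)) ->
  (forall x, X x -> Rabs (f'' x) <= M) ->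
  forall x x', X x -> X x' -> Rabs (f x' - f x - f' x * (x' - x)) <= M * (x' - x) ^ 2.
Proof.
  intros CX D D2 B x x' Xx Xx'.
  assert (M0 : 0 <= M) by (eapply Rle_trans; [apply Rabs_pos|apply (B x Xx)]).
  set (X' := fun t => X t /\ Rmin x x' <= t <= Rmax x x').
  assert (A : Rabs ((f x' - f' x * x') - (f x - f' x * x)) <= M * Rabs (x' - x) * Rabs (x' - x)).
  { apply (dw_lip X' (fun t => f t - f' x * t) (fun t => f' t - f' x)).
    - intros a b t [Xa Ha] [Xb Hb] Ht. split; [now apply (CX a b)|lra].
    - intros t [Xt _]. apply dw_linear. apply dw_sub with X; [intros u [? _]; assumption|auto].
    - intros t [Xt Ht]. eapply Rle_trans; [apply (dw_lip X f' f'' M CX D2 B); assumption|].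
      apply Rmult_le_compat_l; [assumption|].
      revert Ht. unfold Rmin, Rmax, Rabs.
      destruct (Rle_dec x x'), (Rcase_abs (t - x)), (Rcase_abs (x' - x)); lra.
    - split; [assumption|]. split; [apply Rmin_l|apply Rmax_l].
    - split; [assumption|]. split; [apply Rmin_r|apply Rmax_r]. }
  replace (f x' - f x - f' x * (x' - x)) with ((f x' - f' x * x') - (f x - f' x * x)) by ring.
  eapply Rle_trans; [exact A|]. rewrite Rmult_assoc, <- Rabs_mult, Rabs_pos_eq.
  - right; ring.
  - replace ((x' - x) * (x' - x)) with ((x' - x) ^ 2) by ring. apply pow2_ge_0.
Qed.

(** * Termwise differentiation of series *)

Lemma series_abs_le (a b : nat -> R) : (forall n, Rabs (a n) <= b n) -> ex_series b ->
  ex_series a /\ Rabs (Series a) <= Series b.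
Proof.
  intros H B.
  assert (E : ex_series (fun n => Rabs (a n))).
  { apply (ex_series_le (K := R_AbsRing) (V := R_CompleteNormedModule) (fun n => Rabs (a n)) b); [|assumption]. intros n. change (Rabs (Rabs (a n)) <= b n). now rewrite Rabs_Rabsolu. }
  split; [now apply ex_series_Rabs|].
  eapply Rle_trans; [now apply Series_Rabs|].
  apply Series_le; [|assumption]. intros n. split; [apply Rabs_pos|apply H].
Qed.

(** The remainders M n (x' - x)^2 are summable, so the remainder of the sum is quadratic as well;
    summable bounds on second derivatives take the place of an argument by uniform convergence. *)
Lemma series_dw (X : R -> Prop) (g g' g'' : nat -> R -> R) (M0 M1 M : nat -> R) : convex X ->
  (forall n x, X x -> dw X (g n) x (g' n x)) -> (forall n x, X x -> dw X (g' n) x (g'' n x)) ->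
  ex_series M0 -> ex_series M1 -> ex_series M ->
  (forall n x, X x -> Rabs (g n x) <= M0 n) -> (forall n x, X x -> Rabs (g' n x) <= M1 n) ->
  (forall n x, X x -> Rabs (g'' n x) <= M n) ->
  forall x, X x -> dw X (fun x => Series (fun n => g n x)) x (Series (fun n => g' n x)).
Proof.
  intros CX D D2 S0 S1 S B0 B1 B x Xx eps He.
  assert (SM : 0 <= Series M).
  { destruct (series_abs_le (fun n => g'' n x) M) as [_ H]; auto.
    eapply Rle_trans; [apply Rabs_pos|exact H]. }
  exists (eps / (1 + Series M)). split; [apply Rdiv_lt_0_compat; lra|].
  intros x' Xx' Hx'.
  assert (Eg : forall x, X x -> ex_series (fun n => g n x)).
  { intros u Xu. apply (series_abs_le _ M0); auto. }
  assert (Eg' : ex_series (fun n => g' n x)) by (apply (series_abs_le _ M1); auto).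
  rewrite (Rmult_comm (Series (fun n => g' n x))).
  rewrite <- Series_scal_l.
  rewrite <- Series_minus by (apply Eg; assumption).
  assert (E2 : ex_series (fun n => (x' - x) * g' n x)) by exact (ex_series_scal_l (K := R_AbsRing) (x' - x) _ Eg').
  rewrite <- Series_minus; [|exact (ex_series_minus (K := R_AbsRing) (V := R_NormedModule) _ _ (Eg _ Xx') (Eg _ Xx))|exact E2].
  destruct (series_abs_le (fun n => g n x' - g n x - (x' - x) * g' n x) (fun n => (x' - x) ^ 2 * M n)) as [_ H].
  - intros n. rewrite (Rmult_comm (x' - x)), (Rmult_comm _ (M n)).
    apply (dw_taylor X (g n) (g' n) (g'' n)); auto.
  - exact (ex_series_scal_l (K := R_AbsRing) ((x' - x) ^ 2) _ S).
  - eapply Rle_trans; [exact H|]. rewrite Series_scal_l.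
    replace ((x' - x) ^ 2) with (Rabs (x' - x) * Rabs (x' - x))
      by (rewrite <- Rabs_mult, Rabs_pos_eq; [ring|apply Rle_0_sqr]).
    rewrite Rmult_assoc, (Rmult_comm eps). apply Rmult_le_compat_l; [apply Rabs_pos|].
    apply Rle_trans with (eps / (1 + Series M) * Series M).
    + apply Rmult_le_compat_r; lra.
    + apply Rmult_le_reg_r with (1 + Series M); [lra|].
      replace (eps / (1 + Series M) * Series M * (1 + Series M)) with (eps * Series M) by (field; lra). nra.
Qed.

(* [D i j] is the partial derivative of order [i] in x and [j] in y of a function on [X] x [Y]. *)
Definition DF (X Y : R -> Prop) (D : nat -> nat -> R -> R -> R) : Prop :=
  forall i j, (exists M, forall x y, X x -> Y y -> Rabs (D i j x y) <= M) /\
    forall x y, X x -> Y y ->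
      dw X (fun t => D i j t y) x (D (S i) j x y) /\ dw Y (D i j x) y (D i (S j) x y).

Lemma DF_series (X Y : R -> Prop) (D : nat -> nat -> nat -> R -> R -> R) : convex X -> convex Y ->
  (forall n i j x y, X x -> Y y ->
      dw X (fun t => D n i j t y) x (D n (S i) j x y) /\ dw Y (D n i j x) y (D n i (S j) x y)) ->
  (forall i j, exists M : nat -> R, ex_series M /\ forall n x y, X x -> Y y -> Rabs (D n i j x y) <= M n) ->
  DF X Y (fun i j x y => Series (fun n => D n i j x y)).
Proof.
  intros CX CY HD HB i j. split.
  - destruct (HB i j) as (M & SM & HM). exists (Series M). intros x y Xx Yy.
    apply series_abs_le; auto.
  - destruct (HB i j) as (M & SM & HM), (HB (S i) j) as (M1 & SM1 & HM1), (HB (S (S i)) j) as (M2 & SM2 & HM2).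
    destruct (HB i (S j)) as (N1 & SN1 & HN1), (HB i (S (S j))) as (N2 & SN2 & HN2).
    intros x y Xx Yy. split.
    + apply (series_dw X (fun n t => D n i j t y) (fun n t => D n (S i) j t y) (fun n t => D n (S (S i)) j t y) M M1 M2);
        try assumption; try (intros; now apply HD); auto.
    + apply (series_dw Y (fun n t => D n i j x t) (fun n t => D n i (S j) x t) (fun n t => D n i (S (S j)) x t) M N1 N2);
        try assumption; try (intros; now apply HD); auto.
Qed.

Lemma geom_bound (b : nat -> R) N : (forall n, (N <= n)%nat -> b n <= (1 / 2) ^ n) ->
  exists C, forall n : nat, b n <= C * (1 / 2) ^ n.
Proof.
  intros H.
  assert (A : exists C, 1 <= C /\ forall n, (n < N)%nat -> b n <= C * (1 / 2) ^ n).
  { clear H. induction N as [|N (C & C1 & IH)].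
    - exists 1. split; [lra|]. intros; lia.
    - assert (P : 0 < (1 / 2) ^ N) by (apply pow_lt; lra).
      exists (Rmax C (b N / (1 / 2) ^ N)). pose proof (Rmax_l C (b N / (1 / 2) ^ N)).
      split; [lra|]. intros n Hn.
      assert (Q : 0 < (1 / 2) ^ n) by (apply pow_lt; lra).
      destruct (Nat.eq_dec n N) as [->|ne].
      + apply Rle_trans with (b N / (1 / 2) ^ N * (1 / 2) ^ N); [right; field; lra|].
        apply Rmult_le_compat_r; [lra|apply Rmax_r].
      + eapply Rle_trans; [apply IH; lia|]. apply Rmult_le_compat_r; lra. }
  destruct A as (C & C1 & A). exists C. intros n. destruct (Nat.lt_ge_cases n N) as [h|h]; [auto|].
  assert (Q : 0 < (1 / 2) ^ n) by (apply pow_lt; lra).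
  eapply Rle_trans; [apply H, h|]. nra.
Qed.

Lemma choose {A B} (P : A -> B -> Prop) : (forall a, exists b, P a b) -> exists f, forall a, P a (f a).
Proof.
  intros H. exists (fun a => proj1_sig (constructive_indefinite_description _ (H a))).
  intros a. apply (proj2_sig (constructive_indefinite_description _ (H a))).
Qed.

Definition divpow (n : nat) (x : R) : R := x ^ n / INR (fact n).

Lemma divpow_derive n x : is_derive (divpow n) x (match n with O => 0 | S m => divpow m x end).
Proof.
  unfold divpow. destruct n as [|m].
  - simpl. apply (is_derive_ext (fun _ => 1 / 1)); [reflexivity|apply is_derive_Rconst].
  - replace (x ^ m / INR (fact m)) with (INR (S m) * 1 * x ^ m * / INR (fact (S m)) + x ^ S m * 0).
    + apply (is_derive_Rmult (fun t => t ^ S m) (fun _ => / INR (fact (S m)))); [|apply is_derive_Rconst].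
      apply (is_derive_pow (fun t => t) (S m) x 1), is_derive_Rid.
    + rewrite fact_simpl, mult_INR. field. split; [apply INR_fact_neq_0|]. rewrite S_INR. pose proof (pos_INR m). lra.
Qed.

Lemma Derive_n_divpow n i x : Derive_n (divpow n) i x = if le_dec i n then divpow (n - i) x else 0.
Proof.
  revert x. induction i as [|i IH]; intros x.
  - simpl. now rewrite Nat.sub_0_r.
  - simpl Derive_n. rewrite (Derive_ext _ _ _ IH). destruct (le_dec i n) as [h|h].
    + etransitivity; [apply is_derive_unique, (divpow_derive (n - i) x)|].
      destruct (le_dec (S i) n) as [h'|h'].
      * destruct (n - i)%nat as [|m] eqn:E; [lia|]. f_equal. lia.
      * now replace (n - i)%nat with O by lia.
    + rewrite Derive_const. destruct (le_dec (S i) n); [lia|reflexivity].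
Qed.

Definition bump (n : nat) (x : R) : R := divpow n x * plateau x.

Lemma bump_sm n : sm (fun x _ => bump n x).
Proof.
  assert (P : sm (fun x _ => plateau x)).
  { apply (CF_bumps (fun _ x _ => x)). now apply PF_x. }
  assert (Q : sm (fun x _ => x ^ n * plateau x)).
  { induction n as [|n IH].
    - eapply CF_ext; [|exact P]. intros; simpl; ring.
    - eapply CF_ext; [|apply (CF_xmul _ 2 IH)].
      + intros; simpl; ring.
      + intros i x y _ h. rewrite plateau_0; [ring|lra]. }
  eapply CF_ext; [|apply (CF_scal false (/ INR (fact n)) _ Q)].
  intros; unfold bump, divpow, Rdiv; simpl; ring.
Qed.

Lemma sm_1d_Derive_n f : sm (fun x _ => f x) -> forall n, sm (fun x _ => Derive_n f n x).
Proof.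
  intros F n. induction n as [|n IH]; [exact F|]. exact (sm_Dx _ IH).
Qed.

Lemma sm_1d f : sm (fun x _ => f x) -> forall n,
  (forall x, is_derive (Derive_n f n) x (Derive_n f (S n) x)) /\
  exists C, forall x, Rabs (Derive_n f n x) <= C.
Proof.
  intros F n. pose proof (sm_1d_Derive_n f F n) as G. split.
  - intros x. exact (proj1 (sm_is_derive _ G x 0 ltac:(lra))).
  - destruct (sm_bound _ G) as (C & _ & HC). exists C. intros x. apply (HC x 0). lra.
Qed.

Lemma Derive_n_ext_loc' (f g : R -> R) n x : locally x (fun t => f t = g t) -> Derive_n f n x = Derive_n g n x.
Proof. apply Derive_n_ext_loc. Qed.

(** The plateau is 1 near 0, so the derivatives at 0 are those of x^n / n!. *)
Lemma bump_at_0 n i : Derive_n (bump n) i 0 = if Nat.eq_dec i n then 1 else 0.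
Proof.
  rewrite (Derive_n_ext_loc' _ (divpow n)).
  - rewrite Derive_n_divpow. destruct (le_dec i n), (Nat.eq_dec i n); try lia.
    + subst. rewrite Nat.sub_diag. unfold divpow. simpl. field.
    + unfold divpow. rewrite pow_i by lia. unfold Rdiv. ring.
    + reflexivity.
  - assert (h : -1 < 0 < 1) by lra. generalize (open_interval_loc (-1) 1 0 h). apply filter_imp.
    intros t Ht. unfold bump. rewrite plateau_1 by lra. ring.
Qed.

Lemma bump_support n i x : 2 < Rabs x -> Derive_n (bump n) i x = 0.
Proof.
  intros h. rewrite (Derive_n_ext_loc' _ (fun _ => 0)).
  - destruct i; [reflexivity|]. apply (Derive_n_const i 0).
  - generalize (locally_far 2 x h). apply filter_imp.
    intros t Ht. unfold bump. rewrite plateau_0; [ring|lra].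
Qed.

Lemma finite_max (P : nat -> R -> Prop) N : (forall k, exists M, P k M) ->
  (forall k M M', M <= M' -> P k M -> P k M') -> exists M, 0 <= M /\ forall k, (k <= N)%nat -> P k M.
Proof.
  intros H mono. induction N as [|N (M & M0 & IH)].
  - destruct (H O) as [M HM]. exists (Rmax 0 M). split; [apply Rmax_l|]. intros k Hk.
    replace k with O by lia. eapply mono; [|exact HM]. apply Rmax_r.
  - destruct (H (S N)) as [M' HM']. exists (Rmax M M'). split; [eapply Rle_trans; [exact M0|apply Rmax_l]|].
    intros k Hk. destruct (Nat.eq_dec k (S N)) as [->|ne].
    + eapply mono; [|exact HM']. apply Rmax_r.
    + eapply mono; [|apply IH; lia]. apply Rmax_l.
Qed.

(* The [n]-th monomial is cut off at a scale [t n] small enough for all its low-order derivatives to be below [2 ^ - n]. *)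
Lemma borel (Y : R -> Prop) (c : nat -> nat -> R -> R) : convex Y ->
  (forall n j, exists M, forall y, Y y -> Rabs (c n j y) <= M) ->
  (forall n j y, Y y -> dw Y (c n j) y (c n (S j) y)) ->
  exists D, DF (fun _ => True) Y D /\ (forall n j y, Y y -> D n j 0 y = c n j y) /\
    (forall x y, 2 < Rabs x -> D O O x y = 0).
Proof.
  intros CY HB HD.
  (* Only derivatives of order below n are made small by the choice of t. For fixed (i, j) this
     leaves out finitely many n, which merely enlarge a constant ([geom_bound]). *)
  assert (T : forall n, exists t, 0 < t <= 1 /\
    forall i j x y, (i < n)%nat -> (j < n)%nat -> Y y ->
      t * (Rabs (c n j y) * Rabs (Derive_n (bump n) i x)) <= (1 / 2) ^ n).
  { intros n.
    destruct (finite_max (fun j M => forall y, Y y -> Rabs (c n j y) <= M) n) as (M & M0 & HM).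
    { intros j. apply HB. } { intros k M M' h H y Yy. specialize (H y Yy). lra. }
    destruct (finite_max (fun i M => forall x, Rabs (Derive_n (bump n) i x) <= M) n) as (M' & M0' & HM').
    { intros i. apply (sm_1d _ (bump_sm n) i). } { intros k K K' h H y. specialize (H y). lra. }
    assert (P : 0 < (1 / 2) ^ n <= 1).
    { split; [apply pow_lt; lra|]. rewrite <- (pow1 n) at 2. apply pow_incr. lra. }
    assert (MM : 0 <= M * M') by now apply Rmult_le_pos.
    exists ((1 / 2) ^ n / (1 + M * M')). split; [split|].
    - apply Rdiv_lt_0_compat; lra.
    - apply Rle_div_l; lra.
    - intros i j x y Hi Hj Yy.
      assert (A : Rabs (c n j y) * Rabs (Derive_n (bump n) i x) <= M * M').
      { apply Rmult_le_compat; try apply Rabs_pos; [apply HM; auto; lia|apply HM'; lia]. }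
      unfold Rdiv. rewrite Rmult_assoc. rewrite <- (Rmult_1_r ((1 / 2) ^ n)) at 2.
      apply Rmult_le_compat_l; [lra|].
      rewrite Rmult_comm. apply Rle_div_l; lra. }
  destruct (choose _ T) as [t Ht]. clear T.
  assert (ti : forall n, t n <> 0) by (intros n; destruct (Ht n) as [[? ?] _]; lra).
  set (B := fun n i x => t n ^ n * (/ t n) ^ i * Derive_n (bump n) i (x * / t n)).
  set (D := fun n i j x y => c n j y * B n i x : R).
  assert (DB : forall n i x, is_derive (B n i) x (B n (S i) x)).
  { intros n i x. unfold B.
    replace (t n ^ n * (/ t n) ^ S i * Derive_n (bump n) (S i) (x * / t n))
      with (0 * Derive_n (bump n) i (x * / t n) +
            t n ^ n * (/ t n) ^ i * (Derive_n (bump n) (S i) (x * / t n) * (1 * / t n + x * 0)))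
      by (simpl; ring).
    apply (is_derive_Rmult (fun _ => t n ^ n * (/ t n) ^ i) (fun x => Derive_n (bump n) i (x * / t n)));
      [apply is_derive_Rconst|].
    apply (is_derive_Rcomp (Derive_n (bump n) i) (fun x => x * / t n)).
    - apply (sm_1d _ (bump_sm n)).
    - apply (is_derive_Rmult (fun x => x) (fun _ => / t n)); [apply is_derive_Rid|apply is_derive_Rconst]. }
  exists (fun i j x y => Series (fun n => D n i j x y)).
  split; [|split].
  - apply DF_series; [intros ? ? ? ? ? ?; exact Logic.I|assumption| |].
    + intros n i j x y _ Yy. split.
      * apply is_derive_dw. unfold D.
        replace (c n j y * B n (S i) x) with (0 * B n i x + c n j y * B n (S i) x) by ring.
        apply (is_derive_Rmult (fun _ => c n j y) (B n i)); [apply is_derive_Rconst|apply DB].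
      * unfold D. intros eps He.
        destruct (HD n j y Yy (eps / (1 + Rabs (B n i x)))) as (d & d0 & Hd).
        { pose proof (Rabs_pos (B n i x)). apply Rdiv_lt_0_compat; lra. }
        exists d. split; [assumption|]. intros y' Yy' Hy'. specialize (Hd y' Yy' Hy').
        replace (c n j y' * B n i x - c n j y * B n i x - c n (S j) y * B n i x * (y' - y))
          with ((c n j y' - c n j y - c n (S j) y * (y' - y)) * B n i x) by ring.
        rewrite Rabs_mult. pose proof (Rabs_pos (B n i x)). pose proof (Rabs_pos (y' - y)).
        apply Rle_trans with (eps / (1 + Rabs (B n i x)) * Rabs (y' - y) * Rabs (B n i x)).
        { apply Rmult_le_compat_r; assumption. }
        apply Rmult_le_reg_r with (1 + Rabs (B n i x)); [lra|].
        replace (eps / (1 + Rabs (B n i x)) * Rabs (y' - y) * Rabs (B n i x) * (1 + Rabs (B n i x)))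
          with (eps * Rabs (y' - y) * Rabs (B n i x)) by (field; lra). nra.
    + intros i j.
      assert (Bd : forall n, exists M, forall x y, Y y -> Rabs (D n i j x y) <= M).
      { intros n. destruct (HB n j) as [M HM]. destruct (sm_1d _ (bump_sm n) i) as [_ [K HK]].
        exists (M * (Rabs (t n ^ n * (/ t n) ^ i) * K)). intros x y Yy. unfold D, B. rewrite !(Rabs_mult (c n j y)), (Rabs_mult (t n ^ n * _)).
        apply Rmult_le_compat; auto using Rabs_pos.
        { apply Rmult_le_pos; apply Rabs_pos. }
        apply Rmult_le_compat_l; [apply Rabs_pos|auto]. }
      assert (Bd2 : forall n, exists M, (forall x y, Y y -> Rabs (D n i j x y) <= M) /\
                 ((S (i + j) <= n)%nat -> M <= (1 / 2) ^ n)).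
      { intros n. destruct (le_dec (S (i + j)) n) as [h|h].
        - exists ((1 / 2) ^ n). split; [|intros; lra]. intros x y Yy.
          destruct (Ht n) as [[t0 t1] HH]. unfold D, B.
          rewrite !(Rabs_mult (c n j y)), (Rabs_mult (t n ^ n * _)).
          eapply Rle_trans; [|apply (HH i j (x * / t n) y); auto; lia].
          rewrite (Rabs_pos_eq (t n ^ n * _)).
          2:{ apply Rmult_le_pos; apply pow_le; [lra|left; now apply Rinv_0_lt_compat]. }
          (* Each x-derivative costs a factor 1 / t n; since i < n, at least one factor t n
             survives, and the others are at most 1. *)
          assert (E : t n ^ n * (/ t n) ^ i <= t n).
          { replace n with (i + (1 + (n - i - 1)))%nat at 2 by lia. rewrite !pow_add.
            replace (t n ^ i * (t n ^ 1 * t n ^ (n - i - 1)) * (/ t n) ^ i)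
              with ((t n * / t n) ^ i * (t n ^ 1 * t n ^ (n - i - 1))) by (rewrite Rpow_mult_distr; ring).
            rewrite Rinv_r, pow1 by lra.
            assert (t n ^ (n - i - 1) <= 1) by (rewrite <- (pow1 (n - i - 1)); apply pow_incr; lra).
            simpl. nra. }
          pose proof (Rabs_pos (c n j y)). pose proof (Rabs_pos (Derive_n (bump n) i (x * / t n))).
          replace (Rabs (c n j y) * (t n ^ n * (/ t n) ^ i * Rabs (Derive_n (bump n) i (x * / t n))))
            with (t n ^ n * (/ t n) ^ i * (Rabs (c n j y) * Rabs (Derive_n (bump n) i (x * / t n)))) by ring.
          apply Rmult_le_compat_r; [now apply Rmult_le_pos|exact E].
        - destruct (Bd n) as [M HM]. exists M. split; [assumption|]. intros; lia. }
      destruct (choose _ Bd2) as [b Hb].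
      destruct (geom_bound b (S (i + j))) as [C HC]; [intros n Hn; now apply Hb|].
      exists (fun n => C * (1 / 2) ^ n). split.
      * apply (ex_series_scal_l (K := R_AbsRing) C (fun n => (1 / 2) ^ n)). exists (/ (1 - 1 / 2)). apply is_series_geom. rewrite Rabs_pos_eq; lra.
      * intros n x y _ Yy. eapply Rle_trans; [now apply Hb|apply HC].
  (* At x = 0 the n-th derivative of the k-th term is 0 unless k = n, and there the powers of t n
     cancel. *)
  - intros n j y Yy. rewrite (Series_ext _ (fun k => if Nat.eq_dec k n then c n j y else 0)).
    + apply is_series_unique. clear - n.
      apply (is_series_ext (fun k => if Nat.eq_dec k n then c n j y else 0)); [reflexivity|].
      assert (A : is_lim_seq (sum_n (fun k => if Nat.eq_dec k n then c n j y else 0)) (c n j y)).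
      { apply (is_lim_seq_incr_n _ n).
        apply (is_lim_seq_ext (fun _ => c n j y)); [|apply is_lim_seq_const].
        intros m. symmetry.
        assert (Z : forall k, (k < n)%nat -> sum_n (fun k => if Nat.eq_dec k n then c n j y else 0) k = 0).
        { induction k as [|k IH]; intros Hk.
          - rewrite sum_O. destruct (Nat.eq_dec 0 n); [lia|reflexivity].
          - rewrite sum_Sn, IH by lia. destruct (Nat.eq_dec (S k) n); [lia|]. change (0 + 0 = 0). ring. }
        induction m as [|m IH].
        - simpl. destruct n as [|n'].
          + rewrite sum_O. reflexivity.
          + rewrite sum_Sn, Z by lia. destruct (Nat.eq_dec (S n') (S n')); [|lia]. change (0 + c (S n') j y = c (S n') j y). ring.
        - change (S m + n)%nat with (S (m + n)). rewrite sum_Sn, IH.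
          destruct (Nat.eq_dec (S (m + n)) n); [lia|]. change (c n j y + 0 = c n j y). ring. }
      exact A.
    + intros k. unfold D, B. rewrite Rmult_0_l, bump_at_0.
      destruct (Nat.eq_dec n k), (Nat.eq_dec k n); try lia; [subst|ring].
      rewrite <- Rpow_mult_distr, Rinv_r, pow1 by auto. ring.
  - intros x y h. rewrite (Series_ext _ (fun _ => 0)).
    + rewrite (Series_ext _ (fun n => 0 * (1 / 2) ^ n)) by (intros; ring).
      rewrite Series_scal_l. ring.
    + intros n. unfold D, B. rewrite (bump_support n 0); [ring|].
      destruct (Ht n) as [[t0 t1] _]. rewrite Rabs_mult, (Rabs_pos_eq (/ t n)) by (left; now apply Rinv_0_lt_compat).
      assert (1 <= / t n) by (rewrite <- Rinv_1; apply Rinv_le_contravar; lra). nra.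
Qed.

(** * Extension beyond a closed rectangle *)

Lemma DF_sub (X X' Y Y' : R -> Prop) D : (forall x, X' x -> X x) -> (forall y, Y' y -> Y y) ->
  DF X Y D -> DF X' Y' D.
Proof.
  intros HX HY H i j. destruct (H i j) as [[M HM] HD]. split.
  - exists M. auto.
  - intros x y Xx Yy. destruct (HD x y (HX _ Xx) (HY _ Yy)). split; eapply dw_sub; eauto.
Qed.

Lemma DF_swap X Y D : DF X Y D -> DF Y X (fun i j x y => D j i y x).
Proof.
  intros H i j. destruct (H j i) as [[M HM] HD]. split.
  - exists M. auto.
  - intros x y Xx Yy. destruct (HD y x Yy Xx). split; assumption.
Qed.

Lemma dw_reflect (X : R -> Prop) f x l :
  dw X f (- x) l -> dw (fun t => X (- t)) (fun t => f (- t)) x (- l).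
Proof.
  intros H eps He. destruct (H eps He) as (d & d0 & Hd). exists d. split; [exact d0|].
  intros x' Hx' Hd'. specialize (Hd (- x') Hx').
  replace (- x' - - x) with (- (x' - x)) in Hd by ring. rewrite Rabs_Ropp in Hd.
  replace (- l * (x' - x)) with (l * - (x' - x)) by ring. auto.
Qed.

Lemma dw_scal (X : R -> Prop) f x l k : dw X f x l -> dw X (fun t => k * f t) x (k * l).
Proof.
  intros H eps He. pose proof (Rabs_pos k) as K.
  destruct (H (eps / (1 + Rabs k))) as (d & d0 & Hd); [apply Rdiv_lt_0_compat; lra|].
  exists d. split; [exact d0|]. intros x' Hx' Hd'. specialize (Hd x' Hx' Hd').
  replace (k * f x' - k * f x - k * l * (x' - x)) with (k * (f x' - f x - l * (x' - x))) by ring.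
  rewrite Rabs_mult. apply Rle_trans with (Rabs k * (eps / (1 + Rabs k) * Rabs (x' - x))).
  - now apply Rmult_le_compat_l.
  - pose proof (Rabs_pos (x' - x)).
    apply Rmult_le_reg_r with (1 + Rabs k); [lra|].
    replace (Rabs k * (eps / (1 + Rabs k) * Rabs (x' - x)) * (1 + Rabs k))
      with (Rabs k * (eps * Rabs (x' - x))) by (field; lra). nra.
Qed.

Lemma DF_reflect X Y D : DF X Y D ->
  DF (fun t => X (- t)) Y (fun i j x y => (-1) ^ i * D i j (- x) y).
Proof.
  intros H i j. destruct (H i j) as [[M HM] HD]. split.
  - exists (Rabs ((-1) ^ i) * M). intros x y Xx Yy. rewrite Rabs_mult.
    apply Rmult_le_compat_l; [apply Rabs_pos|]. now apply HM.
  - intros x y Xx Yy. destruct (HD (- x) y Xx Yy). split.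
    + replace ((-1) ^ S i * D (S i) j (- x) y) with ((-1) ^ i * - D (S i) j (- x) y) by (simpl; ring).
      apply (dw_scal _ (fun t => D i j (- t) y)). now apply (dw_reflect X (fun t => D i j t y)).
    + now apply dw_scal.
Qed.

(** To the left of p the function is continued by a Borel function with the same derivatives at p.
    Every [D i j] matches there, so the glued family is differentiable across p to all orders. The
    parameter y of [borel] carries the second variable along. *)
Lemma DF_extend_left (p : R) (X Y : R -> Prop) D : convex Y -> X p ->
  DF (fun x => p <= x /\ X x) Y D ->
  exists D', DF X Y D' /\ forall i j x y, p <= x -> D' i j x y = D i j x y.
Proof.
  intros CY Xp H.
  assert (Pp : p <= p /\ X p) by (split; [lra|assumption]).
  destruct (borel Y (fun n j y => D n j p y) CY) as (B & HB & B0 & _).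
  { intros n j. destruct (H n j) as [[M HM] _]. exists M. auto. }
  { intros n j y Yy. apply (H n j); assumption. }
  exists (fun i j x y => if Rle_dec p x then D i j x y else B i j (x - p) y).
  split; [|intros i j x y h; destruct (Rle_dec p x); [reflexivity|contradiction]].
  intros i j. destruct (H i j) as [[M HM] HD], (HB i j) as [[M' HM'] HBD]. split.
  - exists (Rmax M M'). intros x y Xx Yy. destruct (Rle_dec p x).
    + eapply Rle_trans; [apply HM; auto|apply Rmax_l].
    + eapply Rle_trans; [apply HM'; auto|apply Rmax_r].
  - intros x y Xx Yy.
    assert (Sh : forall x, dw X (fun t => B i j (t - p) y) x (B (S i) j (x - p) y)).
    { intros u eps He. destruct (proj1 (HBD (u - p) y Logic.I Yy) eps He) as (d & d0 & Hd).
      exists d. split; [exact d0|]. intros x' _ Hx'. specialize (Hd (x' - p) Logic.I).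
      replace (x' - p - (u - p)) with (x' - u) in Hd by ring. auto. }
    split.
    + destruct (Rtotal_order x p) as [h|[h|h]].
      * destruct (Rle_dec p x); [lra|].
        apply (dw_local X (fun t => B i j (t - p) y) _ x _ (p - x)); [lra| | |apply Sh].
        -- destruct (Rle_dec p x); [lra|reflexivity].
        -- intros t _ Ht. destruct (Rle_dec p t); [|reflexivity].
           rewrite Rabs_pos_eq in Ht; lra.
      * subst x. destruct (Rle_dec p p); [|lra]. intros eps He.
        destruct (proj1 (HD p y Pp Yy) eps He) as (d & d0 & Hd).
        destruct (Sh p eps He) as (d' & d0' & Hd').
        exists (Rmin d d'). split; [now apply Rmin_pos|].
        pose proof (Rmin_l d d'). pose proof (Rmin_r d d'). intros x' Xx' Hx'.
        destruct (Rle_dec p p); [|lra]. destruct (Rle_dec p x') as [q|q].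
        -- apply Hd; [auto|lra].
        -- specialize (Hd' x' Xx'). rewrite Rminus_diag, !B0 in Hd' by assumption. apply Hd'. lra.
      * destruct (Rle_dec p x); [|lra].
        assert (Q : dw (fun t => p <= t /\ X t) (fun t => D i j t y) x (D (S i) j x y)) by (apply HD; auto).
        intros eps He. destruct (Q eps He) as (d & d0 & Hd).
        exists (Rmin d (x - p)). split; [apply Rmin_pos; lra|].
        pose proof (Rmin_l d (x - p)). pose proof (Rmin_r d (x - p)). intros x' Xx' Hx'.
        assert (p <= x').
        { pose proof (Rabs_maj2 (x' - x)). lra. }
        destruct (Rle_dec p x'); [|contradiction]. destruct (Rle_dec p x); [|lra].
        apply Hd; [auto|lra].
    + destruct (Rle_dec p x).
      * apply HD; auto.
      * apply HBD; auto.
Qed.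

Definition all (_ : R) : Prop := True.

Lemma convex_all : convex all. Proof. intros ? ? ? ? ? ?. exact Logic.I. Qed.

(** Extension past the right end is extension past the left end of the reflected function; this is
    the origin of the signs (-1)^i. *)
Lemma DF_extend (p q : R) (Y : R -> Prop) D : convex Y -> p <= q -> DF (fun x => p <= x <= q) Y D ->
  exists D', DF all Y D' /\ forall i j x y, p <= x <= q -> D' i j x y = D i j x y.
Proof.
  intros CY pq H.
  destruct (DF_extend_left p (fun x => x <= q) Y D CY pq H) as (D1 & H1 & E1).
  pose proof (DF_reflect _ _ _ H1) as H2.
  destruct (DF_extend_left (- q) all Y (fun i j x y => (-1) ^ i * D1 i j (- x) y) CY Logic.I) as (D3 & H3 & E3).
  { eapply DF_sub; [| |exact H2]; [|auto]. intros x [h _]. lra. }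
  pose proof (DF_reflect _ _ _ H3) as H4.
  exists (fun i j x y => (-1) ^ i * D3 i j (- x) y). split.
  - eapply DF_sub; [| |exact H4]; [|auto]. intros; exact Logic.I.
  - intros i j x y h. rewrite E3 by lra. rewrite Ropp_involutive, E1 by lra.
    rewrite <- Rmult_assoc, <- Rpow_mult_distr. replace (-1 * -1) with 1 by ring. rewrite pow1. ring.
Qed.

(** One variable at a time: once x is unrestricted, the roles of the variables are exchanged. *)
Lemma DF_extend_rect (p q r s : R) D : p <= q -> r <= s ->
  DF (fun x => p <= x <= q) (fun y => r <= y <= s) D ->
  exists D', DF all all D' /\ forall i j x y, p <= x <= q -> r <= y <= s -> D' i j x y = D i j x y.
Proof.
  intros pq rs H.
  destruct (DF_extend p q (fun y => r <= y <= s) D) as (D1 & H1 & E1); try assumption.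
  { intros a b t [? ?] [? ?] [? ?]. lra. }
  destruct (DF_extend r s all (fun i j x y => D1 j i y x) convex_all rs) as (D2 & H2 & E2).
  { now apply DF_swap. }
  exists (fun i j x y => D2 j i y x). split; [now apply DF_swap|].
  intros i j x y hx hy. rewrite E2, E1; auto.
Qed.

Lemma DF_sm (X : R -> Prop) (Y : R -> Prop) D : (forall x, X x) -> (forall y, -1 < y < 1 -> Y y) ->
  DF X Y D -> forall i j, sm (D i j).
Proof.
  intros HX HY H i j n. revert i j. induction n as [|n IH]; intros i j.
  all: assert (B : bnd W0 strip false (fun _ : unit => D i j)) by
    (destruct (H i j) as [[M HM] _]; exists O, M; intros [] x y Hy; simpl; rewrite Rmult_1_r; auto).
  - split; [exact B|exact Logic.I].
  - apply (Sm_intro false n _ (fun _ => D (S i) j) (fun _ => D i (S j))); try apply IH.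
    + exact B.
    + intros u x y Hy. destruct (H i j) as [_ HD]. destruct (HD x y (HX x) (HY y Hy)) as [D1 D2]. split.
      * apply dw_is_derive with X; [apply filter_forall; exact HX|exact D1].
      * apply dw_is_derive with Y; [|exact D2].
        generalize (open_interval_loc _ _ _ Hy). apply filter_imp. exact HY.
Qed.

Lemma sm_schwarz f : sm f -> forall x y, -1 < y < 1 -> Dx (Dy f) x y = Dy (Dx f) x y.
Proof.
  intros F x y Hy. unfold Dx, Dy. apply (Schwarz f x y).
  - destruct (open_interval_loc _ _ _ Hy) as [d Hd]. exists d. intros u v _ Hv.
    assert (-1 < v < 1) by (apply Hd, Hv).
    destruct (sm_is_derive f F u v H) as [A1 A2].
    destruct (sm_is_derive (Dy f) (sm_Dy f F) u v H) as [A3 _].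
    destruct (sm_is_derive (Dx f) (sm_Dx f F) u v H) as [_ A4].
    split; [|split; [|split]].
    + exact (ex_intro _ _ A1).
    + exact (ex_intro _ _ A2).
    + exact (ex_intro _ _ A3).
    + exact (ex_intro _ _ A4).
  - apply (sm_continuity_2d (Dx (Dy f))); [now apply sm_Dx, sm_Dy|assumption].
  - apply (sm_continuity_2d (Dy (Dx f))); [now apply sm_Dy, sm_Dx|assumption].
Qed.

(** A normal form, y-derivatives first; commuting the derivatives then makes it a [DF] family. *)
Definition Dxy (f : R -> R -> R) (i j : nat) : R -> R -> R := Nat.iter i Dx (Nat.iter j Dy f).

Lemma sm_iter_Dy f j : sm f -> sm (Nat.iter j Dy f).
Proof. intros F. induction j; simpl; [assumption|now apply sm_Dy]. Qed.

Lemma sm_Dxy f i j : sm f -> sm (Dxy f i j).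
Proof. intros F. unfold Dxy. induction i; simpl; [now apply sm_iter_Dy|now apply sm_Dx]. Qed.

Lemma Dx_ext_strip f g : (forall x y, -1 < y < 1 -> f x y = g x y) ->
  forall x y, -1 < y < 1 -> Dx f x y = Dx g x y.
Proof. intros E x y Hy. unfold Dx. apply Derive_ext. intros. now apply E. Qed.

Lemma Dy_Dx_iter f i : sm f -> forall x y, -1 < y < 1 ->
  Dy (Nat.iter i Dx f) x y = Nat.iter i Dx (Dy f) x y.
Proof.
  intros F. induction i as [|i IH]; intros x y Hy; simpl; [reflexivity|].
  rewrite <- sm_schwarz; [|exact (sm_Dxy f i 0 F)|assumption].
  now apply Dx_ext_strip.
Qed.

Lemma sm_DF f : sm f -> DF all (fun y => -1 < y < 1) (Dxy f).
Proof.
  intros F i j. split.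
  - destruct (sm_bound _ (sm_Dxy f i j F)) as (C & _ & HC). exists C. auto.
  - intros x y _ Hy. destruct (sm_is_derive _ (sm_Dxy f i j F) x y Hy) as [D1 D2]. split.
    + apply is_derive_dw, D1.
    + apply is_derive_dw. unfold Dxy in *. simpl. rewrite <- Dy_Dx_iter; [exact D2| |assumption].
      now apply sm_iter_Dy.
Qed.

(** * Complex functions and the smoothness notions of the statement *)

Definition csm (f : R -> R -> C) : Prop :=
  sm (fun x y => fst (f x y)) /\ sm (fun x y => snd (f x y)).

Lemma norm_C_R (z : C) : norm (z : C_R_NormedModule) = sqrt (Rabs (fst z) ^ 2 + Rabs (snd z) ^ 2).
Proof. reflexivity. Qed.

Lemma norm_fst (z : C) : Rabs (fst z) <= norm (z : C_R_NormedModule).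
Proof.
  rewrite norm_C_R. rewrite <- (sqrt_pow2 (Rabs (fst z))) at 1 by apply Rabs_pos.
  apply sqrt_le_1_alt. pose proof (pow2_ge_0 (Rabs (snd z))). lra.
Qed.

Lemma norm_snd (z : C) : Rabs (snd z) <= norm (z : C_R_NormedModule).
Proof.
  rewrite norm_C_R. rewrite <- (sqrt_pow2 (Rabs (snd z))) at 1 by apply Rabs_pos.
  apply sqrt_le_1_alt. pose proof (pow2_ge_0 (Rabs (fst z))). lra.
Qed.

Lemma norm_le_sum (z : C) : norm (z : C_R_NormedModule) <= Rabs (fst z) + Rabs (snd z).
Proof.
  rewrite norm_C_R. pose proof (Rabs_pos (fst z)). pose proof (Rabs_pos (snd z)).
  rewrite <- (sqrt_pow2 (Rabs (fst z) + Rabs (snd z))) by lra.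
  apply sqrt_le_1_alt. nra.
Qed.

(** Translation between the filter form of the relative derivative of a complex function and the
    epsilon-delta form for its real and imaginary parts. *)
Lemma is_derive_on_iff lo hi f x d : lo <= x <= hi ->
  is_derive_on lo hi f x d <->
  dw (fun t => lo <= t <= hi) (fun t => fst (f t)) x (fst d) /\
  dw (fun t => lo <= t <= hi) (fun t => snd (f t)) x (snd d).
Proof.
  intros Hx. split.
  - intros [_ H].
    assert (L : is_filter_lim (within (fun t : R => lo <= t <= hi) (locally x)) x).
    { intros P HP. unfold within. generalize HP. apply filter_imp. auto. }
    specialize (H x L).
    assert (A : forall eps, 0 < eps -> exists e, 0 < e /\ forall x', lo <= x' <= hi -> Rabs (x' - x) < e ->
       norm (minus (minus (f x') (f x)) (scal (minus x' x) (d : C_R_NormedModule)) : C_R_NormedModule)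
         <= eps * Rabs (x' - x)).
    { intros eps He. destruct (H (mkposreal _ He)) as [e Hd]. exists e. split; [apply cond_pos|].
      intros x' Hx' Hd'. apply (Hd x' Hd' Hx'). }
    split; intros eps He; destruct (A eps He) as (e & e0 & HA); exists e; (split; [exact e0|]);
      intros x' Hx' Hd'; specialize (HA x' Hx' Hd'); (eapply Rle_trans; [|exact HA]).
    + eapply Rle_trans; [|apply norm_fst]. right. f_equal.
      change (fst (f x') - fst (f x) - fst d * (x' - x) =
        (fst (f x') + - fst (f x)) + - ((x' + - x) * fst d)). ring.
    + eapply Rle_trans; [|apply norm_snd]. right. f_equal.
      change (snd (f x') - snd (f x) - snd d * (x' - x) =
        (snd (f x') + - snd (f x)) + - ((x' + - x) * snd d)). ring.
  - intros [H1 H2]. split.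
    + apply (is_linear_scal_l (K := R_AbsRing) (d : C_R_NormedModule)).
    + intros x0 L.
      (* [filterdiff] quantifies over all limits of the filter; as x lies in the interval, x is the
         only one. *)
      assert (x0 = x).
      { destruct (Req_dec x0 x) as [|ne]; [assumption|exfalso].
        assert (e0 : 0 < Rabs (x - x0)) by (apply Rabs_pos_lt; lra).
        assert (Q : locally x0 (fun t : R => Rabs (t - x0) < Rabs (x - x0))).
        { exists (mkposreal _ e0). intros t Ht. exact Ht. }
        apply L in Q. destruct Q as [e He]. specialize (He x (ball_center x e) Hx). lra. }
      subst x0. intros [eps He]. simpl.
      destruct (H1 (eps / 2)) as (e1 & p1 & A1); [lra|].
      destruct (H2 (eps / 2)) as (e2 & p2 & A2); [lra|].
      assert (p : 0 < Rmin e1 e2) by now apply Rmin_pos.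
      exists (mkposreal _ p). intros x' Hd' Hx'. change (Rabs (x' - x) < Rmin e1 e2) in Hd'.
      pose proof (Rmin_l e1 e2). pose proof (Rmin_r e1 e2).
      eapply Rle_trans; [apply norm_le_sum|]. change (norm (minus x' x)) with (Rabs (x' - x)).
      specialize (A1 x' Hx'). specialize (A2 x' Hx').
      replace (eps * Rabs (x' - x)) with (eps / 2 * Rabs (x' - x) + eps / 2 * Rabs (x' - x)) by field.
      apply Rplus_le_compat.
      * eapply Rle_trans; [|apply A1; lra]. right. f_equal.
        change ((fst (f x') + - fst (f x)) + - ((x' + - x) * fst d) = fst (f x') - fst (f x) - fst d * (x' - x)). ring.
      * eapply Rle_trans; [|apply A2; lra]. right. f_equal.
        change ((snd (f x') + - snd (f x)) + - ((x' + - x) * snd d) = snd (f x') - snd (f x) - snd d * (x' - x)). ring.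
Qed.

Lemma bounded_interval lo hi f f' : lo <= hi ->
  (forall x, lo <= x <= hi -> dw (fun t => lo <= t <= hi) f x (f' x)) ->
  exists M, forall x, lo <= x <= hi -> Rabs (f x) <= M.
Proof.
  intros h D.
  assert (Cg : forall t, continuity_pt (fun t => f (clamp lo hi t)) t)
    by (apply (dw_continuous_clamp (fun t => lo <= t <= hi) f f'); auto).
  destruct (continuity_ab_maj (fun t => Rabs (f (clamp lo hi t))) lo hi h) as (m & Hm & _).
  { intros c _. apply (continuity_pt_comp (fun t => f (clamp lo hi t)) Rabs); [apply Cg|apply Rcontinuity_abs]. }
  exists (Rabs (f (clamp lo hi m))). intros x Hx. specialize (Hm x Hx). simpl in Hm.
  now rewrite (clamp_id lo hi x Hx) in Hm.
Qed.

Lemma smooth_on_extend lo hi f : lo < hi -> smooth_on lo hi f ->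
  exists g : R -> C, csm (fun x _ => g x) /\ forall x, lo <= x <= hi -> g x = f x.
Proof.
  intros h (D & D0 & HD).
  assert (A : forall pr : C -> R, (forall n x, lo <= x <= hi ->
      dw (fun t => lo <= t <= hi) (fun t => pr (D n t)) x (pr (D (S n) x))) ->
    exists g : R -> R, sm (fun x _ => g x) /\ forall x, lo <= x <= hi -> g x = pr (f x)).
  { intros pr Hpr.
    destruct (DF_extend lo hi all (fun i j x _ => match j with O => pr (D i x) | _ => 0 end))
      as (D' & H' & E'); [apply convex_all|lra| |].
    - intros i j. split.
      + destruct j.
        * destruct (bounded_interval lo hi (fun t => pr (D i t)) (fun t => pr (D (S i) t))) as [M HM]; [lra|auto|].
          exists M. auto.
        * exists 0. intros. rewrite Rabs_R0. lra.
      + intros x y Hx _. split.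
        * destruct j; [now apply Hpr|]. apply is_derive_dw, is_derive_Rconst.
        * apply is_derive_dw. destruct j; apply is_derive_Rconst.
    - exists (fun x => D' O O x 0). split.
      + pose proof (DF_sm all all D' (fun _ => Logic.I) (fun _ _ => Logic.I) H' O O) as S0.
        assert (Q : sm (fun x y => D' O O x 0)).
        { apply (DF_sm all all (fun i j x y => match j with O => D' i O x 0 | _ => 0 end)
                   (fun _ => Logic.I) (fun _ _ => Logic.I)) with (i := O) (j := O).
          intros i j. split.
          - destruct j; [|exists 0; intros; rewrite Rabs_R0; lra].
            destruct (H' i O) as [[M HM] _]. exists M. intros. apply HM; exact Logic.I.
          - intros x y _ _. split.
            + destruct j; [|apply is_derive_dw, is_derive_Rconst].
              apply (proj2 (H' i O) x 0 Logic.I Logic.I).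
            + apply is_derive_dw. destruct j; apply is_derive_Rconst. }
        exact Q.
      + intros x Hx. rewrite E' by exact Hx. now rewrite D0. }
  destruct (A fst) as (g1 & S1 & E1).
  { intros n x Hx. now apply (is_derive_on_iff lo hi (D n) x (D (S n) x) Hx), HD. }
  destruct (A snd) as (g2 & S2 & E2).
  { intros n x Hx. now apply (is_derive_on_iff lo hi (D n) x (D (S n) x) Hx), HD. }
  exists (fun x => (g1 x, g2 x)). split; [split; assumption|].
  intros x Hx. rewrite (E1 x Hx), (E2 x Hx). now destruct (f x).
Qed.

(** Boundedness from uniform continuity: the segment from the corner (a, c) to (x, y) is cut into S
    n steps shorter than e in each coordinate, each changing f by less than 1. *)
Lemma clamp_continuous_2d (f : R -> R -> R) a b c d : a <= b -> c <= d ->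
  (forall x y, a <= x <= b -> c <= y <= d -> forall eps, 0 < eps -> exists e, 0 < e /\
     forall x' y', a <= x' <= b -> c <= y' <= d -> Rabs (x' - x) < e -> Rabs (y' - y) < e ->
       Rabs (f x' y' - f x y) < eps) ->
  exists M, forall x y, a <= x <= b -> c <= y <= d -> Rabs (f x y) <= M.
Proof.
  intros ab cd H.
  destruct (uniform_continuity_2d (fun x y => f (clamp a b x) (clamp c d y)) a b c d) with (eps := mkposreal 1 Rlt_0_1)
    as [[e e0] He].
  { intros x y Hx Hy [eps Heps].
    destruct (H _ _ (clamp_in a b x ab) (clamp_in c d y cd) eps Heps) as (e & e0 & He).
    exists (mkposreal _ e0). intros u v Hu Hv. simpl in *.
    apply He; try now apply clamp_in.
    - eapply Rle_lt_trans; [now apply clamp_lip|assumption].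
    - eapply Rle_lt_trans; [now apply clamp_lip|assumption]. }
  simpl in He.
  set (L := (b - a) + (d - c)).
  destruct (INR_unbounded (L / e)) as [n Hn].
  exists (Rabs (f a c) + INR (S n)). intros x y Hx Hy.
  set (px := fun k => a + (x - a) * (INR k / INR (S n))).
  set (py := fun k => c + (y - c) * (INR k / INR (S n))).
  assert (N0 : 0 < INR (S n)) by (apply lt_0_INR; lia).
  assert (Rg : forall k, (k <= S n)%nat -> a <= px k <= b /\ c <= py k <= d).
  { intros k Hk. assert (0 <= INR k / INR (S n) <= 1).
    { split; [apply Rdiv_le_0_compat; [apply pos_INR|assumption]|apply Rle_div_l; [assumption|]].
      rewrite Rmult_1_l. now apply le_INR. }
    unfold px, py. split; nra. }
  assert (A : forall k, (k <= S n)%nat -> Rabs (f (px k) (py k)) <= Rabs (f a c) + INR k).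
  { induction k as [|k IH]; intros Hk.
    - unfold px, py. simpl (INR 0). unfold Rdiv. rewrite !Rmult_0_l, !Rmult_0_r, !Rplus_0_r. lra.
    - specialize (IH ltac:(lia)).
      destruct (Rg k ltac:(lia)) as [P1 P2]. destruct (Rg (S k) Hk) as [Q1 Q2].
      assert (St : L * / INR (S n) < e).
      { apply Rmult_lt_reg_r with (INR (S n)); [assumption|].
        rewrite Rmult_assoc, Rinv_l, Rmult_1_r by lra.
        assert (L < INR n * e).
        { apply Rmult_lt_reg_r with (/ e); [now apply Rinv_0_lt_compat|].
          rewrite Rmult_assoc, Rinv_r, Rmult_1_r by lra. unfold Rdiv in Hn. lra. }
        rewrite S_INR. lra. }
      assert (B : forall u m w, m <= u <= w -> w - m <= L ->
        Rabs ((m + (u - m) * (INR (S k) / INR (S n))) - (m + (u - m) * (INR k / INR (S n)))) < e).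
      { intros u m w Hu Hw. rewrite (S_INR k).
        replace (m + (u - m) * ((INR k + 1) / INR (S n)) - (m + (u - m) * (INR k / INR (S n))))
          with ((u - m) * / INR (S n)) by (field; lra).
        assert (0 < / INR (S n)) by now apply Rinv_0_lt_compat.
        rewrite Rabs_pos_eq by (apply Rmult_le_pos; lra).
        eapply Rle_lt_trans; [|exact St]. apply Rmult_le_compat_r; lra. }
      specialize (He (px k) (py k) (px (S k)) (py (S k)) P1 P2 Q1 Q2).
      rewrite !clamp_id in He by assumption.
      assert (Rabs (f (px (S k)) (py (S k)) - f (px k) (py k)) < 1).
      { apply He; [apply (B x a b)|apply (B y c d)]; unfold L; lra. }
      rewrite (S_INR k).
      pose proof (Rabs_triang (f (px (S k)) (py (S k)) - f (px k) (py k)) (f (px k) (py k))) as T.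
      replace (f (px (S k)) (py (S k)) - f (px k) (py k) + f (px k) (py k)) with (f (px (S k)) (py (S k))) in T by ring.
      lra. }
  specialize (A (S n) (le_n _)).
  unfold px, py in A. replace (INR (S n) / INR (S n)) with 1 in A by (field; lra).
  replace (a + (x - a) * 1) with x in A by ring. replace (c + (y - c) * 1) with y in A by ring. exact A.
Qed.

(** Joint continuity of the partial derivatives enters through their boundedness on the rectangle,
    which the extension needs. *)
Lemma smooth_on_rect_extend lo hi e0 f : lo < hi -> 0 < e0 -> smooth_on_rect lo hi e0 f ->
  exists g : R -> R -> C, csm g /\ forall x y, lo <= x <= hi -> 0 <= y <= e0 -> g x y = f x y.
Proof.
  intros h he (D & D0 & HD).
  assert (A : forall pr : C -> R, (forall z, Rabs (pr z) <= norm (z : C_R_NormedModule)) ->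
    (forall z w : C, pr (minus (z : C_R_NormedModule) w) = pr z - pr w) ->
    (forall i j x y, lo <= x <= hi -> 0 <= y <= e0 ->
      dw (fun t => lo <= t <= hi) (fun t => pr (D i j t y)) x (pr (D (S i) j x y)) /\
      dw (fun t => 0 <= t <= e0) (fun t => pr (D i j x t)) y (pr (D i (S j) x y))) ->
    exists g : R -> R -> R, sm g /\ forall x y, lo <= x <= hi -> 0 <= y <= e0 -> g x y = pr (f x y)).
  { intros pr Hn Hm Hpr.
    destruct (DF_extend_rect lo hi 0 e0 (fun i j x y => pr (D i j x y))) as (D' & H' & E'); [lra|lra| |].
    - intros i j. split; [|now apply Hpr].
      apply (clamp_continuous_2d (fun x y => pr (D i j x y))); [lra|lra|].
      intros x y Hx Hy eps Heps. destruct (HD i j x y Hx Hy) as (_ & _ & Hc).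
      specialize (Hc (fun z : C_R_NormedModule => norm (minus z (D i j x y : C_R_NormedModule)) < eps)).
      assert (Q : locally (D i j x y : C_R_NormedModule)
         (fun z : C_R_NormedModule => norm (minus z (D i j x y : C_R_NormedModule)) < eps)).
      { assert (p : 0 < eps / 2) by lra. exists (mkposreal _ p). intros z [b1 b2].
        eapply Rle_lt_trans; [apply norm_le_sum|].
        change (Rabs (fst z - fst (D i j x y)) < eps / 2) in b1.
        change (Rabs (snd z - snd (D i j x y)) < eps / 2) in b2.
        change (Rabs (fst z - fst (D i j x y)) + Rabs (snd z - snd (D i j x y)) < eps). lra. }
      apply Hc in Q. destruct Q as [e He]. exists e. split; [apply cond_pos|].
      intros x' y' Hx' Hy' hx hy. rewrite <- Hm. eapply Rle_lt_trans; [apply Hn|].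
      apply (He (x', y')); [split; assumption|split; assumption].
    - exists (D' O O). split.
      + apply (DF_sm all all D' (fun _ => Logic.I) (fun _ _ => Logic.I) H').
      + intros x y Hx Hy. rewrite E' by assumption. now rewrite D0. }
  destruct (A fst) as (g1 & S1 & E1).
  { apply norm_fst. } { intros [? ?] [? ?]; reflexivity. }
  { intros i j x y Hx Hy. destruct (HD i j x y Hx Hy) as (H1 & H2 & _).
    split; [now apply (is_derive_on_iff lo hi (fun t => D i j t y) x (D (S i) j x y) Hx)
           |now apply (is_derive_on_iff 0 e0 (fun t => D i j x t) y (D i (S j) x y) Hy)]. }
  destruct (A snd) as (g2 & S2 & E2).
  { apply norm_snd. } { intros [? ?] [? ?]; reflexivity. }
  { intros i j x y Hx Hy. destruct (HD i j x y Hx Hy) as (H1 & H2 & _).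
    split; [now apply (is_derive_on_iff lo hi (fun t => D i j t y) x (D (S i) j x y) Hx)
           |now apply (is_derive_on_iff 0 e0 (fun t => D i j x t) y (D i (S j) x y) Hy)]. }
  exists (fun x y => (g1 x y, g2 x y)). split; [split; assumption|].
  intros x y Hx Hy. rewrite (E1 x y Hx Hy), (E2 x y Hx Hy). now destruct (f x y).
Qed.

(** The way back: e < 1 puts [0, e] inside the strip, and the Lipschitz bounds give joint
    continuity. *)
Lemma csm_smooth_on_rect lo hi e f : 0 < e < 1 -> csm f -> smooth_on_rect lo hi e f.
Proof.
  intros he [F1 F2].
  set (f1 := fun x y => fst (f x y)) in *. set (f2 := fun x y => snd (f x y)) in *.
  exists (fun i j x y => (Dxy f1 i j x y, Dxy f2 i j x y)). split.
  - intros x y _ _. unfold Dxy, f1, f2. simpl. now destruct (f x y).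
  - intros i j x y Hx Hy.
    destruct (proj2 (sm_DF f1 F1 i j) x y Logic.I) as [A1 B1]; [lra|].
    destruct (proj2 (sm_DF f2 F2 i j) x y Logic.I) as [A2 B2]; [lra|].
    split; [|split].
    + apply is_derive_on_iff; [assumption|]. split.
      * eapply dw_sub; [|exact A1]. intros; exact Logic.I.
      * eapply dw_sub; [|exact A2]. intros; exact Logic.I.
    + apply is_derive_on_iff; [assumption|]. split.
      * eapply dw_sub; [|exact B1]. simpl. intros; lra.
      * eapply dw_sub; [|exact B2]. simpl. intros; lra.
    + destruct (sm_lip _ (sm_Dxy f1 i j F1)) as (M1 & M10 & L1).
      destruct (sm_lip _ (sm_Dxy f2 i j F2)) as (M2 & M20 & L2).
      intros P [[d d0] Hd].
      assert (p : 0 < d / (2 * (1 + M1 + M2))) by (apply Rdiv_lt_0_compat; lra).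
      exists (mkposreal _ p). intros [x' y'] [hx hy] [Hx' Hy']. simpl in Hx', Hy'.
      change (Rabs (x' - x) < d / (2 * (1 + M1 + M2))) in hx.
      change (Rabs (y' - y) < d / (2 * (1 + M1 + M2))) in hy.
      assert (E : d = (1 + M1 + M2) * (2 * (d / (2 * (1 + M1 + M2))))) by (field; lra).
      set (r := d / (2 * (1 + M1 + M2))) in *.
      pose proof (Rabs_pos (x' - x)). pose proof (Rabs_pos (y' - y)).
      apply Hd. split.
      * change (Rabs (Dxy f1 i j x' y' - Dxy f1 i j x y) < d).
        eapply Rle_lt_trans; [apply L1; lra|]. nra.
      * change (Rabs (Dxy f2 i j x' y' - Dxy f2 i j x y) < d).
        eapply Rle_lt_trans; [apply L2; lra|]. nra.
Qed.

(** * Summation of flat families *)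

Lemma ex_series_inv_sq : ex_series (fun n => / (INR n + 1) ^ 2).
Proof.
  assert (T : is_series (fun n => / (INR n + 1) - / (INR n + 2)) 1).
  { assert (S0 : forall n, sum_n (fun n => / (INR n + 1) - / (INR n + 2)) n = 1 - / (INR n + 2)).
    { induction n.
      - rewrite sum_O. simpl. field.
      - rewrite sum_Sn, IHn, S_INR. change plus with Rplus. simpl. pose proof (pos_INR n). field. lra. }
    assert (L : is_lim_seq (sum_n (fun n => / (INR n + 1) - / (INR n + 2))) 1).
    { apply (is_lim_seq_ext (fun n => 1 - / (INR n + 2))); [intros; symmetry; apply S0|].
      replace (Finite 1) with (Finite (1 - 0)) by (f_equal; ring).
      apply is_lim_seq_minus'; [apply is_lim_seq_const|].
      apply (is_lim_seq_inv _ p_infty); [|discriminate].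
      apply (is_lim_seq_plus _ _ p_infty 2 p_infty); [apply is_lim_seq_INR|apply is_lim_seq_const|reflexivity]. }
    exact L. }
  apply (ex_series_le (K := R_AbsRing) (V := R_CompleteNormedModule) _ (fun n => 2 * (/ (INR n + 1) - / (INR n + 2)))).
  - intros n. change (Rabs (/ (INR n + 1) ^ 2) <= 2 * (/ (INR n + 1) - / (INR n + 2))).
    pose proof (pos_INR n). rewrite Rabs_pos_eq by (left; apply Rinv_0_lt_compat, pow_lt; lra).
    replace (/ (INR n + 1) - / (INR n + 2)) with (/ ((INR n + 1) * (INR n + 2))) by (field; lra).
    apply Rmult_le_reg_r with ((INR n + 1) ^ 2 * (INR n + 2)); [apply Rmult_lt_0_compat; [apply pow_lt; lra|lra]|].
    replace (/ (INR n + 1) ^ 2 * ((INR n + 1) ^ 2 * (INR n + 2))) with (INR n + 2) by (field; lra).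
    replace (2 * / ((INR n + 1) * (INR n + 2)) * ((INR n + 1) ^ 2 * (INR n + 2))) with (2 * (INR n + 1)) by (field; lra).
    lra.
  - exists (2 * 1). exact (is_series_scal_l (K := R_AbsRing) 2 _ _ T).
Qed.

(** Row n of a family is meant for step sizes with 1/eps of the order of n, so n + 1 stands for
    1/eps. *)
Definition Wnat (n : nat) : R := INR n + 1.

Lemma Wnat_ge1 n : 1 <= Wnat n.
Proof. unfold Wnat. pose proof (pos_INR n). lra. Qed.

#[global] Instance Wnat_frame : frame Wnat (fun _ y => -1 < y < 1).
Proof. split; [apply Wnat_ge1|intros i y; apply open_interval_loc]. Qed.

Lemma CF_Dxy_nat f : CF Wnat (fun _ y => -1 < y < 1) true f -> forall i j,
  CF Wnat (fun _ y => -1 < y < 1) true (fun n => Dxy (f n) i j).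
Proof.
  intros F i j. unfold Dxy. induction i as [|i IH].
  - simpl. induction j as [|j IH]; [exact F|]. exact (CF_dy _ _ IH).
  - exact (CF_dx _ _ IH).
Qed.

(** Flatness with exponent 2 suffices: every derivative of f n is O((n + 1)^(-2)), so all
    differentiated series converge. This is where decay in the row index turns into smoothness up to
    y = 0. *)
Lemma sm_Series (f : nat -> R -> R -> R) :
  CF Wnat (fun _ y => -1 < y < 1) true f -> sm (fun x y => Series (fun n => f n x y)).
Proof.
  intros F.
  (* A single row has constant weight, whose powers are mere constants; so weight 1 serves as
     well. *)
  assert (S : forall n, sm (f n)).
  { intros n. apply CF_weaken in F.
    assert (G : CF (fun _ : unit => Wnat n) strip false (fun _ => f n)).
    { apply (CF_reindex (WJ := Wnat) (OJ := fun _ y => -1 < y < 1) (fun _ => n) false f); auto. }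
    intros N. specialize (G N). revert G. generalize (f n). induction N as [|N IH]; intros g G.
    all: assert (B : bnd W0 strip false (fun _ : unit => g)) by
      (destruct (Sm_bnd _ _ _ G) as (q & C & HC); exists O, (C * Wnat n ^ q); intros i x y O;
       simpl; rewrite Rmult_1_r; apply (HC i x y O)).
    - split; [exact B|exact Logic.I].
    - destruct G as (_ & D & X & Y). split; [exact B|]. split; [exact D|]. split.
      + exact (IH (Dx g) X).
      + exact (IH (Dy g) Y). }
  apply (DF_sm all (fun y => -1 < y < 1) (fun i j x y => Series (fun n => Dxy (f n) i j x y))
           (fun _ => Logic.I) (fun _ h => h)) with (i := O) (j := O).
  apply DF_series.
  - apply convex_all.
  - intros a b t [? ?] [? ?] [? ?]; lra.
  - intros n i j x y Hx Hy. apply (sm_DF (f n) (S n) i j); assumption.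
  - intros i j. destruct (CF_bnd _ _ (CF_Dxy_nat f F i j) 2%nat) as [C HC].
    exists (fun n => C * / (INR n + 1) ^ 2). split.
    + exact (ex_series_scal_l (K := R_AbsRing) C _ ex_series_inv_sq).
    + intros n x y _ Hy. specialize (HC n x y Hy). unfold Wnat in HC.
      pose proof (pos_INR n). assert (0 < (INR n + 1) ^ 2) by (apply pow_lt; lra).
      apply Rle_div_r in HC; [exact HC|assumption].
Qed.

(** * Complex sums and complex families *)

Lemma C_ext (z w : C) : fst z = fst w -> snd z = snd w -> z = w.
Proof. destruct z, w; simpl; congruence. Qed.

Fixpoint csum (n : nat) (f : nat -> C) : C :=
  match n with O => 0 | S n' => (csum n' f + f n')%C end.

Lemma csum_fst n f : fst (csum n f) = rsum n (fun j => fst (f j)).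
Proof. induction n; simpl; [reflexivity|]. now rewrite IHn. Qed.

Lemma csum_snd n f : snd (csum n f) = rsum n (fun j => snd (f j)).
Proof. induction n; simpl; [reflexivity|]. now rewrite IHn. Qed.

Lemma csum_ext n f g : (forall j, (j < n)%nat -> f j = g j) -> csum n f = csum n g.
Proof. induction n; simpl; intros H; [reflexivity|]. rewrite IHn, H; auto. Qed.

Lemma csum_plus n f g : csum n (fun j => f j + g j)%C = (csum n f + csum n g)%C.
Proof. induction n; simpl; [ring|]. rewrite IHn. ring. Qed.

Lemma csum_mult_l n c f : csum n (fun j => c * f j)%C = (c * csum n f)%C.
Proof. induction n; simpl; [ring|]. rewrite IHn. ring. Qed.

Lemma csum_mult_r n c f : csum n (fun j => f j * c)%C = (csum n f * c)%C.
Proof. induction n; simpl; [ring|]. rewrite IHn. ring. Qed.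

Lemma csum_zero n f : (forall j, (j < n)%nat -> f j = RtoC 0) -> csum n f = RtoC 0.
Proof. intros H. induction n; simpl; [reflexivity|]. rewrite IHn, H by auto. ring. Qed.

Lemma csum_swap n m (f : nat -> nat -> C) :
  csum n (fun i => csum m (fun j => f i j)) = csum m (fun j => csum n (fun i => f i j)).
Proof.
  induction n; simpl.
  - symmetry. now apply csum_zero.
  - now rewrite IHn, csum_plus.
Qed.

Lemma csum_single n k f : (k < n)%nat -> (forall j, (j < n)%nat -> j <> k -> f j = RtoC 0) ->
  csum n f = f k.
Proof.
  induction n as [|n IH]; intros Hk H; [lia|]. simpl.
  destruct (Nat.eq_dec k n) as [->|ne].
  - rewrite csum_zero; [ring|]. intros j Hj. apply H; lia.
  - rewrite IH, (H n); auto; [ring|lia].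
Qed.

Lemma csum_mod n f : Cmod (csum n f) <= rsum n (fun j => Cmod (f j)).
Proof.
  induction n; simpl; [rewrite Cmod_0; lra|].
  eapply Rle_trans; [apply Cmod_triangle|]. lra.
Qed.

Lemma sum_n_csum (f : nat -> C) n : sum_n (G := C_AbelianMonoid) f n = csum (S n) f.
Proof.
  induction n.
  - rewrite sum_O. simpl. symmetry. apply Cplus_0_l.
  - rewrite sum_Sn, IHn. reflexivity.
Qed.

Lemma sum_n_m_csum (f : nat -> C) n : sum_n_m (G := C_AbelianMonoid) f 1 n = csum n (fun j => f (S j)).
Proof.
  induction n.
  - rewrite sum_n_m_zero by lia. reflexivity.
  - rewrite sum_n_Sm by lia. rewrite IHn. reflexivity.
Qed.

Lemma Cexp_plus z w : Cexp (z + w)%C = (Cexp z * Cexp w)%C.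
Proof.
  unfold Cexp. apply C_ext; simpl; rewrite exp_plus, ?cos_plus, ?sin_plus; ring.
Qed.

Lemma Cexp_0 : Cexp 0 = RtoC 1.
Proof. unfold Cexp, RtoC. simpl. rewrite exp_0, cos_0, sin_0. f_equal; ring. Qed.

Lemma Cexp_opp z : (Cexp z * Cexp (- z) = 1)%C.
Proof. rewrite <- Cexp_plus, <- Cexp_0. f_equal. ring. Qed.

Lemma Cexp_neq_0 z : Cexp z <> 0.
Proof. intros E. pose proof (Cexp_opp z) as H. rewrite E, Cmult_0_l in H. apply RtoC_inj in H. lra. Qed.

Lemma Cexp_mod z : Cmod (Cexp z) = exp (fst z).
Proof.
  unfold Cmod, Cexp. simpl.
  replace (_ + _) with (exp (fst z) ^ 2 * (Rsqr (sin (snd z)) + Rsqr (cos (snd z)))) by (unfold Rsqr; ring).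
  rewrite sin2_cos2, Rmult_1_r. apply sqrt_pow2. left. apply exp_pos.
Qed.

Lemma Cmod_sq z : Cmod z ^ 2 = fst z ^ 2 + snd z ^ 2.
Proof.
  unfold Cmod. rewrite pow2_sqrt; [reflexivity|].
  pose proof (pow2_ge_0 (fst z)). pose proof (pow2_ge_0 (snd z)). lra.
Qed.

Lemma Cmod_fst z : Rabs (fst z) <= Cmod z.
Proof. eapply Rle_trans; [apply Rmax_l|apply Rmax_Cmod]. Qed.

Lemma Cmod_snd z : Rabs (snd z) <= Cmod z.
Proof. eapply Rle_trans; [apply Rmax_r|apply Rmax_Cmod]. Qed.

Lemma Cmod_le_sum z : Cmod z <= Rabs (fst z) + Rabs (snd z).
Proof.
  pose proof (norm_le_sum z) as H. rewrite norm_C_R, !pow2_abs in H. exact H.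
Qed.

Lemma Cexp_pow z n : Cpow (Cexp z) n = Cexp (INR n * z)%C.
Proof.
  induction n as [|n IH].
  - simpl. rewrite Cmult_0_l. symmetry. apply Cexp_0.
  - rewrite S_INR, RtoC_plus. simpl. rewrite IH, <- Cexp_plus. f_equal. ring.
Qed.

Definition cCF {I} (W : I -> R) (Om : I -> R -> Prop) (fl : bool) (f : I -> R -> R -> C) : Prop :=
  CF W Om fl (fun i x y => fst (f i x y)) /\ CF W Om fl (fun i x y => snd (f i x y)).

Section ComplexClass.
Context {I : Type} {W : I -> R} {Om : I -> R -> Prop} {FR : frame W Om}.
Local Notation cCF := (cCF W Om).

Lemma cCF_ext fl f g : (forall i x y, Om i y -> f i x y = g i x y) -> cCF fl f -> cCF fl g.
Proof.
  intros E [F1 F2].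
  split; [eapply CF_ext; [|exact F1]|eapply CF_ext; [|exact F2]];
    intros i x y O; simpl; now rewrite (E i x y O).
Qed.

Lemma cCF_const c : cCF false (fun _ _ _ => c).
Proof. split; now apply CF_const. Qed.

Lemma cCF_plus fl f g : cCF fl f -> cCF fl g -> cCF fl (fun i x y => f i x y + g i x y)%C.
Proof. intros [F1 F2] [G1 G2]. split; simpl; now apply CF_plus. Qed.

Lemma cCF_opp fl f : cCF fl f -> cCF fl (fun i x y => - f i x y)%C.
Proof. intros [F1 F2]. split; simpl; now apply CF_opp. Qed.

Lemma cCF_minus fl f g : cCF fl f -> cCF fl g -> cCF fl (fun i x y => f i x y - g i x y)%C.
Proof. intros F G. apply cCF_plus; [assumption|now apply cCF_opp]. Qed.

Lemma cCF_mult fl f g : cCF fl f -> cCF false g -> cCF fl (fun i x y => f i x y * g i x y)%C.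
Proof.
  intros [F1 F2] [G1 G2]. split; simpl.
  - apply CF_minus; try assumption; now apply CF_mult.
  - apply CF_plus; try assumption; now apply CF_mult.
Qed.

Lemma cCF_mult_r fl f g : cCF false f -> cCF fl g -> cCF fl (fun i x y => f i x y * g i x y)%C.
Proof.
  intros F G. eapply cCF_ext; [|apply (cCF_mult fl g f G F)]. intros; simpl; ring.
Qed.

Lemma cCF_RtoC fl f : CF W Om fl f -> cCF fl (fun i x y => RtoC (f i x y)).
Proof. intros F. split; simpl; [exact F|]. intros n. now apply Sm_zero. Qed.

Lemma cCF_weaken f : cCF true f -> cCF false f.
Proof. intros [F1 F2]. split; now apply CF_weaken. Qed.

(** Only the real part of the exponent has to be bounded above; a large imaginary part costs powers
    of W in the derivatives but nothing in size. *)
Lemma cCF_exp f M : cCF false f -> (forall i x y, Om i y -> fst (f i x y) <= M) ->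
  cCF false (fun i x y => Cexp (f i x y)).
Proof.
  intros [F1 F2] HM. destruct (CF_cos_sin _ F2) as [c s].
  split; simpl; (apply CF_mult; try assumption); now apply (CF_exp _ M).
Qed.

Lemma cCF_inv f c : 0 < c -> cCF false f -> (forall i x y, Om i y -> c <= Cmod (f i x y)) ->
  cCF false (fun i x y => / f i x y)%C.
Proof.
  intros c0 [F1 F2] H.
  assert (V : CF W Om false (fun i x y => / (fst (f i x y) ^ 2 + snd (f i x y) ^ 2))).
  { apply (CF_inv _ (c ^ 2)).
    - now apply pow_lt.
    - apply CF_plus; try assumption; now apply CF_pow.
    - intros i x y O. rewrite <- Cmod_sq, Rabs_pos_eq by apply pow2_ge_0.
      apply pow_incr. split; [lra|auto]. }
  split; simpl.
  - now apply (CF_mult false _ _ F1).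
  - eapply CF_ext; [|apply (CF_mult false _ _ (CF_opp false _ F2) V)].
    intros; simpl. unfold Rdiv. ring.
Qed.

Lemma cCF_bnd_false f : cCF false f -> exists q K, 0 <= K /\ forall i x y, Om i y -> Cmod (f i x y) <= K * W i ^ q.
Proof.
  intros [F1 F2]. destruct (CF_bnd _ _ F1) as (q1 & K1 & H1), (CF_bnd _ _ F2) as (q2 & K2 & H2).
  exists (q1 + q2)%nat, (Rabs K1 + Rabs K2).
  split; [pose proof (Rabs_pos K1); pose proof (Rabs_pos K2); lra|].
  intros i x y O. specialize (H1 i x y O). specialize (H2 i x y O).
  eapply Rle_trans; [apply Cmod_le_sum|]. rewrite pow_add.
  pose proof (Wpow_ge1 i q1). pose proof (Wpow_ge1 i q2).
  pose proof (Rle_abs K1). pose proof (Rle_abs K2). pose proof (Rabs_pos K1). pose proof (Rabs_pos K2).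
  rewrite Rmult_plus_distr_r. apply Rplus_le_compat.
  - eapply Rle_trans; [exact H1|]. rewrite <- Rmult_assoc. apply Rle_trans with (Rabs K1 * W i ^ q1); [nra|].
    rewrite <- (Rmult_1_r (Rabs K1 * W i ^ q1)) at 1. apply Rmult_le_compat_l; nra.
  - eapply Rle_trans; [exact H2|]. apply Rle_trans with (Rabs K2 * W i ^ q2); [nra|].
    apply Rmult_le_compat_l; nra.
Qed.

Lemma cCF_bnd_true f : cCF true f -> forall q, exists K, 0 <= K /\ forall i x y, Om i y -> Cmod (f i x y) * W i ^ q <= K.
Proof.
  intros [F1 F2] q. destruct (CF_bnd _ _ F1 q) as (K1 & H1), (CF_bnd _ _ F2 q) as (K2 & H2).
  exists (Rabs K1 + Rabs K2). split; [pose proof (Rabs_pos K1); pose proof (Rabs_pos K2); lra|].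
  intros i x y O. specialize (H1 i x y O). specialize (H2 i x y O).
  pose proof (Wpow_ge1 i q). pose proof (Rle_abs K1). pose proof (Rle_abs K2).
  apply Rle_trans with ((Rabs (fst (f i x y)) + Rabs (snd (f i x y))) * W i ^ q); [|nra].
  apply Rmult_le_compat_r; [lra|apply Cmod_le_sum].
Qed.

Lemma cCF_csum_const n fl (f : nat -> I -> R -> R -> C) : (forall j, (j < n)%nat -> cCF fl (f j)) ->
  cCF fl (fun i x y => csum n (fun j => f j i x y)).
Proof.
  induction n as [|n IH]; intros H; simpl.
  - split; simpl; intros N; now apply Sm_zero.
  - apply cCF_plus; auto.
Qed.

Lemma cCF_csum (n : I -> nat) fl (f : I * nat -> R -> R -> C) q K :
  (forall i y, Om i y -> INR (n i) <= K * W i ^ q) ->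
  (CF (fun p : I * nat => W (fst p)) (fun p y => Om (fst p) y /\ (snd p < n (fst p))%nat) fl (fun i x y => fst (f i x y)) /\
   CF (fun p : I * nat => W (fst p)) (fun p y => Om (fst p) y /\ (snd p < n (fst p))%nat) fl (fun i x y => snd (f i x y))) ->
  cCF fl (fun i x y => csum (n i) (fun j => f (i, j) x y)).
Proof.
  intros Hn [F1 F2]. split.
  - eapply CF_ext; [|apply (CF_rsum n fl _ q K Hn F1)].
    intros; simpl. now rewrite csum_fst.
  - eapply CF_ext; [|apply (CF_rsum n fl _ q K Hn F2)].
    intros; simpl. now rewrite csum_snd.
Qed.

Lemma cCF_comp (f : R -> R -> C) (u v : I -> R -> R -> R) :
  csm f -> PF W Om u -> PF W Om v -> (forall i x y, Om i y -> -1 < v i x y < 1) ->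
  cCF false (fun i x y => f (u i x y) (v i x y)).
Proof.
  intros [F1 F2] U V H. split.
  - now apply (CF_comp (fun x y => fst (f x y)) u v).
  - now apply (CF_comp (fun x y => snd (f x y)) u v).
Qed.

Lemma cCF_if (b : I -> bool) fl f g :
  (CF W (fun i y => Om i y /\ b i = true) fl (fun i x y => fst (f i x y)) /\
   CF W (fun i y => Om i y /\ b i = true) fl (fun i x y => snd (f i x y))) ->
  (CF W (fun i y => Om i y /\ b i = false) fl (fun i x y => fst (g i x y)) /\
   CF W (fun i y => Om i y /\ b i = false) fl (fun i x y => snd (g i x y))) ->
  cCF fl (fun i x y => if b i then f i x y else g i x y).
Proof.
  intros [F1 F2] [G1 G2]. split.
  - eapply CF_ext; [|apply (CF_if b fl _ _ F1 G1)]. intros i x y O. simpl; destruct (b i); reflexivity.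
  - eapply CF_ext; [|apply (CF_if b fl _ _ F2 G2)]. intros i x y O. simpl; destruct (b i); reflexivity.
Qed.

End ComplexClass.

Lemma cCF_reindex {I J} {WI : I -> R} {OI : I -> R -> Prop} {WJ : J -> R} {OJ : J -> R -> Prop}
  (r : I -> J) fl f :
  (forall i y, OI i y -> OJ (r i) y) -> (forall i, WI i = WJ (r i)) ->
  cCF WJ OJ fl f -> cCF WI OI fl (fun i => f (r i)).
Proof.
  intros HO HW [F1 F2].
  split; [exact (CF_reindex r fl _ HO HW F1)|exact (CF_reindex r fl _ HO HW F2)].
Qed.

Lemma csm_const c : csm (fun _ _ => c).
Proof. apply (cCF_const c). Qed.

Lemma csm_plus f g : csm f -> csm g -> csm (fun x y => f x y + g x y)%C.
Proof. exact (cCF_plus false (fun _ => f) (fun _ => g)). Qed.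

Lemma csm_minus f g : csm f -> csm g -> csm (fun x y => f x y - g x y)%C.
Proof. exact (cCF_minus false (fun _ => f) (fun _ => g)). Qed.

Lemma csm_mult f g : csm f -> csm g -> csm (fun x y => f x y * g x y)%C.
Proof. exact (cCF_mult false (fun _ => f) (fun _ => g)). Qed.

Lemma csm_RtoC f : sm f -> csm (fun x y => RtoC (f x y)).
Proof. exact (cCF_RtoC false (fun _ => f)). Qed.

Lemma csm_ext f g : (forall x y, -1 < y < 1 -> f x y = g x y) -> csm f -> csm g.
Proof. intros E. apply (cCF_ext false (fun _ => f) (fun _ => g)). intros u x y Hy. now apply E. Qed.

Lemma csm_csum n (f : nat -> R -> R -> C) : (forall j, (j < n)%nat -> csm (f j)) ->
  csm (fun x y => csum n (fun j => f j x y)).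
Proof. exact (cCF_csum_const n false (fun j _ => f j)). Qed.

Lemma csm_bound f : csm f -> exists K, 0 <= K /\ forall x y, -1 < y < 1 -> Cmod (f x y) <= K.
Proof.
  intros F. destruct (cCF_bnd_false (fun _ => f) F) as (q & K & K0 & H).
  exists K. split; [assumption|]. intros x y Hy. specialize (H tt x y Hy). unfold W0 in H.
  now rewrite pow1, Rmult_1_r in H.
Qed.

Lemma csm_lip f : csm f -> exists M, 0 <= M /\ forall x y x' y', -1 < y < 1 -> -1 < y' < 1 ->
  Cmod (f x' y' - f x y)%C <= M * (Rabs (x' - x) + Rabs (y' - y)).
Proof.
  intros [F1 F2]. destruct (sm_lip _ F1) as (M1 & M10 & H1), (sm_lip _ F2) as (M2 & M20 & H2).
  exists (M1 + M2). split; [lra|]. intros x y x' y' Hy Hy'.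
  eapply Rle_trans; [apply Cmod_le_sum|]. specialize (H1 x y x' y' Hy Hy'). specialize (H2 x y x' y' Hy Hy').
  change (Rabs (fst (f x' y') - fst (f x y)) + Rabs (snd (f x' y') - snd (f x y)) <=
     (M1 + M2) * (Rabs (x' - x) + Rabs (y' - y))). lra.
Qed.

Lemma csm_exp f : csm f -> csm (fun x y => Cexp (f x y)).
Proof.
  intros F. destruct (csm_bound f F) as (K & K0 & HK).
  apply (cCF_exp (fun _ => f) K F).
  intros i x y Hy. eapply Rle_trans; [apply Rle_abs|]. eapply Rle_trans; [apply Cmod_fst|]. now apply HK.
Qed.

Lemma csm_pow f n : csm f -> csm (fun x y => Cpow (f x y) n).
Proof. intros F. induction n; simpl; [apply csm_const|now apply csm_mult]. Qed.

Lemma csm_restrict f : csm f -> csm (fun x _ => f x 0).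
Proof.
  intros F. apply (cCF_comp f (fun _ x _ => x) (fun _ _ _ => 0) F).
  - apply PF_x.
  - apply PF_CF, CF_const.
  - intros; lra.
Qed.

(* Where |f| < c, the denominator |f|^2 is replaced by something bounded below. *)
Lemma csm_recip f c : 0 < c -> csm f -> exists g, csm g /\
  forall x y, -1 < y < 1 -> c <= Cmod (f x y) -> (f x y * g x y = 1)%C.
Proof.
  intros c0 F. pose proof F as [F1 F2].
  assert (N : sm (fun x y => fst (f x y) ^ 2 + snd (f x y) ^ 2)).
  { apply (CF_plus false (fun _ x y => fst (f x y) ^ 2) (fun _ x y => snd (f x y) ^ 2));
    [apply (CF_pow (fun _ x y => fst (f x y)) 2 F1)
    |apply (CF_pow (fun _ x y => snd (f x y)) 2 F2)]. }
  assert (cc : 0 < c ^ 2) by now apply pow_lt.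
  set (m := fun x y => floorat (c ^ 2) (fst (f x y) ^ 2 + snd (f x y) ^ 2)).
  assert (V : sm (fun x y => / m x y)).
  { apply (CF_inv (fun _ => m) (c ^ 2 / 2)); [lra| |].
    - apply (CF_floorat (c ^ 2) (fun _ x y => fst (f x y) ^ 2 + snd (f x y) ^ 2) N).
    - intros i x y _. pose proof (floorat_ge (c ^ 2) (fst (f x y) ^ 2 + snd (f x y) ^ 2) cc) as G.
      change (c ^ 2 / 2 <= Rabs (m x y)). fold (m x y) in G. rewrite Rabs_pos_eq; lra. }
  exists (fun x y => (fst (f x y) * / m x y, - snd (f x y) * / m x y)). split.
  - split; simpl.
    + apply (CF_mult false (fun _ x y => fst (f x y)) (fun _ x y => / m x y)); assumption.
    + apply (CF_mult false (fun _ x y => - snd (f x y)) (fun _ x y => / m x y)); [|assumption].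
      now apply (CF_opp false (fun _ x y => snd (f x y))).
  - intros x y Hy Hc. unfold m. rewrite floorat_id; [|assumption|].
    + assert (P : 0 < fst (f x y) ^ 2 + snd (f x y) ^ 2).
      { rewrite <- Cmod_sq. apply pow_lt. lra. }
      apply C_ext; simpl; field; simpl in P; lra.
    + rewrite <- Cmod_sq. apply pow_incr. lra.
Qed.

(** * Divided differences *)

(** Differentiation under the integral sign, again from a quadratic remainder uniform in t. *)
Lemma RInt_dw (X : R -> Prop) (g g' : R -> R -> R) M x : X x -> 0 <= M ->
  (forall x' t, X x' -> 0 <= t <= 1 -> Rabs (g t x' - g t x - g' t x * (x' - x)) <= M * (x' - x) ^ 2) ->
  (forall x', X x' -> ex_RInt (fun t => g t x') 0 1) -> ex_RInt (fun t => g' t x) 0 1 ->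
  dw X (fun x => RInt (fun t => g t x) 0 1) x (RInt (fun t => g' t x) 0 1).
Proof.
  intros Xx M0 H E E' eps He. exists (eps / (1 + M)). split; [apply Rdiv_lt_0_compat; lra|].
  intros x' Xx' Hx'.
  replace (RInt (fun t => g t x') 0 1 - RInt (fun t => g t x) 0 1 - RInt (fun t => g' t x) 0 1 * (x' - x))
    with (RInt (fun t => g t x' - g t x - (x' - x) * g' t x) 0 1).
  - eapply Rle_trans.
    + apply (abs_RInt_le_const _ 0 1 (M * (x' - x) ^ 2)); [lra| |].
      * apply (ex_RInt_minus (V := R_NormedModule) (fun t => g t x' - g t x) (fun t => (x' - x) * g' t x)).
        -- apply (ex_RInt_minus (V := R_NormedModule)); auto.
        -- apply (ex_RInt_scal (V := R_NormedModule)); auto.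
      * intros t Ht. rewrite (Rmult_comm (x' - x)). auto.
    + rewrite Rminus_0_r, Rmult_1_l.
      replace ((x' - x) ^ 2) with (Rabs (x' - x) * Rabs (x' - x))
        by (rewrite <- Rabs_mult, Rabs_pos_eq; [ring|apply Rle_0_sqr]).
      rewrite <- Rmult_assoc. apply Rmult_le_compat_r; [apply Rabs_pos|].
      apply Rle_trans with (M * (eps / (1 + M))); [apply Rmult_le_compat_l; lra|].
      apply Rmult_le_reg_r with (1 + M); [lra|].
      replace (M * (eps / (1 + M)) * (1 + M)) with (M * eps) by (field; lra). nra.
  - rewrite (RInt_minus (V := R_CompleteNormedModule) (fun t => g t x' - g t x) (fun t => (x' - x) * g' t x)).
    + rewrite (RInt_minus (V := R_CompleteNormedModule) (fun t => g t x') (fun t => g t x)) by auto.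
      rewrite (RInt_scal (V := R_CompleteNormedModule) (fun t => g' t x)) by auto.
      change (RInt (fun t => g t x') 0 1 - RInt (fun t => g t x) 0 1 - (x' - x) * RInt (fun t => g' t x) 0 1
        = RInt (fun t => g t x') 0 1 - RInt (fun t => g t x) 0 1 - RInt (fun t => g' t x) 0 1 * (x' - x)). ring.
    + apply (ex_RInt_minus (V := R_NormedModule)); auto.
    + apply (ex_RInt_scal (V := R_NormedModule)); auto.
Qed.

Section Average.
Variable J : R.

Let K (a : nat) (k : R -> R -> R) (t x y : R) : R := t ^ a * k (x + t * J * y) y.

(** The weight t^a is there for closure: a y-derivative of k (x + t J y, y) produces a factor t and
    raises a by one. *)
Definition segmean (a : nat) (k : R -> R -> R) (x y : R) : R :=
  RInt (fun t => t ^ a * k (x + t * J * y) y) 0 1.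

Lemma K_continuous a k x y t : sm k -> -1 < y < 1 -> continuous (fun t => K a k t x y) t.
Proof.
  intros S Hy. apply (ex_derive_continuous (V := R_NormedModule)). unfold K.
  assert (D : is_derive (fun t => k (x + t * J * y) y) t (Dx k (x + t * J * y) y * (J * y) + Dy k (x + t * J * y) y * 0)).
  { apply (sm_chain k (fun t => x + t * J * y) (fun _ => y)); try assumption.
    - auto_derive; [exact Logic.I|ring].
    - apply is_derive_Rconst. }
  eexists. apply (is_derive_Rmult (fun t => t ^ a) (fun t => k (x + t * J * y) y)); [|exact D].
  apply (is_derive_pow (fun t => t) a t 1), is_derive_Rid.
Qed.

Lemma K_ex_RInt a k x y : sm k -> -1 < y < 1 -> ex_RInt (fun t => K a k t x y) 0 1.
Proof.
  intros S Hy. apply (ex_RInt_continuous (V := R_CompleteNormedModule)).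
  intros t _. now apply K_continuous.
Qed.

Lemma K_dx a k t x y : sm k -> -1 < y < 1 -> is_derive (fun x => K a k t x y) x (K a (Dx k) t x y).
Proof.
  intros S Hy. unfold K.
  replace (t ^ a * Dx k (x + t * J * y) y) with
    (0 * k (x + t * J * y) y + t ^ a * (Dx k (x + t * J * y) y * 1 + Dy k (x + t * J * y) y * 0)) by ring.
  apply (is_derive_Rmult (fun _ => t ^ a) (fun x => k (x + t * J * y) y)); [apply is_derive_Rconst|].
  apply (sm_chain k (fun x => x + t * J * y) (fun _ => y)); try assumption.
  - auto_derive; [exact Logic.I|ring].
  - apply is_derive_Rconst.
Qed.

Lemma K_dy a k t x y : sm k -> -1 < y < 1 ->
  is_derive (fun y => K a k t x y) y (J * K (S a) (Dx k) t x y + K a (Dy k) t x y).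
Proof.
  intros S Hy. unfold K.
  replace (J * (t ^ Datatypes.S a * Dx k (x + t * J * y) y) + t ^ a * Dy k (x + t * J * y) y) with
    (0 * k (x + t * J * y) y + t ^ a * (Dx k (x + t * J * y) y * (t * J) + Dy k (x + t * J * y) y * 1))
    by (simpl; ring).
  apply (is_derive_Rmult (fun _ => t ^ a) (fun y => k (x + t * J * y) y)); [apply is_derive_Rconst|].
  apply (sm_chain k (fun y => x + t * J * y) (fun y => y)); try assumption.
  - auto_derive; [exact Logic.I|ring].
  - apply is_derive_Rid.
Qed.

Lemma K_bound a k : sm k -> exists C, 0 <= C /\ forall t x y, 0 <= t <= 1 -> -1 < y < 1 -> Rabs (K a k t x y) <= C.
Proof.
  intros S. destruct (sm_bound k S) as (C & C0 & HC). exists C. split; [assumption|].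
  intros t x y Ht Hy. unfold K. rewrite Rabs_mult, (Rabs_pos_eq (t ^ a)) by (apply pow_le; lra).
  assert (t ^ a <= 1) by (rewrite <- (pow1 a); apply pow_incr; lra).
  assert (0 <= t ^ a) by (apply pow_le; lra).
  specialize (HC (x + t * J * y) y Hy). pose proof (Rabs_pos (k (x + t * J * y) y)). nra.
Qed.

Lemma segmean_dx a k x y : sm k -> -1 < y < 1 ->
  is_derive (fun x => segmean a k x y) x (segmean a (Dx k) x y).
Proof.
  intros S Hy. destruct (K_bound a (Dx (Dx k))) as (C & C0 & HC); [now apply sm_Dx, sm_Dx|].
  apply dw_is_derive with all; [apply filter_forall; intros; exact Logic.I|].
  apply (RInt_dw all (fun t x => K a k t x y) (fun t x => K a (Dx k) t x y) C x Logic.I C0).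
  - intros x' t _ Ht.
    apply (dw_taylor all (fun x => K a k t x y) (fun x => K a (Dx k) t x y) (fun x => K a (Dx (Dx k)) t x y));
      try exact Logic.I; try apply convex_all; intros u _.
    + apply is_derive_dw. now apply K_dx.
    + apply is_derive_dw. apply K_dx; [now apply sm_Dx|assumption].
    + now apply HC.
  - intros x' _. now apply K_ex_RInt.
  - apply K_ex_RInt; [now apply sm_Dx|assumption].
Qed.

Lemma segmean_dy a k x y : sm k -> -1 < y < 1 ->
  is_derive (fun y => segmean a k x y) y (J * segmean (S a) (Dx k) x y + segmean a (Dy k) x y).
Proof.
  intros S Hy.
  assert (Sx : sm (Dx k)) by now apply sm_Dx. assert (Sy : sm (Dy k)) by now apply sm_Dy.
  destruct (K_bound (Datatypes.S (Datatypes.S a)) (Dx (Dx k))) as (C1 & C10 & H1); [now apply sm_Dx|].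
  destruct (K_bound (Datatypes.S a) (Dy (Dx k))) as (C2 & C20 & H2); [now apply sm_Dy|].
  destruct (K_bound (Datatypes.S a) (Dx (Dy k))) as (C3 & C30 & H3); [now apply sm_Dx|].
  destruct (K_bound a (Dy (Dy k))) as (C4 & C40 & H4); [now apply sm_Dy|].
  set (X := fun y => -1 < y < 1).
  set (M := Rabs J * (Rabs J * C1 + C2) + (Rabs J * C3 + C4)).
  assert (M0 : 0 <= M) by (pose proof (Rabs_pos J); unfold M; nra).
  assert (E : RInt (fun t => J * K (Datatypes.S a) (Dx k) t x y + K a (Dy k) t x y) 0 1 =
              J * segmean (Datatypes.S a) (Dx k) x y + segmean a (Dy k) x y).
  { rewrite (RInt_plus (V := R_CompleteNormedModule) (fun t => J * K (Datatypes.S a) (Dx k) t x y)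
              (fun t => K a (Dy k) t x y)).
    - rewrite (RInt_scal (V := R_CompleteNormedModule) (fun t => K (Datatypes.S a) (Dx k) t x y));
        [reflexivity|now apply K_ex_RInt].
    - apply (ex_RInt_scal (V := R_NormedModule)). now apply K_ex_RInt.
    - now apply K_ex_RInt. }
  rewrite <- E.
  apply dw_is_derive with X; [now apply open_interval_loc|].
  apply (RInt_dw X (fun t y => K a k t x y) (fun t y => J * K (Datatypes.S a) (Dx k) t x y + K a (Dy k) t x y) M y Hy M0).
  - intros y' t Hy' Ht.
    apply (dw_taylor X (fun y => K a k t x y) (fun y => J * K (Datatypes.S a) (Dx k) t x y + K a (Dy k) t x y)
       (fun y => J * (J * K (Datatypes.S (Datatypes.S a)) (Dx (Dx k)) t x y + K (Datatypes.S a) (Dy (Dx k)) t x y)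
                 + (J * K (Datatypes.S a) (Dx (Dy k)) t x y + K a (Dy (Dy k)) t x y))); try assumption.
    + intros p q r [? ?] [? ?] [? ?]. split; lra.
    + intros u Hu. apply is_derive_dw. now apply K_dy.
    + intros u Hu. apply is_derive_dw.
      apply (is_derive_Rplus (fun y => J * K (Datatypes.S a) (Dx k) t x y) (fun y => K a (Dy k) t x y)).
      * apply (is_derive_ext (fun y => K (Datatypes.S a) (Dx k) t x y * J)); [intros; apply Rmult_comm|].
        replace (J * _) with ((J * K (Datatypes.S (Datatypes.S a)) (Dx (Dx k)) t x u + K (Datatypes.S a) (Dy (Dx k)) t x u) * J
           + K (Datatypes.S a) (Dx k) t x u * 0) by ring.
        apply (is_derive_Rmult (fun y => K (Datatypes.S a) (Dx k) t x y) (fun _ => J)); [now apply K_dy|apply is_derive_Rconst].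
      * now apply K_dy.
    + intros u Hu. unfold M. eapply Rle_trans; [apply Rabs_triang|]. apply Rplus_le_compat.
      * rewrite Rabs_mult. apply Rmult_le_compat_l; [apply Rabs_pos|].
        eapply Rle_trans; [apply Rabs_triang|]. rewrite Rabs_mult. apply Rplus_le_compat; [|now apply H2].
        apply Rmult_le_compat_l; [apply Rabs_pos|now apply H1].
      * eapply Rle_trans; [apply Rabs_triang|]. rewrite Rabs_mult. apply Rplus_le_compat; [|now apply H4].
        apply Rmult_le_compat_l; [apply Rabs_pos|now apply H3].
  - intros y' Hy'. now apply K_ex_RInt.
  - apply (ex_RInt_plus (V := R_NormedModule) (fun t => J * K (Datatypes.S a) (Dx k) t x y)).
    + apply (ex_RInt_scal (V := R_NormedModule)). now apply K_ex_RInt.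
    + now apply K_ex_RInt.
Qed.

(** Induction on the order for all a and k at once, since both partial derivatives are again
    combinations of segment means of derivatives of k. *)
Lemma sm_segmean a k : sm k -> sm (segmean a k).
Proof.
  intros S n. revert a k S. induction n as [|n IH]; intros a k S.
  all: assert (B : bnd W0 strip false (fun _ : unit => segmean a k)) by
    (destruct (K_bound a k S) as (C & C0 & HC); exists O, C; intros u x y Hy; simpl; rewrite Rmult_1_r;
     unfold segmean; eapply Rle_trans;
     [apply (abs_RInt_le_const _ 0 1 C); [lra|exact (K_ex_RInt a k x y S Hy)|intros t Ht; now apply HC]|lra]).
  - split; [exact B|exact Logic.I].
  - apply (Sm_intro false n _ (fun _ => segmean a (Dx k))
       (fun _ x y => J * segmean (Datatypes.S a) (Dx k) x y + segmean a (Dy k) x y)).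
    + exact B.
    + intros u x y Hy. split; [now apply segmean_dx|now apply segmean_dy].
    + apply IH. now apply sm_Dx.
    + apply (Sm_plus false n (fun _ x y => J * segmean (Datatypes.S a) (Dx k) x y) (fun _ => segmean a (Dy k))).
      * eapply Sm_ext; [|apply (Sm_mult false n (fun _ => segmean (Datatypes.S a) (Dx k)) (fun _ _ _ => J))].
        -- intros; simpl; ring.
        -- apply IH. now apply sm_Dx.
        -- apply CF_const.
      * apply IH. now apply sm_Dy.
Qed.

Lemma segmean_at_0 a k x : sm k -> segmean a k x 0 = k x 0 / INR (S a).
Proof.
  intros S. unfold segmean.
  apply is_RInt_unique.
  assert (N : INR (Datatypes.S a) <> 0) by (apply not_0_INR; lia).
  replace (k x 0 / INR (Datatypes.S a)) with
    (minus (1 ^ Datatypes.S a * / INR (Datatypes.S a) * k x 0) (0 ^ Datatypes.S a * / INR (Datatypes.S a) * k x 0)).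
  2:{ change (1 ^ Datatypes.S a * / INR (Datatypes.S a) * k x 0 - 0 ^ Datatypes.S a * / INR (Datatypes.S a) * k x 0 = k x 0 / INR (Datatypes.S a)).
      rewrite pow1, pow_i by lia. unfold Rdiv. ring. }
  apply (is_RInt_derive (V := R_CompleteNormedModule) (fun t => t ^ Datatypes.S a * / INR (Datatypes.S a) * k x 0)).
  - intros t _. rewrite Rmult_0_r, Rplus_0_r.
    evar_last; [apply (is_derive_Rmult (fun t => t ^ Datatypes.S a * / INR (Datatypes.S a)) (fun _ => k x 0))|].
    + apply (is_derive_Rmult (fun t => t ^ Datatypes.S a) (fun _ => / INR (Datatypes.S a))); [|apply is_derive_Rconst].
      apply (is_derive_pow (fun t => t) (Datatypes.S a) t 1), is_derive_Rid.
    + apply is_derive_Rconst.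
    + simpl (Nat.pred _). field. exact N.
  - intros t _. exact (K_continuous a k x 0 t S ltac:(lra)).
Qed.

(* The divided difference (F (x + J y) - F x) / y in a form that is smooth across y = 0. *)
Definition dq (F : R -> R -> R) (x y : R) : R := J * segmean 0 (Dx F) x y.

Lemma sm_dq F : sm F -> sm (dq F).
Proof.
  intros S. exact (CF_scal false J (fun _ => segmean 0 (Dx F)) (sm_segmean 0 _ (sm_Dx F S))).
Qed.

Lemma dq_at_0 F x : sm F -> dq F x 0 = J * Dx F x 0.
Proof. intros S. unfold dq. rewrite segmean_at_0 by now apply sm_Dx. simpl. field. Qed.

(** Fundamental theorem of calculus for t -> F (x + t J y, y) on [0, 1]. *)
Lemma dq_spec F x y : sm F -> -1 < y < 1 -> y * dq F x y = F (x + J * y) y - F x y.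
Proof.
  intros S Hy. unfold dq, segmean.
  pose proof (is_RInt_derive (V := R_CompleteNormedModule) (fun t => F (x + t * J * y) y)
     (fun t => (y * J) * (t ^ 0 * Dx F (x + t * J * y) y)) 0 1) as H.
  assert (H1 : is_RInt (fun t => (y * J) * (t ^ 0 * Dx F (x + t * J * y) y)) 0 1
     (minus (F (x + 1 * J * y) y) (F (x + 0 * J * y) y))).
  { apply H.
    - intros t _.
      replace ((y * J) * (t ^ 0 * Dx F (x + t * J * y) y)) with
        (Dx F (x + t * J * y) y * (J * y) + Dy F (x + t * J * y) y * 0) by (simpl; ring).
      apply (sm_chain F (fun t => x + t * J * y) (fun _ => y)); try assumption.
      + auto_derive; [exact Logic.I|ring].
      + apply is_derive_Rconst.
    - intros t _. apply (continuous_scal_r (K := R_AbsRing) (V := R_NormedModule) (y * J) (fun t => t ^ 0 * Dx F (x + t * J * y) y)).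
      exact (K_continuous 0 (Dx F) x y t (sm_Dx F S) Hy). }
  apply (is_RInt_unique (V := R_CompleteNormedModule)) in H1.
  rewrite (RInt_scal (V := R_CompleteNormedModule) (fun t => t ^ 0 * Dx F (x + t * J * y) y)) in H1
    by exact (K_ex_RInt 0 (Dx F) x y (sm_Dx F S) Hy).
  change ((y * J) * RInt (fun t => t ^ 0 * Dx F (x + t * J * y) y) 0 1 =
     F (x + 1 * J * y) y - F (x + 0 * J * y) y) in H1.
  rewrite Rmult_1_l, !Rmult_0_l, Rplus_0_r in H1. rewrite <- H1. ring.
Qed.

End Average.

(** * Jets at y = 0 *)

Definition is_cderive (f : R -> C) (t : R) (l : C) : Prop :=
  is_derive (fun s => fst (f s)) t (fst l) /\ is_derive (fun s => snd (f s)) t (snd l).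

Lemma is_cderive_const c t : is_cderive (fun _ => c) t 0.
Proof. split; apply is_derive_Rconst. Qed.

Lemma is_cderive_plus f g t a b : is_cderive f t a -> is_cderive g t b ->
  is_cderive (fun s => f s + g s)%C t (a + b)%C.
Proof.
  intros [F1 F2] [G1 G2]. split; simpl.
  - now apply (is_derive_Rplus (fun s => fst (f s)) (fun s => fst (g s))).
  - now apply (is_derive_Rplus (fun s => snd (f s)) (fun s => snd (g s))).
Qed.

Lemma is_derive_Ropp (f : R -> R) x a : is_derive f x a -> is_derive (fun t => - f t) x (- a).
Proof. exact (is_derive_opp f x a). Qed.

Lemma is_cderive_opp f t a : is_cderive f t a -> is_cderive (fun s => - f s)%C t (- a)%C.
Proof.
  intros [F1 F2]. split; simpl.
  - now apply (is_derive_Ropp (fun s => fst (f s))).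
  - now apply (is_derive_Ropp (fun s => snd (f s))).
Qed.

Lemma is_cderive_minus f g t a b : is_cderive f t a -> is_cderive g t b ->
  is_cderive (fun s => f s - g s)%C t (a - b)%C.
Proof. intros F G. apply is_cderive_plus; [assumption|now apply is_cderive_opp]. Qed.

Lemma is_cderive_mult f g t a b : is_cderive f t a -> is_cderive g t b ->
  is_cderive (fun s => f s * g s)%C t (a * g t + f t * b)%C.
Proof.
  intros [F1 F2] [G1 G2]. split; simpl.
  - evar_last; [apply (is_derive_Rplus (fun s => fst (f s) * fst (g s)) (fun s => - (snd (f s) * snd (g s))))|].
    + exact (is_derive_Rmult _ _ _ _ _ F1 G1).
    + exact (is_derive_Ropp _ _ _ (is_derive_Rmult _ _ _ _ _ F2 G2)).
    + simpl. ring.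
  - evar_last; [apply (is_derive_Rplus (fun s => fst (f s) * snd (g s)) (fun s => snd (f s) * fst (g s)))|].
    + exact (is_derive_Rmult _ _ _ _ _ F1 G2).
    + exact (is_derive_Rmult _ _ _ _ _ F2 G1).
    + simpl. ring.
Qed.

Lemma is_cderive_exp f t a : is_cderive f t a -> is_cderive (fun s => Cexp (f s)) t (Cexp (f t) * a)%C.
Proof.
  intros [F1 F2].
  pose proof (is_derive_Rcomp exp _ _ _ _ (is_derive_exp _) F1) as E.
  pose proof (is_derive_Rcomp cos _ _ _ _ (is_derive_cos _) F2) as Cs.
  pose proof (is_derive_Rcomp sin _ _ _ _ (is_derive_sin _) F2) as Sn.
  split; simpl.
  - evar_last; [exact (is_derive_Rmult _ _ _ _ _ E Cs)|]. simpl. ring.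
  - evar_last; [exact (is_derive_Rmult _ _ _ _ _ E Sn)|]. simpl. ring.
Qed.

Lemma is_cderive_eq f t a b : is_cderive f t a -> a = b -> is_cderive f t b.
Proof. now intros H <-. Qed.

Definition cDx (f : R -> R -> C) (x y : R) : C := (Dx (fun x y => fst (f x y)) x y, Dx (fun x y => snd (f x y)) x y).
Definition cDy (f : R -> R -> C) (x y : R) : C := (Dy (fun x y => fst (f x y)) x y, Dy (fun x y => snd (f x y)) x y).

Lemma csm_is_cderive f : csm f -> forall x y, -1 < y < 1 ->
  is_cderive (fun t => f t y) x (cDx f x y) /\ is_cderive (fun t => f x t) y (cDy f x y).
Proof.
  intros [F1 F2] x y Hy. destruct (sm_is_derive _ F1 x y Hy), (sm_is_derive _ F2 x y Hy).
  split; split; assumption.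
Qed.

Lemma csm_cDx f : csm f -> csm (cDx f).
Proof. intros [F1 F2]. split; [exact (sm_Dx _ F1)|exact (sm_Dx _ F2)]. Qed.

Lemma csm_cDy f : csm f -> csm (cDy f).
Proof. intros [F1 F2]. split; [exact (sm_Dy _ F1)|exact (sm_Dy _ F2)]. Qed.

Lemma cDy_unique f x y l : is_cderive (fun t => f x t) y l -> cDy f x y = l.
Proof. intros [H1 H2]. apply C_ext; simpl; now apply is_derive_unique. Qed.

Lemma cDx_unique f x y l : is_cderive (fun t => f t y) x l -> cDx f x y = l.
Proof. intros [H1 H2]. apply C_ext; simpl; now apply is_derive_unique. Qed.

(** The primitive of a compactly supported function is constant on either side of the support, hence
    bounded, which [sm] requires. *)
Lemma prim_exists (f : R -> R) A : sm (fun x _ => f x) -> (forall x, A < Rabs x -> f x = 0) ->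
  sm (fun x _ => RInt f 0 x) /\ forall x, is_derive (RInt f 0) x (f x).
Proof.
  intros F H.
  assert (Cf : forall t, continuous f t).
  { intros t. apply (ex_derive_continuous (V := R_NormedModule)). eexists. exact (proj1 (sm_is_derive _ F t 0 ltac:(lra))). }
  assert (D : forall x, is_derive (RInt f 0) x (f x)).
  { intros x. apply (is_derive_RInt (V := R_NormedModule) f (RInt f 0) 0 x); [|apply Cf].
    apply filter_forall. intros t. apply (RInt_correct (V := R_CompleteNormedModule)).
    apply (ex_RInt_continuous (V := R_CompleteNormedModule)). intros; apply Cf. }
  split; [|exact D].
  apply (CF_of_derivs false (fun _ x _ => RInt f 0 x) (fun _ x _ => f x) (fun _ _ _ => 0)).
  - destruct (sm_bound _ F) as (C & C0 & HC). set (B := Rabs A + 1).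
    assert (B0 : 0 < B) by (unfold B; pose proof (Rabs_pos A); lra).
    assert (H1 : forall x, Rabs x <= B -> Rabs (RInt f 0 x) <= C * B).
    { intros x Hx. pose proof (derive_bound_lip (RInt f 0) f 0 x C) as L.
      rewrite RInt_point in L. change zero with 0 in L. rewrite !Rminus_0_r in L.
      eapply Rle_trans; [apply L|].
      - intros t _. apply D.
      - intros t _. apply (HC t 0). lra.
      - now apply Rmult_le_compat_l. }
    assert (H2 : forall a b, (forall t, Rmin a b <= t <= Rmax a b -> f t = 0) -> RInt f 0 b = RInt f 0 a).
    { intros a b Z. assert (L : Rabs (RInt f 0 b - RInt f 0 a) <= 0 * Rabs (b - a)).
      { apply (derive_bound_lip (RInt f 0) f).
        - intros t _. apply D.
        - intros t Ht. rewrite Z by assumption. rewrite Rabs_R0. lra. }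
      rewrite Rmult_0_l in L. pose proof (Rabs_pos (RInt f 0 b - RInt f 0 a)).
      destruct (Req_dec (RInt f 0 b - RInt f 0 a) 0) as [e|ne]; [lra|].
      pose proof (Rabs_pos_lt _ ne). lra. }
    exists O, (C * B). intros u x y _. simpl. rewrite Rmult_1_r.
    pose proof (Rle_abs A) as hA.
    destruct (Rle_lt_dec (Rabs x) B) as [h|h]; [now apply H1|].
    destruct (Rle_lt_dec 0 x) as [p|p].
    + rewrite Rabs_pos_eq in h by assumption. rewrite (H2 B x).
      * apply H1. rewrite Rabs_pos_eq; lra.
      * rewrite Rmin_left, Rmax_right by lra. intros t Ht. apply H. rewrite Rabs_pos_eq; unfold B in *; lra.
    + rewrite Rabs_left in h by assumption. rewrite (H2 (- B) x).
      * apply H1. rewrite Rabs_left; lra.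
      * rewrite Rmin_right, Rmax_left by lra. intros t Ht. apply H. rewrite Rabs_left; unfold B in *; lra.
  - intros u x y _. split; [apply D|apply is_derive_Rconst].
  - exact F.
  - apply CF_const.
Qed.

Definition cprim (f : R -> C) (x : R) : C := (RInt (fun t => fst (f t)) 0 x, RInt (fun t => snd (f t)) 0 x).

Lemma cprim_spec f A : csm (fun x _ => f x) -> (forall x, A < Rabs x -> f x = RtoC 0) ->
  csm (fun x _ => cprim f x) /\ forall x, is_cderive (cprim f) x (f x).
Proof.
  intros [F1 F2] H.
  destruct (prim_exists (fun x => fst (f x)) A F1) as [S1 D1]; [intros x h; now rewrite H|].
  destruct (prim_exists (fun x => snd (f x)) A F2) as [S2 D2]; [intros x h; now rewrite H|].
  split; [split; assumption|]. intros x. split; [apply D1|apply D2].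
Qed.

Definition cutoff (A x : R) : R := plateau (x / A).

Lemma sm_cutoff A : 0 < A -> sm (fun x _ => cutoff A x).
Proof.
  intros A0. apply (CF_bumps (fun _ x _ => x / A)).
  apply (PF_ext (fun _ x _ => 0 + / A * x)); [intros; unfold Rdiv; ring|].
  apply (PF_affine (fun _ x _ => x)), PF_x.
Qed.

Lemma cutoff_1 A x : 0 < A -> Rabs x <= A -> cutoff A x = 1.
Proof.
  intros A0 h. unfold cutoff. apply plateau_1. apply Rabs_le_between.
  unfold Rdiv. rewrite Rabs_mult, (Rabs_pos_eq (/ A)) by (left; now apply Rinv_0_lt_compat).
  apply Rle_div_l; lra.
Qed.

Lemma cutoff_0 A x : 0 < A -> 2 * A < Rabs x -> cutoff A x = 0.
Proof.
  intros A0 h. unfold cutoff. apply plateau_0.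
  unfold Rdiv. rewrite Rabs_mult, (Rabs_pos_eq (/ A)) by (left; now apply Rinv_0_lt_compat).
  apply Rle_div_r; lra.
Qed.

(** Vanishing to order M in y at y = 0, over X. It stands for congruence modulo y^M and spares any
    handling of power series. *)
Fixpoint jet (M : nat) (X : R -> Prop) (f : R -> R -> R) : Prop :=
  match M with
  | O => True
  | S M' => (forall x, X x -> f x 0 = 0) /\ jet M' X (Dy f)
  end.

Lemma jet_ext M X f g : (forall x y, -1 < y < 1 -> f x y = g x y) -> jet M X f -> jet M X g.
Proof.
  revert f g. induction M as [|M IH]; intros f g E; simpl; [trivial|].
  intros [V H]. split.
  - intros x Xx. rewrite <- E by lra. auto.
  - apply (IH (Dy f)); [|exact H].
    exact (dy_ext (fun _ : unit => f) (fun _ => g) (fun _ x y Hy => E x y Hy) tt).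
Qed.

Lemma jet_le M N X f : (N <= M)%nat -> jet M X f -> jet N X f.
Proof.
  revert N f. induction M as [|M IH]; intros N f h H.
  - replace N with O by lia. exact H.
  - destruct N; [exact Logic.I|]. destruct H as [V H]. split; [exact V|]. apply IH; [lia|exact H].
Qed.

Lemma jet_sub M (X X' : R -> Prop) f : (forall x, X' x -> X x) -> jet M X f -> jet M X' f.
Proof.
  intros S. revert f. induction M as [|M IH]; intros f; simpl; [trivial|]. intros [V H]. split; auto.
Qed.

Lemma Dy_plus f g : sm f -> sm g -> forall x y, -1 < y < 1 ->
  Dy (fun x y => f x y + g x y) x y = Dy f x y + Dy g x y.
Proof.
  intros F G x y Hy. apply is_derive_unique.
  apply (is_derive_Rplus (f x) (g x)); [now apply (sm_is_derive f F)|now apply (sm_is_derive g G)].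
Qed.

Lemma Dy_mult f g : sm f -> sm g -> forall x y, -1 < y < 1 ->
  Dy (fun x y => f x y * g x y) x y = Dy f x y * g x y + f x y * Dy g x y.
Proof.
  intros F G x y Hy. apply is_derive_unique.
  apply (is_derive_Rmult (f x) (g x)); [now apply (sm_is_derive f F)|now apply (sm_is_derive g G)].
Qed.

Lemma sm_plus f g : sm f -> sm g -> sm (fun x y => f x y + g x y).
Proof. exact (CF_plus false (fun _ => f) (fun _ => g)). Qed.

Lemma sm_mult f g : sm f -> sm g -> sm (fun x y => f x y * g x y).
Proof. exact (CF_mult false (fun _ => f) (fun _ => g)). Qed.

Lemma sm_opp f : sm f -> sm (fun x y => - f x y).
Proof. exact (CF_opp false (fun _ => f)). Qed.

Lemma sm_const c : sm (fun _ _ => c).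
Proof. exact (CF_const c). Qed.

Lemma sm_y : sm (fun _ y => y).
Proof. apply (CF_y 1). intros i y [h1 h2]. apply Rabs_le. lra. Qed.

Lemma sm_ext f g : (forall x y, -1 < y < 1 -> f x y = g x y) -> sm f -> sm g.
Proof. intros E. apply (CF_ext false (fun _ => f) (fun _ => g)). intros u x y Hy. now apply E. Qed.

Lemma jet_plus M X f g : sm f -> sm g -> jet M X f -> jet M X g -> jet M X (fun x y => f x y + g x y).
Proof.
  revert f g. induction M as [|M IH]; intros f g F G; simpl; [trivial|].
  intros [V H] [V' H']. split.
  - intros x Xx. rewrite V, V' by assumption. ring.
  - apply (jet_ext M X (fun x y => Dy f x y + Dy g x y)).
    + intros. symmetry. now apply Dy_plus.
    + apply IH; try assumption; now apply sm_Dy.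
Qed.

(** Orders of vanishing add: Leibniz lowers one of the two by one. Truncated subtraction is
    harmless, because order 0 says nothing. *)
Lemma jet_mult K M N X f g : (K <= M + N)%nat -> sm f -> sm g -> jet M X f -> jet N X g ->
  jet K X (fun x y => f x y * g x y).
Proof.
  revert M N f g. induction K as [|K IH]; intros M N f g h F G Hf Hg; [exact Logic.I|]. split.
  - intros x Xx. destruct M as [|M].
    + destruct N as [|N]; [lia|]. rewrite (proj1 Hg x Xx). ring.
    + rewrite (proj1 Hf x Xx). ring.
  - apply (jet_ext K X (fun x y => Dy f x y * g x y + f x y * Dy g x y)).
    { intros. symmetry. now apply Dy_mult. }
    apply jet_plus; try (apply sm_mult; try assumption; now apply sm_Dy).
    + apply (IH (M - 1)%nat N); try assumption; [lia|now apply sm_Dy|].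
      destruct M; [exact Logic.I|]. simpl. rewrite Nat.sub_0_r. apply Hf.
    + apply (IH M (N - 1)%nat); try assumption; [lia|now apply sm_Dy|].
      destruct N; [exact Logic.I|]. simpl. rewrite Nat.sub_0_r. apply Hg.
Qed.

Lemma jet_mult_r M X f g : sm f -> sm g -> jet M X f -> jet M X (fun x y => f x y * g x y).
Proof. intros F G H. apply (jet_mult M M 0); auto; [lia|exact Logic.I]. Qed.

Lemma jet_opp M X f : sm f -> jet M X f -> jet M X (fun x y => - f x y).
Proof.
  intros F H. apply (jet_ext M X (fun x y => f x y * -1)); [intros; ring|].
  apply jet_mult_r; try assumption. apply sm_const.
Qed.

(** Vanishing is assumed for all x, so that it can be differentiated in x. *)
Lemma jet_Dx M f : sm f -> jet M all f -> jet M all (Dx f).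
Proof.
  revert f. induction M as [|M IH]; intros f F; simpl; [trivial|]. intros [V H]. split.
  - intros x _. unfold Dx. rewrite (Derive_ext _ (fun _ => 0)); [apply Derive_const|].
    intros t. now apply V.
  - apply (jet_ext M all (Dx (Dy f))).
    + intros. now apply sm_schwarz.
    + apply IH; [now apply sm_Dy|assumption].
Qed.

Lemma jet_segmean M J a k : sm k -> jet M all k -> jet M all (segmean J a k).
Proof.
  revert a k. induction M as [|M IH]; intros a k S; simpl; [trivial|]. intros [V H]. split.
  - intros x Xx. rewrite segmean_at_0, V by assumption. unfold Rdiv; ring.
  - apply (jet_ext M all (fun x y => segmean J (Datatypes.S a) (Dx k) x y * J + segmean J a (Dy k) x y)).
    + intros x y Hy. symmetry. etransitivity; [apply is_derive_unique; now apply segmean_dy|]. ring.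
    + apply jet_plus.
      * apply sm_mult; [apply sm_segmean; now apply sm_Dx|apply sm_const].
      * apply sm_segmean; now apply sm_Dy.
      * apply jet_mult_r; [apply sm_segmean; now apply sm_Dx|apply sm_const|].
        apply IH; [now apply sm_Dx|]. apply jet_Dx; [assumption|].
        apply (jet_le (Datatypes.S M)); [lia|split; assumption].
      * apply IH; [now apply sm_Dy|assumption].
Qed.

Lemma jet_dq M J F : sm F -> jet M all F -> jet M all (dq J F).
Proof.
  intros S H. apply (jet_ext M all (fun x y => segmean J 0 (Dx F) x y * J)); [intros; unfold dq; ring|].
  apply jet_mult_r; [apply sm_segmean; now apply sm_Dx|apply sm_const|].
  apply jet_segmean; [now apply sm_Dx|now apply jet_Dx].
Qed.

Lemma jet_iter M X f : jet M X f <-> forall k x, (k < M)%nat -> X x -> Nat.iter k Dy f x 0 = 0.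
Proof.
  revert f. induction M as [|M IH]; intros f; simpl.
  - split; [intros; lia|trivial].
  - rewrite IH. split.
    + intros [V H] k x h Xx. destruct k; [now apply V|].
      rewrite Nat.iter_succ_r. apply H; [lia|assumption].
    + intros H. split.
      * intros x Xx. apply (H O); [lia|assumption].
      * intros k x h Xx. rewrite <- Nat.iter_succ_r. apply H; [lia|assumption].
Qed.

Lemma iter_Dy_ext k f g : (forall x y, -1 < y < 1 -> f x y = g x y) ->
  forall x y, -1 < y < 1 -> Nat.iter k Dy f x y = Nat.iter k Dy g x y.
Proof.
  intros E. induction k as [|k IH]; intros x y Hy; simpl; [now apply E|].
  exact (dy_ext (fun _ : unit => Nat.iter k Dy f) (fun _ => Nat.iter k Dy g)
           (fun _ x y Hy => IH x y Hy) tt x y Hy).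
Qed.

Lemma iter_Dy_plus k f g : sm f -> sm g -> forall x y, -1 < y < 1 ->
  Nat.iter k Dy (fun x y => f x y + g x y) x y = Nat.iter k Dy f x y + Nat.iter k Dy g x y.
Proof.
  intros F G. induction k as [|k IH]; intros x y Hy; simpl; [reflexivity|].
  rewrite <- Dy_plus; try assumption; try now apply sm_iter_Dy.
  exact (dy_ext (fun _ : unit => Nat.iter k Dy (fun x y => f x y + g x y))
           (fun _ x y => Nat.iter k Dy f x y + Nat.iter k Dy g x y)
           (fun _ x y Hy => IH x y Hy) tt x y Hy).
Qed.

Lemma iter_Dy_divpow k M (h : R -> R) : (k <= M)%nat -> forall x y,
  Nat.iter k Dy (fun x y => divpow M y * h x) x y = divpow (M - k) y * h x.
Proof.
  induction k as [|k IH]; intros hk x y; simpl.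
  - now rewrite Nat.sub_0_r.
  - unfold Dy at 1. rewrite (Derive_ext _ (fun t => divpow (M - k) t * h x)).
    2:{ intros t. apply IH. lia. }
    apply is_derive_unique.
    replace (divpow (M - Datatypes.S k) y * h x) with (divpow (M - Datatypes.S k) y * h x + divpow (M - k) y * 0) by ring.
    apply (is_derive_Rmult (divpow (M - k)) (fun _ => h x)); [|apply is_derive_Rconst].
    pose proof (divpow_derive (M - k) y) as D. destruct (M - k)%nat as [|m] eqn:E; [lia|].
    replace (M - Datatypes.S k)%nat with m by lia. exact D.
Qed.

Lemma sm_divpow M : sm (fun _ y => divpow M y).
Proof.
  apply (sm_ext (fun _ y => y ^ M * / INR (fact M))); [reflexivity|].
  apply sm_mult; [|apply sm_const]. apply (CF_pow (fun _ _ y => y) M sm_y).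
Qed.

Lemma jet_divpow M (h : R -> R) : jet M all (fun x y => divpow M y * h x).
Proof.
  apply jet_iter. intros k x hk _. rewrite iter_Dy_divpow by lia.
  unfold divpow. rewrite pow_i by lia. unfold Rdiv. ring.
Qed.

Lemma divpow_at_0 : divpow 0 0 = 1.
Proof. unfold divpow. simpl. field. Qed.

Definition cjet (M : nat) (X : R -> Prop) (f : R -> R -> C) : Prop :=
  jet M X (fun x y => fst (f x y)) /\ jet M X (fun x y => snd (f x y)).

Lemma cjet_ext M X f g : (forall x y, -1 < y < 1 -> f x y = g x y) -> cjet M X f -> cjet M X g.
Proof.
  intros E [H1 H2]. split.
  - apply (jet_ext M X (fun x y => fst (f x y))); [intros; now rewrite E|assumption].
  - apply (jet_ext M X (fun x y => snd (f x y))); [intros; now rewrite E|assumption].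
Qed.

Lemma cjet_sub M (X X' : R -> Prop) f : (forall x, X' x -> X x) -> cjet M X f -> cjet M X' f.
Proof. intros S [H1 H2]. split; now apply (jet_sub M X). Qed.

Lemma cjet_plus M X f g : csm f -> csm g -> cjet M X f -> cjet M X g -> cjet M X (fun x y => f x y + g x y)%C.
Proof. intros [F1 F2] [G1 G2] [H1 H2] [H3 H4]. split; simpl; now apply jet_plus. Qed.

Lemma cjet_mult K M N X f g : (K <= M + N)%nat -> csm f -> csm g -> cjet M X f -> cjet N X g ->
  cjet K X (fun x y => f x y * g x y)%C.
Proof.
  intros h [F1 F2] [G1 G2] [H1 H2] [H3 H4]. split; simpl.
  - apply (jet_plus K X (fun x y => fst (f x y) * fst (g x y)) (fun x y => - (snd (f x y) * snd (g x y)))).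
    + now apply sm_mult.
    + apply sm_opp. now apply sm_mult.
    + now apply (jet_mult K M N).
    + apply jet_opp; [now apply sm_mult|]. now apply (jet_mult K M N).
  - apply jet_plus; try now apply sm_mult.
    + now apply (jet_mult K M N).
    + now apply (jet_mult K M N).
Qed.

Lemma cjet_mult_l M X f g : csm f -> csm g -> cjet M X g -> cjet M X (fun x y => f x y * g x y)%C.
Proof. intros F G H. apply (cjet_mult M 0 M); auto. split; exact Logic.I. Qed.

Lemma cjet_S M X f : (forall x, X x -> f x 0 = RtoC 0) -> cjet M X (cDy f) -> cjet (S M) X f.
Proof.
  intros V [H1 H2]. split; (split; [intros x Xx; now rewrite V|]); assumption.
Qed.

Lemma cjet_S_inv M X f : cjet (S M) X f -> (forall x, X x -> f x 0 = RtoC 0) /\ cjet M X (cDy f).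
Proof.
  intros [[V1 H1] [V2 H2]]. split; [|split; assumption].
  intros x Xx. apply C_ext; simpl; auto.
Qed.

Lemma cjet_csum n M X (f : nat -> R -> R -> C) : (forall j, (j < n)%nat -> csm (f j)) ->
  (forall j, (j < n)%nat -> cjet M X (f j)) -> cjet M X (fun x y => csum n (fun j => f j x y)).
Proof.
  induction n as [|n IH]; intros S H; simpl.
  - clear. assert (Z : jet M X (fun _ _ => 0)).
    { induction M as [|M IH]; [exact Logic.I|]. split; [reflexivity|].
      apply (jet_ext M X (fun _ _ => 0)); [|exact IH]. intros. unfold Dy. now rewrite Derive_const. }
    split; exact Z.
  - apply cjet_plus; auto. apply csm_csum. auto.
Qed.

Lemma cjet_exp1 M X v : csm v -> cjet M X v -> cjet M X (fun x y => Cexp (v x y) - 1)%C.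
Proof.
  intros S H. destruct M as [|M]; [split; exact Logic.I|].
  destruct (cjet_S_inv _ _ _ H) as [V D]. apply cjet_S.
  - intros x Xx. rewrite V by assumption. rewrite Cexp_0. ring.
  - apply (cjet_ext M X (fun x y => Cexp (v x y) * cDy v x y)%C).
    + intros x y Hy. symmetry. apply cDy_unique.
      replace (Cexp (v x y) * cDy v x y)%C with (Cexp (v x y) * cDy v x y - 0)%C by ring.
      apply is_cderive_minus; [|apply is_cderive_const]. apply is_cderive_exp. now apply csm_is_cderive.
    + apply cjet_mult_l; [now apply csm_exp|now apply csm_cDy|assumption].
Qed.

(** The y-derivative of exp v - 1 - v is (exp v - 1) v', of order M + (M - 1) >= M. *)
Lemma cjet_exp2 M X v : (1 <= M)%nat -> csm v -> cjet M X v ->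
  cjet (S M) X (fun x y => Cexp (v x y) - 1 - v x y)%C.
Proof.
  intros h S H. destruct M as [|M]; [lia|].
  destruct (cjet_S_inv _ _ _ H) as [V D]. apply cjet_S.
  - intros x Xx. rewrite V by assumption. rewrite Cexp_0. ring.
  - apply (cjet_ext _ X (fun x y => (Cexp (v x y) - 1) * cDy v x y)%C).
    + intros x y Hy. symmetry. apply cDy_unique.
      replace ((Cexp (v x y) - 1) * cDy v x y)%C with (Cexp (v x y) * cDy v x y - 0 - cDy v x y)%C by ring.
      apply is_cderive_minus; [|now apply csm_is_cderive].
      apply is_cderive_minus; [|apply is_cderive_const]. apply is_cderive_exp. now apply csm_is_cderive.
    + apply (cjet_mult _ (Datatypes.S M) M); [lia| |now apply csm_cDy| |assumption].
      * apply csm_minus; [now apply csm_exp|apply csm_const].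
      * now apply cjet_exp1.
Qed.

Definition cdq (J : R) (F : R -> R -> C) (x y : R) : C :=
  (dq J (fun x y => fst (F x y)) x y, dq J (fun x y => snd (F x y)) x y).

Lemma csm_cdq J F : csm F -> csm (cdq J F).
Proof. intros [F1 F2]. split; now apply sm_dq. Qed.

Lemma cdq_spec J F x y : csm F -> -1 < y < 1 -> (y * cdq J F x y = F (x + J * y)%R y - F x y)%C.
Proof.
  intros [F1 F2] Hy. pose proof (dq_spec J _ x y F1 Hy). pose proof (dq_spec J _ x y F2 Hy).
  apply C_ext; simpl in *; lra.
Qed.

Lemma cdq_at_0 J F x : csm F -> (cdq J F x 0 = J * cDx F x 0)%C.
Proof.
  intros [F1 F2]. pose proof (dq_at_0 J _ x F1). pose proof (dq_at_0 J _ x F2).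
  apply C_ext; simpl in *; lra.
Qed.

Lemma cjet_cdq M J F : csm F -> cjet M all F -> cjet M all (cdq J F).
Proof. intros [F1 F2] [H1 H2]. split; now apply jet_dq. Qed.

(** For y <> 0 this is linearity of a difference in x, in which c y is a constant factor; at y = 0
    the quotient is J times an x-derivative and linearity holds again. *)
Lemma cdq_lin J F G (c : R -> R) : csm F -> csm G -> sm (fun _ y => c y) -> forall x y, -1 < y < 1 ->
  (cdq J (fun x y => F x y + c y * G x y) x y = cdq J F x y + c y * cdq J G x y)%C.
Proof.
  intros SF SG Sc x y Hy.
  assert (S : csm (fun x y => F x y + c y * G x y)%C).
  { apply csm_plus; [assumption|]. apply csm_mult; [now apply csm_RtoC|assumption]. }
  destruct (Req_dec y 0) as [->|ne].
  - rewrite !cdq_at_0 by assumption.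
    assert (z : -1 < 0 < 1) by lra.
    pose proof (proj1 (csm_is_cderive F SF x 0 z)) as DF.
    pose proof (proj1 (csm_is_cderive G SG x 0 z)) as DG.
    pose proof (is_cderive_plus _ _ _ _ _ DF (is_cderive_mult _ _ _ _ _ (is_cderive_const (RtoC (c 0)) x) DG)) as D.
    rewrite (cDx_unique (fun x y => F x y + RtoC (c y) * G x y)%C x 0 _ D). ring.
  - assert (E : (y * cdq J (fun x y => F x y + c y * G x y) x y = y * (cdq J F x y + c y * cdq J G x y))%C).
    { rewrite cdq_spec by assumption.
      replace (y * (cdq J F x y + c y * cdq J G x y))%C with (y * cdq J F x y + c y * (y * cdq J G x y))%C by ring.
      rewrite !cdq_spec by assumption. ring. }
    assert (Y : RtoC y <> 0) by (intros e; apply ne; now apply RtoC_inj).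
    transitivity (/ y * (y * cdq J (fun x y => F x y + c y * G x y) x y))%C; [field; exact Y|].
    rewrite E. field. exact Y.
Qed.

(** * Formal solutions *)

Lemma RtoC_m1 : RtoC (-1) = (- RtoC 1)%C.
Proof. apply C_ext; simpl; ring. Qed.

Lemma iter_Dy_divpow_gt k M (h : R -> R) : (M < k)%nat -> forall x y,
  Nat.iter k Dy (fun x y => divpow M y * h x) x y = 0.
Proof.
  induction k as [|k IH]; intros hk x y; [lia|]. simpl. unfold Dy at 1.
  destruct (Nat.eq_dec M k) as [->|ne].
  - rewrite (Derive_ext _ (fun t => h x)); [apply Derive_const|].
    intros t. rewrite iter_Dy_divpow by lia. rewrite Nat.sub_diag. unfold divpow. simpl. field.
  - rewrite (Derive_ext _ (fun _ => 0)); [apply Derive_const|]. intros t. apply IH. lia.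
Qed.

(** No factorial: paired with monomials y^n / n! ([divpow]), the coefficients are read off
    directly. *)
Definition taylor (k : nat) (f : R -> R -> C) (x : R) : C :=
  (Nat.iter k Dy (fun x y => fst (f x y)) x 0, Nat.iter k Dy (fun x y => snd (f x y)) x 0).

Lemma csm_taylor k f : csm f -> csm (fun x _ => taylor k f x).
Proof.
  intros [F1 F2]. apply (csm_restrict (fun x y => (Nat.iter k Dy (fun x y => fst (f x y)) x y, Nat.iter k Dy (fun x y => snd (f x y)) x y))).
  split; simpl.
  - exact (sm_iter_Dy _ k F1).
  - exact (sm_iter_Dy _ k F2).
Qed.

Lemma cjet_taylor M X f : cjet M X f <-> forall k x, (k < M)%nat -> X x -> taylor k f x = RtoC 0.
Proof.
  unfold cjet. rewrite !jet_iter. split.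
  - intros [H1 H2] k x hk Xx. apply C_ext; simpl; auto.
  - intros H. split; intros k x hk Xx; specialize (H k x hk Xx);
      [exact (f_equal fst H)|exact (f_equal snd H)].
Qed.

Lemma taylor_plus k f g x : csm f -> csm g ->
  taylor k (fun x y => f x y + g x y)%C x = (taylor k f x + taylor k g x)%C.
Proof.
  intros [F1 F2] [G1 G2]. apply C_ext; simpl.
  - apply (iter_Dy_plus k _ _ F1 G1). lra.
  - apply (iter_Dy_plus k _ _ F2 G2). lra.
Qed.

Lemma taylor_monomial k M (h : R -> C) x :
  taylor k (fun x y => divpow M y * h x)%C x = if Nat.eq_dec k M then h x else RtoC 0.
Proof.
  assert (A : forall g : R -> R, Nat.iter k Dy (fun x y => divpow M y * g x) x 0 = if Nat.eq_dec k M then g x else 0).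
  { intros g. destruct (Nat.eq_dec k M) as [->|ne].
    - rewrite iter_Dy_divpow by lia. rewrite Nat.sub_diag. unfold divpow. simpl. field.
    - destruct (Nat.lt_ge_cases k M).
      + rewrite iter_Dy_divpow by lia. unfold divpow. rewrite pow_i by lia. unfold Rdiv; ring.
      + apply iter_Dy_divpow_gt. lia. }
  unfold taylor. simpl.
  rewrite (iter_Dy_ext k _ (fun x y => divpow M y * fst (h x))); [|intros; simpl; ring|lra].
  rewrite (iter_Dy_ext k (fun x y => divpow M y * snd (h x) + 0 * fst (h x)) (fun x y => divpow M y * snd (h x)));
    [|intros; simpl; ring|lra].
  rewrite !A. destruct (Nat.eq_dec k M); [now destruct (h x)|reflexivity].
Qed.

Lemma csm_monomial M (h : R -> C) : csm (fun x _ => h x) -> csm (fun x y => divpow M y * h x)%C.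
Proof. intros H. apply csm_mult; [|assumption]. apply csm_RtoC, sm_divpow. Qed.

(** [borel] with the variables exchanged: the series runs in y, and x is the parameter. *)
Lemma borel_sm (h : nat -> R -> R) : (forall n, sm (fun x _ => h n x)) ->
  exists F, sm F /\ forall n x, Nat.iter n Dy F x 0 = h n x.
Proof.
  intros H.
  destruct (borel all (fun n j => Derive_n (h n) j) convex_all) as (D & HD & D0 & _).
  - intros n j. destruct (sm_1d _ (H n) j) as [_ [C HC]]. exists C. auto.
  - intros n j y _. apply is_derive_dw. apply (sm_1d _ (H n) j).
  - pose proof (DF_swap _ _ _ HD) as HS.
    exists (fun x y => D O O y x). split.
    + exact (DF_sm all all _ (fun _ => Logic.I) (fun _ _ => Logic.I) HS O O).
    + assert (A : forall n x y, -1 < y < 1 -> Nat.iter n Dy (fun x y => D O O y x) x y = D n O y x).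
      { induction n as [|n IH]; intros x y Hy; [reflexivity|]. simpl.
        etransitivity.
        - exact (dy_ext (fun _ : unit => Nat.iter n Dy (fun x y => D O O y x)) (fun _ x y => D n O y x)
                   (fun _ x y Hy => IH x y Hy) tt x y Hy).
        - apply is_derive_unique. destruct (HD n O) as [_ d].
          apply dw_is_derive with all; [apply filter_forall; intros; exact Logic.I|].
          apply (d y x Logic.I Logic.I). }
      intros n x. rewrite A by lra. rewrite D0 by exact Logic.I. reflexivity.
Qed.

Lemma borel_csm (h : nat -> R -> C) : (forall n, csm (fun x _ => h n x)) ->
  exists F, csm F /\ forall n x, taylor n F x = h n x.
Proof.
  intros H.
  destruct (borel_sm (fun n x => fst (h n x))) as (F1 & S1 & E1); [intros n; apply H|].
  destruct (borel_sm (fun n x => snd (h n x))) as (F2 & S2 & E2); [intros n; apply H|].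
  exists (fun x y => (F1 x y, F2 x y)). split; [split; assumption|].
  intros n x. apply C_ext; [apply E1|apply E2].
Qed.

Section WKB.
Variables (l : nat) (a : nat -> R -> R -> C).
Hypothesis Sa : forall j, csm (a j).

(* The recurrence applied to exp(F/y) at the lattice point x, divided by exp(F(x, y)/y). *)
Definition resid (F : R -> R -> C) (x y : R) : C :=
  csum (S l) (fun j => a j x y * Cexp (cdq (INR j) F x y))%C.

Lemma csm_coef F j : csm F -> csm (fun x y => a j x y * Cexp (cdq (INR j) F x y))%C.
Proof. intros SF. apply csm_mult; [apply Sa|]. apply csm_exp. now apply csm_cdq. Qed.

Lemma csm_resid F : csm F -> csm (resid F).
Proof. intros SF. apply (csm_csum (Datatypes.S l) (fun j x y => a j x y * Cexp (cdq (INR j) F x y))%C). intros j _. now apply csm_coef. Qed.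

Variables (lo hi A : R).
Hypothesis A0 : 0 < A.
Hypothesis HA : forall x, lo <= x <= hi -> Rabs x <= A.
Let X (x : R) : Prop := lo <= x <= hi.
(** In the application L is a smooth logarithm of a root lambda, and cinv inverts the sum of j a_j
    lambda^j, that is lambda P'(lambda), nonzero for a simple nonzero root. *)
Variables (L cinv : R -> C).
Hypothesis SL : csm (fun x _ => L x).
Hypothesis Sc : csm (fun x _ => cinv x).
Hypothesis HL : forall x, X x -> csum (S l) (fun j => a j x 0 * Cexp (INR j * L x))%C = RtoC 0.
Hypothesis Hc : forall x, X x ->
  (csum (S l) (fun j => a j x 0%R * Cexp (INR j * L x) * INR j) * cinv x = 1)%C.

Lemma coef_at_0 F j x : csm F -> (cDx F x 0 = L x) ->
  (a j x 0 * Cexp (cdq (INR j) F x 0) = a j x 0 * Cexp (INR j * L x))%C.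
Proof. intros SF E. now rewrite cdq_at_0, E. Qed.

(** Primitive of the transport equation at order M: h' lambda P'(lambda) has to cancel the M-th
    coefficient of the residual. The cutoff is 1 on the interval and keeps the primitive bounded on
    R. *)
Definition corr (M : nat) (G : R -> R -> C) : R -> C :=
  cprim (fun x => - (cutoff A x * (cinv x * taylor M (resid G) x)))%C.

Lemma corr_spec M G : csm G -> csm (fun x _ => corr M G x) /\
  forall x, X x -> is_cderive (corr M G) x (- (cinv x * taylor M (resid G) x))%C.
Proof.
  intros SG.
  destruct (cprim_spec (fun x => - (cutoff A x * (cinv x * taylor M (resid G) x)))%C (2 * A)) as [S D].
  - apply (csm_ext (fun x y => 0 - cutoff A x * (cinv x * taylor M (resid G) x))%C); [intros; ring|].
    apply csm_minus; [apply csm_const|]. apply csm_mult; [apply csm_RtoC; now apply sm_cutoff|].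
    apply csm_mult; [exact Sc|]. apply csm_taylor. now apply csm_resid.
  - intros x h. rewrite cutoff_0 by assumption. ring.
  - split; [exact S|]. intros x Xx. specialize (D x). rewrite cutoff_1, Cmult_1_l in D; auto.
Qed.

(** Adding (y^M / M!) h to G changes the j-th exponent by v_j, of order M with leading part j h' y^M
    / M!. To leading order the residual changes by (y^M / M!) h' times the sum of j a_j lambda^j,
    and h was chosen so that this kills its M-th coefficient. M >= 1 makes terms quadratic in v_j
    negligible and leaves the slope at y = 0 alone. *)
Lemma wkb_step M G : (1 <= M)%nat -> csm G -> (forall x, X x -> cDx G x 0 = L x) ->
  cjet M X (resid G) ->
  let G' := fun x y => (G x y + divpow M y * corr M G x)%C in
  csm G' /\ (forall x, X x -> cDx G' x 0 = L x) /\ cjet (S M) X (resid G').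
Proof.
  intros hM SG EL HJ G'. destruct (corr_spec M G SG) as [Sh Dh]. set (h := corr M G) in *.
  assert (SG' : csm G') by (apply csm_plus; [assumption|now apply csm_monomial]).
  split; [exact SG'|]. split.
  { intros x Xx. assert (z : -1 < 0 < 1) by lra.
    pose proof (proj1 (csm_is_cderive G SG x 0 z)) as DG.
    pose proof (is_cderive_plus _ _ _ _ _ DG (is_cderive_mult _ _ _ _ _ (is_cderive_const (RtoC (divpow M 0)) x) (Dh x Xx))) as D.
    rewrite (cDx_unique G' x 0 _ D), EL by assumption. unfold divpow. rewrite pow_i by lia. unfold Rdiv.
    rewrite !Rmult_0_l. ring. }
  set (b := fun j x y => (a j x y * Cexp (cdq (INR j) G x y) * cdq (INR j) (fun x _ => h x) x y)%C).
  assert (Sb : forall j, csm (b j)).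
  { intros j. apply csm_mult; [now apply csm_coef|now apply csm_cdq]. }
  set (v := fun j x y => (divpow M y * cdq (INR j) (fun x _ => h x) x y)%C).
  assert (Sv : forall j, csm (v j)).
  { intros j. apply csm_mult; [apply csm_RtoC, sm_divpow|now apply csm_cdq]. }
  assert (Jp : cjet M all (fun x y => RtoC (divpow M y))).
  { split; simpl.
    - apply (jet_ext M all (fun x y => divpow M y * 1)); [intros; ring|]. apply (jet_divpow M (fun _ => 1)).
    - apply (jet_ext M all (fun x y => divpow M y * 0)); [intros; ring|]. apply (jet_divpow M (fun _ => 0)). }
  assert (Jv : forall j, cjet M X (v j)).
  { intros j. apply (cjet_sub M all); [intros; exact Logic.I|].
    apply (cjet_mult M M 0); [lia|apply csm_RtoC, sm_divpow|now apply csm_cdq|assumption|split; exact Logic.I]. }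
  (* Split of the new residual: T1 collects what is quadratic and higher in v_j, T2 the variation of
     the b_j away from y = 0, both of order M + 1; T3 is the old residual plus the leading
     change. *)
  set (T1 := fun x y => csum (Datatypes.S l) (fun j => a j x y * Cexp (cdq (INR j) G x y) * (Cexp (v j x y) - 1 - v j x y))%C).
  set (T2 := fun x y => (divpow M y * csum (Datatypes.S l) (fun j => b j x y - b j x 0%R))%C).
  set (k := fun x => csum (Datatypes.S l) (fun j => b j x 0)).
  set (T3 := fun x y => (resid G x y + divpow M y * k x)%C).
  assert (Sw : forall j, csm (fun x y => Cexp (v j x y) - 1 - v j x y)%C).
  { intros j. apply csm_minus; [apply csm_minus; [now apply csm_exp|apply csm_const]|apply Sv]. }
  assert (Sbd : forall j, csm (fun x y => b j x y - b j x 0%R)%C).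
  { intros j. apply csm_minus; [apply Sb|]. apply (csm_restrict (b j)), Sb. }
  assert (Sk : csm (fun x _ => k x)).
  { apply (csm_csum (Datatypes.S l) (fun j x _ => b j x 0)). intros j _. apply (csm_restrict (b j)), Sb. }
  assert (S1 : csm T1).
  { apply (csm_csum (Datatypes.S l) (fun j x y => a j x y * Cexp (cdq (INR j) G x y) * (Cexp (v j x y) - 1 - v j x y))%C).
    intros j _. apply csm_mult; [now apply csm_coef|apply Sw]. }
  assert (S2 : csm T2).
  { apply csm_mult; [apply csm_RtoC, sm_divpow|].
    apply (csm_csum (Datatypes.S l) (fun j x y => b j x y - b j x 0%R)%C). intros j _. apply Sbd. }
  assert (S3 : csm T3).
  { apply csm_plus; [now apply csm_resid|now apply csm_monomial]. }
  apply (cjet_ext _ X (fun x y => (T1 x y + T2 x y) + T3 x y)%C).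
  { intros x y Hy. unfold T1, T2, T3, resid, k. rewrite <- !csum_mult_l, <- !csum_plus.
    apply csum_ext. intros j _. unfold G'. rewrite (cdq_lin (INR j) G (fun x _ => h x) (divpow M)); auto.
    2: apply sm_divpow.
    rewrite Cexp_plus. fold (v j x y). unfold b, v. ring. }
  apply cjet_plus; [now apply csm_plus|assumption| |].
  - apply cjet_plus; [assumption|assumption| |].
    + apply (cjet_csum (Datatypes.S l) _ X (fun j x y => a j x y * Cexp (cdq (INR j) G x y) * (Cexp (v j x y) - 1 - v j x y))%C).
      * intros j _. apply csm_mult; [now apply csm_coef|apply Sw].
      * intros j _. apply cjet_mult_l; [now apply csm_coef|apply Sw|]. now apply cjet_exp2.
    + apply (cjet_sub _ all); [intros; exact Logic.I|].
      apply (cjet_mult _ M 1); [lia|apply csm_RtoC, sm_divpow| |assumption|].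
      * apply (csm_csum (Datatypes.S l) (fun j x y => b j x y - b j x 0%R)%C). intros j _. apply Sbd.
      * apply (cjet_csum (Datatypes.S l) 1 all (fun j x y => b j x y - b j x 0%R)%C); [intros; apply Sbd|].
        intros j _. apply cjet_S; [intros; ring|split; exact Logic.I].
  (* Below order M both parts of T3 vanish; at order M they cancel by [Hc]. *)
  - apply cjet_taylor. intros n x hn Xx. unfold T3. rewrite taylor_plus; [|now apply csm_resid|now apply csm_monomial].
    rewrite taylor_monomial. destruct (Nat.eq_dec n M) as [->|ne].
    + unfold k.
      assert (E : csum (Datatypes.S l) (fun j => b j x 0) =
        (csum (Datatypes.S l) (fun j => a j x 0%R * Cexp (INR j * L x) * INR j) * - (cinv x * taylor M (resid G) x))%C).
      { rewrite <- csum_mult_r. apply csum_ext. intros j _. unfold b.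
        rewrite coef_at_0 by auto. rewrite cdq_at_0 by assumption.
        rewrite (cDx_unique _ x 0 _ (Dh x Xx)). ring. }
      rewrite E.
      transitivity (taylor M (resid G) x - (csum (Datatypes.S l) (fun j => a j x 0%R * Cexp (INR j * L x) * INR j) * cinv x) * taylor M (resid G) x)%C; [ring|].
      rewrite Hc by assumption. ring.
    + rewrite (proj1 (cjet_taylor M X (resid G)) HJ n x) by (auto; lia). ring.
Qed.

Fixpoint stage (n : nat) : R -> R -> C :=
  match n with
  | O => fun x y => (divpow 0 y * cprim (fun t => cutoff A t * L t) x)%C
  | S n' => fun x y => (stage n' x y + divpow (S n') y * corr (S n') (stage n') x)%C
  end.

Definition coeffs (n : nat) : R -> C :=
  match n with
  | O => cprim (fun t => cutoff A t * L t)%C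
  | S n' => corr (S n') (stage n')
  end.

Lemma stage_spec n : csm (stage n) /\ (forall x, X x -> cDx (stage n) x 0 = L x) /\
  cjet (S n) X (resid (stage n)).
Proof.
  induction n as [|n (S1 & E & J)].
  - destruct (cprim_spec (fun x => cutoff A x * L x)%C (2 * A)) as [S D].
    { apply csm_mult; [apply csm_RtoC; now apply sm_cutoff|exact SL]. }
    { intros x h. rewrite cutoff_0 by assumption. ring. }
    assert (S0 : csm (stage 0)) by now apply csm_monomial.
    assert (E0 : forall x, X x -> cDx (stage 0) x 0 = L x).
    { intros x Xx. pose proof (is_cderive_mult _ _ _ _ _ (is_cderive_const (RtoC (divpow 0 0)) x) (D x)) as D'.
      rewrite (cDx_unique (stage 0) x 0 _ D'), divpow_at_0, cutoff_1 by auto. ring. }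
    split; [exact S0|]. split; [exact E0|].
    (* At y = 0 the residual is the characteristic polynomial at exp(L x). *)
    apply cjet_S; [|split; exact Logic.I]. intros x Xx. unfold resid. rewrite <- (HL x Xx).
    apply csum_ext. intros j _. apply coef_at_0; auto.
  - apply (wkb_step (S n) (stage n)); auto. lia.
Qed.

Lemma csm_coeffs n : csm (fun x _ => coeffs n x).
Proof.
  destruct n; simpl.
  - apply (cprim_spec (fun x => cutoff A x * L x)%C (2 * A)).
    + apply csm_mult; [apply csm_RtoC; now apply sm_cutoff|exact SL].
    + intros x h. rewrite cutoff_0 by assumption. ring.
  - apply corr_spec. apply stage_spec.
Qed.

Lemma taylor_stage n k x : taylor k (stage n) x = if le_dec k n then coeffs k x else RtoC 0.
Proof.
  induction n as [|n IH].
  - simpl stage. rewrite taylor_monomial. destruct (Nat.eq_dec k 0) as [->|ne]; [reflexivity|].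
    destruct (le_dec k 0); [lia|reflexivity].
  - simpl stage. rewrite taylor_plus; [|apply stage_spec|apply csm_monomial, (csm_coeffs (S n))].
    rewrite taylor_monomial, IH.
    destruct (le_dec k n), (le_dec k (S n)), (Nat.eq_dec k (S n)); try lia; try ring.
    subst k. simpl coeffs. ring.
Qed.

(** The Borel sum F agrees with stage n to order n + 1 for all x, hence so do the divided
    differences, and the residual of F vanishes to the order that [stage_spec] gives for stage n,
    for every n. *)
Lemma wkb_formal : exists F, csm F /\ (forall x, X x -> cDx F x 0 = L x) /\
  forall M, cjet M X (resid F).
Proof.
  destruct (borel_csm coeffs csm_coeffs) as (F & SF & HF).
  assert (Jd : forall n, cjet (S n) all (fun x y => F x y + (-1)%R * stage n x y)%C).
  { intros n. apply cjet_taylor. intros k x hk _.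
    destruct (stage_spec n) as [Sn _].
    rewrite taylor_plus; [|assumption|apply csm_mult; [apply csm_const|assumption]].
    rewrite HF.
    assert (E : taylor k (fun x y => (-1)%R * stage n x y)%C x = (- taylor k (stage n) x)%C).
    (* The coefficients of -stage n are found from the vanishing of those of (-stage n) + stage
       n. *)
    { pose proof (taylor_plus k (fun x y => (-1)%R * stage n x y)%C (stage n) x) as T.
      assert (Z : taylor k (fun x y => (-1)%R * stage n x y + stage n x y)%C x = RtoC 0).
      { pose proof (taylor_monomial k O (fun _ => RtoC 0) x) as Tm. rewrite <- (proj1 (cjet_taylor (S k) all (fun x y => RtoC 0)) ) with (k := k) (x := x); try lia; try exact Logic.I.
        - f_equal. apply functional_extensionality; intros u. apply functional_extensionality; intros w.
          rewrite RtoC_m1. ring.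
        - apply (cjet_csum 0 (S k) all (fun _ _ _ => RtoC 0)); intros; lia. }
      cbv beta in T. rewrite Z in T. specialize (T (csm_mult _ _ (csm_const _) Sn) Sn).
      rewrite <- (Cplus_0_r (taylor k (fun x y => (-1)%R * stage n x y)%C x)).
      replace (RtoC 0) with (taylor k (stage n) x - taylor k (stage n) x)%C by ring.
      transitivity ((taylor k (fun x y => (-1)%R * stage n x y)%C x + taylor k (stage n) x) - taylor k (stage n) x)%C; [ring|].
      rewrite <- T. ring. }
    rewrite E, taylor_stage. destruct (le_dec k n); [ring|lia]. }
  exists F. split; [exact SF|]. split.
  - intros x Xx. destruct (stage_spec 0) as (S0 & E0 & _). rewrite <- E0 by assumption.
    pose proof (Jd O) as J0. apply cjet_S_inv in J0. destruct J0 as [V _].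
    assert (Q : forall t, F t 0 = stage 0 t 0).
    { intros t. specialize (V t Logic.I). rewrite RtoC_m1 in V.
      transitivity ((F t 0%R + - (1) * stage 0 t 0%R) + stage 0 t 0%R)%C; [ring|]. rewrite V. ring. }
    unfold cDx, Dx. f_equal; apply Derive_ext; intros t; now rewrite Q.
  - intros M. destruct M as [|n]; [split; exact Logic.I|].
    destruct (stage_spec n) as (Sn & _ & Jn).
    set (d := fun x y => (F x y + (-1)%R * stage n x y)%C).
    assert (Sd : csm d) by (apply csm_plus; [assumption|apply csm_mult; [apply csm_const|assumption]]).
    assert (Sw : forall j, csm (fun x y => Cexp (cdq (INR j) d x y) - 1)%C).
    { intros j. apply csm_minus; [apply csm_exp; now apply csm_cdq|apply csm_const]. }
    apply (cjet_ext _ X (fun x y => csum (Datatypes.S l) (fun j => a j x y * Cexp (cdq (INR j) (stage n) x y)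
              * (Cexp (cdq (INR j) d x y) - 1)) + resid (stage n) x y)%C).
    { intros x y Hy. unfold resid. rewrite <- csum_plus. apply csum_ext. intros j _.
      replace (cdq (INR j) F x y) with (cdq (INR j) (stage n) x y + cdq (INR j) d x y)%C.
      - rewrite Cexp_plus. ring.
      - unfold d. rewrite (cdq_lin (INR j) F (stage n) (fun _ => -1)); try assumption; [|apply sm_const].
        rewrite RtoC_m1. ring. }
    apply cjet_plus.
    + apply (csm_csum (Datatypes.S l) (fun j x y => a j x y * Cexp (cdq (INR j) (stage n) x y) * (Cexp (cdq (INR j) d x y) - 1))%C).
      intros j _. apply csm_mult; [now apply csm_coef|apply Sw].
    + now apply csm_resid.
    + apply (cjet_sub _ all); [intros; exact Logic.I|].
      apply (cjet_csum (Datatypes.S l) _ all (fun j x y => a j x y * Cexp (cdq (INR j) (stage n) x y) * (Cexp (cdq (INR j) d x y) - 1))%C).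
      * intros j _. apply csm_mult; [now apply csm_coef|apply Sw].
      * intros j _. apply cjet_mult_l; [now apply csm_coef|apply Sw|].
        apply cjet_exp1; [now apply csm_cdq|]. apply cjet_cdq; [assumption|apply Jd].
    + exact Jn.
Qed.

End WKB.

(** * Polynomials with simple roots *)

Definition peval (n : nat) (c : nat -> C) (z : C) : C := csum (S n) (fun j => c j * Cpow z j)%C.

(* The coefficients of (peval l c z - peval l c w) / (z - w). *)
Definition pquot (l : nat) (c : nat -> C) (w : C) (i : nat) : C :=
  csum (l - i) (fun t => c (i + 1 + t)%nat * Cpow w t)%C.

Lemma Cpow_S (z : C) n : Cpow z (S n) = (z * Cpow z n)%C.
Proof. reflexivity. Qed.

Lemma Cpow_plus (z : C) m n : Cpow z (m + n) = (Cpow z m * Cpow z n)%C.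
Proof. induction m; simpl; [ring|]. rewrite IHm. ring. Qed.

Lemma geometric (z w : C) n :
  ((z - w) * csum (S n) (fun i => Cpow w (n - i) * Cpow z i) = Cpow z (S n) - Cpow w (S n))%C.
Proof.
  induction n as [|n IH].
  - simpl. ring.
  - change (csum (S (S n)) (fun i => Cpow w (S n - i) * Cpow z i)%C) with
      (csum (S n) (fun i => Cpow w (S n - i) * Cpow z i)%C + Cpow w (S n - S n) * Cpow z (S n))%C.
    rewrite Nat.sub_diag.
    rewrite (csum_ext (S n) _ (fun i => w * (Cpow w (n - i) * Cpow z i))%C).
    + rewrite csum_mult_l.
      transitivity (w * ((z - w) * csum (S n) (fun i => Cpow w (n - i) * Cpow z i)) + (z - w) * Cpow z (S n))%C.
      * simpl. ring.
      * rewrite IH. rewrite (Cpow_S z (S n)), (Cpow_S w (S n)). ring.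
    + intros i Hi. replace (S n - i)%nat with (S (n - i)) by lia. rewrite Cpow_S. ring.
Qed.

Lemma pquot_S l c w i : (i <= l)%nat ->
  pquot (S l) c w i = (pquot l c w i + c (S l) * Cpow w (l - i))%C.
Proof.
  intros h. unfold pquot. replace (S l - i)%nat with (S (l - i)) by lia. simpl.
  f_equal. f_equal. f_equal. lia.
Qed.

Lemma pquot_diag l c w : pquot l c w l = RtoC 0.
Proof. unfold pquot. now rewrite Nat.sub_diag. Qed.

Lemma peval_div l c z w :
  (peval l c z - peval l c w = (z - w) * csum l (fun i => pquot l c w i * Cpow z i))%C.
Proof.
  induction l as [|l IH].
  - unfold peval. simpl. ring.
  - unfold peval in *.
    transitivity ((csum (S l) (fun j => c j * Cpow z j) - csum (S l) (fun j => c j * Cpow w j))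
       + c (S l) * (Cpow z (S l) - Cpow w (S l)))%C; [simpl; ring|].
    rewrite IH, <- geometric.
    rewrite (csum_ext (S l) (fun i => pquot (S l) c w i * Cpow z i)%C
       (fun i => pquot l c w i * Cpow z i + c (S l) * (Cpow w (l - i) * Cpow z i))%C).
    + rewrite csum_plus, csum_mult_l.
      replace (csum (S l) (fun i => pquot l c w i * Cpow z i)%C) with (csum l (fun i => pquot l c w i * Cpow z i)%C).
      * ring.
      * change (csum (S l) (fun i => pquot l c w i * Cpow z i)%C) with
          (csum l (fun i => pquot l c w i * Cpow z i)%C + pquot l c w l * Cpow z l)%C. rewrite pquot_diag. ring.
    + intros i Hi. rewrite pquot_S by lia. ring.
Qed.

(** At z = w the quotient polynomial takes the value P'(w), so both sides are w P'(w); no formal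
    derivative is introduced. *)
Lemma peval_deriv l c w :
  (w * csum l (fun i => pquot l c w i * Cpow w i) = csum (S l) (fun j => c j * Cpow w j * INR j))%C.
Proof.
  assert (R : forall n (z : C), csum n (fun _ => z) = (INR n * z)%C).
  { induction n as [|n IH]; intros z; [simpl; ring|]. simpl csum. rewrite IH, S_INR, RtoC_plus. ring. }
  induction l as [|l IH].
  - simpl. ring.
  - change (csum (S (S l)) (fun j => c j * Cpow w j * INR j)%C) with
      (csum (S l) (fun j => c j * Cpow w j * INR j) + c (S l) * Cpow w (S l) * INR (S l))%C.
    rewrite <- IH.
    rewrite (csum_ext (S l) _ (fun i => pquot l c w i * Cpow w i + c (S l) * Cpow w l)%C).
    + rewrite csum_plus, R.
      change (csum (S l) (fun i => pquot l c w i * Cpow w i)%C) with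
          (csum l (fun i => pquot l c w i * Cpow w i)%C + pquot l c w l * Cpow w l)%C. rewrite pquot_diag.
      rewrite (Cpow_S w l). ring.
    + intros i Hi. rewrite pquot_S by lia. rewrite Cmult_plus_distr_r.
      rewrite <- Cmult_assoc, <- Cpow_plus. replace (l - i + i)%nat with l by lia. reflexivity.
Qed.

Lemma pquot_top l c w : pquot (S l) c w l = c (S l).
Proof. rewrite pquot_S, pquot_diag, Nat.sub_diag by lia. simpl. ring. Qed.

Lemma Cmult_integral' (z w : C) : (z * w)%C = RtoC 0 -> z = RtoC 0 \/ w = RtoC 0.
Proof.
  intros E. destruct (excluded_middle_informative (z = RtoC 0)) as [|n]; [now left|right].
  transitivity (/ z * (z * w))%C; [field; exact n|]. rewrite E. ring.
Qed.

Lemma Cminus_neq (z w : C) : z <> w -> (z - w)%C <> RtoC 0.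
Proof. intros n E. apply n. transitivity ((z - w) + w)%C; [ring|]. rewrite E. ring. Qed.

(** Dividing out the root z (S n) keeps the leading coefficient and the n + 1 other roots, so
    induction applies. *)
Lemma roots_leading n c (z : nat -> C) :
  (forall i j, (i <= n)%nat -> (j <= n)%nat -> i <> j -> z i <> z j) ->
  (forall i, (i <= n)%nat -> peval n c (z i) = RtoC 0) -> c n = RtoC 0.
Proof.
  revert c. induction n as [|n IH]; intros c D H.
  - specialize (H O (le_n _)). unfold peval in H. simpl in H. rewrite <- H. ring.
  - rewrite <- (pquot_top n c (z (S n))).
    apply (IH (pquot (S n) c (z (S n)))); [intros; apply D; lia|].
    intros i Hi. pose proof (peval_div (S n) c (z i) (z (S n))) as E.
    rewrite !H in E by lia.
    assert (E' : ((z i - z (S n)) * peval n (pquot (S n) c (z (S n))) (z i) = 0)%C).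
    { unfold peval. rewrite <- E. ring. }
    destruct (Cmult_integral' _ _ E') as [Z|Z]; [|exact Z].
    exfalso. revert Z. apply Cminus_neq, D; lia.
Qed.

Lemma roots_zero n c (z : nat -> C) :
  (forall i j, (i <= n)%nat -> (j <= n)%nat -> i <> j -> z i <> z j) ->
  (forall i, (i <= n)%nat -> peval n c (z i) = RtoC 0) -> forall j, (j <= n)%nat -> c j = RtoC 0.
Proof.
  induction n as [|n IH]; intros D H j Hj.
  - replace j with O by lia. now apply (roots_leading 0 c z).
  - assert (T : c (S n) = RtoC 0) by now apply (roots_leading (S n) c z).
    destruct (Nat.eq_dec j (S n)) as [->|ne]; [exact T|].
    apply IH; [intros; apply D; lia| |lia].
    intros i Hi. specialize (H i ltac:(lia)). unfold peval in *. simpl in *. rewrite T in H.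
    rewrite <- H. ring.
Qed.

Section Interpolation.
Variables (l : nat) (c : nat -> C) (z : nat -> C).
Hypothesis Dz : forall i j, (i < S l)%nat -> (j < S l)%nat -> i <> j -> z i <> z j.
Hypothesis Rz : forall i, (i < S l)%nat -> peval (S l) c (z i) = RtoC 0.
Hypothesis Ct : c (S l) <> RtoC 0.

(** The value P'(z n), obtained as P / (z - z n) at z n. *)
Definition pder (n : nat) : C := peval l (pquot (S l) c (z n)) (z n).

Lemma pquot_other n m : (n < S l)%nat -> (m < S l)%nat -> m <> n ->
  peval l (pquot (S l) c (z n)) (z m) = RtoC 0.
Proof.
  intros Hn Hm ne. pose proof (peval_div (S l) c (z m) (z n)) as E. rewrite !Rz in E by lia.
  assert (E' : ((z m - z n) * peval l (pquot (S l) c (z n)) (z m) = 0)%C).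
  { unfold peval. rewrite <- E. ring. }
  destruct (Cmult_integral' _ _ E') as [Z|Z]; [|exact Z].
  exfalso. revert Z. apply Cminus_neq, Dz; lia.
Qed.

Lemma pder_neq_0 n : (n < S l)%nat -> pder n <> RtoC 0.
Proof.
  intros Hn E. apply Ct. rewrite <- (pquot_top l c (z n)).
  apply (roots_leading l (pquot (S l) c (z n)) z).
  - intros; apply Dz; lia.
  - intros m Hm. destruct (Nat.eq_dec m n) as [->|ne]; [exact E|]. apply pquot_other; lia.
Qed.

(* The polynomial interpolating z^s at the roots is z^s itself. *)
Lemma lagrange s i : (s < S l)%nat -> (i < S l)%nat ->
  csum (S l) (fun n => Cpow (z n) s * / pder n * pquot (S l) c (z n) i)%C
  = if Nat.eq_dec s i then RtoC 1 else RtoC 0.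
Proof.
  intros Hs Hi.
  (* Coefficients of the interpolant minus z^s: a polynomial of degree at most l with l + 1 distinct
     roots. *)
  set (d := fun i => (csum (S l) (fun n => Cpow (z n) s * / pder n * pquot (S l) c (z n) i)
               - (if Nat.eq_dec s i then RtoC 1 else RtoC 0))%C).
  assert (Z : d i = RtoC 0).
  { apply (roots_zero l d z); [intros; apply Dz; lia| |lia].
    intros m Hm. unfold peval, d.
    rewrite (csum_ext _ _ (fun j => csum (S l) (fun n => Cpow (z n) s * / pder n * (pquot (S l) c (z n) j * Cpow (z m) j))
        + - ((if Nat.eq_dec s j then RtoC 1 else RtoC 0) * Cpow (z m) j))%C).
    2:{ intros j Hj. unfold Cminus. rewrite Cmult_plus_distr_r, <- csum_mult_r. f_equal; [|ring].
        apply csum_ext. intros; ring. }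
    rewrite csum_plus, csum_swap.
    rewrite (csum_single (S l) m).
    - rewrite csum_mult_l. change (csum (S l) (fun j => pquot (S l) c (z m) j * Cpow (z m) j)%C) with (pder m).
      rewrite (csum_single (S l) s (fun j => - ((if Nat.eq_dec s j then RtoC 1 else RtoC 0) * Cpow (z m) j))%C); [|lia|].
      + destruct (Nat.eq_dec s s); [|lia]. field. apply pder_neq_0. lia.
      + intros j Hj ne. destruct (Nat.eq_dec s j); [lia|]. ring.
    - lia.
    - intros n Hn ne. rewrite csum_mult_l.
      change (csum (S l) (fun j => pquot (S l) c (z n) j * Cpow (z m) j)%C) with (peval l (pquot (S l) c (z n)) (z m)).
      rewrite pquot_other by lia. ring. }
  unfold d in Z.
  transitivity ((csum (S l) (fun n => Cpow (z n) s * / pder n * pquot (S l) c (z n) i)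
    - (if Nat.eq_dec s i then RtoC 1 else RtoC 0)) + (if Nat.eq_dec s i then RtoC 1 else RtoC 0))%C; [ring|].
  rewrite Z. ring.
Qed.

End Interpolation.

(** * Lower bounds by compactness and smooth logarithms *)

Lemma csm_nonzero_bound lo hi f : lo <= hi -> csm f -> (forall x, lo <= x <= hi -> f x 0 <> RtoC 0) ->
  exists c, 0 < c /\ forall x, lo <= x <= hi -> c <= Cmod (f x 0).
Proof.
  intros h S H.
  destruct (continuity_ab_min (fun x => Cmod (f x 0)) lo hi h) as (m & Hm & Im).
  { intros x _ eps He. destruct (csm_lip f S) as (M & M0 & HM).
    exists (eps / (M + 1)). split; [apply Rdiv_lt_0_compat; lra|]. intros u [_ Hu].
    simpl in *. unfold Rdist in *. specialize (HM x 0 u 0 ltac:(lra) ltac:(lra)).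
    rewrite Rminus_diag, Rabs_R0, Rplus_0_r in HM.
    eapply Rle_lt_trans with (Cmod (f u 0 - f x 0)%C).
    - apply Rabs_le. pose proof (Cmod_triangle (f u 0 - f x 0)%C (f x 0)) as T1.
      replace (f u 0%R - f x 0%R + f x 0%R)%C with (f u 0) in T1 by ring.
      pose proof (Cmod_triangle (f x 0 - f u 0)%C (f u 0)) as T2.
      replace (f x 0%R - f u 0%R + f u 0%R)%C with (f x 0) in T2 by ring.
      assert (Eo : Cmod (f x 0 - f u 0)%C = Cmod (f u 0 - f x 0)%C)
        by (rewrite <- Cmod_opp; f_equal; ring). lra.
    - eapply Rle_lt_trans; [exact HM|].
      apply Rle_lt_trans with (M * (eps / (M + 1))); [apply Rmult_le_compat_l; lra|].
      apply Rmult_lt_reg_r with (M + 1); [lra|].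
      replace (M * (eps / (M + 1)) * (M + 1)) with (M * eps) by (field; lra). nra. }
  exists (Cmod (f m 0)). split; [|assumption].
  apply Cmod_gt_0, H, Im.
Qed.

Lemma Cexp_surj (z : C) : z <> RtoC 0 -> exists w, Cexp w = z.
Proof.
  intros nz. assert (P : 0 < Cmod z) by now apply Cmod_gt_0.
  set (u := fst z / Cmod z). set (w := snd z / Cmod z).
  assert (E : u ^ 2 + w ^ 2 = 1).
  { unfold u, w. replace ((fst z / Cmod z) ^ 2 + (snd z / Cmod z) ^ 2) with ((fst z ^ 2 + snd z ^ 2) / Cmod z ^ 2) by (field; lra).
    rewrite <- Cmod_sq. field. lra. }
  assert (U : -1 <= u <= 1) by (pose proof (pow2_ge_0 w); nra).
  assert (T : exists t, cos t = u /\ sin t = w).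
  { pose proof (sin_acos u U) as Sa. pose proof (cos_acos u U) as Ca.
    replace (1 - u²) with (w ^ 2) in Sa by (unfold Rsqr; lra).
    destruct (Rle_lt_dec 0 w) as [h|h].
    - exists (acos u). split; [exact Ca|]. rewrite Sa. now apply sqrt_pow2.
    - exists (- acos u). rewrite cos_neg, sin_neg, Ca, Sa. split; [reflexivity|].
      replace (w ^ 2) with ((- w) ^ 2) by ring. rewrite sqrt_pow2 by lra. ring. }
  destruct T as (t & T1 & T2). exists (ln (Cmod z), t). unfold Cexp. simpl.
  rewrite exp_ln, T1, T2 by assumption. unfold u, w. apply C_ext; simpl; field; lra.
Qed.

Lemma inf_on_pos lo hi g : Rbar_lt 0 (inf_on lo hi g) -> exists c, 0 < c /\ forall x, lo <= x <= hi -> c <= g x.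
Proof.
  intros H. unfold inf_on in H.
  destruct (Glb_Rbar_correct (fun r => exists x, lo <= x <= hi /\ r = g x)) as [LB _].
  set (m := Glb_Rbar (fun r => exists x, lo <= x <= hi /\ r = g x)) in *.
  destruct m as [r| |]; simpl in H; try contradiction.
  - exists r. split; [exact H|]. intros x Hx. apply (LB (g x)). now exists x.
  (* An infimum +oo means that the interval is empty. *)
  - exists 1. split; [lra|]. intros x Hx. exfalso. apply (LB (g x)). now exists x.
Qed.

Lemma constant_of_derive_0 lo hi (f : R -> C) : (forall x, lo <= x <= hi -> is_cderive f x 0) ->
  forall x, lo <= x <= hi -> f x = f lo.
Proof.
  intros D x Hx.
  assert (A : forall g : R -> R, (forall x, lo <= x <= hi -> is_derive g x 0) -> g x = g lo).
  { intros g Dg. assert (B : Rabs (g x - g lo) <= 0 * Rabs (x - lo)).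
    { apply (derive_bound_lip g (fun _ => 0)).
      - intros t. rewrite Rmin_left, Rmax_right by lra. intros Ht. apply Dg. lra.
      - intros. rewrite Rabs_R0. lra. }
    rewrite Rmult_0_l in B. destruct (Req_dec (g x - g lo) 0) as [|ne]; [lra|].
    pose proof (Rabs_pos_lt _ ne). lra. }
  apply C_ext; apply (A (fun x => _ (f x))); intros; now apply D.
Qed.

(** L is a primitive of f' / f, started from a logarithm w of f lo; then f exp(-L) has derivative 0
    on the interval. The function g is defined for all x but is a reciprocal of f only where |f| >=
    c. *)
Lemma smooth_log lo hi (f : R -> C) : lo <= hi -> csm (fun x _ => f x) ->
  (forall x, lo <= x <= hi -> f x <> RtoC 0) ->
  exists L : R -> C, csm (fun x _ => L x) /\ forall x, lo <= x <= hi -> Cexp (L x) = f x.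
Proof.
  intros h S H.
  destruct (csm_nonzero_bound lo hi (fun x _ => f x) h S H) as (c & c0 & Hc).
  destruct (csm_recip (fun x _ => f x) c c0 S) as (g & Sg & Hg).
  destruct (Cexp_surj (f lo)) as [w Hw]; [apply H; lra|].
  set (A := 1 + Rabs lo + Rabs hi).
  assert (A0 : 0 < A) by (unfold A; pose proof (Rabs_pos lo); pose proof (Rabs_pos hi); lra).
  assert (HA : forall x, lo <= x <= hi -> Rabs x <= A).
  { intros x Hx. unfold A. pose proof (Rle_abs hi). pose proof (Rabs_maj2 lo).
    pose proof (Rabs_pos lo). pose proof (Rabs_pos hi). apply Rabs_le. lra. }
  set (f' := fun x => cDx (fun x _ => f x) x 0).
  assert (Df : forall x, is_cderive f x (f' x)).
  { intros x. exact (proj1 (csm_is_cderive _ S x 0 ltac:(lra))). }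
  destruct (cprim_spec (fun x => cutoff A x * (f' x * g x 0))%C (2 * A)) as [SP DP].
  { apply csm_mult; [apply csm_RtoC; now apply sm_cutoff|]. apply csm_mult.
    - apply (csm_restrict (cDx (fun x _ => f x))). now apply csm_cDx.
    - now apply csm_restrict. }
  { intros x Hx. rewrite cutoff_0 by assumption. ring. }
  set (p := cprim (fun x => cutoff A x * (f' x * g x 0))%C) in *.
  exists (fun x => p x + (w - p lo))%C. split.
  - apply csm_plus; [exact SP|apply csm_const].
  - intros x Hx.
    assert (E : (f x * Cexp (- (p x + (w - p lo))) = f lo * Cexp (- (p lo + (w - p lo))))%C).
    { apply (constant_of_derive_0 lo hi (fun x => f x * Cexp (- (p x + (w - p lo))))%C); [|assumption].
      intros t Ht. specialize (DP t). rewrite cutoff_1, Cmult_1_l in DP by auto.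
      pose proof (is_cderive_opp _ _ _ (is_cderive_plus _ _ _ _ _ DP (is_cderive_const (w - p lo)%C t))) as D1.
      pose proof (is_cderive_mult _ _ _ _ _ (Df t) (is_cderive_exp _ _ _ D1)) as D2.
      assert (G : (f t * g t 0%R = 1)%C) by (apply Hg; [lra|now apply Hc]).
      cbv beta in D2.
      match type of D2 with is_cderive _ _ ?v => assert (V : v = RtoC 0) end.
      { transitivity (f' t * Cexp (- (p t + (w - p lo))) * (1 - f t * g t 0%R))%C; [ring|rewrite G; ring]. }
      rewrite V in D2. exact D2. }
    rewrite <- Hw in E.
    assert (E2 : (Cexp w * Cexp (- (p lo + (w - p lo))) = 1)%C).
    { replace (p lo + (w - p lo))%C with w by ring. apply Cexp_opp. }
    rewrite E2 in E. rewrite <- (Cmult_1_r (f x)), <- (Cexp_opp (p x + (w - p lo))%C).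
    rewrite (Cmult_comm (Cexp (p x + (w - p lo)))), Cmult_assoc, E. ring.
Qed.

(** * Small linear systems depending on parameters *)

Lemma dw_zero lo hi f x l : lo < hi -> lo <= x <= hi -> (forall t, lo <= t <= hi -> f t = 0) ->
  dw (fun t => lo <= t <= hi) f x l -> l = 0.
Proof.
  intros h Hx Z D. destruct (Req_dec l 0) as [|ne]; [assumption|exfalso].
  pose proof (Rabs_pos_lt _ ne) as lp.
  destruct (D (Rabs l / 2)) as (d & d0 & Hd); [lra|].
  assert (E : exists x', lo <= x' <= hi /\ x' <> x /\ Rabs (x' - x) < d).
  { destruct (Rlt_le_dec x hi) as [g|g].
    - exists (Rmin hi (x + d / 2)). pose proof (Rmin_l hi (x + d / 2)). pose proof (Rmin_r hi (x + d / 2)).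
      assert (x < Rmin hi (x + d / 2)) by (apply Rmin_glb_lt; lra).
      repeat split; try lra. rewrite Rabs_pos_eq; lra.
    - exists (Rmax lo (x - d / 2)). pose proof (Rmax_l lo (x - d / 2)). pose proof (Rmax_r lo (x - d / 2)).
      assert (Rmax lo (x - d / 2) < x) by (apply Rmax_lub_lt; lra).
      repeat split; try lra. rewrite Rabs_left; lra. }
  destruct E as (x' & Hx' & ne' & Hd'). specialize (Hd x' Hx' Hd').
  rewrite (Z x' Hx'), (Z x Hx) in Hd.
  replace (0 - 0 - l * (x' - x)) with (- (l * (x' - x))) in Hd by ring. rewrite Rabs_Ropp, Rabs_mult in Hd.
  assert (0 < Rabs (x' - x)) by (apply Rabs_pos_lt; lra). nra.
Qed.

(** The jets kill the pure y-derivatives on the interval; the x-derivatives of a function vanishing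
    there are 0 too, at the ends by a one-sided argument ([dw_zero]). *)
Lemma jets_Dxy lo hi f : lo < hi -> sm f -> (forall M, jet M (fun x => lo <= x <= hi) f) ->
  forall i j x, lo <= x <= hi -> Dxy f i j x 0 = 0.
Proof.
  intros h S J i. induction i as [|i IH]; intros j x Hx.
  - apply (proj1 (jet_iter (Datatypes.S j) _ f) (J _) j x); [lia|assumption].
  - destruct (proj2 (sm_DF f S i j) x 0 Logic.I) as [D _]; [lra|].
    apply (dw_zero lo hi (fun t => Dxy f i j t 0) x); try assumption; [intros; now apply IH|].
    eapply dw_sub; [|exact D]. intros; exact Logic.I.
Qed.

(** Induction on N: move in x from x0, then in y from 0; each step gains one power of the distance
    to (x0, 0). The point x may lie outside the interval, as the outermost lattice points can. *)
Lemma jets_flat lo hi f : lo < hi -> sm f -> (forall M, jet M (fun x => lo <= x <= hi) f) ->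
  forall N i j, exists C, 0 <= C /\ forall x x0 y, lo <= x0 <= hi -> -1 < y < 1 ->
    Rabs (Dxy f i j x y) <= C * (Rabs (x - x0) + Rabs y) ^ N.
Proof.
  intros h S J N. induction N as [|N IH]; intros i j.
  - destruct (sm_bound _ (sm_Dxy f i j S)) as (C & C0 & HC). exists C. split; [assumption|].
    intros x x0 y _ Hy. simpl. rewrite Rmult_1_r. auto.
  - destruct (IH (Datatypes.S i) j) as (C1 & C10 & H1), (IH i (Datatypes.S j)) as (C2 & C20 & H2).
    exists (C1 + C2). split; [lra|]. intros x x0 y Hx0 Hy.
    set (r := Rabs (x - x0) + Rabs y).
    assert (r0 : 0 <= r) by (unfold r; pose proof (Rabs_pos (x - x0)); pose proof (Rabs_pos y); lra).
    assert (rN : 0 <= r ^ N) by now apply pow_le.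
    assert (A : Rabs (Dxy f i j x y - Dxy f i j x0 y) <= (C1 * r ^ N) * Rabs (x - x0)).
    { apply (derive_bound_lip (fun t => Dxy f i j t y) (fun t => Dxy f (Datatypes.S i) j t y)).
      - intros t _. apply (sm_is_derive _ (sm_Dxy f i j S) t y Hy).
      - intros t Ht. eapply Rle_trans; [apply (H1 t x0 y Hx0 Hy)|].
        apply Rmult_le_compat_l; [assumption|]. apply pow_incr.
        split; [pose proof (Rabs_pos (t - x0)); pose proof (Rabs_pos y); lra|].
        unfold r. apply Rplus_le_compat_r.
        revert Ht. unfold Rmin, Rmax, Rabs.
        destruct (Rle_dec x0 x), (Rcase_abs (t - x0)), (Rcase_abs (x - x0)); lra. }
    assert (B : Rabs (Dxy f i j x0 y - Dxy f i j x0 0) <= (C2 * r ^ N) * Rabs (y - 0)).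
    { apply (derive_bound_lip (fun t => Dxy f i j x0 t) (fun t => Dxy f i (Datatypes.S j) x0 t)).
      - intros t Ht. assert (Hty : -1 < t < 1) by (eapply between_open; [| |exact Ht]; lra).
        apply dw_is_derive with (fun y => -1 < y < 1); [now apply open_interval_loc|].
        apply (proj2 (sm_DF f S i j) x0 t Logic.I Hty).
      - intros t Ht. assert (Hty : -1 < t < 1) by (eapply between_open; [| |exact Ht]; lra).
        eapply Rle_trans; [apply (H2 x0 x0 t Hx0 Hty)|].
        apply Rmult_le_compat_l; [assumption|]. apply pow_incr.
        rewrite Rminus_diag, Rabs_R0. split; [pose proof (Rabs_pos t); lra|].
        unfold r. pose proof (Rabs_pos (x - x0)).
        assert (Rabs t <= Rabs y).
        { revert Ht. unfold Rmin, Rmax, Rabs. destruct (Rle_dec 0 y), (Rcase_abs t), (Rcase_abs y); lra. }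
        lra. }
    rewrite (jets_Dxy lo hi f h S J i j x0 Hx0), !Rminus_0_r in B.
    pose proof (Rabs_triang (Dxy f i j x y - Dxy f i j x0 y) (Dxy f i j x0 y)) as T.
    replace (Dxy f i j x y - Dxy f i j x0 y + Dxy f i j x0 y) with (Dxy f i j x y) in T by ring.
    pose proof (Rabs_pos (x - x0)). pose proof (Rabs_pos y).
    assert (E1 : Rabs (x - x0) <= r) by (unfold r; lra). assert (E2 : Rabs y <= r) by (unfold r; lra).
    assert ((C1 * r ^ N) * Rabs (x - x0) <= C1 * r ^ N * r) by (apply Rmult_le_compat_l; [nra|assumption]).
    assert ((C2 * r ^ N) * Rabs y <= C2 * r ^ N * r) by (apply Rmult_le_compat_l; [nra|assumption]).
    simpl. lra.
Qed.

(** The arguments stay within K / W of the segment y = 0 over [lo, hi], where f is flat, so a power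
    of the distance is as good as a power of 1 / W. *)
Lemma CF_flat_comp {I} {W : I -> R} {Om : I -> R -> Prop} {FR : frame W Om} lo hi f (u v : I -> R -> R -> R) K :
  lo < hi -> sm f -> (forall M, jet M (fun x => lo <= x <= hi) f) ->
  PF W Om u -> PF W Om v -> (forall i x y, Om i y -> -1 < v i x y < 1) ->
  (forall i x y, Om i y -> exists x0, lo <= x0 <= hi /\ (Rabs (u i x y - x0) + Rabs (v i x y)) * W i <= K) ->
  CF W Om true (fun i x y => f (u i x y) (v i x y)).
Proof.
  intros h S J (UD & UX & UY) (VD & VX & VY) HV HK.
  assert (A : forall n i j, Sm W Om true n (fun k x y => Dxy f i j (u k x y) (v k x y))).
  { induction n as [|n IH]; intros i j.
    all: assert (B : bnd W Om true (fun k x y => Dxy f i j (u k x y) (v k x y))) by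
     (intros q; destruct (jets_flat lo hi f h S J q i j) as (C & C0 & HC); exists (C * K ^ q);
      intros k x y O; destruct (HK k x y O) as (x0 & Hx0 & Hr);
      pose proof (HC (u k x y) x0 (v k x y) Hx0 (HV k x y O)) as Hb;
      pose proof (Wpow_ge1 k q); pose proof (W1 k);
      pose proof (Rabs_pos (u k x y - x0)); pose proof (Rabs_pos (v k x y));
      apply Rle_trans with (C * (Rabs (u k x y - x0) + Rabs (v k x y)) ^ q * W k ^ q);
      [apply Rmult_le_compat_r; lra|];
      rewrite Rmult_assoc, <- Rpow_mult_distr; apply Rmult_le_compat_l; [assumption|];
      apply pow_incr; split; [apply Rmult_le_pos; lra|exact Hr]).
    - split; [exact B|exact Logic.I].
    - apply (Sm_intro true n _
        (fun k x y => Dxy f (Datatypes.S i) j (u k x y) (v k x y) * dx u k x y + Dxy f i (Datatypes.S j) (u k x y) (v k x y) * dx v k x y)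
        (fun k x y => Dxy f (Datatypes.S i) j (u k x y) (v k x y) * dy u k x y + Dxy f i (Datatypes.S j) (u k x y) (v k x y) * dy v k x y)).
      + exact B.
      + intros k x y O. specialize (HV k x y O). destruct (UD k x y O), (VD k x y O).
        assert (E : forall X Y, -1 < Y < 1 -> Dy (Dxy f i j) X Y = Dxy f i (Datatypes.S j) X Y).
        { intros X Y HY. unfold Dxy. rewrite Dy_Dx_iter; [reflexivity|now apply sm_iter_Dy|assumption]. }
        rewrite <- !E by assumption.
        split; [apply (sm_chain (Dxy f i j) (fun t => u k t y) (fun t => v k t y))
               |apply (sm_chain (Dxy f i j) (fun t => u k x t) (fun t => v k x t))]; try assumption; now apply sm_Dxy.
      + apply Sm_plus; (apply Sm_mult; [apply IH|]); [apply UX|apply VX].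
      + apply Sm_plus; (apply Sm_mult; [apply IH|]); [apply UY|apply VY]. }
  intros n. exact (A n O O).
Qed.

Lemma cCF_flat_comp {I} {W : I -> R} {Om : I -> R -> Prop} {FR : frame W Om} lo hi (f : R -> R -> C) (u v : I -> R -> R -> R) K :
  lo < hi -> csm f -> (forall M, cjet M (fun x => lo <= x <= hi) f) ->
  PF W Om u -> PF W Om v -> (forall i x y, Om i y -> -1 < v i x y < 1) ->
  (forall i x y, Om i y -> exists x0, lo <= x0 <= hi /\ (Rabs (u i x y - x0) + Rabs (v i x y)) * W i <= K) ->
  cCF W Om true (fun i x y => f (u i x y) (v i x y)).
Proof.
  intros h [F1 F2] J U V HV HK. split.
  - apply (CF_flat_comp lo hi (fun x y => fst (f x y)) u v K); try assumption. intros M; apply J.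
  - apply (CF_flat_comp lo hi (fun x y => snd (f x y)) u v K); try assumption. intros M; apply J.
Qed.

(** * Systems whose kernel has row sums at most 1/2 *)

Lemma finite_upper n (f : nat -> R) : exists M, 0 <= M /\ forall j, (j < n)%nat -> f j <= M.
Proof.
  induction n as [|n (M & M0 & H)].
  - exists 0. split; [lra|]. intros; lia.
  - exists (Rmax M (f n)). split; [eapply Rle_trans; [exact M0|apply Rmax_l]|].
    intros j Hj. destruct (Nat.eq_dec j n) as [->|ne]; [apply Rmax_r|].
    eapply Rle_trans; [apply H; lia|apply Rmax_l].
Qed.

Lemma finite_max_attained n (f : nat -> R) : (0 < n)%nat -> exists k, (k < n)%nat /\ forall j, (j < n)%nat -> f j <= f k.
Proof.
  induction n as [|n IH]; intros h; [lia|]. destruct n as [|n].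
  - exists O. split; [lia|]. intros j Hj. replace j with O by lia. lra.
  - destruct IH as (k & Hk & H); [lia|]. destruct (Rle_lt_dec (f (S n)) (f k)) as [g|g].
    + exists k. split; [lia|]. intros j Hj. destruct (Nat.eq_dec j (S n)) as [->|ne]; [assumption|apply H; lia].
    + exists (S n). split; [lia|]. intros j Hj. destruct (Nat.eq_dec j (S n)) as [->|ne]; [lra|].
      eapply Rle_trans; [apply H; lia|lra].
Qed.

(** A component of largest modulus satisfies |f k| <= M + |f k| / 2. *)
Lemma system_bound n (T : nat -> nat -> C) (r f : nat -> C) M :
  (forall j, (j < n)%nat -> rsum n (fun j' => Cmod (T j j')) <= 1 / 2) ->
  (forall j, (j < n)%nat -> f j = (r j + csum n (fun j' => T j j' * f j'))%C) ->
  (forall j, (j < n)%nat -> Cmod (r j) <= M) -> forall j, (j < n)%nat -> Cmod (f j) <= 2 * M.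
Proof.
  intros HT Hf Hr j Hj.
  destruct (finite_max_attained n (fun j => Cmod (f j))) as (k & Hk & Hmax); [lia|].
  assert (A : Cmod (f k) <= M + 1 / 2 * Cmod (f k)).
  { rewrite (Hf k Hk) at 1. eapply Rle_trans; [apply Cmod_triangle|]. apply Rplus_le_compat; [auto|].
    eapply Rle_trans; [apply csum_mod|].
    apply Rle_trans with (rsum n (fun j' => Cmod (f k) * Cmod (T k j'))).
    - apply rsum_le. intros j' Hj'. rewrite Cmod_mult, Rmult_comm. apply Rmult_le_compat_r; [apply Cmod_ge_0|auto].
    - rewrite <- rsum_mult_l, Rmult_comm. apply Rmult_le_compat_r; [apply Cmod_ge_0|auto]. }
  specialize (Hmax j Hj). simpl in Hmax. lra.
Qed.

Lemma C_series_cv (u : nat -> C) K : (forall k, Cmod (u k) <= K * (1 / 2) ^ k) ->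
  exists s, forall eps, 0 < eps -> exists N, forall k, (N <= k)%nat -> Cmod (s - csum k u)%C < eps.
Proof.
  intros H.
  assert (A : forall pr : C -> R, (forall z, Rabs (pr z) <= Cmod z) ->
    (forall k, pr (csum k u) = rsum k (fun j => pr (u j))) ->
    exists s, forall eps, 0 < eps -> exists N, forall k, (N <= k)%nat -> Rabs (s - pr (csum k u)) < eps).
  { intros pr Hpr Hs.
    destruct (series_abs_le (fun k => pr (u k)) (fun k => K * (1 / 2) ^ k)) as [[s Es] _].
    - intros k. eapply Rle_trans; [apply Hpr|apply H].
    - apply (ex_series_scal_l (K := R_AbsRing) K (fun k => (1 / 2) ^ k)). exists (/ (1 - 1 / 2)). apply is_series_geom.
      rewrite Rabs_pos_eq; lra.
    - exists s. intros eps He. assert (L : is_lim_seq (sum_n (fun k => pr (u k))) s) by exact Es.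
      apply is_lim_seq_spec in L. destruct (L (mkposreal _ He)) as [N HN]. exists (S N). intros k Hk.
      destruct k as [|k]; [lia|]. specialize (HN k ltac:(lia)). simpl in HN. rewrite Hs.
      assert (E : forall m, sum_n (fun k => pr (u k)) m = rsum (S m) (fun j => pr (u j))).
      { induction m; [rewrite sum_O; simpl; ring|]. rewrite sum_Sn, IHm. reflexivity. }
      rewrite E, Rabs_minus_sym in HN. exact HN. }
  destruct (A fst Cmod_fst) as [s1 H1]; [intros; apply csum_fst|].
  destruct (A snd Cmod_snd) as [s2 H2]; [intros; apply csum_snd|].
  exists (s1, s2). intros eps He.
  destruct (H1 (eps / 2)) as [N1 HN1]; [lra|]. destruct (H2 (eps / 2)) as [N2 HN2]; [lra|].
  exists (N1 + N2)%nat. intros k Hk. specialize (HN1 k ltac:(lia)). specialize (HN2 k ltac:(lia)).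
  eapply Rle_lt_trans; [apply Cmod_le_sum|].
  change (Rabs (s1 - fst (csum k u)) + Rabs (s2 - snd (csum k u)) < eps). lra.
Qed.

(** Neumann series: by the row sums each iterate is at most half the size of the previous one. *)
Lemma system_solve n (T : nat -> nat -> C) (r : nat -> C) :
  (forall j, (j < n)%nat -> rsum n (fun j' => Cmod (T j j')) <= 1 / 2) ->
  exists f : nat -> C, forall j, (j < n)%nat -> f j = (r j + csum n (fun j' => T j j' * f j'))%C.
Proof.
  intros HT.
  set (it := fix it (k : nat) (j : nat) : C := match k with O => r j | S k' => csum n (fun j' => T j j' * it k' j')%C end).
  destruct (finite_upper n (fun j => Cmod (r j))) as (M & M0 & HM).
  assert (B : forall k j, (j < n)%nat -> Cmod (it k j) <= M * (1 / 2) ^ k).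
  { induction k as [|k IH]; intros j Hj; simpl; [rewrite Rmult_1_r; now apply HM|].
    eapply Rle_trans; [apply csum_mod|].
    apply Rle_trans with (rsum n (fun j' => (M * (1 / 2) ^ k) * Cmod (T j j'))).
    - apply rsum_le. intros j' Hj'. rewrite Cmod_mult, Rmult_comm. apply Rmult_le_compat_r; [apply Cmod_ge_0|auto].
    - rewrite <- rsum_mult_l. assert (0 <= M * (1 / 2) ^ k) by (apply Rmult_le_pos; [lra|apply pow_le; lra]).
      replace (M * (1 / 2 * (1 / 2) ^ k)) with (M * (1 / 2) ^ k * (1 / 2)) by ring.
      apply Rmult_le_compat_l; auto. }
  assert (Lm : forall j, exists s, (j < n)%nat -> forall eps, 0 < eps ->
     exists N, forall k, (N <= k)%nat -> Cmod (s - csum k (fun k => it k j))%C < eps).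
  { intros j. destruct (lt_dec j n) as [h|h].
    - destruct (C_series_cv (fun k => it k j) M) as [s Hs]; [intros; now apply B|]. exists s. auto.
    - exists (RtoC 0). intros; lia. }
  destruct (choose _ Lm) as [f Hf]. exists f. intros j Hj.
  set (z := (f j - (r j + csum n (fun j' => T j j' * f j')))%C).
  assert (Z : forall eps, 0 < eps -> Cmod z <= eps).
  { intros eps He.
    assert (A : exists N, forall j, (j < n)%nat -> forall k, (N <= k)%nat -> Cmod (f j - csum k (fun k => it k j))%C < eps / 2).
    { assert (A : forall m, (m <= n)%nat -> exists N, forall j, (j < m)%nat -> forall k, (N <= k)%nat -> Cmod (f j - csum k (fun k => it k j))%C < eps / 2).
      { induction m as [|m IH]; intros hm; [exists O; intros; lia|].
        destruct IH as [N HN]; [lia|]. destruct (Hf m ltac:(lia) (eps / 2)) as [N' HN']; [lra|].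
        exists (N + N')%nat. intros i Hi k Hk. destruct (Nat.eq_dec i m) as [->|ne]; [apply HN'; lia|apply HN; lia]. }
      apply (A n (le_n _)). }
    destruct A as [N HN].
    assert (E : csum (S N) (fun k => it k j) = (r j + csum n (fun j' => T j j' * csum N (fun k => it k j')))%C).
    { rewrite (csum_ext n _ (fun j' => csum N (fun k => T j j' * it k j'))%C).
      - rewrite csum_swap. clear. induction N as [|N IH]; [simpl; ring|].
        change (csum (S (S N)) (fun k => it k j)) with (csum (S N) (fun k => it k j) + it (S N) j)%C. rewrite IH.
        simpl. ring.
      - intros j' _. now rewrite csum_mult_l. }
    assert (Ez : z = ((f j - csum (S N) (fun k => it k j)) - csum n (fun j' => T j j' * (f j' - csum N (fun k => it k j'))))%C).
    { unfold z. rewrite E.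
      rewrite (csum_ext n (fun j' => T j j' * (f j' - csum N (fun k => it k j')))%C
        (fun j' => T j j' * f j' + (-1)%R * (T j j' * csum N (fun k => it k j')))%C) by (intros; rewrite RtoC_m1; ring).
      rewrite csum_plus, csum_mult_l, RtoC_m1. ring. }
    rewrite Ez. eapply Rle_trans; [apply Cmod_triangle|]. rewrite Cmod_opp.
    assert (H1 : Cmod (f j - csum (S N) (fun k => it k j))%C < eps / 2) by (apply HN; [assumption|lia]).
    assert (H2 : Cmod (csum n (fun j' => T j j' * (f j' - csum N (fun k => it k j'))))%C <= eps / 2).
    { eapply Rle_trans; [apply csum_mod|].
      apply Rle_trans with (rsum n (fun j' => (eps / 2) * Cmod (T j j'))).
      - apply rsum_le. intros j' Hj'. rewrite Cmod_mult, Rmult_comm. apply Rmult_le_compat_r; [apply Cmod_ge_0|].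
        left. now apply HN.
      - rewrite <- rsum_mult_l. specialize (HT j Hj). nra. }
    lra. }
  assert (Cmod z = 0).
  { pose proof (Cmod_ge_0 z). destruct (Req_dec (Cmod z) 0); [assumption|]. specialize (Z (Cmod z / 2) ltac:(lra)). lra. }
  apply Cmod_eq_0 in H. unfold z in H.
  transitivity ((f j - (r j + csum n (fun j' => T j j' * f j'))) + (r j + csum n (fun j' => T j j' * f j')))%C; [ring|].
  rewrite H. ring.
Qed.

Definition Om2 {I} (Om : I -> R -> Prop) (n : I -> nat) (p : I * nat) (y : R) : Prop :=
  Om (fst p) y /\ (snd p < n (fst p))%nat.

#[global] Instance Om2_frame {I} (W : I -> R) Om n {FR : frame W Om} : frame (fun p : I * nat => W (fst p)) (Om2 Om n).
Proof.
  split.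
  - intros i. apply W1.
  - intros i y [O h]. generalize (Oop (fst i) y O). apply filter_imp. intros t Ht. now split.
Qed.

Lemma is_cderive_csum n (f : nat -> R -> C) f' t : (forall j, (j < n)%nat -> is_cderive (f j) t (f' j)) ->
  is_cderive (fun s => csum n (fun j => f j s)) t (csum n f').
Proof.
  induction n; simpl; intros H; [apply is_cderive_const|]. apply is_cderive_plus; auto.
Qed.

Lemma is_cderive_small g t : is_cderive g t 0 -> g t = RtoC 0 -> forall eps, 0 < eps ->
  exists d, 0 < d /\ forall s, Rabs (s - t) < d -> Cmod (g s) <= eps * Rabs (s - t).
Proof.
  intros [G1 G2] Z eps He.
  destruct (is_derive_dw all _ _ _ G1 (eps / 2)) as (d1 & p1 & H1); [lra|].
  destruct (is_derive_dw all _ _ _ G2 (eps / 2)) as (d2 & p2 & H2); [lra|].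
  exists (Rmin d1 d2). split; [now apply Rmin_pos|]. pose proof (Rmin_l d1 d2). pose proof (Rmin_r d1 d2).
  intros s Hs. specialize (H1 s Logic.I ltac:(lra)). specialize (H2 s Logic.I ltac:(lra)).
  rewrite Z in H1, H2. simpl in H1, H2. rewrite Rmult_0_l, !Rminus_0_r in H1, H2.
  eapply Rle_trans; [apply Cmod_le_sum|]. lra.
Qed.

Lemma finite_delta n (P : nat -> R -> Prop) : (forall j, (j < n)%nat -> exists d, 0 < d /\ P j d) ->
  (forall j d d', d' <= d -> P j d -> P j d') -> exists d, 0 < d /\ forall j, (j < n)%nat -> P j d.
Proof.
  intros H mono. induction n as [|n IH].
  - exists 1. split; [lra|]. intros; lia.
  - destruct IH as (d & d0 & Hd); [auto|]. destruct (H n) as (d' & d0' & Hd'); [lia|].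
    exists (Rmin d d'). split; [now apply Rmin_pos|]. intros j Hj. destruct (Nat.eq_dec j n) as [->|ne].
    + eapply mono; [|exact Hd']. apply Rmin_r.
    + eapply mono; [|apply Hd; lia]. apply Rmin_l.
Qed.

Section System.
Context {I : Type} {W : I -> R} {Om : I -> R -> Prop} {FR : frame W Om}.
Variable n : I -> nat.
Local Notation W2 := (fun p : I * nat => W (fst p)).
Local Notation W3 := (fun p : I * nat * nat => W (fst (fst p))).
Local Notation O2 := (Om2 Om n).
Local Notation O3 := (Om2 (Om2 Om n) (fun p : I * nat => n (fst p))).
#[local] Instance O3_frame : frame W3 O3 := Om2_frame (fun p : I * nat => W (fst p)) (Om2 Om n) (fun p => n (fst p)).
Variable (T : I * nat * nat -> R -> C) (q : nat) (K : R).
Hypothesis Hn : forall i y, Om i y -> INR (n i) <= K * W i ^ q.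
Hypothesis HT : cCF W3 O3 false (fun p _ y => T p y).
Hypothesis rows : forall i y, Om i y -> forall j, (j < n i)%nat -> rsum (n i) (fun j' => Cmod (T (i, j, j') y)) <= 1 / 2.

Let T' (p : I * nat * nat) (y : R) : C :=
  (dy (fun p (x y : R) => fst (T p y)) p 0 y, dy (fun p (x y : R) => snd (T p y)) p 0 y).

Lemma T'_spec p y : O3 p y -> is_cderive (T p) y (T' p y).
Proof.
  intros O. destruct HT as [H1 H2]. split.
  - exact (proj2 (CF_is_derive _ _ H1 p 0 y O)).
  - exact (proj2 (CF_is_derive _ _ H2 p 0 y O)).
Qed.

Lemma T'_CF : cCF W3 O3 false (fun p _ y => T' p y).
Proof.
  destruct HT as [H1 H2]. split; simpl.
  - exact (CF_dy _ _ H1).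
  - exact (CF_dy _ _ H2).
Qed.

Definition cSm (N : nat) (f : I * nat -> R -> C) : Prop :=
  Sm W2 O2 true N (fun p _ y => fst (f p y)) /\ Sm W2 O2 true N (fun p _ y => snd (f p y)).

Definition solves (r f : I * nat -> R -> C) : Prop := forall i y, Om i y -> forall j, (j < n i)%nat ->
  f (i, j) y = (r (i, j) y + csum (n i) (fun j' => T (i, j, j') y * f (i, j') y))%C.

Lemma solves_exists r : exists f, solves r f.
Proof.
  assert (A : forall p : I * R, exists f : nat -> C, Om (fst p) (snd p) -> forall j, (j < n (fst p))%nat ->
    f j = (r (fst p, j) (snd p) + csum (n (fst p)) (fun j' => T (fst p, j, j') (snd p) * f j'))%C).
  { intros [i y]. simpl. destruct (excluded_middle_informative (Om i y)) as [O|nO].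
    - destruct (system_solve (n i) (fun j j' => T (i, j, j') y) (fun j => r (i, j) y) (rows i y O)) as [f Hf].
      exists f. auto.
    - exists (fun _ => RtoC 0). contradiction. }
  destruct (choose _ A) as [f Hf]. exists (fun p y => f (fst p, y) (snd p)).
  intros i y O j Hj. exact (Hf (i, y) O j Hj).
Qed.

(** The candidate d solves the formally differentiated system. The linear approximation f(y) + (s -
    y) d satisfies the system at s up to g, which vanishes at s = y together with its derivative; so
    the error of the approximation solves the system with right-hand side g and is o(s - y) by
    [system_bound]. *)
Lemma solves_derive r r' f d : solves r f ->
  (forall p y, O2 p y -> is_cderive (r p) y (r' p y)) ->
  solves (fun p y => csum (n (fst p)) (fun j' => T' (p, j') y * f (fst p, j') y) + r' p y)%C d ->
  forall p y, O2 p y -> is_cderive (f p) y (d p y).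
Proof.
  intros Sf Dr Sd [i j0] y [O Hj0]. simpl in O, Hj0.
  set (g := fun j s => (r (i, j) s + csum (n i) (fun j' => T (i, j, j') s * (f (i, j') y + (s - y)%R * d (i, j') y))
              - (f (i, j) y + (s - y)%R * d (i, j) y))%C).
  assert (Dl : forall j, is_cderive (fun s => f (i, j) y + (s - y)%R * d (i, j) y)%C y (d (i, j) y)).
  { intros j. apply is_cderive_eq with (0 + (1 * d (i, j) y + (y - y)%R * 0))%C; [|ring].
    apply is_cderive_plus; [apply is_cderive_const|].
    apply (is_cderive_mult (fun s => RtoC (s - y)) (fun _ => d (i, j) y)); [|apply is_cderive_const].
    split; simpl; [|apply is_derive_Rconst]. auto_derive; [exact Logic.I|ring]. }
  assert (Dg : forall j, (j < n i)%nat -> is_cderive (g j) y 0).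
  { intros j Hj.
    assert (D1 : is_cderive (g j) y (r' (i, j) y + csum (n i) (fun j' => T' (i, j, j') y * (f (i, j') y + (y - y)%R * d (i, j') y)
        + T (i, j, j') y * d (i, j') y) - d (i, j) y)%C).
    { apply is_cderive_minus; [|apply Dl]. apply is_cderive_plus; [apply Dr; split; assumption|].
      apply (is_cderive_csum (n i) (fun j' s => T (i, j, j') s * (f (i, j') y + (s - y)%R * d (i, j') y))%C).
      intros j' Hj'. apply (is_cderive_mult (T (i, j, j'))); [|apply Dl].
      apply T'_spec. split; [split|]; assumption. }
    apply (is_cderive_eq _ _ _ _ D1).
    rewrite csum_plus.
    rewrite (csum_ext (n i) (fun j' => T' (i, j, j') y * (f (i, j') y + (y - y)%R * d (i, j') y))%C
        (fun j' => T' (i, j, j') y * f (i, j') y)%C).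
    - rewrite (Sd i y O j Hj). simpl. ring.
    - intros j' _. rewrite Rminus_diag. ring. }
  assert (Zg : forall j, (j < n i)%nat -> g j y = RtoC 0).
  { intros j Hj. unfold g. rewrite (Sf i y O j Hj).
    rewrite (csum_ext (n i) (fun j' => T (i, j, j') y * (f (i, j') y + (y - y)%R * d (i, j') y))%C
        (fun j' => T (i, j, j') y * f (i, j') y)%C).
    - rewrite Rminus_diag. ring.
    - intros j' _. rewrite Rminus_diag. ring. }
  assert (E : forall s, Om i s -> forall j, (j < n i)%nat ->
    (f (i, j) s - (f (i, j) y + (s - y)%R * d (i, j) y) =
     g j s + csum (n i) (fun j' => T (i, j, j') s * (f (i, j') s - (f (i, j') y + (s - y)%R * d (i, j') y))))%C).
  { intros s Os j Hj. rewrite (Sf i s Os j Hj) at 1. unfold g.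
    rewrite (csum_ext (n i) (fun j' => T (i, j, j') s * (f (i, j') s - (f (i, j') y + (s - y)%R * d (i, j') y)))%C
       (fun j' => T (i, j, j') s * f (i, j') s + (-1)%R * (T (i, j, j') s * (f (i, j') y + (s - y)%R * d (i, j') y)))%C).
    - rewrite csum_plus, csum_mult_l, RtoC_m1. ring.
    - intros j' _. rewrite RtoC_m1. ring. }
  assert (Sm : forall eps, 0 < eps -> exists dl, 0 < dl /\ forall s, Om i s -> Rabs (s - y) < dl ->
     Cmod (f (i, j0) s - (f (i, j0) y + (s - y)%R * d (i, j0) y))%C <= eps * Rabs (s - y)).
  { intros eps He.
    (* At fixed i there are finitely many rows, so one neighbourhood of y serves them all. *)
    destruct (finite_delta (n i) (fun j dl => forall s, Rabs (s - y) < dl -> Cmod (g j s) <= eps / 2 * Rabs (s - y)))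
      as (dl & dl0 & Hdl).
    - intros j Hj. destruct (is_cderive_small (g j) y (Dg j Hj) (Zg j Hj) (eps / 2)) as (dl & p & Hd); [lra|].
      exists dl. auto.
    - intros j u u' h H s Hs. apply H. lra.
    - exists dl. split; [assumption|]. intros s Os Hs.
      replace (eps * Rabs (s - y)) with (2 * (eps / 2 * Rabs (s - y))) by field.
      apply (system_bound (n i) (fun j j' => T (i, j, j') s) (fun j => g j s)
         (fun j => f (i, j) s - (f (i, j) y + (s - y)%R * d (i, j) y))%C); auto. }
  split; apply dw_is_derive with (Om i); try (now apply Oop); intros eps He;
    destruct (Sm eps He) as (dl & dl0 & Hdl); exists dl; (split; [assumption|]); intros s Os Hs;
    (eapply Rle_trans; [|apply (Hdl s Os Hs)]).
  - eapply Rle_trans; [|apply Cmod_fst]. right. f_equal. simpl. ring.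
  - eapply Rle_trans; [|apply Cmod_snd]. right. f_equal. simpl. ring.
Qed.

Lemma solves_bnd r f : solves r f -> bnd W2 O2 true (fun p _ y => fst (r p y)) ->
  bnd W2 O2 true (fun p _ y => snd (r p y)) ->
  bnd W2 O2 true (fun p _ y => fst (f p y)) /\ bnd W2 O2 true (fun p _ y => snd (f p y)).
Proof.
  intros Sf B1 B2.
  assert (A : forall k, exists M, forall p y, O2 p y -> Cmod (f p y) * W2 p ^ k <= M).
  { intros k. destruct (B1 k) as [C1 H1], (B2 k) as [C2 H2]. exists (2 * (C1 + C2)).
    intros [i j] y [O Hj]. simpl in O, Hj.
    pose proof (Wpow_ge1 i k) as Wk. simpl.
    apply Rle_div_r; [lra|]. unfold Rdiv. rewrite Rmult_assoc.
    apply (system_bound (n i) (fun j j' => T (i, j, j') y) (fun j => r (i, j) y) (fun j => f (i, j) y)); auto.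
    intros j1 Hj1. apply Rle_div_r; [lra|].
    specialize (H1 (i, j1) 0 y (conj O Hj1)). specialize (H2 (i, j1) 0 y (conj O Hj1)).
    simpl in H1, H2.
    eapply Rle_trans; [apply Rmult_le_compat_r; [lra|apply Cmod_le_sum]|]. lra. }
  split; intros k; destruct (A k) as [M HM]; exists M; intros p x y O;
    (eapply Rle_trans; [|apply (HM p y O)]); (apply Rmult_le_compat_r; [destruct O as [O _]; pose proof (Wpow_ge1 (fst p) k); lra|]).
  - apply Cmod_fst.
  - apply Cmod_snd.
Qed.

Lemma cSm_kernel N U (f : I * nat -> R -> C) : cCF W3 O3 false (fun p _ y => U p y) -> cSm N f ->
  cSm N (fun p y => csum (n (fst p)) (fun j' => U (p, j') y * f (fst p, j') y)%C).
Proof.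
  intros [U1 U2] [F1 F2].
  assert (G : forall pr : C -> R, Sm W2 O2 true N (fun p _ y => pr (f p y)) ->
     Sm W3 O3 true N (fun p _ y => pr (f (fst (fst p), snd p) y))).
  { intros pr. clear F1 F2. revert f.
    assert (Re : forall M (h : I * nat -> R -> R -> R), Sm W2 O2 true M h -> Sm W3 O3 true M (fun p => h (fst (fst p), snd p))).
    { induction M as [|M IH]; intros h Hh.
      all: assert (B : bnd W3 O3 true (fun p => h (fst (fst p), snd p))) by
        (apply Sm_bnd in Hh; intros k; destruct (Hh k) as [C HC]; exists C; intros [[i j] j'] x y [[O Hj] Hj'];
         exact (HC (i, j') x y (conj O Hj'))).
      - split; [exact B|exact Logic.I].
      - destruct Hh as (_ & D & X & Y). split; [exact B|]. split; [|split].
        + intros [[i j] j'] x y [[O Hj] Hj']. exact (D (i, j') x y (conj O Hj')).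
        + exact (IH _ X).
        + exact (IH _ Y). }
    intros f F. exact (Re N (fun p _ y => pr (f p y)) F). }
  pose proof (G fst F1) as G1. pose proof (G snd F2) as G2.
  assert (H2n : forall i y, O2 i y -> INR (n (fst i)) <= K * W2 i ^ q).
  { intros i y [O _]. eauto. }
  split.
  - eapply Sm_ext; [|apply (Sm_rsum (W := W2) (Om := O2) (fun p => n (fst p)) true N
       (fun p _ y => fst (f (fst (fst p), snd p) y) * fst (U p y) + - 1 * (snd (f (fst (fst p), snd p) y) * snd (U p y))) q K H2n)].
    + intros p x y O. rewrite csum_fst. apply rsum_ext. intros j' _. simpl. ring.
    + apply (Sm_plus (W := W3) (Om := O3) true N); [apply (Sm_mult (W := W3) (Om := O3)); [exact G1|apply U1]|].
      eapply Sm_ext; [|apply (Sm_mult (W := W3) (Om := O3) true N (fun p _ y => snd (f (fst (fst p), snd p) y) * snd (U p y)) (fun _ _ _ => -1))].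
      * intros; simpl; ring.
      * apply (Sm_mult (W := W3) (Om := O3)); [exact G2|apply U2].
      * apply CF_const.
  - eapply Sm_ext; [|apply (Sm_rsum (W := W2) (Om := O2) (fun p => n (fst p)) true N
       (fun p _ y => snd (f (fst (fst p), snd p) y) * fst (U p y) + fst (f (fst (fst p), snd p) y) * snd (U p y)) q K H2n)].
    + intros p x y O. rewrite csum_snd. apply rsum_ext. intros j' _. simpl. ring.
    + apply (Sm_plus (W := W3) (Om := O3) true N); apply (Sm_mult (W := W3) (Om := O3)); auto.
Qed.

(** Bootstrap: if f is flat to order N, so is the right-hand side T' f + r' of the system for its
    derivative d; hence d is flat to order N and f to order N + 1. The kernel and its derivatives
    may grow polynomially, only the row sums of T must be small. *)
Lemma solves_cSm N : forall r f, solves r f -> cSm N r -> cSm N f.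
Proof.
  induction N as [|N IH]; intros r f Sf Sr.
  all: destruct (solves_bnd r f Sf (Sm_bnd _ _ _ (proj1 Sr)) (Sm_bnd _ _ _ (proj2 Sr))) as [B1 B2].
  - split; (split; [assumption|exact Logic.I]).
  - destruct Sr as [R1 R2].
    assert (Fn : cSm N f) by (apply (IH r f Sf); split; now apply Sm_pred).
    set (r' := fun (p : I * nat) (y : R) => (dy (fun p (x y : R) => fst (r p y)) p 0 y, dy (fun p (x y : R) => snd (r p y)) p 0 y) : C).
    assert (Dr : forall p y, O2 p y -> is_cderive (r p) y (r' p y)).
    { intros p y O. split.
      - exact (proj2 (Sm_is_derive _ _ _ R1 p 0 y O)).
      - exact (proj2 (Sm_is_derive _ _ _ R2 p 0 y O)). }
    assert (Sr' : cSm N r').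
    { destruct R1 as (_ & _ & _ & Y1), R2 as (_ & _ & _ & Y2). split; [exact Y1|exact Y2]. }
    set (r1 := fun p y => (csum (n (fst p)) (fun j' => T' (p, j') y * f (fst p, j') y) + r' p y)%C).
    assert (S1 : cSm N r1).
    { destruct (cSm_kernel N T' f T'_CF Fn) as [A1 A2]. destruct Sr' as [A3 A4]. split.
      - exact (Sm_plus (W := W2) (Om := O2) true N _ _ A1 A3).
      - exact (Sm_plus (W := W2) (Om := O2) true N _ _ A2 A4). }
    destruct (solves_exists r1) as [d Sd].
    pose proof (solves_derive r r' f d Sf Dr Sd) as Df.
    destruct (IH r1 d Sd S1) as [D1 D2].
    split.
    + apply (Sm_intro (W := W2) (Om := O2) true N _ (fun _ _ _ => 0) (fun p _ y => fst (d p y))); [exact B1| |apply Sm_zero|exact D1].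
      intros p x y O. split; [apply is_derive_Rconst|apply (Df p y O)].
    + apply (Sm_intro (W := W2) (Om := O2) true N _ (fun _ _ _ => 0) (fun p _ y => snd (d p y))); [exact B2| |apply Sm_zero|exact D2].
      intros p x y O. split; [apply is_derive_Rconst|apply (Df p y O)].
Qed.

Lemma system_family (r : I * nat -> R -> C) : cCF W2 O2 true (fun p _ y => r p y) ->
  exists f, solves r f /\ cCF W2 O2 true (fun p _ y => f p y).
Proof.
  intros [R1 R2]. destruct (solves_exists r) as [f Sf]. exists f. split; [exact Sf|].
  split; intros N; apply (solves_cSm N r f Sf (conj (R1 N) (R2 N))).
Qed.

End System.

(** * Exact solutions on one piece *)

(* The windows of step sizes over which the lattice changes by less than one point
   near any point of the interval. *)
Definition shell (kap : R) (i0 i : nat) (y : R) : Prop :=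
  (i0 <= i)%nat /\ 0 < y /\ INR i - 2 < kap / y < INR i + 2.

#[global] Instance shell_frame kap i0 : frame Wnat (shell kap i0).
Proof.
  split; [apply Wnat_ge1|]. intros i y (h & y0 & H).
  assert (C : continuous (fun t => kap / t) y).
  { apply (ex_derive_continuous (V := R_NormedModule)). auto_derive. lra. }
  assert (L1 : locally y (fun t => INR i - 2 < kap / t < INR i + 2)).
  { apply (C (fun s => INR i - 2 < s < INR i + 2)). now apply open_interval_loc. }
  assert (L2 : locally y (fun t => 0 < t)) by now apply open_gt.
  generalize (filter_and _ _ L1 L2). apply filter_imp. intros t [A B]. split; [assumption|split; assumption].
Qed.

(* [kappa lft i] and [kappa rgt i] bound, for all step sizes in the i-th window, the numbers of
   the lattice points in [lft, rgt]. *)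
Definition kappa (kap b : R) (i : nat) : Z := up (b * INR i / kap - 1 / 2).

Lemma kappa_spec kap b i : Rabs (IZR (kappa kap b i) - b * INR i / kap) <= 1 / 2.
Proof.
  unfold kappa. destruct (archimed (b * INR i / kap - 1 / 2)) as [H1 H2].
  apply Rabs_le. lra.
Qed.

Lemma kappa_mono kap b b' i : 0 < kap -> b <= b' -> (kappa kap b i <= kappa kap b' i)%Z.
Proof.
  intros k0 h. unfold kappa.
  assert (E : b * INR i / kap <= b' * INR i / kap).
  { unfold Rdiv. apply Rmult_le_compat_r; [left; now apply Rinv_0_lt_compat|].
    apply Rmult_le_compat_r; [apply pos_INR|assumption]. }
  destruct (archimed (b * INR i / kap - 1 / 2)) as [H1 H2].
  destruct (archimed (b' * INR i / kap - 1 / 2)) as [H3 H4].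
  apply Znot_gt_le. intros G. assert (G' : (up (b' * INR i / kap - 1 / 2) + 1 <= up (b * INR i / kap - 1 / 2))%Z) by lia.
  apply IZR_le in G'. rewrite plus_IZR in G'. lra.
Qed.

Section Shell.
Variables (kap : R) (i0 : nat).
Hypothesis Hk : 8 <= kap.
Hypothesis Hi0 : kap + 4 <= INR i0.

Lemma shell_index i y : shell kap i0 i y -> kap + 4 <= INR i.
Proof. intros (h & _). apply le_INR in h. lra. Qed.

Lemma shell_kap i y : shell kap i0 i y -> kap = (kap / y) * y.
Proof. intros (_ & y0 & _). field. lra. Qed.

Lemma shell_y i y : shell kap i0 i y -> 0 < y < 1.
Proof.
  intros S. pose proof (shell_index i y S). pose proof (shell_kap i y S). destruct S as (_ & y0 & H1).
  split; [assumption|]. nra.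
Qed.

Lemma shell_yW i y : shell kap i0 i y -> y * Wnat i <= 2 * kap.
Proof.
  intros S. pose proof (shell_index i y S). pose proof (shell_kap i y S) as E. destruct S as (_ & y0 & H1).
  unfold Wnat. nra.
Qed.

Lemma shell_inv_y i y : shell kap i0 i y -> / y <= Wnat i.
Proof.
  intros S. pose proof (shell_index i y S). pose proof (shell_kap i y S) as E. destruct S as (_ & y0 & H1).
  replace (/ y) with (kap / y * / kap) by (field; lra).
  apply Rle_div_l; [lra|]. unfold Wnat. nra.
Qed.

(** Rounding contributes 1/2, and the width of the window, |INR i - kap / y| < 2 times |b| / kap <=
    1/8, contributes 1/4. The total 3/4 is below one lattice step, which is what lets one numbering
    serve the whole window. *)
Lemma kappa_near b i y : shell kap i0 i y -> Rabs b <= kap / 8 -> Rabs (IZR (kappa kap b i) * y - b) <= 3 / 4 * y.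
Proof.
  intros S Hb. pose proof (kappa_spec kap b i) as K. destruct S as (_ & y0 & H1).
  replace (IZR (kappa kap b i) * y - b) with
    (((IZR (kappa kap b i) - b * INR i / kap) + b / kap * (INR i - kap / y)) * y) by (field; lra).
  rewrite Rabs_mult, (Rabs_pos_eq y) by lra. apply Rmult_le_compat_r; [lra|].
  eapply Rle_trans; [apply Rabs_triang|]. rewrite Rabs_mult.
  assert (A : Rabs (INR i - kap / y) <= 2) by (apply Rabs_le; lra).
  assert (B : Rabs (b / kap) <= 1 / 8).
  { unfold Rdiv. rewrite Rabs_mult, (Rabs_pos_eq (/ kap)) by (left; apply Rinv_0_lt_compat; lra).
    apply Rle_div_l; lra. }
  pose proof (Rabs_pos (INR i - kap / y)). pose proof (Rabs_pos (b / kap)). nra.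
Qed.

(** Since 3/4 < 1, a smaller integer would give a point strictly to the left of b. With its mirror
    image this places all lattice points of [lft, rgt] between the two [kappa]. *)
Lemma kappa_le_lattice b i y k : shell kap i0 i y -> Rabs b <= kap / 8 -> b <= IZR k * y -> (kappa kap b i <= k)%Z.
Proof.
  intros S Hb h. pose proof (kappa_near b i y S Hb) as N. pose proof (shell_y i y S).
  apply Znot_gt_le. intros G. assert (G' : (k + 1 <= kappa kap b i)%Z) by lia.
  apply IZR_le in G'. rewrite plus_IZR in G'. pose proof (Rle_abs (IZR (kappa kap b i) * y - b)). nra.
Qed.

Lemma lattice_le_kappa b i y k : shell kap i0 i y -> Rabs b <= kap / 8 -> IZR k * y <= b -> (k <= kappa kap b i)%Z.
Proof.
  intros S Hb h. pose proof (kappa_near b i y S Hb) as N. pose proof (shell_y i y S).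
  apply Znot_gt_le. intros G. assert (G' : (kappa kap b i + 1 <= k)%Z) by lia.
  apply IZR_le in G'. rewrite plus_IZR in G'. pose proof (Rabs_maj2 (IZR (kappa kap b i) * y - b)). nra.
Qed.

Lemma kappa_abs b i : Rabs b <= kap / 8 -> Rabs (IZR (kappa kap b i)) <= Wnat i.
Proof.
  intros Hb. pose proof (kappa_spec kap b i) as K.
  assert (A : Rabs (b * INR i / kap) <= INR i / 8).
  { unfold Rdiv. rewrite !Rabs_mult, (Rabs_pos_eq (/ kap)), (Rabs_pos_eq (INR i));
      [|apply pos_INR|left; apply Rinv_0_lt_compat; lra].
    apply Rle_div_l; [lra|]. pose proof (pos_INR i). nra. }
  replace (IZR (kappa kap b i)) with ((IZR (kappa kap b i) - b * INR i / kap) + b * INR i / kap) by ring.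
  eapply Rle_trans; [apply Rabs_triang|]. unfold Wnat. pose proof (pos_INR i). lra.
Qed.

End Shell.

Lemma PF_linear {I} {W : I -> R} {Om : I -> R -> Prop} {FR : frame W Om} (p : I -> R) q K :
  (forall i y, Om i y -> Rabs (p i) <= K * W i ^ q) -> PF W Om (fun i _ y => p i * y).
Proof.
  intros H. apply (PF_intro _ (fun _ _ _ => 0) (fun i _ _ => p i)).
  - intros i x y O. split; [apply is_derive_Rconst|].
    evar_last; [exact (is_derive_Rmult (fun _ => p i) (fun t => t) y 0 1 (is_derive_Rconst _ _) (is_derive_Rid _))|].
    simpl. ring.
  - apply CF_const.
  - now apply (CF_index p q K).
Qed.

Lemma PF_y {I} {W : I -> R} {Om : I -> R -> Prop} {FR : frame W Om} : PF W Om (fun _ _ y => y).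
Proof.
  apply (PF_intro _ (fun _ _ _ => 0) (fun _ _ _ => 1)); try apply CF_const.
  intros i x y O. split; [apply is_derive_Rconst|apply is_derive_Rid].
Qed.

(** At y = 0 the real part is weakly decreasing along the piece. Replacing (X, y) by the nearest
    point of the piece at y = 0 costs O(y), as X is at most y outside. After division by y the
    exponent is bounded above, with no strict inequality between moduli. *)
Lemma ordered_phase lft rgt (Phi : R -> R -> C) : lft <= rgt -> csm Phi ->
  (forall x, lft <= x <= rgt -> fst (cDx Phi x 0) <= 0) ->
  exists K, forall y X X', 0 < y < 1 -> lft - y <= X' -> X' <= X -> X <= rgt + y ->
    fst (Phi X y - Phi X' y)%C <= K * y.
Proof.
  intros h S H. pose proof S as [S1 _]. destruct (sm_lip _ S1) as (M & M0 & HM).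
  exists (6 * M). intros y X X' Hy H1 H2 H3.
  set (G := fun x => fst (Phi x 0)).
  assert (mono : forall u v, lft <= u -> u <= v -> v <= rgt -> G v <= G u).
  { intros u v hu huv hv. destruct (MVT_gen G u v (fun x => fst (cDx Phi x 0))) as (c & Hc & E).
    - intros t _. exact (proj1 (sm_is_derive _ S1 t 0 ltac:(lra))).
    - intros t _. apply continuity_pt_filterlim. apply (ex_derive_continuous (V := R_NormedModule) G t).
      eexists. exact (proj1 (sm_is_derive _ S1 t 0 ltac:(lra))).
    - rewrite Rmin_left, Rmax_right in Hc by lra. specialize (H c ltac:(lra)). nra. }
  set (x := clamp lft rgt X). set (x' := clamp lft rgt X').
  pose proof (clamp_in lft rgt X h) as Ix. pose proof (clamp_in lft rgt X' h) as Ix'. fold x in Ix. fold x' in Ix'.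
  assert (cl : forall Z, lft - y <= Z <= rgt + y -> Rabs (Z - clamp lft rgt Z) <= y).
  { intros Z HZ. unfold clamp, Rmax, Rmin. destruct (Rle_dec rgt Z), (Rle_dec lft _); apply Rabs_le; lra. }
  pose proof (cl X ltac:(lra)) as d1. pose proof (cl X' ltac:(lra)) as d2. fold x in d1. fold x' in d2.
  assert (ord : x' <= x).
  { unfold x, x', clamp, Rmax, Rmin. destruct (Rle_dec rgt X), (Rle_dec rgt X');
      repeat match goal with |- context [Rle_dec ?p ?q] => destruct (Rle_dec p q) end; lra. }
  pose proof (mono x' x ltac:(lra) ord ltac:(lra)) as g. unfold G in g.
  pose proof (HM x 0 X y ltac:(lra) ltac:(lra)) as e1. pose proof (HM x' 0 X' y ltac:(lra) ltac:(lra)) as e2.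
  rewrite Rminus_0_r, (Rabs_pos_eq y) in e1, e2 by lra.
  change (fst (Phi X y) - fst (Phi X' y) <= 6 * M * y).
  pose proof (Rle_abs (fst (Phi X y) - fst (Phi x 0))). pose proof (Rabs_maj2 (fst (Phi X' y) - fst (Phi x' 0))).
  assert (M * (Rabs (X - x) + y) <= M * (2 * y)) by (apply Rmult_le_compat_l; lra).
  assert (M * (Rabs (X' - x') + y) <= M * (2 * y)) by (apply Rmult_le_compat_l; lra).
  nra.
Qed.

(** Exchange of summation over i < s <= D, with s = i + 1 + t. *)
Lemma csum_triangle D (h : nat -> nat -> C) :
  csum (S D) (fun s => csum s (fun i => h s i)) = csum D (fun i => csum (D - i) (fun t => h (i + 1 + t)%nat i)).
Proof.
  induction D as [|D IH]; [simpl; ring|].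
  change (csum (S (S D)) (fun s => csum s (fun i => h s i))) with
    (csum (S D) (fun s => csum s (fun i => h s i)) + csum (S D) (fun i => h (S D) i))%C.
  rewrite IH.
  rewrite (csum_ext (S D) (fun i => csum (S D - i) (fun t => h (i + 1 + t)%nat i))
    (fun i => csum (D - i) (fun t => h (i + 1 + t)%nat i) + h (S D) i)%C).
  - rewrite csum_plus. f_equal. simpl. rewrite Nat.sub_diag. simpl. ring.
  - intros i Hi. replace (S D - i)%nat with (S (D - i)) by lia. simpl. f_equal. f_equal. lia.
Qed.

Lemma rsum_select n k c : 0 <= c -> rsum n (fun j => if Nat.eqb j k then c else 0) <= c.
Proof.
  intros c0. assert (A : forall n, rsum n (fun j => if Nat.eqb j k then c else 0) = if Nat.ltb k n then c else 0).
  { clear n. induction n as [|n IH]; [reflexivity|]. simpl. rewrite IH.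
    destruct (Nat.ltb_spec k n), (Nat.eqb_spec n k), (Nat.ltb_spec k (S n)); try lia; lra. }
  rewrite A. destruct (Nat.ltb k n); lra.
Qed.

Lemma rsum_plus n f g : rsum n (fun j => f j + g j) = rsum n f + rsum n g.
Proof. induction n; simpl; [ring|]. rewrite IHn; ring. Qed.

Lemma rsum_swap n m (f : nat -> nat -> R) :
  rsum n (fun i => rsum m (fun j => f i j)) = rsum m (fun j => rsum n (fun i => f i j)).
Proof.
  induction n; simpl.
  - induction m; simpl; lra.
  - now rewrite IHn, rsum_plus.
Qed.

Lemma csum_select n k f : csum n (fun j => if Nat.eqb j k then f j else RtoC 0) = if Nat.ltb k n then f k else RtoC 0.
Proof.
  induction n as [|n IH]; [reflexivity|]. simpl. rewrite IH.
  destruct (Nat.ltb_spec k n), (Nat.eqb_spec n k), (Nat.ltb_spec k (S n)); subst; try lia; ring.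
Qed.

#[global] Instance and_frame {I} (W : I -> R) Om (P : I -> Prop) {FR : frame W Om} :
  frame W (fun i y => Om i y /\ P i).
Proof.
  split; [apply W1|]. intros i y [O h]. generalize (Oop i y O). apply filter_imp. intros t Ht. now split.
Qed.

Lemma csm_shift f c : csm f -> csm (fun x y => f (x + c * y) y).
Proof.
  intros F. apply (cCF_comp f (fun _ x y => x + c * y) (fun _ _ y => y) F).
  - apply (PF_intro _ (fun _ _ _ => 1) (fun _ _ _ => c)); try apply CF_const.
    intros u x y O. split; auto_derive; try exact Logic.I; ring.
  - apply PF_y.
  - intros i x y Hy. exact Hy.
Qed.

Lemma clamp_dist lft rgt y Z : lft <= rgt -> 0 <= y -> lft - y <= Z <= rgt + y ->
  exists x0, lft <= x0 <= rgt /\ Rabs (Z - x0) <= y.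
Proof.
  intros h Hy HZ. exists (clamp lft rgt Z). split; [now apply clamp_in|].
  unfold clamp, Rmax, Rmin. destruct (Rle_dec rgt Z), (Rle_dec lft _); apply Rabs_le; lra.
Qed.

Section ExactPiece.
Variables (d : nat) (a : nat -> R -> R -> C) (lo hi : R).
Hypothesis lohi : lo < hi.
Hypothesis Sa : forall j, csm (a j).
Variables (F : nat -> R -> R -> C) (g : nat -> R -> C).
Hypothesis SF : forall n, csm (F n).
Hypothesis JF : forall n, (n < S d)%nat -> forall M, cjet M (fun x => lo <= x <= hi) (resid (S d) a (F n)).
Hypothesis Sg : forall n, csm (fun x _ => g n x).
(** Lagrange's identity with g n = 1 / P'(lambda_n): the inner sum is the i-th coefficient of P / (z
    - lambda_n). It makes the Green operator below invert the recurrence from the right up to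
    O(y). *)
Hypothesis HE : forall i x, (i < S d)%nat -> lo <= x <= hi ->
  csum (S d) (fun n => csum (S d - i) (fun t => a (i + 1 + t)%nat x 0 * Cexp (INR t * cDx (F n) x 0)) * g n x)%C
  = if Nat.eq_dec i 0 then RtoC 1 else RtoC 0.
Variable m : nat.
Hypothesis Hm : (m < S d)%nat.
Variables (lft rgt : R) (side : nat -> bool).
Hypothesis Hlr : lo <= lft /\ lft < rgt /\ rgt <= hi.
Hypothesis Hside : forall n x, (n < S d)%nat -> lft <= x <= rgt ->
  if side n then fst (cDx (F n) x 0) <= fst (cDx (F m) x 0)
  else fst (cDx (F m) x 0) <= fst (cDx (F n) x 0).
Variables (kap : R) (ib : nat).
Hypothesis Hkap : 8 * (Rabs lo + Rabs hi + 1) <= kap.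
Hypothesis Hib : kap + 4 <= INR ib.

Lemma kap8 : 8 <= kap.
Proof. pose proof (Rabs_pos lo). pose proof (Rabs_pos hi). lra. Qed.

Lemma point_kap x : lo <= x <= hi -> Rabs x <= kap / 8.
Proof.
  intros Hx. pose proof (Rabs_pos lo). pose proof (Rabs_pos hi).
  pose proof (Rle_abs hi). pose proof (Rabs_maj2 lo). apply Rabs_le. lra.
Qed.

Definition nodes (i : nat) : nat := Z.to_nat (kappa kap rgt i - kappa kap lft i).
(** The equation at node j involves j, ..., j + S d, and the last node has number [nodes i]; this
    leaves nodes i - d equations, and none when the subtraction truncates. *)
Definition wins (i : nat) : nat := (nodes i - d)%nat.
Definition pos (i j : nat) : R := IZR (kappa kap lft i) + INR j.

Lemma nodes_Z i : Z.of_nat (nodes i) = (kappa kap rgt i - kappa kap lft i)%Z.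
Proof.
  unfold nodes. apply Z2Nat.id. assert (kappa kap lft i <= kappa kap rgt i)%Z; [|lia].
  apply kappa_mono; [pose proof kap8; lra|lra].
Qed.

Lemma pos_near i j y : shell kap ib i y -> (j <= nodes i)%nat -> lft - y <= pos i j * y <= rgt + y.
Proof.
  intros S h. pose proof kap8 as k8. destruct (shell_y kap ib k8 Hib i y S) as [y0 y1].
  pose proof (kappa_near kap ib k8 lft i y S (point_kap lft ltac:(lra))) as N1.
  pose proof (kappa_near kap ib k8 rgt i y S (point_kap rgt ltac:(lra))) as N2.
  assert (E : pos i j <= IZR (kappa kap rgt i)).
  { unfold pos. rewrite INR_IZR_INZ, <- plus_IZR. apply IZR_le. pose proof (nodes_Z i). lia. }
  assert (E' : IZR (kappa kap lft i) <= pos i j) by (unfold pos; pose proof (pos_INR j); lra).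
  apply Rabs_le_between in N1. apply Rabs_le_between in N2. nra.
Qed.

Lemma pos_abs i j : (j <= nodes i)%nat -> Rabs (pos i j) <= Wnat i.
Proof.
  intros h. pose proof kap8 as k8.
  pose proof (kappa_abs kap k8 lft i (point_kap lft ltac:(lra))) as N1.
  pose proof (kappa_abs kap k8 rgt i (point_kap rgt ltac:(lra))) as N2.
  assert (E : pos i j <= IZR (kappa kap rgt i)).
  { unfold pos. rewrite INR_IZR_INZ, <- plus_IZR. apply IZR_le. pose proof (nodes_Z i). lia. }
  assert (E' : IZR (kappa kap lft i) <= pos i j) by (unfold pos; pose proof (pos_INR j); lra).
  apply Rabs_le_between in N1. apply Rabs_le_between in N2. apply Rabs_le. lra.
Qed.

Lemma nodes_W i : INR (nodes i) <= 2 * Wnat i.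
Proof.
  pose proof (pos_abs i (nodes i) (le_n _)) as P1. pose proof (pos_abs i 0 ltac:(lia)) as P2.
  unfold pos in *. simpl (INR 0) in P2. apply Rabs_le_between in P1. apply Rabs_le_between in P2. lra.
Qed.

Definition Phi (n : nat) (x y : R) : C := (F n x y + (-1)%R * F m x y)%C.
(** Source weight of mode n: 1 / P'(lambda_n), divided by exp((F m (x + y) - F m x) / y), the growth
    of the reference solution over one lattice step. *)
Definition gam (n : nat) (x y : R) : C := (g n x * Cexp (- cdq 1 (F m) x y))%C.
Definition rho (n : nat) : R -> R -> C := resid (S d) a (F n).
(** The coefficient with which f at node j + i enters when the recurrence, divided by exp(F m / y),
    is applied to the sum of the modal solutions; see [green]. *)
Definition bigE (i : nat) (x y : R) : C :=
  csum (S d) (fun n => csum (S d - i) (fun t => a (i + 1 + t)%nat x y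
      * Cexp (cdq (INR (i + 1 + t)) (F n) x y - cdq (INR (i + 1)) (Phi n) x y)) * gam n (x + INR i * y)%R y)%C.
Definition err (i : nat) (x y : R) : C := (bigE i x y - (if Nat.eq_dec i 0 then RtoC 1 else RtoC 0))%C.

Lemma csm_Phi n : csm (Phi n).
Proof. apply csm_plus; [apply SF|]. apply csm_mult; [apply csm_const|apply SF]. Qed.

Lemma csm_gam n : csm (gam n).
Proof.
  apply csm_mult; [apply Sg|]. apply csm_exp.
  apply (csm_ext (fun x y => 0 - cdq 1 (F m) x y)%C); [intros; ring|].
  apply csm_minus; [apply csm_const|]. apply csm_cdq, SF.
Qed.

Lemma csm_err i : csm (err i).
Proof.
  apply csm_minus; [|apply csm_const].
  apply (csm_csum (S d) (fun n x y => csum (S d - i) (fun t => a (i + 1 + t)%nat x y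
      * Cexp (cdq (INR (i + 1 + t)) (F n) x y - cdq (INR (i + 1)) (Phi n) x y)) * gam n (x + INR i * y)%R y)%C).
  intros n _. apply csm_mult; [|apply (csm_shift (gam n)), csm_gam].
  apply (csm_csum (S d - i) (fun t x y => a (i + 1 + t)%nat x y
      * Cexp (cdq (INR (i + 1 + t)) (F n) x y - cdq (INR (i + 1)) (Phi n) x y))%C).
  intros t _. apply csm_mult; [apply Sa|]. apply csm_exp, csm_minus; apply csm_cdq; [apply SF|apply csm_Phi].
Qed.

Lemma cdq_Phi J n x y : -1 < y < 1 -> cdq J (Phi n) x y = (cdq J (F n) x y - cdq J (F m) x y)%C.
Proof.
  intros Hy. unfold Phi. rewrite (cdq_lin J (F n) (F m) (fun _ => -1)); auto; [|apply sm_const].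
  rewrite RtoC_m1. ring.
Qed.

(** At y = 0 the exponentials collapse to lambda_m^i lambda_n^t, and [HE] gives the Kronecker
    delta. *)
Lemma err_at_0 i x : (i < S d)%nat -> lo <= x <= hi -> err i x 0 = RtoC 0.
Proof.
  intros Hi Hx. unfold err, bigE.
  set (Lm := cDx (F m) x 0).
  rewrite (csum_ext (S d) _ (fun n => Cexp (INR i * Lm) *
     (csum (S d - i) (fun t => a (i + 1 + t)%nat x 0 * Cexp (INR t * cDx (F n) x 0)) * g n x))%C).
  - rewrite csum_mult_l, HE by assumption. destruct (Nat.eq_dec i 0) as [->|ne]; [|ring].
    simpl INR. rewrite Cmult_0_l, Cexp_0. ring.
  - intros n _. unfold gam. rewrite Rmult_0_r, Rplus_0_r. rewrite (cdq_at_0 1 (F m)) by apply SF.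
    fold Lm. rewrite <- !csum_mult_r, <- csum_mult_l. apply csum_ext. intros t _.
    rewrite cdq_Phi by lra. rewrite !cdq_at_0 by apply SF. fold Lm.
    assert (X : (Cexp (INR (i + 1 + t) * cDx (F n) x 0 - (INR (i + 1) * cDx (F n) x 0 - INR (i + 1) * Lm)) * Cexp (- (1%R * Lm))
      = Cexp (INR i * Lm) * Cexp (INR t * cDx (F n) x 0))%C).
    { rewrite <- !Cexp_plus. f_equal. rewrite !plus_INR, !RtoC_plus. simpl (INR 1). ring. }
    transitivity (a (i + 1 + t)%nat x 0%R * g n x * (Cexp (INR (i + 1 + t) * cDx (F n) x 0 - (INR (i + 1) * cDx (F n) x 0 - INR (i + 1) * Lm)) * Cexp (- (1%R * Lm))))%C; [ring|].
    rewrite X. ring.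
Qed.

Definition ratio (n i p q : nat) (y : R) : C :=
  Cexp ((Phi n (pos i p * y) y - Phi n (pos i q * y) y) * (/ y)%R)%C.

(* Green's function of the n-th mode, relative to the m-th one. *)
Definition sig (n : nat) (p : nat * nat * nat) (y : R) : C :=
  let '(i, j, k) := p in
  if side n
  then (if Nat.ltb k j then ratio n i j (k + 1) y * gam n (pos i k * y)%R y else 0)%C
  else (if Nat.leb j k then (-1)%R * (ratio n i j (k + 1) y * gam n (pos i k * y)%R y) else 0)%C.

Section Families.
(** Index sets will be pairs and triples with side conditions, so facts along lattice rays are
    proved over any index type J carrying a window number. *)
Context {J : Type} (ii : J -> nat) (Om : J -> R -> Prop).
Context {FR : frame (fun p => Wnat (ii p)) Om}.
Hypothesis HOm : forall p y, Om p y -> shell kap ib (ii p) y.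

Lemma family_y : forall (p : J) (x y : R), Om p y -> -1 < y < 1.
Proof. intros p x y O. pose proof (shell_y kap ib kap8 Hib _ _ (HOm p y O)). lra. Qed.

Lemma PF_ray (pp : J -> nat) : (forall p y, Om p y -> (pp p <= nodes (ii p))%nat) ->
  PF (fun p => Wnat (ii p)) Om (fun p _ y => pos (ii p) (pp p) * y).
Proof.
  intros H. apply (PF_linear (fun p => pos (ii p) (pp p)) 1 1). intros p y O. simpl.
  rewrite Rmult_1_l, Rmult_1_r. apply pos_abs. eauto.
Qed.

Lemma cCF_ray (pp : J -> nat) f : csm f -> (forall p y, Om p y -> (pp p <= nodes (ii p))%nat) ->
  cCF (fun p => Wnat (ii p)) Om false (fun p _ y => f (pos (ii p) (pp p) * y)%R y).
Proof.
  intros S H. apply (cCF_comp f (fun p _ y => pos (ii p) (pp p) * y) (fun _ _ y => y) S).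
  - now apply PF_ray.
  - apply PF_y.
  - exact family_y.
Qed.

(** Nodes are within y of the piece and y W <= 2 kap, so the argument stays within 4 kap / W of the
    set where the residual is flat. *)
Lemma cCF_ray_flat (pp : J -> nat) n : (n < S d)%nat -> (forall p y, Om p y -> (pp p <= nodes (ii p))%nat) ->
  cCF (fun p => Wnat (ii p)) Om true (fun p _ y => rho n (pos (ii p) (pp p) * y)%R y).
Proof.
  intros Hn H.
  apply (cCF_flat_comp lo hi (rho n) (fun p _ y => pos (ii p) (pp p) * y) (fun _ _ y => y) (4 * kap)); auto.
  - apply csm_resid; auto.
  - intros M. now apply JF.
  - now apply PF_ray.
  - apply PF_y.
  - exact family_y.
  - intros p x y O. pose proof (HOm p y O) as S.
    destruct (shell_y kap ib kap8 Hib _ _ S) as [y0 y1].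
    destruct (clamp_dist lft rgt y (pos (ii p) (pp p) * y)) as (x0 & I0 & D0); [lra|lra|apply pos_near; eauto|].
    exists x0. split; [lra|]. rewrite (Rabs_pos_eq y) by lra.
    pose proof (shell_yW kap ib kap8 Hib _ _ S). pose proof (Wnat_ge1 (ii p)). nra.
Qed.

Lemma CF_inv_y : CF (fun p => Wnat (ii p)) Om false (fun _ _ y => / y).
Proof.
  apply (CF_inv_gen (fun _ _ y => y)).
  - apply (CF_y 1). intros p y O. pose proof (family_y p 0 y O). apply Rabs_le. lra.
  - intros p x y O. pose proof (shell_y kap ib kap8 Hib _ _ (HOm p y O)). lra.
  - exists 1%nat, 1. intros p x y O. pose proof (HOm p y O) as S.
    pose proof (shell_y kap ib kap8 Hib _ _ S). rewrite Rabs_pos_eq by (left; apply Rinv_0_lt_compat; lra).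
    simpl. rewrite Rmult_1_r, Rmult_1_l. now apply (shell_inv_y kap ib kap8 Hib).
Qed.

(** The exponent is a phase difference over y, hence of polynomial growth, and its real part is
    bounded above by the ordering. For modes summed from the right the sign of the phase is reversed
    before [ordered_phase] applies. *)
Lemma cCF_ratio n (pp qq : J -> nat) : (n < S d)%nat ->
  (forall p y, Om p y -> (pp p <= nodes (ii p))%nat /\ (qq p <= nodes (ii p))%nat) ->
  (forall p y, Om p y -> if side n then (qq p <= pp p)%nat else (pp p <= qq p)%nat) ->
  cCF (fun p => Wnat (ii p)) Om false (fun p _ y => ratio n (ii p) (pp p) (qq p) y).
Proof.
  intros Hn H Hord.
  set (Ps := if side n then Phi n else fun x y => ((-1)%R * Phi n x y)%C).
  assert (SP : csm Ps).
  { unfold Ps. destruct (side n); [apply csm_Phi|]. apply csm_mult; [apply csm_const|apply csm_Phi]. }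
  assert (DP : forall x, cDx (Phi n) x 0 = (cDx (F n) x 0 - cDx (F m) x 0)%C).
  { intros x. assert (z : -1 < 0 < 1) by lra.
    pose proof (proj1 (csm_is_cderive _ (SF n) x 0 z)) as D1. pose proof (proj1 (csm_is_cderive _ (SF m) x 0 z)) as D2.
    pose proof (is_cderive_plus _ _ _ _ _ D1 (is_cderive_mult _ _ _ _ _ (is_cderive_const (RtoC (-1)) x) D2)) as D.
    rewrite (cDx_unique (Phi n) x 0 _ D). rewrite RtoC_m1. ring. }
  destruct (ordered_phase lft rgt Ps) as [K HK]; [lra|exact SP| |].
  { intros x Hx. specialize (Hside n x Hn Hx). unfold Ps. destruct (side n).
    - rewrite DP. revert Hside. generalize (cDx (F n) x 0) (cDx (F m) x 0). intros u v h. simpl. lra.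
    - assert (z : -1 < 0 < 1) by lra.
      pose proof (is_cderive_mult _ _ _ _ _ (is_cderive_const (RtoC (-1)) x) (proj1 (csm_is_cderive _ (csm_Phi n) x 0 z))) as D.
      rewrite (cDx_unique (fun x y => (-1)%R * Phi n x y)%C x 0 _ D), DP. revert Hside.
      generalize (cDx (F n) x 0) (cDx (F m) x 0). intros u v h. simpl. lra. }
  apply (cCF_exp (fun p _ y => (Phi n (pos (ii p) (pp p) * y)%R y - Phi n (pos (ii p) (qq p) * y)%R y) * (/ y)%R)%C K).
  - apply cCF_mult; [|apply cCF_RtoC, CF_inv_y].
    apply cCF_minus; apply (cCF_ray _ (Phi n)); try apply csm_Phi; intros p y O; apply (H p y O).
  - intros p x y O. pose proof (HOm p y O) as S. destruct (shell_y kap ib kap8 Hib _ _ S) as [y0 y1].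
    destruct (H p y O) as [H1 H2]. specialize (Hord p y O).
    pose proof (pos_near _ _ _ S H1) as N1. pose proof (pos_near _ _ _ S H2) as N2.
    replace (fst ((Phi n (pos (ii p) (pp p) * y)%R y - Phi n (pos (ii p) (qq p) * y)%R y) * (/ y)%R)%C)
      with (fst (Phi n (pos (ii p) (pp p) * y)%R y - Phi n (pos (ii p) (qq p) * y)%R y)%C * / y) by (simpl; ring).
    apply Rmult_le_reg_r with y; [assumption|]. rewrite Rmult_assoc, Rinv_l, Rmult_1_r by lra.
    unfold Ps in HK. destruct (side n).
    + apply HK; try lra. apply Rmult_le_compat_r; [lra|]. unfold pos. apply le_INR in Hord. lra.
    + specialize (HK y (pos (ii p) (qq p) * y) (pos (ii p) (pp p) * y) (conj y0 y1)).
      simpl in HK. simpl. eapply Rle_trans; [|apply HK; try lra].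
      * right. ring.
      * apply Rmult_le_compat_r; [lra|]. unfold pos. apply le_INR in Hord. lra.
Qed.

End Families.

Lemma cCF_sig {J} (r : J -> nat * nat * nat) (Om : J -> R -> Prop)
  {FR : frame (fun p => Wnat (fst (fst (r p)))) Om} n : (n < S d)%nat ->
  (forall p y, Om p y -> shell kap ib (fst (fst (r p))) y) ->
  (forall p y, Om p y -> (snd (fst (r p)) <= nodes (fst (fst (r p))))%nat /\ (snd (r p) + 1 <= nodes (fst (fst (r p))))%nat) ->
  cCF (fun p => Wnat (fst (fst (r p)))) Om false (fun p _ y => sig n (r p) y).
Proof.
  intros Hn HS Hj.
  set (ii := fun p => fst (fst (r p))). set (jj := fun p => snd (fst (r p))). set (kk := fun p => snd (r p)).
  apply (cCF_ext false (fun p _ y => if side n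
     then (if Nat.ltb (kk p) (jj p) then ratio n (ii p) (jj p) (kk p + 1) y * gam n (pos (ii p) (kk p) * y)%R y else 0)%C
     else (if Nat.leb (jj p) (kk p) then (-1)%R * (ratio n (ii p) (jj p) (kk p + 1) y * gam n (pos (ii p) (kk p) * y)%R y) else 0)%C)).
  { intros p x y _. unfold sig, ii, jj, kk. now destruct (r p) as [[i j] k]. }
  destruct (side n) eqn:Es.
  - apply (cCF_if (fun p => Nat.ltb (kk p) (jj p)) false
      (fun p _ y => ratio n (ii p) (jj p) (kk p + 1) y * gam n (pos (ii p) (kk p) * y)%R y)%C (fun _ _ _ => RtoC 0)).
    + apply (cCF_mult (W := fun p => Wnat (ii p)) (Om := fun p y => Om p y /\ (fun p => Nat.ltb (kk p) (jj p) = true) p)).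
      * apply (cCF_ratio ii _ (fun p y O => HS p y (proj1 O)) n jj (fun p => (kk p + 1)%nat) Hn).
        -- intros p y [O _]. exact (Hj p y O).
        -- intros p y [_ h]. rewrite Es. apply Nat.ltb_lt in h. lia.
      * apply (cCF_ray ii _ (fun p y O => HS p y (proj1 O)) kk (gam n)); [apply csm_gam|].
        intros p y [O _]. destruct (Hj p y O). unfold kk, ii. lia.
    + apply (cCF_const (W := fun p => Wnat (ii p)) (Om := fun p y => Om p y /\ (fun p => Nat.ltb (kk p) (jj p) = false) p)).
  - apply (cCF_if (fun p => Nat.leb (jj p) (kk p)) false
      (fun p _ y => (-1)%R * (ratio n (ii p) (jj p) (kk p + 1) y * gam n (pos (ii p) (kk p) * y)%R y))%C (fun _ _ _ => RtoC 0)).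
    + apply (cCF_mult_r (W := fun p => Wnat (ii p)) (Om := fun p y => Om p y /\ (fun p => Nat.leb (jj p) (kk p) = true) p));
        [apply (cCF_const (W := fun p => Wnat (ii p)) (Om := fun p y => Om p y /\ (fun p => Nat.leb (jj p) (kk p) = true) p))|].
      apply (cCF_mult (W := fun p => Wnat (ii p)) (Om := fun p y => Om p y /\ (fun p => Nat.leb (jj p) (kk p) = true) p)).
      * apply (cCF_ratio ii _ (fun p y O => HS p y (proj1 O)) n jj (fun p => (kk p + 1)%nat) Hn).
        -- intros p y [O _]. exact (Hj p y O).
        -- intros p y [_ h]. rewrite Es. apply Nat.leb_le in h. lia.
      * apply (cCF_ray ii _ (fun p y O => HS p y (proj1 O)) kk (gam n)); [apply csm_gam|].
        intros p y [O _]. destruct (Hj p y O). unfold kk, ii. lia.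
    + apply (cCF_const (W := fun p => Wnat (ii p)) (Om := fun p y => Om p y /\ (fun p => Nat.leb (jj p) (kk p) = false) p)).
Qed.

(** The equation f = - rho_m + kern f is the conjugated recurrence solved for the identity part of
    [bigE]: [err] is what [bigE] leaves besides the identity, and rho_n times [sig] appears because
    exp(F n / y) solves the recurrence only up to a flat residual. *)
Definition kern (p : nat * nat * nat) (y : R) : C :=
  let '(i, j, k) := p in
  ((-1)%R * (csum (S d) (fun r => if Nat.eqb k (j + r) then err r (pos i j * y)%R y else RtoC 0)
      + csum (S d) (fun n => rho n (pos i j * y)%R y * sig n (i, j, k) y)))%C.

Notation W3 := (fun p : nat * nat * nat => Wnat (fst (fst p))).
Notation O3 ix := (Om2 (Om2 (shell kap ix) wins) (fun p : nat * nat => wins (fst p))).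

Instance O3_fr ix : frame W3 (O3 ix) :=
  Om2_frame (fun p : nat * nat => Wnat (fst p)) (Om2 (shell kap ix) wins) (fun p => wins (fst p)).

Lemma O3_facts p y : O3 ib p y -> shell kap ib (fst (fst p)) y /\
  (snd (fst p) <= nodes (fst (fst p)))%nat /\ (snd p + 1 <= nodes (fst (fst p)))%nat.
Proof. intros [[O h1] h2]. unfold wins in *. split; [exact O|]. lia. Qed.

Lemma cCF_rho_sig n : (n < S d)%nat ->
  cCF W3 (O3 ib) true (fun p _ y => rho n (pos (fst (fst p)) (snd (fst p)) * y)%R y * sig n p y)%C.
Proof.
  intros Hn. apply (cCF_mult (W := W3) (Om := O3 ib)).
  - apply (cCF_ray_flat (fun p : nat * nat * nat => fst (fst p)) (O3 ib)) with (pp := fun p => snd (fst p)); auto.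
    + intros p y O. apply (O3_facts p y O).
    + intros p y O. apply (O3_facts p y O).
  - apply (cCF_sig (fun p => p) (O3 ib) n Hn).
    + intros p y O. apply (O3_facts p y O).
    + intros p y O. apply (O3_facts p y O).
Qed.

Lemma cCF_kern : cCF W3 (O3 ib) false (fun p _ y => kern p y).
Proof.
  apply (cCF_ext false (fun p _ y =>
    ((-1)%R * (csum (S d) (fun r => if Nat.eqb (snd p) (snd (fst p) + r) then err r (pos (fst (fst p)) (snd (fst p)) * y)%R y else RtoC 0)
      + csum (S d) (fun n => rho n (pos (fst (fst p)) (snd (fst p)) * y)%R y * sig n p y)))%C)).
  { intros [[i j] k] x y _. reflexivity. }
  apply (cCF_mult_r (W := W3) (Om := O3 ib)); [apply (cCF_const (W := W3) (Om := O3 ib))|].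
  apply (cCF_plus (W := W3) (Om := O3 ib)).
  - apply (cCF_csum_const (W := W3) (Om := O3 ib) (S d) false
      (fun r p _ y => if Nat.eqb (snd p) (snd (fst p) + r) then err r (pos (fst (fst p)) (snd (fst p)) * y)%R y else RtoC 0)).
    intros r _.
    apply (cCF_if (W := W3) (Om := O3 ib) (fun p => Nat.eqb (snd p) (snd (fst p) + r)) false
       (fun p _ y => err r (pos (fst (fst p)) (snd (fst p)) * y)%R y) (fun _ _ _ => RtoC 0)).
    + apply (cCF_ray (fun p : nat * nat * nat => fst (fst p)) (fun p y => O3 ib p y /\ (fun p => Nat.eqb (snd p) (snd (fst p) + r) = true) p))
        with (pp := fun p => snd (fst p)).
      * intros p y [O _]. apply (O3_facts p y O).
      * apply csm_err.
      * intros p y [O _]. apply (O3_facts p y O).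
    + apply (cCF_const (W := W3) (Om := fun p y => O3 ib p y /\ (fun p => Nat.eqb (snd p) (snd (fst p) + r) = false) p)).
  - apply (cCF_csum_const (W := W3) (Om := O3 ib) (S d) false
      (fun n p _ y => rho n (pos (fst (fst p)) (snd (fst p)) * y)%R y * sig n p y)%C).
    intros n Hn. apply (cCF_weaken (W := W3) (Om := O3 ib)). now apply cCF_rho_sig.
Qed.

(** [err] is Lipschitz and vanishes at y = 0 over the interval; a node is O(y) away from it, and y W
    is bounded. *)
Lemma err_bound : exists K, 0 <= K /\ forall r i j y, (r < S d)%nat -> shell kap ib i y -> (j <= nodes i)%nat ->
  Cmod (err r (pos i j * y) y) * Wnat i <= K.
Proof.
  assert (A : forall r, exists K, forall i j y, (r < S d)%nat -> shell kap ib i y -> (j <= nodes i)%nat ->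
    Cmod (err r (pos i j * y) y) * Wnat i <= K).
  { intros r. destruct (csm_lip _ (csm_err r)) as (M & M0 & HM). exists (M * (4 * kap)).
    intros i j y Hr S Hj. destruct (shell_y kap ib kap8 Hib _ _ S) as [y0 y1].
    destruct (clamp_dist lft rgt y (pos i j * y)) as (x0 & I0 & D0); [lra|lra|now apply pos_near|].
    specialize (HM x0 0 (pos i j * y) y ltac:(lra) ltac:(lra)).
    rewrite err_at_0 in HM by (auto; lra). rewrite Rminus_0_r, (Rabs_pos_eq y) in HM by lra.
    replace (err r (pos i j * y)%R y - 0)%C with (err r (pos i j * y)%R y) in HM by ring.
    pose proof (shell_yW kap ib kap8 Hib _ _ S). pose proof (Wnat_ge1 i).
    apply Rle_trans with (M * (2 * y) * Wnat i).
    - apply Rmult_le_compat_r; [lra|]. eapply Rle_trans; [exact HM|]. apply Rmult_le_compat_l; lra.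
    - rewrite Rmult_assoc. apply Rmult_le_compat_l; [assumption|]. nra. }
  destruct (choose _ A) as [K HK]. destruct (finite_upper (S d) K) as (M & M0 & HM).
  exists M. split; [assumption|]. intros r i j y Hr S Hj. eapply Rle_trans; [now apply HK|auto].
Qed.

(** Two powers of W: one pays for the O(W) columns in a row sum, the other makes that sum tend to
    0. *)
Lemma rho_sig_bound : exists K, 0 <= K /\ forall n p y, (n < S d)%nat -> O3 ib p y ->
  Cmod (rho n (pos (fst (fst p)) (snd (fst p)) * y)%R y * sig n p y)%C * Wnat (fst (fst p)) ^ 2 <= K.
Proof.
  assert (A : forall n, exists K, forall p y, (n < S d)%nat -> O3 ib p y ->
    Cmod (rho n (pos (fst (fst p)) (snd (fst p)) * y)%R y * sig n p y)%C * Wnat (fst (fst p)) ^ 2 <= K).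
  { intros n. destruct (lt_dec n (S d)) as [h|h].
    - destruct (cCF_bnd_true (W := W3) (Om := O3 ib) _ (cCF_rho_sig n h) 2) as (K & _ & HK).
      exists K. intros p y _ O. exact (HK p 0 y O).
    - exists 0. intros; lia. }
  destruct (choose _ A) as [K HK]. destruct (finite_upper (S d) K) as (M & M0 & HM).
  exists M. split; [assumption|]. intros n p y Hn O. eapply Rle_trans; [now apply HK|auto].
Qed.

Lemma kern_rows : exists i1, (ib <= i1)%nat /\ forall i y, shell kap i1 i y -> forall j, (j < wins i)%nat ->
  rsum (wins i) (fun k => Cmod (kern (i, j, k) y)) <= 1 / 2.
Proof.
  destruct err_bound as (K1 & K10 & H1). destruct rho_sig_bound as (K2 & K20 & H2).
  (* A row sum is at most INR (S d) * (K1 + 2 * K2) / W: there are at most S d entries near the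
     diagonal, and at most 2 W columns in the flat part. B is twice the numerator, so W >= B gives
     1/2. *)
  set (B := 2 * (INR (S d) * (K1 + 2 * K2))).
  destruct (INR_unbounded B) as [i2 Hi2].
  exists (ib + i2)%nat. split; [lia|]. intros i y S j Hj.
  assert (Sb : shell kap ib i y) by (destruct S as (h & S); split; [lia|exact S]).
  assert (WB : B <= Wnat i).
  { destruct S as (h & _). unfold Wnat. assert (INR i2 <= INR i) by (apply le_INR; lia). lra. }
  pose proof (Wnat_ge1 i) as W1'. pose proof (nodes_W i) as NW.
  assert (Hjn : (j <= nodes i)%nat) by (unfold wins in Hj; lia).
  apply Rle_trans with (rsum (wins i) (fun k => rsum (Datatypes.S d) (fun r => if Nat.eqb k (j + r) then K1 / Wnat i else 0)
      + rsum (Datatypes.S d) (fun n => K2 / Wnat i ^ 2))).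
  - apply rsum_le. intros k Hk. unfold kern. rewrite Cmod_mult, Cmod_R.
    replace (Rabs (-1)) with 1 by (rewrite Rabs_left; lra). rewrite Rmult_1_l.
    eapply Rle_trans; [apply Cmod_triangle|]. apply Rplus_le_compat.
    + eapply Rle_trans; [apply csum_mod|]. apply rsum_le. intros r Hr.
      destruct (Nat.eqb k (j + r)); [|rewrite Cmod_0; lra].
      apply Rle_div_r; [lra|]. now apply H1.
    + eapply Rle_trans; [apply csum_mod|]. apply rsum_le. intros n Hn.
      apply Rle_div_r; [apply pow_lt; lra|]. apply (H2 n (i, j, k) y Hn). split; [split|]; assumption.
  - rewrite rsum_plus, rsum_swap. rewrite !rsum_const.
    assert (A1 : rsum (Datatypes.S d) (fun r => rsum (wins i) (fun k => if Nat.eqb k (j + r) then K1 / Wnat i else 0))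
      <= INR (Datatypes.S d) * (K1 / Wnat i)).
    { rewrite <- rsum_const. apply rsum_le. intros r _. apply rsum_select. apply Rdiv_le_0_compat; lra. }
    assert (A2 : INR (wins i) <= 2 * Wnat i).
    { eapply Rle_trans; [|exact NW]. apply le_INR. unfold wins. lia. }
    assert (A3 : INR (wins i) * (INR (Datatypes.S d) * (K2 / Wnat i ^ 2)) <= INR (Datatypes.S d) * (2 * K2 / Wnat i)).
    { pose proof (pos_INR (Datatypes.S d)).
      apply Rle_trans with (2 * Wnat i * (INR (Datatypes.S d) * (K2 / Wnat i ^ 2))).
      - apply Rmult_le_compat_r; [|assumption]. apply Rmult_le_pos; [assumption|]. apply Rdiv_le_0_compat; [assumption|apply pow_lt; lra].
      - right. field. lra. }
    assert (A4 : INR (Datatypes.S d) * (K1 / Wnat i) + INR (Datatypes.S d) * (2 * K2 / Wnat i) = B / 2 / Wnat i).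
    { unfold B. field. lra. }
    assert (A5 : B / 2 / Wnat i <= 1 / 2) by (apply Rle_div_l; lra).
    lra.
Qed.

Lemma ratio_mult n i p q r y : (ratio n i p q y * ratio n i q r y = ratio n i p r y)%C.
Proof. unfold ratio. rewrite <- Cexp_plus. f_equal. ring. Qed.

Lemma ratio_refl n i p y : ratio n i p p y = RtoC 1.
Proof. unfold ratio. rewrite <- Cexp_0. f_equal. ring. Qed.

Lemma pos_shift i j s y : pos i (j + s) * y = pos i j * y + INR s * y.
Proof. unfold pos. rewrite plus_INR. ring. Qed.

Lemma ratio_cdq n i j s t y : 0 < y < 1 ->
  ratio n i (j + s) (j + t) y = Cexp (cdq (INR s) (Phi n) (pos i j * y) y - cdq (INR t) (Phi n) (pos i j * y) y).
Proof.
  intros Hy. unfold ratio. f_equal. rewrite !pos_shift.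
  assert (Y : RtoC y <> 0) by (intros e; apply RtoC_inj in e; lra).
  pose proof (cdq_spec (INR s) (Phi n) (pos i j * y) y (csm_Phi n) ltac:(lra)) as E1.
  pose proof (cdq_spec (INR t) (Phi n) (pos i j * y) y (csm_Phi n) ltac:(lra)) as E2.
  rewrite RtoC_inv by lra.
  transitivity (((Phi n (pos i j * y + INR s * y)%R y - Phi n (pos i j * y)%R y) -
     (Phi n (pos i j * y + INR t * y)%R y - Phi n (pos i j * y)%R y)) * / y)%C; [ring|].
  rewrite <- E1, <- E2. field. exact Y.
Qed.

Section Algebra.
Variables (i : nat) (y : R) (f : nat -> C).
Hypothesis Sy : shell kap ib i y.

(** f is continued by 0 beyond the last equation, since the sum in [green] at node j reaches up to j
    + d. *)
Let fx (k : nat) : C := if Nat.ltb k (wins i) then f k else RtoC 0.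
Definition modal (n j : nat) : C := csum (wins i) (fun k => sig n (i, j, k) y * f k)%C.

(** Both directions of summation solve the same first-order recurrence with source gam f; they
    differ by a solution of the homogeneous one. The algebra from here on does not see [side]. *)
Lemma modal_step n j : modal n (j + 1) = (ratio n i (j + 1) j y * modal n j + gam n (pos i j * y)%R y * fx j)%C.
Proof.
  unfold modal. rewrite <- csum_mult_l.
  assert (E : forall k, (sig n (i, (j + 1)%nat, k) y * f k)%C =
    (ratio n i (j + 1) j y * (sig n (i, j, k) y * f k) + (if Nat.eqb k j then gam n (pos i k * y)%R y * f k else 0))%C).
  { intros k. unfold sig. destruct (side n).
    - destruct (Nat.ltb_spec k (j + 1)), (Nat.ltb_spec k j), (Nat.eqb_spec k j); try lia.
      + transitivity ((ratio n i (j + 1) j y * ratio n i j (k + 1) y) * gam n (pos i k * y)%R y * f k)%C; [|ring].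
        rewrite ratio_mult. ring.
      + subst k. rewrite ratio_refl. ring.
      + ring.
    - destruct (Nat.leb_spec (j + 1) k), (Nat.leb_spec j k), (Nat.eqb_spec k j); try lia.
      + transitivity ((-1)%R * ((ratio n i (j + 1) j y * ratio n i j (k + 1) y) * gam n (pos i k * y)%R y * f k))%C; [|ring].
        rewrite ratio_mult. ring.
      (* Summing from the right, the term k = j is present at j and absent at j + 1; its sign -1
         makes the source appear with a plus. *)
      + subst k. transitivity (gam n (pos i j * y)%R y * f j - (ratio n i (j + 1) j y * ratio n i j (j + 1) y) * gam n (pos i j * y)%R y * f j)%C.
        * rewrite ratio_mult, ratio_refl. ring.
        * rewrite RtoC_m1. ring.
      + ring. }
  rewrite (csum_ext _ _ _ (fun k _ => E k)), csum_plus, csum_select. unfold fx.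
  destruct (Nat.ltb j (wins i)); ring.
Qed.

Lemma modal_steps n j s : modal n (j + s) =
  (ratio n i (j + s) j y * modal n j + csum s (fun r => ratio n i (j + s) (j + (r + 1)) y * gam n (pos i (j + r) * y)%R y * fx (j + r)%nat))%C.
Proof.
  induction s as [|s IH].
  - rewrite !Nat.add_0_r, ratio_refl. simpl. ring.
  - replace (j + S s)%nat with (j + s + 1)%nat by lia.
    rewrite modal_step, IH. simpl csum.
    replace (j + (s + 1))%nat with (j + s + 1)%nat by lia. rewrite ratio_refl.
    rewrite Cmult_plus_distr_l, Cmult_assoc, ratio_mult, <- csum_mult_l.
    rewrite (csum_ext s _ (fun r => ratio n i (j + s + 1) (j + (r + 1)) y * gam n (pos i (j + r) * y)%R y * fx (j + r)%nat)%C).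
    + ring.
    + intros r _. transitivity ((ratio n i (j + s + 1) (j + s) y * ratio n i (j + s) (j + (r + 1)) y) * gam n (pos i (j + r) * y)%R y * fx (j + r)%nat)%C; [ring|].
      now rewrite ratio_mult.
Qed.

(* Applying the conjugated recurrence to the sum of the modal solutions returns f up to
   the small kernel. *)
Lemma green j :
  csum (S (S d)) (fun s => a s (pos i j * y)%R y * Cexp (cdq (INR s) (F m) (pos i j * y) y) * csum (S d) (fun n => modal n (j + s)))%C
  = (csum (S d) (fun r => bigE r (pos i j * y)%R y * fx (j + r)%nat) + csum (S d) (fun n => rho n (pos i j * y)%R y * modal n j))%C.
Proof.
  destruct (shell_y kap ib kap8 Hib _ _ Sy) as [y0 y1]. set (X := pos i j * y).
  assert (A : forall n, csum (S (S d)) (fun s => a s X y * Cexp (cdq (INR s) (F m) X y) * modal n (j + s))%C =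
    (rho n X y * modal n j + csum (S d) (fun r => csum (S d - r) (fun t => a (r + 1 + t)%nat X y
      * Cexp (cdq (INR (r + 1 + t)) (F n) X y - cdq (INR (r + 1)) (Phi n) X y)) * gam n (X + INR r * y)%R y * fx (j + r)%nat))%C).
  { intros n.
    assert (Eb : forall s t, (a s X y * Cexp (cdq (INR s) (F m) X y) * ratio n i (j + s) (j + t) y =
       a s X y * Cexp (cdq (INR s) (F n) X y - cdq (INR t) (Phi n) X y))%C).
    { intros s t. rewrite ratio_cdq by lra. fold X. rewrite <- Cmult_assoc, <- Cexp_plus. f_equal. f_equal.
      rewrite (cdq_Phi (INR s)) by lra. ring. }
    rewrite (csum_ext (S (S d)) _ (fun s => a s X y * Cexp (cdq (INR s) (F n) X y) * modal n j +
       csum s (fun r => a s X y * Cexp (cdq (INR s) (F n) X y - cdq (INR (r + 1)) (Phi n) X y) * gam n (X + INR r * y)%R y * fx (j + r)%nat))%C).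
    - rewrite csum_plus, csum_mult_r. fold (resid (S d) a (F n) X y). fold (rho n X y). f_equal.
      rewrite csum_triangle. apply csum_ext. intros r _. rewrite <- !csum_mult_r.
      apply csum_ext. intros t _. reflexivity.
    - intros s _. rewrite modal_steps, Cmult_plus_distr_l. f_equal.
      + rewrite Cmult_assoc. f_equal. pose proof (Eb s O) as E. rewrite Nat.add_0_r in E. rewrite E. f_equal. f_equal.
        assert (Z0 : cdq (INR 0) (Phi n) X y = RtoC 0).
        { unfold cdq, dq. simpl INR. apply C_ext; simpl; ring. }
        rewrite Z0. ring.
      + rewrite <- csum_mult_l. apply csum_ext. intros r _.
        rewrite <- Eb. rewrite pos_shift. fold X. ring. }
  rewrite (csum_ext (S (S d)) _ (fun s => csum (S d) (fun n => a s X y * Cexp (cdq (INR s) (F m) X y) * modal n (j + s)))%C).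
  2:{ intros s _. now rewrite csum_mult_l. }
  rewrite csum_swap. rewrite (csum_ext _ _ _ (fun n _ => A n)).
  rewrite csum_plus, csum_swap, Cplus_comm. f_equal.
  apply csum_ext. intros r _. unfold bigE. rewrite <- csum_mult_r. reflexivity.
Qed.

(** By [green] the sum is rho_m + f j plus the [err] and rho_n terms, and the fixed-point equation
    for f says exactly that this is 0. *)
Lemma exact_algebra j : (j < wins i)%nat ->
  f j = ((-1)%R * rho m (pos i j * y)%R y + csum (wins i) (fun k => kern (i, j, k) y * f k))%C ->
  csum (S (S d)) (fun s => a s (pos i j * y)%R y * Cexp (cdq (INR s) (F m) (pos i j * y) y)
     * (1 + csum (S d) (fun n => modal n (j + s))))%C = RtoC 0.
Proof.
  intros Hj Hf.
  rewrite (csum_ext _ _ (fun s => a s (pos i j * y)%R y * Cexp (cdq (INR s) (F m) (pos i j * y) y) +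
     a s (pos i j * y)%R y * Cexp (cdq (INR s) (F m) (pos i j * y) y) * csum (S d) (fun n => modal n (j + s)))%C)
    by (intros; ring).
  rewrite csum_plus, green. fold (resid (S d) a (F m) (pos i j * y) y). fold (rho m (pos i j * y) y).
  assert (K : csum (wins i) (fun k => kern (i, j, k) y * f k)%C =
    ((-1)%R * (csum (S d) (fun r => err r (pos i j * y)%R y * fx (j + r)%nat) + csum (S d) (fun n => rho n (pos i j * y)%R y * modal n j)))%C).
  { unfold kern, modal.
    rewrite (csum_ext (wins i) _ (fun k => (-1)%R * (csum (S d) (fun r => if Nat.eqb k (j + r) then err r (pos i j * y)%R y * f k else RtoC 0)
       + csum (S d) (fun n => rho n (pos i j * y)%R y * (sig n (i, j, k) y * f k))))%C).
    - rewrite csum_mult_l, csum_plus. f_equal. f_equal.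
      + rewrite csum_swap. apply csum_ext. intros r _.
        rewrite (csum_select (wins i) (j + r) (fun k => err r (pos i j * y)%R y * f k)%C). unfold fx.
        destruct (Nat.ltb (j + r) (wins i)); ring.
      + rewrite csum_swap. apply csum_ext. intros n _. now rewrite csum_mult_l.
    - intros k _. rewrite <- Cmult_assoc. f_equal. rewrite Cmult_plus_distr_r, <- !csum_mult_r. f_equal.
      + apply csum_ext. intros r _. destruct (Nat.eqb k (j + r)); ring.
      + apply csum_ext. intros n _. ring. }
  rewrite K in Hf.
  assert (E0 : csum (S d) (fun r => bigE r (pos i j * y)%R y * fx (j + r)%nat)%C =
    (csum (S d) (fun r => err r (pos i j * y)%R y * fx (j + r)%nat) + f j)%C).
  { rewrite (csum_ext _ _ (fun r => err r (pos i j * y)%R y * fx (j + r)%nat + (if Nat.eqb r 0 then f j else RtoC 0))%C).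
    - rewrite csum_plus, (csum_select (S d) 0 (fun _ => f j)). reflexivity.
    - intros r _. unfold err. destruct (Nat.eq_dec r 0) as [->|ne].
      + rewrite Nat.add_0_r. unfold fx. destruct (Nat.ltb_spec j (wins i)); [|lia]. simpl. ring.
      + destruct (Nat.eqb_spec r 0); [lia|]. ring. }
  rewrite E0, Hf. rewrite RtoC_m1. ring.
Qed.

End Algebra.

Lemma exact_piece : exists i1 (del : nat * nat -> R -> C), (ib <= i1)%nat /\
  cCF (fun p : nat * nat => Wnat (fst p)) (Om2 (shell kap i1) (fun i => S (nodes i))) true (fun p _ y => del p y) /\
  forall i y, shell kap i1 i y -> forall j, (j + S d <= nodes i)%nat ->
    csum (S (S d)) (fun s => a s (pos i j * y)%R y * Cexp (cdq (INR s) (F m) (pos i j * y) y) * (1 + del (i, (j + s)%nat) y))%C = RtoC 0.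
Proof.
  destruct kern_rows as (i1 & Hi1 & rows).
  assert (Sub : forall i y, shell kap i1 i y -> shell kap ib i y).
  { intros i y (h & S). split; [lia|exact S]. }
  assert (HT : cCF W3 (O3 i1) false (fun p _ y => kern p y)).
  { apply (cCF_reindex (WJ := W3) (OJ := O3 ib) (fun p => p)); auto; [|exact cCF_kern].
    intros p y [[O h1] h2]. split; [split|]; auto. }
  assert (Hn : forall i y, shell kap i1 i y -> INR (wins i) <= 2 * Wnat i ^ 1).
  { intros i y _. rewrite pow_1. eapply Rle_trans; [|apply nodes_W]. apply le_INR. unfold wins. lia. }
  assert (Hr : cCF (fun p : nat * nat => Wnat (fst p)) (Om2 (shell kap i1) wins) true
     (fun p _ y => (-1)%R * rho m (pos (fst p) (snd p) * y)%R y)%C).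
  { apply (cCF_mult_r (W := fun p : nat * nat => Wnat (fst p)) (Om := Om2 (shell kap i1) wins));
      [apply (cCF_const (W := fun p : nat * nat => Wnat (fst p)) (Om := Om2 (shell kap i1) wins))|].
    apply (cCF_ray_flat (fun p : nat * nat => fst p) (Om2 (shell kap i1) wins)) with (pp := fun p => snd p); auto.
    - intros p y [O _]. now apply Sub.
    - intros p y [_ h]. unfold wins in h. lia. }
  destruct (system_family wins kern 1 2 Hn HT rows (fun p y => (-1)%R * rho m (pos (fst p) (snd p) * y)%R y)%C Hr)
    as (f & Sf & Ff).
  (* The correction at a node is the sum of its modal solutions. It is defined at all S (nodes i)
     nodes although f has only wins i components, and it is flat because f is. *)
  exists i1, (fun p y => csum (S d) (fun n => csum (wins (fst p)) (fun k => sig n (fst p, snd p, k) y * f (fst p, k) y)%C)).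
  split; [assumption|]. split.
  - apply (cCF_csum_const (W := fun p : nat * nat => Wnat (fst p)) (Om := Om2 (shell kap i1) (fun i => S (nodes i))) (S d) true
      (fun n p _ y => csum (wins (fst p)) (fun k => sig n (fst p, snd p, k) y * f (fst p, k) y)%C)).
    intros n Hnd.
    assert (FR4 : frame W3 (Om2 (Om2 (shell kap i1) (fun i => S (nodes i))) (fun p : nat * nat => wins (fst p)))).
    { exact (Om2_frame (fun p : nat * nat => Wnat (fst p)) (Om2 (shell kap i1) (fun i => S (nodes i))) (fun p => wins (fst p))). }
    apply (cCF_csum (W := fun p : nat * nat => Wnat (fst p)) (Om := Om2 (shell kap i1) (fun i => S (nodes i)))
      (fun p => wins (fst p)) true (fun p _ y => sig n (fst (fst p), snd (fst p), snd p) y * f (fst (fst p), snd p) y)%C 1 2).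
    + intros p y [O _]. exact (Hn _ _ O).
    + apply (cCF_mult_r (W := W3) (Om := Om2 (Om2 (shell kap i1) (fun i => S (nodes i))) (fun p : nat * nat => wins (fst p)))).
      * apply (cCF_sig (fun p => (fst (fst p), snd (fst p), snd p))
          (Om2 (Om2 (shell kap i1) (fun i => S (nodes i))) (fun p : nat * nat => wins (fst p))) n Hnd).
        -- intros p y [[O _] _]. now apply Sub.
        -- intros p y [[O h1] h2]. simpl in *. unfold wins in h2. lia.
      * apply (cCF_reindex (WJ := fun p : nat * nat => Wnat (fst p)) (OJ := Om2 (shell kap i1) wins)
          (fun p : nat * nat * nat => (fst (fst p), snd p)) true (fun p _ y => f p y)); [|reflexivity|exact Ff].
        intros p y [[O h1] h2]. split; assumption.
  - intros i y S j Hj. apply (exact_algebra i y (fun k => f (i, k) y)).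
    + now apply Sub.
    + unfold wins. lia.
    + apply (Sf i y S j). unfold wins. lia.
Qed.

End ExactPiece.

(** * Gluing over step sizes and pieces *)

(** [Om] and the open set Z cover [Om'] and f vanishes on the overlap, so the extension is near
    every point either f or 0. *)
Lemma CF_extend_zero {I} {W : I -> R} {Om Om' Z : I -> R -> Prop} {FR : frame W Om} {FR' : frame W Om'} f :
  (forall i y, Z i y -> locally y (Z i)) ->
  (forall i y, Om' i y -> Om i y \/ Z i y) ->
  (forall i x y, Om i y -> Z i y -> f i x y = 0) ->
  CF W Om true f ->
  CF W Om' true (fun i x y => if excluded_middle_informative (Om i y) then f i x y else 0).
Proof.
  intros Zop HZ f0 F n. specialize (F n). revert f f0 F.
  set (ext := fun (f : I -> R -> R -> R) i x y => if excluded_middle_informative (Om i y) then f i x y else 0).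
  assert (E1 : forall f i x y, Om i y -> ext f i x y = f i x y).
  { intros f i x y O. unfold ext. destruct (excluded_middle_informative _); [reflexivity|contradiction]. }
  assert (E2 : forall f i x y, (forall i x y, Om i y -> Z i y -> f i x y = 0) -> Z i y -> ext f i x y = 0).
  { intros f i x y H z. unfold ext. destruct (excluded_middle_informative _); [now apply H|reflexivity]. }
  induction n as [|n IH]; intros f f0 F; fold (ext f).
  all: assert (B : bnd W Om' true (ext f)) by
    (intros q; destruct (Sm_bnd _ _ _ F q) as [C HC]; exists (Rmax C 0); intros i x y O;
     unfold ext; destruct (excluded_middle_informative _) as [O'|_];
     [eapply Rle_trans; [now apply HC|apply Rmax_l]|rewrite Rabs_R0, Rmult_0_l; apply Rmax_r]).
  - split; [exact B|exact Logic.I].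
  - destruct F as (_ & D & X & Y).
    assert (X0 : forall i x y, Om i y -> Z i y -> dx f i x y = 0).
    { intros i x y O z. unfold dx. apply is_derive_unique.
      apply (is_derive_ext (fun _ => 0)); [intros t; symmetry; now apply f0|apply is_derive_Rconst]. }
    assert (Y0 : forall i x y, Om i y -> Z i y -> dy f i x y = 0).
    { intros i x y O z. unfold dy. apply is_derive_unique.
      apply (is_derive_ext_loc (fun _ => 0)); [|apply is_derive_Rconst].
      generalize (filter_and _ _ (Oop i y O) (Zop i y z)). apply filter_imp. intros t [a b]. symmetry. now apply f0. }
    apply (Sm_intro true n (ext f) (ext (dx f)) (ext (dy f)) B); [|exact (IH _ X0 X)|exact (IH _ Y0 Y)].
    intros i x y O'. destruct (HZ i y O') as [O|z].
    + rewrite !E1 by assumption. destruct (D i x y O) as [D1 D2]. split.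
      * apply (is_derive_ext (fun t => f i t y)); [intros t; symmetry; now apply E1|now apply Derive_correct].
      * apply (is_derive_ext_loc (fun t => f i x t)); [|now apply Derive_correct].
        generalize (Oop i y O). apply filter_imp. intros t a. symmetry. now apply E1.
    + rewrite !E2 by assumption. split.
      * apply (is_derive_ext (fun _ => 0)); [intros t; symmetry; now apply E2|apply is_derive_Rconst].
      * apply (is_derive_ext_loc (fun _ => 0)); [|apply is_derive_Rconst].
        generalize (Zop i y z). apply filter_imp. intros t a. symmetry. now apply E2.
Qed.

Lemma Series_two f j : (forall n, n <> j -> n <> S j -> f n = 0) -> Series f = f j + f (S j).
Proof.
  intros H. apply is_series_unique.
  assert (A : forall n, (S j <= n)%nat -> sum_n f n = f j + f (S j)).
  { assert (B : forall n, (n < j)%nat -> sum_n f n = 0).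
    { induction n as [|n IH]; intros h; [rewrite sum_O; apply H; lia|].
      rewrite sum_Sn, IH by lia. rewrite (H (S n)) by lia. apply (Rplus_0_l 0). }
    assert (Bj : sum_n f j = f j).
    { destruct j as [|j]; [apply sum_O|]. rewrite sum_Sn, B by lia. apply Rplus_0_l. }
    intros n h. induction h as [|n h IH].
    - rewrite sum_Sn, Bj. reflexivity.
    - rewrite sum_Sn, IH, (H (S n)) by lia. apply Rplus_0_r. }
  apply (filterlim_ext_loc (fun _ => f j + f (S j))); [|apply filterlim_const].
  exists (S j). intros n h. symmetry. now apply A.
Qed.

Lemma rsum_single n k (c : R) : (k < n)%nat -> forall f, f k = c -> (forall j, (j < n)%nat -> j <> k -> f j = 0) ->
  rsum n f = c.
Proof.
  induction n as [|n IH]; intros h f E H; [lia|]. simpl. destruct (Nat.eq_dec k n) as [->|ne].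
  - assert (Z : rsum n f = 0); [|lra]. rewrite (rsum_ext n f (fun _ => 0)) by (intros; apply H; lia).
    rewrite rsum_const. ring.
  - rewrite (IH ltac:(lia) f E) by (intros; apply H; lia). rewrite (H n) by lia. ring.
Qed.

(* The lattice point with number k is stored in row i of a family at this index. *)
Definition idx (i : nat) (k : Z) : nat := Z.to_nat (k + Z.of_nat i + 1).

Section Glue.
Variables (kap A : R) (i1 : nat).
Hypothesis Hk : 8 <= kap.
Hypothesis Hi1 : kap + 4 <= INR i1.
Hypothesis HA : 0 < A <= kap / 8.

(* Row [i] stores the numbers -i-1, ..., i+1 of the lattice points, see [idx]. *)
Definition rows (i : nat) : nat := (2 * i + 3)%nat.

(** |k| y <= A <= kap / 8 and kap / y < i + 2 give |k| < i + 1, so row i has room for every lattice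
    number in range. *)
Lemma idx_row i y k : shell kap i1 i y -> Rabs (IZR k * y) <= A ->
  (idx i k < rows i)%nat /\ INR (idx i k) - INR i - 1 = IZR k.
Proof.
  intros (h & y0 & h1) hA. apply Rabs_le_between in hA.
  assert (E : kap = kap / y * y) by (field; lra).
  assert (B1 : IZR k < INR i + 1). { assert (2 <= INR i) by (apply le_INR in h; lra). nra. }
  assert (B2 : - INR i - 1 < IZR k). { assert (2 <= INR i) by (apply le_INR in h; lra). nra. }
  rewrite INR_IZR_INZ in B1, B2. rewrite <- plus_IZR in B1. rewrite <- opp_IZR, <- minus_IZR in B2.
  apply lt_IZR in B1. apply lt_IZR in B2. unfold idx, rows. split; [lia|].
  rewrite !INR_IZR_INZ, Z2Nat.id by lia. rewrite !plus_IZR. ring.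
Qed.

Section RealFamily.
Variable th : nat * nat -> R -> R.
Hypothesis Hth : CF (fun p : nat * nat => Wnat (fst p)) (Om2 (shell kap i1) rows) true (fun p _ y => th p y).

(* The hats sum to 1 in [i], and at a lattice point only its own spike is nonzero. *)
Definition patch (i : nat) (x y : R) : R :=
  hat (kap / y - INR i) * rsum (rows i) (fun r => th (i, r) y * spike (x * cutoff A x / y - (INR r - INR i - 1))).

Lemma CF_inv_shell {J} (ii : J -> nat) (Om : J -> R -> Prop) {FR : frame (fun p => Wnat (ii p)) Om} :
  (forall p y, Om p y -> shell kap i1 (ii p) y) -> CF (fun p => Wnat (ii p)) Om false (fun _ _ y => / y).
Proof.
  intros H. apply (CF_inv_gen (fun _ _ y => y)).
  - apply (CF_y 1). intros p y O. pose proof (shell_y kap i1 Hk Hi1 _ _ (H p y O)). apply Rabs_le. lra.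
  - intros p x y O. pose proof (shell_y kap i1 Hk Hi1 _ _ (H p y O)). lra.
  - exists 1%nat, 1. intros p x y O. pose proof (H p y O) as S.
    pose proof (shell_y kap i1 Hk Hi1 _ _ S). rewrite Rabs_pos_eq by (left; apply Rinv_0_lt_compat; lra).
    simpl. rewrite Rmult_1_r, Rmult_1_l. now apply (shell_inv_y kap i1 Hk Hi1).
Qed.

(** The coordinate x is multiplied by the cutoff because it is unbounded; for |x| <= A, where
    lattice points are used, nothing changes. *)
Lemma CF_patch : CF Wnat (shell kap i1) true patch.
Proof.
  unfold patch. apply CF_mult_r.
  - apply (CF_bumps (fun i _ y => kap / y - INR i)). apply PF_CF. apply CF_minus.
    + apply (CF_scal false kap (fun _ _ y => / y)), (CF_inv_shell (fun i => i) (shell kap i1) (FR := shell_frame kap i1)). auto.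
    + apply (CF_index INR 1 1). intros i y _. rewrite pow_1. unfold Wnat. pose proof (pos_INR i).
      rewrite Rabs_pos_eq; lra.
  - apply (CF_rsum rows true (fun p x y => th p y * spike (x * cutoff A x / y - (INR (snd p) - INR (fst p) - 1))) 1 3).
    + intros i y _. rewrite pow_1. unfold rows, Wnat. rewrite plus_INR, mult_INR. simpl (INR 2). simpl (INR 3).
      pose proof (pos_INR i). lra.
    + assert (FR := Om2_frame Wnat (shell kap i1) rows).
      apply (CF_mult (W := fun p : nat * nat => Wnat (fst p)) (Om := Om2 (shell kap i1) rows) true (fun p _ y => th p y)); [exact Hth|].
      apply (CF_bumps (fun p x y => x * cutoff A x / y - (INR (snd p) - INR (fst p) - 1))). apply PF_CF. apply CF_minus.
      * apply (CF_mult false (fun p x _ => x * cutoff A x) (fun _ _ y => / y)).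
        -- apply (CF_xmul (fun _ x _ => cutoff A x) (2 * A)).
           ++ apply (CF_comp (fun x _ => cutoff A x) (fun _ x _ => x) (fun _ _ _ => 0)).
              ** apply sm_cutoff. lra.
              ** apply PF_x.
              ** apply PF_CF, CF_const.
              ** intros; lra.
           ++ intros p x y _ h. apply cutoff_0; lra.
        -- apply (CF_inv_shell fst (Om2 (shell kap i1) rows) (FR := FR)). intros p y [O _]. exact O.
      * apply (CF_index (fun p => INR (snd p) - INR (fst p) - 1) 1 2). intros [i r] y [_ h]. simpl in *.
        rewrite Rmult_1_r. unfold rows in h. unfold Wnat.
        assert (h' : (r <= 2 * i + 2)%nat) by lia. apply le_INR in h'. rewrite plus_INR, mult_INR in h'. simpl (INR 2) in h'.
        pose proof (pos_INR i). pose proof (pos_INR r). apply Rabs_le. lra.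
Qed.

Definition patch0 (i : nat) (x y : R) : R :=
  if excluded_middle_informative (shell kap i1 i y) then patch i x y else 0.

Lemma patch0_far i x y : 1 <= Rabs (kap / y - INR i) -> patch0 i x y = 0.
Proof.
  intros h. unfold patch0. destruct (excluded_middle_informative _); [|reflexivity].
  unfold patch. rewrite hat_0 by assumption. ring.
Qed.

Lemma CF_patch0 : CF Wnat (fun _ y => -1 < y < 1) true patch0.
Proof.
  (* The hat vanishes where kap / y is more than 1 away from i; written as conditions on y, this
     also covers y <= 0. Rows below i1 have an empty shell. *)
  set (Z := fun i y => (i < i1)%nat \/ y < kap / (INR i + 1) \/ kap / (INR i - 1) < y).
  apply (CF_extend_zero (Z := Z)).
  - intros i y [h|[h|h]].
    + apply filter_forall. intros t. now left.
    + generalize (open_lt (kap / (INR i + 1)) y h). apply filter_imp. intros t ht. right. now left.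
    + generalize (open_gt (kap / (INR i - 1)) y h). apply filter_imp. intros t ht. right. now right.
  - intros i y _. destruct (le_lt_dec i1 i) as [hi|hi]; [|right; now left].
    assert (i12 : 12 <= INR i) by (apply le_INR in hi; lra).
    destruct (Rlt_dec y (kap / (INR i + 1))) as [h1|h1]; [right; right; now left|].
    destruct (Rlt_dec (kap / (INR i - 1)) y) as [h2|h2]; [right; right; now right|].
    left. split; [assumption|].
    assert (0 < kap / (INR i + 1)) by (apply Rdiv_lt_0_compat; lra).
    assert (y0 : 0 < y) by lra. split; [exact y0|].
    apply Rnot_lt_le in h1. apply Rnot_lt_le in h2.
    apply Rle_div_l in h1; [|lra]. apply Rle_div_r in h2; [|lra].
    split; [apply Rlt_div_r; [lra|]; nra|apply Rlt_div_l; [lra|]; nra].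
  - intros i x y (h & y0 & S1 & S2) [z|z]; [lia|].
    assert (i12 : 12 <= INR i) by (apply le_INR in h; lra).
    unfold patch. rewrite hat_0; [ring|]. unfold Rabs. destruct z as [z|z].
    + apply Rlt_div_r in z; [|lra]. assert (INR i + 1 < kap / y) by (apply Rlt_div_r; [lra|nra]).
      destruct (Rcase_abs _); lra.
    + apply Rlt_div_l in z; [|lra]. assert (kap / y < INR i - 1) by (apply Rlt_div_l; [lra|nra]).
      destruct (Rcase_abs _); lra.
  - exact CF_patch.
Qed.

Lemma hat_frac j u : 0 <= u <= 1 -> INR j <= INR j + u ->
  hat (INR j + u - INR j) = 1 - step u /\ hat (INR j + u - INR (S j)) = step u.
Proof.
  intros Hu _. rewrite S_INR. unfold hat. split.
  - rewrite (step_1 (INR j + u - INR j + 1)) by lra. f_equal. f_equal. ring.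
  - rewrite (step_0 (INR j + u - (INR j + 1))) by lra.
    replace (INR j + u - (INR j + 1) + 1) with u by ring. ring.
Qed.

Lemma patch_lattice i y k : shell kap i1 i y -> Rabs (IZR k * y) <= A ->
  patch0 i (IZR k * y) y = hat (kap / y - INR i) * th (i, idx i k) y.
Proof.
  intros S h. unfold patch0. destruct (excluded_middle_informative _); [|contradiction].
  unfold patch. f_equal. destruct (idx_row i y k S h) as [r1 r2]. destruct S as (_ & y0 & _).
  rewrite cutoff_1 by (auto; lra). rewrite Rmult_1_r.
  apply (rsum_single _ (idx i k)); [assumption| |].
  - rewrite r2. replace (IZR k * y / y - IZR k) with 0 by (field; lra). rewrite spike_at_0. ring.
  - intros r _ ne. rewrite spike_0; [ring|].
    replace (IZR k * y / y - (INR r - INR i - 1)) with (IZR (Z.of_nat (idx i k) - Z.of_nat r)).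
    + rewrite <- abs_IZR. assert (1 <= Z.abs (Z.of_nat (idx i k) - Z.of_nat r))%Z by lia.
      apply IZR_le in H. lra.
    + rewrite minus_IZR, <- !INR_IZR_INZ, <- r2. field. lra.
Qed.

(** At fixed y > 0 at most two rows contribute, j = floor(kap / y) and j + 1, and their weights
    depend on y alone. Flatness of the rows makes the sum smooth at y = 0. Dropping the rows below
    i2 makes f small, so that 1 + f will have a logarithm. *)
Lemma glue_real : exists f i2, sm f /\ (i1 <= i2)%nat /\ (forall x, f x 0 = 0) /\
  (forall x y, -1 < y < 1 -> Rabs (f x y) <= 1 / 4) /\
  forall y j k, (i2 <= j)%nat -> 0 < y -> INR j <= kap / y < INR j + 1 -> Rabs (IZR k * y) <= A ->
    f (IZR k * y) y = (1 - step (kap / y - INR j)) * th (j, idx j k) y + step (kap / y - INR j) * th (S j, idx (S j) k) y.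
Proof.
  destruct (CF_bnd _ _ CF_patch0 3%nat) as [C HC].
  set (Sg := Series (fun n => / (INR n + 1) ^ 2)).
  (* The bound C W^(-3) is read as C / W times W^(-2): beyond row N the first factor is at most C /
     (N + 1), and N + 1 > 4 C Sg makes the whole sum at most 1/4. *)
  destruct (nfloor_ex (Rmax 0 (4 * Rmax 0 C * Sg)) (Rmax_l _ _)) as (N & _ & HN).
  assert (Sg0 : 0 <= Sg).
  { unfold Sg. apply Rle_trans with (Series (fun _ => 0)); [rewrite (Series_two _ O) by reflexivity; lra|].
    apply Series_le; [|exact ex_series_inv_sq].
    intros n. pose proof (pos_INR n). split; [lra|]. left. apply Rinv_0_lt_compat, pow_lt. lra. }
  set (i2 := Nat.max i1 N).
  set (h := fun i x y => (if Nat.leb i2 i then 1 else 0) * patch0 i x y).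
  assert (Fh : CF Wnat (fun _ y => -1 < y < 1) true h).
  { apply CF_mult_r; [|exact CF_patch0]. apply (CF_index (fun i => if Nat.leb i2 i then 1 else 0) 0 1).
    intros i y _. simpl. destruct (Nat.leb i2 i); rewrite Rabs_pos_eq; lra. }
  exists (fun x y => Series (fun n => h n x y)), i2.
  split; [now apply sm_Series|]. split; [unfold i2; lia|]. split; [|split].
  - intros x. assert (Z : forall n, h n x 0 = 0).
    { intros n. unfold h, patch0. destruct (excluded_middle_informative _) as [(_ & q & _)|_]; [lra|ring]. }
    rewrite (Series_two _ O) by (intros; apply Z). rewrite !Z. ring.
  - intros x y Hy.
    assert (B : forall n, Rabs (h n x y) <= (Rmax 0 C / (INR N + 1)) * / (INR n + 1) ^ 2).
    { intros n. pose proof (pos_INR n). pose proof (pos_INR N). pose proof (Rmax_l 0 C).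
      assert (P2 : 0 < (INR n + 1) ^ 2) by (apply pow_lt; lra).
      unfold h. destruct (Nat.leb_spec i2 n) as [l|l].
      - rewrite Rmult_1_l. assert (l' : (N <= n)%nat) by (unfold i2 in l; lia). apply le_INR in l'.
        specialize (HC n x y Hy). unfold Wnat in HC.
        apply Rle_div_r in HC; [|apply pow_lt; lra].
        eapply Rle_trans; [exact HC|].
        apply Rle_trans with (Rmax 0 C / (INR n + 1) ^ 3).
        + apply Rmult_le_compat_r; [left; apply Rinv_0_lt_compat, pow_lt; lra|apply Rmax_r].
        + replace (Rmax 0 C / (INR n + 1) ^ 3) with (Rmax 0 C / (INR n + 1) * / (INR n + 1) ^ 2) by (field; lra).
          apply Rmult_le_compat_r; [left; now apply Rinv_0_lt_compat|].
          apply Rmult_le_compat_l; [assumption|]. apply Rinv_le_contravar; lra.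
      - rewrite Rmult_0_l, Rabs_R0. apply Rmult_le_pos; [|left; now apply Rinv_0_lt_compat].
        apply Rdiv_le_0_compat; lra. }
    eapply Rle_trans; [apply (series_abs_le _ _ B); exact (ex_series_scal_l (K := R_AbsRing) _ _ ex_series_inv_sq)|].
    rewrite Series_scal_l. fold Sg. pose proof (pos_INR N).
    replace (Rmax 0 C / (INR N + 1) * Sg) with (Rmax 0 C * Sg / (INR N + 1)) by (field; lra).
    apply Rle_div_l; [lra|]. pose proof (Rmax_r 0 (4 * Rmax 0 C * Sg)). lra.
  - intros y j k hj y0 hu hA.
    assert (S1 : forall i, i = j \/ i = S j -> shell kap i1 i y).
    { intros i hi. split; [unfold i2 in hj; lia|]. split; [assumption|].
      destruct hi as [-> | ->]; rewrite ?S_INR; lra. }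
    rewrite (Series_two _ j).
    + unfold h. destruct (Nat.leb_spec i2 j); [|lia]. destruct (Nat.leb_spec i2 (S j)); [|lia].
      rewrite !patch_lattice by (auto using S1).
      destruct (hat_frac j (kap / y - INR j)) as [e1 e2]; [lra|lra|].
      replace (INR j + (kap / y - INR j)) with (kap / y) in e1, e2 by ring. rewrite e1, e2. ring.
    + intros n n1 n2. unfold h. rewrite patch0_far; [ring|].
      destruct (Nat.lt_trichotomy n j) as [l|[l|l]]; [|lia|].
      * assert (l' : (S n <= j)%nat) by lia. apply le_INR in l'. rewrite S_INR in l'.
        rewrite Rabs_pos_eq; lra.
      * assert (l' : (S (S j) <= n)%nat) by lia. apply le_INR in l'. rewrite !S_INR in l'.
        rewrite Rabs_left1; lra.
Qed.

End RealFamily.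

Lemma glue (th : nat * nat -> R -> C) :
  cCF (fun p : nat * nat => Wnat (fst p)) (Om2 (shell kap i1) rows) true (fun p _ y => th p y) ->
  exists f i2, csm f /\ (i1 <= i2)%nat /\ (forall x, f x 0 = RtoC 0) /\
  (forall x y, -1 < y < 1 -> Rabs (fst (f x y)) <= 1 / 4 /\ Rabs (snd (f x y)) <= 1 / 4) /\
  forall y j k, (i2 <= j)%nat -> 0 < y -> INR j <= kap / y < INR j + 1 -> Rabs (IZR k * y) <= A ->
    f (IZR k * y)%R y = ((1 - step (kap / y - INR j))%R * th (j, idx j k) y + step (kap / y - INR j) * th (S j, idx (S j) k) y)%C.
Proof.
  intros [T1 T2]. destruct (glue_real (fun p y => fst (th p y)) T1) as (f & i2 & Sf & h2 & f0 & bf & Hf).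
  destruct (glue_real (fun p y => snd (th p y)) T2) as (g & i3 & Sg & h3 & g0 & bg & Hg).
  exists (fun x y => (f x y, g x y)), (Nat.max i2 i3). split; [split; assumption|]. split; [lia|].
  split; [intros x; now rewrite f0, g0|]. split; [intros x y Hy; split; simpl; auto|].
  intros y j k hj y0 hu hA.
  apply C_ext; simpl; [rewrite (Hf y j k)|rewrite (Hg y j k)]; auto; try lia; ring.
Qed.

End Glue.

Lemma finite_max_nat n (f : nat -> nat) : exists N, forall p, (p <= n)%nat -> (f p <= N)%nat.
Proof.
  induction n as [|n [N H]].
  - exists (f O). intros p hp. replace p with O by lia. lia.
  - exists (Nat.max N (f (S n))). intros p hp. destruct (Nat.eq_dec p (S n)) as [->|ne]; [lia|].
    specialize (H p ltac:(lia)). lia.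
Qed.

Lemma shell_mono kap i1 i2 i y : (i1 <= i2)%nat -> shell kap i2 i y -> shell kap i1 i y.
Proof. intros h (a & b). split; [lia|exact b]. Qed.

(** 1 + de stays in the half-plane Re >= 3/4, where a logarithm is (1/2) ln(Re^2 + Im^2) + i atan(Im
    / Re). *)
Lemma csm_log1p (de : R -> R -> C) : csm de ->
  (forall x y, -1 < y < 1 -> Rabs (fst (de x y)) <= 1 / 4 /\ Rabs (snd (de x y)) <= 1 / 4) ->
  (forall x, de x 0 = RtoC 0) ->
  exists La, csm La /\ (forall x, La x 0 = RtoC 0) /\ forall x y, -1 < y < 1 -> Cexp (La x y) = (1 + de x y)%C.
Proof.
  intros [S1 S2] B Z.
  set (u := fun x y => 1 + fst (de x y)). set (v := fun x y => snd (de x y)).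
  assert (Su : sm u) by (apply sm_plus; [apply sm_const|exact S1]).
  assert (Bu : forall x y, -1 < y < 1 -> 3 / 4 <= u x y).
  { intros x y Hy. destruct (B x y Hy) as [b _]. apply Rabs_le_between in b. unfold u. lra. }
  exists (fun x y => (/ 2 * ln (u x y ^ 2 + v x y ^ 2), atan (v x y * / u x y))). split; [split|split].
  - apply (CF_scal false (/ 2) (fun _ x y => ln (u x y ^ 2 + v x y ^ 2))).
    apply (CF_ln (fun _ x y => u x y ^ 2 + v x y ^ 2) (9 / 16)); [lra| |].
    + apply CF_plus; [apply (CF_pow (fun _ => u)); exact Su|apply (CF_pow (fun _ => v)); exact S2].
    + intros i x y O. specialize (Bu x y O). pose proof (pow2_ge_0 (v x y)). nra.
  - apply (CF_atan_flat false (fun _ x y => v x y * / u x y)).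
    apply (CF_mult false (fun _ => v)); [exact S2|].
    apply (CF_inv (fun _ => u) (3 / 4)); [lra|exact Su|].
    intros i x y O. specialize (Bu x y O). rewrite Rabs_pos_eq; lra.
  - intros x. unfold u, v. rewrite Z. simpl. replace ((1 + 0) * ((1 + 0) * 1) + 0 * (0 * 1)) with 1 by ring.
    rewrite ln_1, Rmult_0_l, atan_0. unfold RtoC. f_equal. ring.
  - intros x y Hy. specialize (Bu x y Hy). set (p := u x y) in *. set (q := v x y).
    assert (Q : 0 < p ^ 2 + q ^ 2) by (pose proof (pow2_ge_0 q); nra).
    assert (E1 : exp (/ 2 * ln (p ^ 2 + q ^ 2)) = sqrt (p ^ 2 + q ^ 2)).
    { apply Rsqr_inj; [left; apply exp_pos|apply sqrt_pos|].
      rewrite Rsqr_sqrt by lra. unfold Rsqr. rewrite <- exp_plus.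
      replace (/ 2 * ln (p ^ 2 + q ^ 2) + / 2 * ln (p ^ 2 + q ^ 2)) with (ln (p ^ 2 + q ^ 2)) by field.
      now apply exp_ln. }
    assert (E2 : sqrt (1 + (q * / p)²) = sqrt (p ^ 2 + q ^ 2) / p).
    { apply Rsqr_inj; [apply sqrt_pos|apply Rdiv_le_0_compat; [apply sqrt_pos|lra]|].
      pose proof (Rle_0_sqr (q * / p)). rewrite Rsqr_div', !Rsqr_sqrt by lra. unfold Rsqr. field. lra. }
    pose proof (sqrt_lt_R0 _ Q) as Q'.
    unfold Cexp. cbn [fst snd]. rewrite E1, cos_atan, sin_atan, E2.
    set (R0q := sqrt (p ^ 2 + q ^ 2)) in *. apply C_ext; cbn [fst snd Cplus RtoC].
    + change (1 + fst (de x y)) with p. field. lra.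
    + change (snd (de x y)) with q. rewrite Rplus_0_l. field. lra.
Qed.

(** * Joining the corrections of different pieces *)

Section Combine.
Variables (d P : nat) (lo hi : R) (lft rgt : nat -> R).
Hypothesis Hin : forall p, (1 <= p <= P)%nat -> lo <= lft p /\ lft p <= rgt p /\ rgt p <= hi.
Hypothesis Hsep : forall p q, (1 <= p <= P)%nat -> (1 <= q <= P)%nat -> p <> q ->
  Rmin (rgt p) (rgt q) <= Rmax (lft p) (lft q).
Variables (kap : R) (i1 : nat).
Hypothesis Hkap : 8 * (Rabs lo + Rabs hi + 1) <= kap.
Variable D : nat -> nat * nat -> R -> C.
Let nd p i := nodes (lft p) (rgt p) kap i.
Let kl p i := kappa kap (lft p) i.
Let kr p i := kappa kap (rgt p) i.
Hypothesis HD : forall p, (1 <= p <= P)%nat ->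
  cCF (fun p : nat * nat => Wnat (fst p)) (Om2 (shell kap i1) (fun i => S (nd p i))) true (fun q _ y => D p q y).

(** The node number of the lattice point k in piece p, clamped to 0 on the left by [Z.to_nat] and to
    the last node on the right. *)
Definition slot (p i : nat) (k : Z) : nat := Nat.min (nd p i) (Z.to_nat (k - kl p i)).

(* Constant in [k] on the other pieces, hence invisible to the recurrence there. *)
Definition fac (p i : nat) (k : Z) (y : R) : C := ((1 + D p (i, slot p i k) y) / (1 + D p (i, O) y))%C.

Fixpoint facs (n i : nat) (k : Z) (y : R) : C :=
  match n with O => RtoC 1 | S n' => (facs n' i k y * fac (S n') i k y)%C end.

Lemma kap_8 : 8 <= kap.
Proof. pose proof (Rabs_pos lo). pose proof (Rabs_pos hi). lra. Qed.

Lemma nd_Z p i : (1 <= p <= P)%nat -> Z.of_nat (nd p i) = (kr p i - kl p i)%Z.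
Proof.
  intros hp. destruct (Hin p hp) as (h1 & h2 & h3). pose proof kap_8.
  unfold nd, nodes. rewrite Z2Nat.id; [reflexivity|].
  assert (kl p i <= kr p i)%Z by (apply kappa_mono; lra). unfold kl, kr in *. lia.
Qed.

(** On piece p the factor of any other piece is constant in k: pieces meet at most in endpoints and
    [kappa] is monotone, so all k of piece p are clamped to the same end of the other piece; a
    one-point piece has a single slot anyway. *)
Lemma facs_piece p i y : (1 <= p <= P)%nat -> lft p < rgt p -> forall n, (n <= P)%nat ->
  exists G, forall k, (kl p i <= k <= kr p i)%Z ->
    facs n i k y = (G * (if le_dec p n then 1 + D p (i, Z.to_nat (k - kl p i)) y else 1))%C.
Proof.
  intros hp hlr n. pose proof kap_8. induction n as [|n IH]; intros hn.
  - exists (RtoC 1). intros k hk. destruct (le_dec p 0); [lia|]. simpl. ring.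
  - destruct (IH ltac:(lia)) as [G HG]. destruct (Nat.eq_dec p (S n)) as [e|ne].
    + exists (G / (1 + D p (i, O) y))%C. intros k hk. simpl. rewrite HG by assumption.
      destruct (le_dec p n); [lia|]. destruct (le_dec p (S n)); [|lia]. rewrite <- e. unfold fac.
      replace (slot p i k) with (Z.to_nat (k - kl p i)); [unfold Cdiv; ring|].
      unfold slot. pose proof (nd_Z p i hp). lia.
    + assert (Q : exists r, forall k, (kl p i <= k <= kr p i)%Z -> slot (S n) i k = r).
      { assert (hq : (1 <= S n <= P)%nat) by lia. pose proof (Hsep p (S n) hp hq ne) as sep.
        destruct (Hin (S n) hq) as (_ & hq2 & _). pose proof (nd_Z (S n) i hq) as ndq.
        assert (cases : rgt (S n) <= lft p \/ rgt p <= lft (S n) \/ rgt (S n) <= lft (S n)).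
        { unfold Rmin, Rmax in sep. destruct (Rle_dec _ _), (Rle_dec _ _); lra. }
        destruct cases as [c|[c|c]].
        - exists (nd (S n) i). intros k hk. unfold slot.
          assert (kr (S n) i <= kl p i)%Z by (apply kappa_mono; lra). lia.
        - exists O. intros k hk. unfold slot.
          assert (kr p i <= kl (S n) i)%Z by (apply kappa_mono; lra). lia.
        - exists O. intros k hk. unfold slot.
          assert (kr (S n) i <= kl (S n) i)%Z by (apply kappa_mono; lra). lia. }
      destruct Q as [r Hr].
      exists (G * ((1 + D (S n) (i, r) y) / (1 + D (S n) (i, O) y)))%C. intros k hk. simpl.
      rewrite HG by assumption. unfold fac. rewrite Hr by assumption.
      destruct (le_dec p n), (le_dec p (S n)); try lia; ring.
Qed.

Lemma D_small : exists i2, (i1 <= i2)%nat /\ forall p, (1 <= p <= P)%nat -> forall i y, shell kap i2 i y ->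
  forall r, (r <= nd p i)%nat -> Cmod (D p (i, r) y) <= 1 / 2.
Proof.
  assert (A : forall p, exists N, (1 <= p <= P)%nat -> forall i y, shell kap (Nat.max i1 N) i y ->
    forall r, (r <= nd p i)%nat -> Cmod (D p (i, r) y) <= 1 / 2).
  { intros p. destruct (le_dec 1 p) as [h1|h1]; [|exists O; intros; lia].
    destruct (le_dec p P) as [h2|h2]; [|exists O; intros; lia].
    destruct (cCF_bnd_true _ (HD p (conj h1 h2)) 1%nat) as (K & K0 & HK).
    destruct (nfloor_ex (2 * K) ltac:(lra)) as (N & _ & HN). exists N. intros _ i y S r hr.
    specialize (HK (i, r) 0 y). simpl in HK.
    assert (O : Om2 (shell kap i1) (fun i => Datatypes.S (nd p i)) (i, r) y).
    { split; [apply (shell_mono kap i1 (Nat.max i1 N)); [lia|exact S]|simpl; lia]. }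
    specialize (HK O). rewrite Rmult_1_r in HK. apply Rle_div_r in HK; [|pose proof (Wnat_ge1 i); lra].
    eapply Rle_trans; [exact HK|]. apply Rle_div_l; [pose proof (Wnat_ge1 i); lra|].
    destruct S as (hS & _). assert (hN : (N <= i)%nat) by lia. apply le_INR in hN. unfold Wnat. lra. }
  destruct (choose _ A) as [N HN]. destruct (finite_max_nat P N) as [M HM].
  exists (Nat.max i1 M). split; [lia|]. intros p hp i y S. apply (HN p hp i y).
  specialize (HM p ltac:(lia)). apply (shell_mono kap _ (Nat.max i1 M)); [lia|exact S].
Qed.

(** Inverse of [idx]: the lattice number stored at this place. *)
Definition key (q : nat * nat) : Z := (Z.of_nat (snd q) - Z.of_nat (fst q) - 1)%Z.

Lemma one_plus_lower z : Cmod z <= 1 / 2 -> 1 / 2 <= Cmod (1 + z)%C.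
Proof.
  intros h. pose proof (Cmod_triangle (1 + z) (- z)) as T. rewrite Cmod_opp in T.
  replace (1 + z + - z)%C with (RtoC 1) in T by ring. rewrite Cmod_1 in T. lra.
Qed.

(** fac - 1 = (D(slot) - D(0)) / (1 + D(0)) is flat, the denominator having modulus at least 1/2,
    and u v - 1 = (u - 1) v + (v - 1) passes this to products. *)
Lemma facs_flat i2 : (i1 <= i2)%nat -> (forall p, (1 <= p <= P)%nat -> forall i y, shell kap i2 i y ->
    forall r, (r <= nd p i)%nat -> Cmod (D p (i, r) y) <= 1 / 2) ->
  forall n, (n <= P)%nat -> cCF (fun p : nat * nat => Wnat (fst p)) (Om2 (shell kap i2) rows) true
    (fun q _ y => facs n (fst q) (key q) y - 1)%C.
Proof.
  intros h12 sm n. set (W2 := fun p : nat * nat => Wnat (fst p)). set (O2 := Om2 (shell kap i2) rows).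
  assert (FR : frame W2 O2) by (apply (Om2_frame Wnat (shell kap i2) rows)).
  induction n as [|n IH]; intros hn.
  - apply (cCF_ext true (fun _ _ _ => RtoC 0)); [intros; simpl; ring|].
    split; simpl; intros N; apply Sm_zero.
  - specialize (IH ltac:(lia)). set (q1 := S n). assert (hq : (1 <= q1 <= P)%nat) by (unfold q1; lia).
    assert (A : forall sl : nat * nat -> nat, (forall q, (sl q <= nd q1 (fst q))%nat) ->
      cCF W2 O2 true (fun q _ y => D q1 (fst q, sl q) y)).
    { intros sl hsl. apply (cCF_reindex (WJ := W2) (OJ := Om2 (shell kap i1) (fun i => S (nd q1 i)))
        (fun q => (fst q, sl q)) true (fun q _ y => D q1 q y)).
      - intros q y [O _]. split; [now apply (shell_mono kap i1 i2)|simpl; specialize (hsl q); lia].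
      - reflexivity.
      - now apply HD. }
    assert (fl : cCF W2 O2 true (fun q _ y => fac q1 (fst q) (key q) y - 1)%C).
    { apply (cCF_ext true (fun q _ y => (D q1 (fst q, slot q1 (fst q) (key q)) y - D q1 (fst q, O) y) * / (1 + D q1 (fst q, O) y))%C).
      - intros q x y [Oq _]. unfold fac. assert (nz : (1 + D q1 (fst q, O) y)%C <> RtoC 0).
        { intros e. pose proof (one_plus_lower _ (sm q1 hq _ _ Oq O ltac:(lia))) as L. rewrite e, Cmod_0 in L. lra. }
        field. exact nz.
      - apply cCF_mult.
        + apply cCF_minus; [apply (A (fun q => slot q1 (fst q) (key q))); intros; unfold slot; lia|apply (A (fun _ => O)); intros; lia].
        + apply (cCF_inv (fun q _ y => 1 + D q1 (fst q, O) y)%C (1 / 2)); [lra| |].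
          * apply cCF_plus; [apply cCF_const|apply cCF_weaken, (A (fun _ => O)); intros; lia].
          * intros q x y [Oq _]. apply one_plus_lower. apply (sm q1 hq _ _ Oq). lia. }
    apply (cCF_ext true (fun q _ y => (facs n (fst q) (key q) y - 1) * (1 + (fac q1 (fst q) (key q) y - 1)) + (fac q1 (fst q) (key q) y - 1))%C).
    + intros q x y _. simpl. fold q1. ring.
    + apply cCF_plus; [|exact fl]. apply cCF_mult; [exact IH|].
      apply cCF_plus; [apply cCF_const|now apply cCF_weaken].
Qed.

Variable c : nat -> R -> R -> C.
Hypothesis Hc : forall p, (1 <= p <= P)%nat -> lft p < rgt p -> forall i y, shell kap i1 i y ->
  forall j, (j + S d <= nd p i)%nat ->
  csum (S (S d)) (fun s => c s (pos (lft p) kap i j * y)%R y * (1 + D p (i, (j + s)%nat) y))%C = RtoC 0.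

(** On piece p the product is a factor independent of k times 1 + D p, and the recurrence is
    linear. *)
Lemma combine_pieces : exists i2 th, (i1 <= i2)%nat /\
  cCF (fun p : nat * nat => Wnat (fst p)) (Om2 (shell kap i2) rows) true (fun q _ y => th q y) /\
  forall p, (1 <= p <= P)%nat -> lft p < rgt p -> forall i y, shell kap i2 i y ->
  forall k, (kl p i <= k)%Z -> (k + Z.of_nat (S d) <= kr p i)%Z ->
    csum (S (S d)) (fun s => c s (IZR k * y)%R y * (1 + th (i, idx i (k + Z.of_nat s)) y))%C = RtoC 0.
Proof.
  destruct D_small as (i2 & h12 & sm).
  exists i2, (fun q y => facs P (fst q) (key q) y - 1)%C. split; [assumption|]. split; [now apply facs_flat|].
  intros p hp hlr i y S k hk1 hk2. destruct (facs_piece p i y hp hlr P ltac:(lia)) as [G HG].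
  destruct (Hin p hp) as (h1 & h2 & h3). pose proof kap_8.
  assert (Bl : Rabs (IZR (kl p i)) <= Wnat i).
  { apply kappa_abs; [assumption|]. pose proof (Rabs_pos lo). pose proof (Rabs_pos hi).
    pose proof (Rle_abs hi). pose proof (Rabs_maj2 lo). apply Rabs_le. lra. }
  assert (Bk : (- Z.of_nat i - 1 <= kl p i)%Z).
  { apply le_IZR. rewrite minus_IZR, opp_IZR, <- INR_IZR_INZ. apply Rabs_le_between in Bl. unfold Wnat in Bl. lra. }
  pose proof (nd_Z p i hp) as ndZ.
  rewrite (csum_ext _ _ (fun s => G * (c s (pos (lft p) kap i (Z.to_nat (k - kl p i)) * y)%R y
     * (1 + D p (i, (Z.to_nat (k - kl p i) + s)%nat) y)))%C).
  - rewrite csum_mult_l, Hc; auto; [ring|now apply (shell_mono kap i1 i2)|lia].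
  - intros s hs. cbn [fst snd].
    replace (key (i, idx i (k + Z.of_nat s))) with (k + Z.of_nat s)%Z.
    + rewrite HG by lia. destruct (le_dec p P); [|lia].
      replace (pos (lft p) kap i (Z.to_nat (k - kl p i))) with (IZR k).
      * replace (Z.to_nat (k + Z.of_nat s - kl p i)) with (Z.to_nat (k - kl p i) + s)%nat by lia. ring.
      * unfold pos. fold (kl p i). rewrite INR_IZR_INZ, Z2Nat.id, minus_IZR by lia. ring.
    + unfold key, idx. simpl. lia.
Qed.

End Combine.

(** * The fundamental set *)

Section ExactModes.
Variables (d : nat) (a : nat -> R -> R -> C) (lo hi : R).
Hypothesis lohi : lo < hi.
Hypothesis Sa : forall j, csm (a j).
Variables (F : nat -> R -> R -> C) (g : nat -> R -> C).
Hypothesis SF : forall n, csm (F n).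
Hypothesis JF : forall n, (n < S d)%nat -> forall M, cjet M (fun x => lo <= x <= hi) (resid (S d) a (F n)).
Hypothesis Sg : forall n, csm (fun x _ => g n x).
Hypothesis HE : forall i x, (i < S d)%nat -> lo <= x <= hi ->
  csum (S d) (fun n => csum (S d - i) (fun t => a (i + 1 + t)%nat x 0 * Cexp (INR t * cDx (F n) x 0)) * g n x)%C
  = if Nat.eq_dec i 0 then RtoC 1 else RtoC 0.
Variables (P : nat) (lft rgt : nat -> R).
Hypothesis Hin : forall p, (1 <= p <= P)%nat -> lo <= lft p /\ lft p <= rgt p /\ rgt p <= hi.
Hypothesis Hsep : forall p q, (1 <= p <= P)%nat -> (1 <= q <= P)%nat -> p <> q ->
  Rmin (rgt p) (rgt q) <= Rmax (lft p) (lft q).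
Hypothesis Hord : forall p, (1 <= p <= P)%nat -> forall m n, (m < S d)%nat -> (n < S d)%nat ->
  (forall x, lft p <= x <= rgt p -> fst (cDx (F n) x 0) <= fst (cDx (F m) x 0)) \/
  (forall x, lft p <= x <= rgt p -> fst (cDx (F m) x 0) <= fst (cDx (F n) x 0)).

(** [exact_piece] for all pieces with a common first window. Degenerate pieces and indices out of
    range get the correction 0; nothing is claimed for them. *)
Lemma exact_pieces m kap ib : (m < S d)%nat -> 8 * (Rabs lo + Rabs hi + 1) <= kap -> kap + 4 <= INR ib ->
  exists i1 (D : nat -> nat * nat -> R -> C), (ib <= i1)%nat /\
  (forall p, cCF (fun q : nat * nat => Wnat (fst q))
     (Om2 (shell kap i1) (fun i => S (nodes (lft p) (rgt p) kap i))) true (fun q _ y => D p q y)) /\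
  forall p, (1 <= p <= P)%nat -> lft p < rgt p -> forall i y, shell kap i1 i y ->
  forall j, (j + S d <= nodes (lft p) (rgt p) kap i)%nat ->
  csum (S (S d)) (fun s => a s (pos (lft p) kap i j * y)%R y * Cexp (cdq (INR s) (F m) (pos (lft p) kap i j * y) y)
    * (1 + D p (i, (j + s)%nat) y))%C = RtoC 0.
Proof.
  intros Hm Hk Hib.
  assert (A : forall p, exists q : nat * (nat * nat -> R -> C), (ib <= fst q)%nat /\
    cCF (fun p : nat * nat => Wnat (fst p)) (Om2 (shell kap (fst q)) (fun i => S (nodes (lft p) (rgt p) kap i))) true (fun p _ y => snd q p y) /\
    ((1 <= p <= P)%nat -> lft p < rgt p -> forall i y, shell kap (fst q) i y ->
     forall j, (j + S d <= nodes (lft p) (rgt p) kap i)%nat ->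
     csum (S (S d)) (fun s => a s (pos (lft p) kap i j * y)%R y * Cexp (cdq (INR s) (F m) (pos (lft p) kap i j * y) y)
     * (1 + snd q (i, (j + s)%nat) y))%C = RtoC 0)).
  { intros p. destruct (excluded_middle_informative ((1 <= p <= P)%nat /\ lft p < rgt p)) as [[hp hl]|no].
    - destruct (Hin p hp) as (h1 & h2 & h3).
      assert (B : forall n, exists b : bool, (n < S d)%nat -> forall x, lft p <= x <= rgt p ->
        if b then fst (cDx (F n) x 0) <= fst (cDx (F m) x 0) else fst (cDx (F m) x 0) <= fst (cDx (F n) x 0)).
      { intros n. destruct (lt_dec n (S d)) as [hn|hn]; [|exists true; intros; lia].
        destruct (Hord p hp m n Hm hn) as [H|H]; [exists true|exists false]; intros _; exact H. }
      destruct (choose _ B) as [side Hside].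
      destruct (exact_piece d a lo hi lohi Sa F g SF JF Sg HE m Hm (lft p) (rgt p) side ltac:(lra)
        (fun n x hn => Hside n hn x) kap ib Hk Hib) as (i1 & D & Q1 & Q2 & Q3).
      exists (i1, D). simpl. auto.
    - exists (ib, fun _ _ => RtoC 0). simpl. split; [lia|]. split.
      + assert (FR := Om2_frame Wnat (shell kap ib) (fun i => S (nodes (lft p) (rgt p) kap i))).
        split; simpl; intros N; apply Sm_zero.
      + intros hp hl. now destruct no. }
  destruct (choose _ A) as [q Hq]. destruct (finite_max_nat P (fun p => fst (q p))) as [N HN].
  exists (Nat.max ib N), (fun p => if le_dec p P then snd (q p) else fun _ _ => RtoC 0).
  split; [lia|]. split.
  - intros p. destruct (le_dec p P) as [hp|hp].
    + destruct (Hq p) as (q1 & q2 & _). specialize (HN p hp).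
      apply (cCF_reindex (WJ := fun q : nat * nat => Wnat (fst q))
        (OJ := Om2 (shell kap (fst (q p))) (fun i => S (nodes (lft p) (rgt p) kap i))) (fun r => r) true (fun r _ y => snd (q p) r y)).
      * intros r y [Or h]. split; [apply (shell_mono kap _ (Nat.max ib N)); [simpl in HN; lia|exact Or]|exact h].
      * reflexivity.
      * exact q2.
    + assert (FR := Om2_frame Wnat (shell kap (Nat.max ib N)) (fun i => S (nodes (lft p) (rgt p) kap i))).
      split; simpl; intros M; apply Sm_zero.
  - intros p hp hl i y Sh. destruct (le_dec p P); [|lia]. destruct (Hq p) as (q1 & _ & q3).
    apply (q3 hp hl). specialize (HN p l). apply (shell_mono kap _ (Nat.max ib N)); [simpl in HN; lia|exact Sh].
Qed.

(** At a given y the glued correction is a convex combination, with weights independent of k, of the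
    corrections for two neighbouring windows. Both satisfy the linear recurrence, hence so does the
    combination, and La is the logarithm of 1 plus it. *)
Lemma exact_mode m : (m < S d)%nat -> exists La e, csm La /\ (forall x, La x 0 = RtoC 0) /\ 0 < e < 1 /\
  forall p, (1 <= p <= P)%nat -> lft p < rgt p -> forall y, 0 < y < e -> forall k,
  lft p <= IZR k * y -> IZR (k + Z.of_nat (S d)) * y <= rgt p ->
  csum (S (S d)) (fun s => a s (IZR k * y)%R y * Cexp (cdq (INR s) (F m) (IZR k * y) y)
    * Cexp (La (IZR (k + Z.of_nat s) * y)%R y))%C = RtoC 0.
Proof.
  intros Hm. set (A := Rabs lo + Rabs hi + 1). set (kap := 8 * A).
  pose proof (Rabs_pos lo) as l0. pose proof (Rabs_pos hi) as h0.
  assert (k8 : 8 <= kap) by (unfold kap, A; lra).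
  destruct (nfloor_ex (kap + 4) ltac:(lra)) as (ib0 & _ & hib0).
  assert (hib : kap + 4 <= INR (S ib0)) by (rewrite S_INR; lra).
  destruct (exact_pieces m kap (S ib0) Hm ltac:(unfold kap, A; lra) hib) as (i1 & D & hi1 & HD & Hs).
  assert (hI1 : kap + 4 <= INR i1) by (apply le_INR in hi1; lra).
  destruct (combine_pieces d P lo hi lft rgt Hin Hsep kap i1 ltac:(unfold kap, A; lra) D
    (fun p _ => HD p) (fun s x y => a s x y * Cexp (cdq (INR s) (F m) x y))%C Hs) as (i2 & th & h12 & Fth & Hth).
  assert (hI2 : kap + 4 <= INR i2) by (apply le_INR in h12; lra).
  destruct (glue kap A i2 k8 hI2 ltac:(unfold kap, A; lra) th Fth) as (f & i3 & Sf & h23 & f0 & Bf & Hf).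
  destruct (csm_log1p f Sf Bf f0) as (La & SL & L0 & HL).
  (* For smaller y, kap / y > i3 + 1, so the window number j is at least i3. *)
  exists La, (kap / (INR i3 + 1)). split; [exact SL|]. split; [exact L0|].
  assert (hI3 : kap + 4 <= INR i3) by (apply le_INR in h23; lra).
  split; [split; [apply Rdiv_lt_0_compat; lra|apply Rlt_div_l; lra]|].
  intros p hp hl y [y0 y1] k hk1 hk2.
  apply Rlt_div_r in y1; [|lra].
  assert (U : INR i3 + 1 < kap / y) by (apply Rlt_div_r; [assumption|lra]).
  destruct (nfloor_ex (kap / y) ltac:(lra)) as (j & hj).
  assert (hj3 : (i3 <= j)%nat).
  { apply Nat.nlt_ge. intros h. assert (h' : (S j <= i3)%nat) by lia. apply le_INR in h'. rewrite S_INR in h'. lra. }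
  assert (y1' : y < 1) by (apply Rmult_lt_reg_r with (INR i3 + 1); lra).
  assert (Sh : forall i, i = j \/ i = S j -> shell kap i2 i y).
  { intros i hi'. split; [lia|]. split; [assumption|]. destruct hi' as [-> | ->]; rewrite ?S_INR; lra. }
  destruct (Hin p hp) as (q1 & q2 & q3).
  assert (In : forall x, lo <= x <= hi -> Rabs x <= A).
  { intros x hx. pose proof (Rle_abs hi). pose proof (Rabs_maj2 lo). unfold A. apply Rabs_le. lra. }
  assert (Pt : forall s, (s < S (S d))%nat -> lft p <= IZR (k + Z.of_nat s) * y <= rgt p).
  { intros s hs. split.
    - eapply Rle_trans; [exact hk1|]. apply Rmult_le_compat_r; [lra|]. apply IZR_le. lia.
    - eapply Rle_trans; [|exact hk2]. apply Rmult_le_compat_r; [lra|]. apply IZR_le. lia. }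
  assert (Row : forall i, i = j \/ i = S j ->
    csum (S (S d)) (fun s => a s (IZR k * y)%R y * Cexp (cdq (INR s) (F m) (IZR k * y) y) * (1 + th (i, idx i (k + Z.of_nat s)) y))%C = RtoC 0).
  { intros i hi'. apply (Hth p hp hl i y (Sh i hi')).
    - apply (kappa_le_lattice kap i2 k8 hI2 (lft p) i y k (Sh i hi')); [|assumption].
      replace (kap / 8) with A by (unfold kap; field). apply In. lra.
    - apply (lattice_le_kappa kap i2 k8 hI2 (rgt p) i y _ (Sh i hi')); [|assumption].
      replace (kap / 8) with A by (unfold kap; field). apply In. lra. }
  set (w := step (kap / y - INR j)) in *.
  rewrite (csum_ext _ _ (fun s =>
     (1 - w)%R * (a s (IZR k * y)%R y * Cexp (cdq (INR s) (F m) (IZR k * y) y) * (1 + th (j, idx j (k + Z.of_nat s)) y))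
     + w * (a s (IZR k * y)%R y * Cexp (cdq (INR s) (F m) (IZR k * y) y) * (1 + th (S j, idx (S j) (k + Z.of_nat s)) y)))%C).
  - rewrite csum_plus, !csum_mult_l, !Row by auto. ring.
  - intros s hs. rewrite HL by lra. pose proof (Pt s hs).
    rewrite (Hf y j (k + Z.of_nat s)%Z hj3 y0 hj) by (apply In; lra). fold w.
    rewrite RtoC_minus. ring.
Qed.

End ExactModes.

Section Modes.
Variables (d : nat) (a : nat -> R -> R -> C) (lo hi : R) (z : nat -> R -> C).
Hypothesis lohi : lo < hi.
Hypothesis Sa : forall j, csm (a j).
Hypothesis Sz : forall n, csm (fun x _ => z n x).
Let c x j : C := a j x 0.
Hypothesis Hroot : forall x, lo <= x <= hi -> forall n, (n < S d)%nat -> peval (S d) (c x) (z n x) = RtoC 0.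
Hypothesis Hdist : forall x, lo <= x <= hi -> forall m n, (m < S d)%nat -> (n < S d)%nat -> m <> n -> z m x <> z n x.
Hypothesis Hlead : forall x, lo <= x <= hi -> a (S d) x 0 <> RtoC 0.
Hypothesis Hz0 : forall x, lo <= x <= hi -> forall n, (n < S d)%nat -> z n x <> RtoC 0.

Let pd n x : C := pder d (c x) (fun m => z m x) n.

Lemma csm_pquot n i : csm (fun x _ => pquot (S d) (c x) (z n x) i).
Proof.
  apply (csm_csum (S d - i) (fun t x _ => a (i + 1 + t)%nat x 0 * Cpow (z n x) t)%C).
  intros t _. apply csm_mult; [apply (csm_restrict (a (i + 1 + t)%nat)), Sa|].
  apply (csm_pow (fun x _ => z n x)), Sz.
Qed.

Lemma csm_pder n : csm (fun x _ => pd n x).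
Proof.
  apply (csm_csum (S d) (fun j x _ => pquot (S d) (c x) (z n x) j * Cpow (z n x) j)%C).
  intros t _. apply csm_mult; [apply csm_pquot|]. apply (csm_pow (fun x _ => z n x)), Sz.
Qed.

Lemma csm_inverse_on (f : R -> C) : csm (fun x _ => f x) -> (forall x, lo <= x <= hi -> f x <> RtoC 0) ->
  exists g : R -> C, csm (fun x _ => g x) /\ forall x, lo <= x <= hi -> (f x * g x)%C = RtoC 1.
Proof.
  intros S N. destruct (csm_nonzero_bound lo hi (fun x _ => f x) ltac:(lra) S N) as (m & m0 & Hm).
  destruct (csm_recip _ m m0 S) as (g & Sg & Hg).
  exists (fun x => g x 0). split; [now apply csm_restrict|]. intros x Hx. apply Hg; [lra|auto].
Qed.

Lemma inverse_derivatives : exists g : nat -> R -> C, (forall n, csm (fun x _ => g n x)) /\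
  forall n x, (n < S d)%nat -> lo <= x <= hi -> g n x = (/ pd n x)%C.
Proof.
  assert (A : forall n, exists g : R -> C, csm (fun x _ => g x) /\
    ((n < S d)%nat -> forall x, lo <= x <= hi -> g x = (/ pd n x)%C)).
  { intros n. destruct (lt_dec n (S d)) as [hn|hn].
    - assert (N : forall x, lo <= x <= hi -> pd n x <> RtoC 0).
      { intros x Hx. exact (pder_neq_0 d (c x) (fun m => z m x) (Hdist x Hx) (Hroot x Hx) (Hlead x Hx) n hn). }
      destruct (csm_inverse_on (pd n) (csm_pder n) N) as (g & Sg & Hg). exists g. split; [exact Sg|].
      intros _ x Hx. specialize (N x Hx). transitivity (/ pd n x * (pd n x * g x))%C; [field; exact N|].
      rewrite Hg by assumption. ring.
    - exists (fun _ => RtoC 0). split; [apply csm_const|]. intros; lia. }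
  destruct (choose _ A) as [g Hg]. exists g. split; intros; apply Hg; auto.
Qed.

(** [wkb_formal] with L a logarithm of lambda_n and cinv = 1 / (lambda_n P'(lambda_n));
    [peval_deriv] identifies the sum in its hypothesis as lambda_n P'(lambda_n). *)
Lemma wkb_modes : exists F : nat -> R -> R -> C, (forall n, csm (F n)) /\ forall n, (n < S d)%nat ->
  (forall x, lo <= x <= hi -> Cexp (cDx (F n) x 0) = z n x) /\
  forall M, cjet M (fun x => lo <= x <= hi) (resid (S d) a (F n)).
Proof.
  destruct inverse_derivatives as (g & Sg & Hg).
  assert (A : forall n, exists F : R -> R -> C, csm F /\ ((n < S d)%nat ->
    (forall x, lo <= x <= hi -> Cexp (cDx F x 0) = z n x) /\
    forall M, cjet M (fun x => lo <= x <= hi) (resid (S d) a F))).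
  { intros n. destruct (lt_dec n (S d)) as [hn|hn]; [|exists (fun _ _ => RtoC 0); split; [apply csm_const|intros; lia]].
    destruct (smooth_log lo hi (z n) ltac:(lra) (Sz n) (fun x Hx => Hz0 x Hx n hn)) as (L & SL & HL).
    destruct (csm_inverse_on (z n) (Sz n) (fun x Hx => Hz0 x Hx n hn)) as (zi & Szi & Hzi).
    destruct (wkb_formal (S d) a Sa lo hi (Rabs lo + Rabs hi + 1)) with (L := L) (cinv := fun x => (zi x * g n x)%C)
      as (F & SF & HF & JF).
    - pose proof (Rabs_pos lo). pose proof (Rabs_pos hi). lra.
    - intros x Hx. pose proof (Rabs_pos lo). pose proof (Rabs_pos hi).
      pose proof (Rle_abs hi). pose proof (Rabs_maj2 lo). apply Rabs_le. lra.
    - exact SL.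
    - apply csm_mult; auto.
    - intros x Hx. rewrite <- (Hroot x Hx n hn). unfold peval. apply csum_ext. intros j _.
      unfold c. now rewrite <- Cexp_pow, HL.
    - intros x Hx. rewrite (csum_ext _ _ (fun j => c x j * Cpow (z n x) j * INR j)%C).
      + rewrite <- peval_deriv. change (csum (S d) (fun i => pquot (S d) (c x) (z n x) i * z n x ^ i)%C) with (pd n x).
        rewrite Hg by auto. assert (N : pd n x <> RtoC 0) by exact (pder_neq_0 d (c x) (fun m => z m x) (Hdist x Hx) (Hroot x Hx) (Hlead x Hx) n hn).
        transitivity ((z n x * zi x) * (pd n x * / pd n x))%C; [ring|].
        rewrite Hzi, Cinv_r by assumption. ring.
      + intros j _. unfold c. now rewrite <- Cexp_pow, HL.
    - exists F. split; [exact SF|]. intros _. split; [|exact JF]. intros x Hx. now rewrite HF, HL. }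
  destruct (choose _ A) as [F HF]. exists F. split; intros; now apply HF.
Qed.

Variables (P : nat) (lft rgt : nat -> R).
Hypothesis Hin : forall p, (1 <= p <= P)%nat -> lo <= lft p /\ lft p <= rgt p /\ rgt p <= hi.
Hypothesis Hsep : forall p q, (1 <= p <= P)%nat -> (1 <= q <= P)%nat -> p <> q ->
  Rmin (rgt p) (rgt q) <= Rmax (lft p) (lft q).
Hypothesis Hord : forall p, (1 <= p <= P)%nat -> forall m n, (m < S d)%nat -> (n < S d)%nat ->
  (forall x, lft p <= x <= rgt p -> Cmod (z n x) <= Cmod (z m x)) \/
  (forall x, lft p <= x <= rgt p -> Cmod (z m x) <= Cmod (z n x)).

Lemma wkb_seq_shift G x0 y k s : csm G -> 0 < y < 1 -> x0 = IZR k * y ->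
  wkb_seq G y (k + Z.of_nat s) = (wkb_seq G y k * Cexp (cdq (INR s) G x0 y))%C.
Proof.
  intros SG Hy ->. unfold wkb_seq. rewrite <- Cexp_plus. f_equal.
  rewrite plus_IZR, <- INR_IZR_INZ, Rmult_plus_distr_r.
  pose proof (cdq_spec (INR s) G (IZR k * y) y SG ltac:(lra)) as E.
  assert (Y : RtoC y <> RtoC 0) by (intros e; apply RtoC_inj in e; lra).
  transitivity (/ y * ((G (IZR k * y + INR s * y)%R y - G (IZR k * y)%R y) + G (IZR k * y)%R y))%C;
    rewrite RtoC_inv by lra; [ring|]. rewrite <- E. field. exact Y.
Qed.

Lemma exact_modes : exists (G : nat -> R -> R -> C) e, (forall n, csm (G n)) /\ 0 < e < 1 /\
  forall n, (n < S d)%nat -> (forall x, lo <= x <= hi -> Cexp (cDx (G n) x 0) = z n x) /\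
  forall p, (1 <= p <= P)%nat -> forall y, 0 < y < e -> forall k,
  lft p <= IZR k * y -> IZR (k + Z.of_nat (S d)) * y <= rgt p ->
  csum (S (S d)) (fun s => a s (IZR k * y)%R y * wkb_seq (G n) y (k + Z.of_nat s))%C = RtoC 0.
Proof.
  destruct wkb_modes as (F & SF & HF). destruct inverse_derivatives as (g & Sg & Hg).
  assert (HE : forall i x, (i < S d)%nat -> lo <= x <= hi ->
    csum (S d) (fun n => csum (S d - i) (fun t => a (i + 1 + t)%nat x 0 * Cexp (INR t * cDx (F n) x 0)) * g n x)%C
    = if Nat.eq_dec i 0 then RtoC 1 else RtoC 0).
  { intros i x hi' Hx.
    (* The power s = 0 of Lagrange's identity, with the powers of the roots rewritten as
       exponentials. *)
    pose proof (lagrange d (c x) (fun m => z m x) (Hdist x Hx) (Hroot x Hx) (Hlead x Hx) O i ltac:(lia) hi') as Lg.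
    transitivity (if Nat.eq_dec 0 i then RtoC 1 else RtoC 0); [|destruct (Nat.eq_dec 0 i), (Nat.eq_dec i 0); congruence].
    rewrite <- Lg. apply csum_ext. intros n hn. rewrite Hg by assumption. fold (pd n x). simpl (_ ^ 0)%C.
    rewrite Cmult_1_l, Cmult_comm. f_equal. unfold pquot. apply csum_ext. intros t _.
    rewrite <- Cexp_pow. now rewrite (proj1 (HF n hn)). }
  assert (Hre : forall n x, (n < S d)%nat -> lo <= x <= hi -> exp (fst (cDx (F n) x 0)) = Cmod (z n x)).
  { intros n x hn Hx. rewrite <- Cexp_mod. f_equal. now apply HF. }
  assert (Hord' : forall p, (1 <= p <= P)%nat -> forall m n, (m < S d)%nat -> (n < S d)%nat ->
    (forall x, lft p <= x <= rgt p -> fst (cDx (F n) x 0) <= fst (cDx (F m) x 0)) \/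
    (forall x, lft p <= x <= rgt p -> fst (cDx (F m) x 0) <= fst (cDx (F n) x 0))).
  { intros p hp m n hm hn. destruct (Hin p hp) as (p1 & p2 & p3).
    destruct (Hord p hp m n hm hn) as [H|H]; [left|right]; intros x Hx; specialize (H x Hx);
      rewrite <- !Hre in H by (auto; lra); apply Rnot_lt_le; intros q; apply exp_increasing in q; lra. }
  assert (A : forall n, exists q : (R -> R -> C) * R, csm (fst q) /\ (forall x, fst q x 0 = RtoC 0) /\ 0 < snd q < 1 /\
    ((n < S d)%nat -> forall p, (1 <= p <= P)%nat -> lft p < rgt p -> forall y, 0 < y < snd q -> forall k,
    lft p <= IZR k * y -> IZR (k + Z.of_nat (S d)) * y <= rgt p ->
    csum (S (S d)) (fun s => a s (IZR k * y)%R y * Cexp (cdq (INR s) (F n) (IZR k * y) y)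
      * Cexp (fst q (IZR (k + Z.of_nat s) * y)%R y))%C = RtoC 0)).
  { intros n. destruct (lt_dec n (S d)) as [hn|hn].
    - destruct (exact_mode d a lo hi lohi Sa F g SF (fun n hn => proj2 (HF n hn)) Sg HE P lft rgt Hin Hsep Hord' n hn)
        as (La & e & Q). exists (La, e). tauto.
    - exists (fun _ _ => RtoC 0, 1 / 2). simpl. split; [apply csm_const|]. split; [auto|]. split; [lra|]. intros; lia. }
  destruct (choose _ A) as [q Hq].
  destruct (finite_delta (S d) (fun n t => t <= snd (q n))) as (e & e0 & He).
  { intros n _. exists (snd (q n)). split; [apply Hq|lra]. }
  { intros; lra. }
  (* exp(G / y) = exp(F / y) exp(La): the correction enters with a factor y, so the slope at y = 0
     is still a logarithm of lambda_n. *)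
  set (G := fun n x y => (F n x y + RtoC y * fst (q n) x y)%C).
  assert (SG : forall n, csm (G n)).
  { intros n. apply csm_plus; [apply SF|]. apply csm_mult; [apply csm_RtoC, sm_y|apply Hq]. }
  exists G, (Rmin e (1 / 2)). split; [exact SG|]. split; [unfold Rmin; destruct (Rle_dec _ _); lra|].
  intros n hn. split.
  - intros x Hx. rewrite <- (proj1 (HF n hn) x Hx). f_equal. unfold cDx, Dx. f_equal; apply Derive_ext; intros t;
      unfold G; destruct (Hq n) as (_ & Z & _); rewrite Z; simpl; ring.
  - intros p hp y Hy k h1 h2. destruct (Hin p hp) as (p1 & p2 & p3).
    assert (y1 : y < e /\ y < 1 / 2) by (unfold Rmin in Hy; destruct (Rle_dec _ _); lra).
    (* Two lattice points S d steps apart fit into the piece, so it is nondegenerate. *)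
    assert (lr : lft p < rgt p).
    { eapply Rle_lt_trans; [exact h1|]. eapply Rlt_le_trans; [|exact h2]. apply Rmult_lt_compat_r; [lra|]. apply IZR_lt. lia. }
    destruct (Hq n) as (_ & _ & _ & H). specialize (H hn p hp lr y ltac:(specialize (He n hn); lra) k h1 h2).
    assert (W : forall j, wkb_seq (G n) y j = (wkb_seq (F n) y j * Cexp (fst (q n) (IZR j * y)%R y))%C).
    { intros j. unfold wkb_seq. rewrite <- Cexp_plus. f_equal. unfold G.
      assert (Y : RtoC y <> RtoC 0) by (intros u; apply RtoC_inj in u; lra).
      rewrite RtoC_inv by lra. field. exact Y. }
    transitivity (wkb_seq (F n) y k * 0)%C; [|ring]. rewrite <- H, <- csum_mult_l. apply csum_ext. intros s _.
    rewrite W, (wkb_seq_shift (F n) (IZR k * y) y k s (SF n) ltac:(lra) eq_refl). ring.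
Qed.

Section Fundamental.
Variable G : nat -> R -> R -> C.
Hypothesis SG : forall n, csm (G n).
Hypothesis HG : forall n, (n < S d)%nat -> forall x, lo <= x <= hi -> Cexp (cDx (G n) x 0) = z n x.

(** After division by the value at k the matrix entries are close to lambda_n^s. B inverts the
    limiting Vandermonde matrix by Lagrange's identity; the product of the actual matrix with B is
    the identity plus E, which vanishes at y = 0, and a Neumann series inverts it. *)
Lemma initial_values : exists e, 0 < e < 1 /\ forall y k, 0 < y < e -> lo <= IZR k * y <= hi -> forall r : nat -> C,
  exists K : nat -> C, forall s, (s < S d)%nat -> csum (S d) (fun n => K n * wkb_seq (G n) y (k + Z.of_nat s))%C = r s.
Proof.
  destruct inverse_derivatives as (g & Sg & Hg).
  set (B := fun n i x => (g n x * pquot (S d) (c x) (z n x) i)%C).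
  set (E := fun (q : nat * nat) x y => (csum (S d) (fun n => Cexp (cdq (INR (fst q)) (G n) x y) * B n (snd q) x)
     - (if Nat.eq_dec (fst q) (snd q) then RtoC 1 else RtoC 0))%C).
  assert (SE : forall q, csm (E q)).
  { intros q. apply csm_minus; [|apply csm_const].
    apply (csm_csum (S d) (fun n x y => Cexp (cdq (INR (fst q)) (G n) x y) * B n (snd q) x)%C). intros n _.
    apply csm_mult; [apply csm_exp, csm_cdq, SG|]. unfold B. apply csm_mult; [apply Sg|apply csm_pquot]. }
  assert (E0 : forall s i x, (s < S d)%nat -> (i < S d)%nat -> lo <= x <= hi -> E (s, i) x 0 = RtoC 0).
  { intros s i x hs hi' Hx. unfold E. simpl fst. simpl snd.
    pose proof (lagrange d (c x) (fun m => z m x) (Hdist x Hx) (Hroot x Hx) (Hlead x Hx) s i hs hi') as Lg.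
    rewrite <- Lg. rewrite (csum_ext _ _ (fun n => z n x ^ s * / pder d (c x) (fun m => z m x) n * pquot (S d) (c x) (z n x) i)%C); [ring|].
    intros n hn. unfold B. rewrite Hg by assumption. fold (pd n x). rewrite cdq_at_0, <- Cexp_pow, HG by auto. ring. }
  assert (ML : forall q, exists M, 0 <= M /\ forall x y, -1 < y < 1 -> Cmod (E q x y - E q x 0)%C <= M * Rabs y).
  { intros q. destruct (csm_lip _ (SE q)) as (M & M0 & HM). exists M. split; [assumption|]. intros x y Hy.
    eapply Rle_trans; [apply (HM x 0 x y); lra|]. rewrite !Rminus_diag, Rabs_R0, Rminus_0_r. lra. }
  destruct (choose _ ML) as [M HM].
  assert (U : exists U, 0 <= U /\ forall s i, (s < S d)%nat -> (i < S d)%nat -> M (s, i) <= U).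
  { destruct (choose _ (fun s => finite_upper (S d) (fun i => M (s, i)))) as [U HU].
    destruct (finite_upper (S d) U) as (V & V0 & HV). exists V. split; [assumption|]. intros s i hs hi'.
    eapply Rle_trans; [apply HU; assumption|auto]. }
  destruct U as (U & U0 & HU). pose proof (pos_INR d) as d0.
  (* The entries of E are at most U y; this bound on y makes a row of S d of them at most 1/2. *)
  exists (Rmin (1 / 2) (/ (2 * INR (S d) * (U + 1)))).
  assert (D1 : 1 <= INR (S d)) by (rewrite S_INR; lra).
  split; [unfold Rmin; destruct (Rle_dec _ _); split; try lra; apply Rinv_0_lt_compat; nra|].
  intros y k [y0 y1] Hx r. set (x := IZR k * y) in *.
  assert (y2 : y < 1 / 2 /\ y < / (2 * INR (S d) * (U + 1))) by (unfold Rmin in y1; destruct (Rle_dec _ _); lra).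
  assert (y3 : y * (2 * INR (S d) * (U + 1)) < 1).
  { apply Rlt_le_trans with (/ (2 * INR (S d) * (U + 1)) * (2 * INR (S d) * (U + 1))); [apply Rmult_lt_compat_r; nra|].
    rewrite Rinv_l by nra. lra. }
  destruct (system_solve (S d) (fun s i => - E (s, i) x y)%C r) as [f Hf].
  { intros s hs. apply Rle_trans with (rsum (S d) (fun _ => U * y)).
    - apply rsum_le. intros i hi'. rewrite Cmod_opp. destruct (HM (s, i)) as [_ H]. specialize (H x y ltac:(lra)).
      rewrite E0 in H by auto. replace (E (s, i) x y - 0)%C with (E (s, i) x y) in H by ring.
      rewrite Rabs_pos_eq in H by lra. eapply Rle_trans; [exact H|]. apply Rmult_le_compat_r; [lra|auto].
    - rewrite rsum_const. nra. }
  exists (fun n => csum (S d) (fun i => B n i x * f i) / wkb_seq (G n) y k)%C. intros s hs.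
  rewrite (csum_ext _ _ (fun n => csum (S d) (fun i => Cexp (cdq (INR s) (G n) x y) * B n i x * f i)))%C.
  - rewrite csum_swap.
    rewrite (csum_ext _ _ (fun i => E (s, i) x y * f i + (if Nat.eqb i s then f i else RtoC 0))%C).
    + rewrite csum_plus, csum_select. destruct (Nat.ltb_spec s (S d)); [|lia]. rewrite (Hf s hs).
      rewrite (csum_ext _ (fun i => - E (s, i) x y * f i)%C (fun i => (-1)%R * (E (s, i) x y * f i))%C) by (intros; rewrite RtoC_m1; ring).
      rewrite csum_mult_l, RtoC_m1. ring.
    + intros i hi'. rewrite csum_mult_r. unfold E. simpl fst. simpl snd.
      destruct (Nat.eq_dec s i), (Nat.eqb_spec i s); try congruence; ring.
  - intros n hn. rewrite (wkb_seq_shift (G n) x y k s (SG n) ltac:(lra) eq_refl).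
    assert (N : wkb_seq (G n) y k <> RtoC 0) by apply Cexp_neq_0.
    transitivity (csum (S d) (fun i => B n i x * f i) * Cexp (cdq (INR s) (G n) x y))%C; [field; exact N|].
    rewrite <- csum_mult_r. apply csum_ext. intros i _. ring.
Qed.

(** By continuity from y = 0; it allows the recurrence to be solved forward for its last value. *)
Lemma leading_nonzero : exists e, 0 < e < 1 /\ forall x y, lo <= x <= hi -> 0 < y < e -> a (S d) x y <> RtoC 0.
Proof.
  destruct (csm_nonzero_bound lo hi _ ltac:(lra) (Sa (S d)) Hlead) as (m & m0 & Hm).
  destruct (csm_lip _ (Sa (S d))) as (M & M0 & HM).
  assert (0 < m / (M + 1)) by (apply Rdiv_lt_0_compat; lra).
  exists (Rmin (1 / 2) (m / (M + 1))). split; [unfold Rmin; destruct (Rle_dec _ _); lra|].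
  intros x y Hx [y0 y1] Z.
  assert (y2 : y < 1 / 2 /\ y < m / (M + 1)) by (unfold Rmin in y1; destruct (Rle_dec _ _); lra).
  destruct y2 as [y2 y3]. apply Rlt_div_r in y3; [|lra].
  specialize (Hm x Hx). specialize (HM x 0 x y ltac:(lra) ltac:(lra)).
  rewrite Z, Rminus_diag, Rabs_R0, Rminus_0_r, (Rabs_pos_eq y) in HM by lra.
  replace (0 - a (S d) x 0%R)%C with (- a (S d) x 0%R)%C in HM by ring. rewrite Cmod_opp in HM. nra.
Qed.

End Fundamental.

Lemma zero_solution (u : Z -> C) y k0 rg : 0 < y ->
  (forall k, (k0 <= k)%Z -> IZR (k + Z.of_nat (S d)) * y <= rg ->
     a (S d) (IZR k * y)%R y <> RtoC 0 /\ csum (S (S d)) (fun s => a s (IZR k * y)%R y * u (k + Z.of_nat s)%Z)%C = RtoC 0) ->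
  (forall s, (s < S d)%nat -> u (k0 + Z.of_nat s)%Z = RtoC 0) ->
  forall t, IZR (k0 + Z.of_nat t) * y <= rg -> u (k0 + Z.of_nat t)%Z = RtoC 0.
Proof.
  intros y0 H I0 t. induction t as [t IH] using (well_founded_induction lt_wf). intros ht.
  destruct (lt_dec t (S d)) as [h|h]; [now apply I0|].
  set (k := (k0 + Z.of_nat (t - S d))%Z).
  assert (e : (k0 + Z.of_nat t = k + Z.of_nat (S d))%Z) by (unfold k; lia).
  destruct (H k ltac:(unfold k; lia) ltac:(rewrite <- e; exact ht)) as [N Q].
  change (csum (S (S d)) (fun s => a s (IZR k * y)%R y * u (k + Z.of_nat s)%Z)%C) with
    (csum (S d) (fun s => a s (IZR k * y)%R y * u (k + Z.of_nat s)%Z) + a (S d) (IZR k * y)%R y * u (k + Z.of_nat (S d))%Z)%C in Q.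
  rewrite csum_zero in Q.
  - rewrite Cplus_0_l in Q. apply Cmult_integral' in Q. rewrite e. now destruct Q.
  - intros s hs. replace (k + Z.of_nat s)%Z with (k0 + Z.of_nat (t - S d + s))%Z by (unfold k; lia).
    rewrite IH; [ring|lia|]. eapply Rle_trans; [|exact ht]. apply Rmult_le_compat_r; [lra|]. apply IZR_le. lia.
Qed.

(** The combination that matches v at S d consecutive lattice points, from the first one in the
    piece, agrees with v on the whole piece by forward recursion. With fewer lattice points in the
    piece the matching runs past its end, where v is arbitrary and nothing is claimed. *)
Lemma fundamental_modes : exists (G : nat -> R -> R -> C) e, (forall n, csm (G n)) /\ 0 < e < 1 /\
  forall y, 0 < y < e ->
  (forall n p, (n < S d)%nat -> (1 <= p <= P)%nat -> forall k,
    lft p <= IZR k * y -> IZR (k + Z.of_nat (S d)) * y <= rgt p ->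
    csum (S (S d)) (fun s => a s (IZR k * y)%R y * wkb_seq (G n) y (k + Z.of_nat s))%C = RtoC 0) /\
  forall (v : Z -> C) p, (1 <= p <= P)%nat -> (forall k,
    lft p <= IZR k * y -> IZR (k + Z.of_nat (S d)) * y <= rgt p ->
    csum (S (S d)) (fun s => a s (IZR k * y)%R y * v (k + Z.of_nat s)%Z)%C = RtoC 0) ->
  exists K : nat -> C, forall k, lft p <= IZR k * y <= rgt p -> v k = csum (S d) (fun n => K n * wkb_seq (G n) y k)%C.
Proof.
  destruct exact_modes as (G & e1 & SG & He1 & HG).
  destruct (initial_values G SG (fun n hn => proj1 (HG n hn))) as (e2 & He2 & IV).
  destruct leading_nonzero as (e3 & He3 & LN).
  exists G, (Rmin e1 (Rmin e2 e3)). split; [exact SG|].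
  split; [unfold Rmin; repeat destruct (Rle_dec _ _); lra|]. intros y Hy.
  assert (y1 : 0 < y < e1 /\ 0 < y < e2 /\ 0 < y < e3).
  { unfold Rmin in Hy. repeat destruct (Rle_dec _ _); lra. }
  destruct y1 as (y1 & y2 & y3). split.
  - intros n p hn hp. exact (proj2 (HG n hn) p hp y y1).
  - intros v p hp Hv. destruct (Hin p hp) as (p1 & p2 & p3).
    (* [up] gives the least integer strictly above its argument, so 1 - up(-q) is the least integer
       >= q, here with q = lft p / y. *)
    set (k0 := (1 - up (- (lft p / y)))%Z). destruct (archimed (- (lft p / y))) as [u1 u2].
    assert (K0 : IZR k0 = 1 - IZR (up (- (lft p / y)))) by (unfold k0; rewrite minus_IZR; ring).
    assert (L : lft p = lft p / y * y) by (field; lra).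
    assert (L0 : lft p <= IZR k0 * y) by (rewrite L at 1; apply Rmult_le_compat_r; lra).
    assert (Lk : forall k, lft p <= IZR k * y -> (k0 <= k)%Z).
    { intros k hk. apply Rle_div_l in hk; [|lra]. apply Znot_gt_le. intros q. assert (q' : (k + 1 <= k0)%Z) by lia.
      apply IZR_le in q'. rewrite plus_IZR in q'. lra. }
    destruct (Rle_dec (IZR k0 * y) (rgt p)) as [R0|R0].
    + destruct (IV y k0 y2 ltac:(lra) (fun s => v (k0 + Z.of_nat s)%Z)) as [K HK].
      exists K. intros k hk.
      set (u := fun k => (v k - csum (S d) (fun n => K n * wkb_seq (G n) y k))%C).
      assert (Z : u (k0 + Z.of_nat (Z.to_nat (k - k0)))%Z = RtoC 0).
      { specialize (Lk k (proj1 hk)). apply (zero_solution u y k0 (rgt p)); [lra| | |].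
        - intros j hj hj'. split.
          + apply LN; [|assumption]. apply IZR_le in hj.
            assert (IZR j <= IZR (j + Z.of_nat (S d))) by (apply IZR_le; lia). nra.
          + assert (hl : lft p <= IZR j * y) by (apply IZR_le in hj; nra).
            unfold u. rewrite (csum_ext _ _ (fun s => a s (IZR j * y)%R y * v (j + Z.of_nat s)%Z
               + (-1)%R * csum (S d) (fun n => K n * (a s (IZR j * y)%R y * wkb_seq (G n) y (j + Z.of_nat s))))%C).
            * rewrite csum_plus, csum_mult_l, csum_swap, Hv by assumption.
              rewrite (csum_zero (S d)); [ring|]. intros n hn. rewrite csum_mult_l.
              rewrite (proj2 (HG n hn) p hp y y1 j hl hj'). ring.
            * intros s _. rewrite RtoC_m1.
              rewrite (csum_ext _ (fun n => K n * (a s (IZR j * y)%R y * wkb_seq (G n) y (j + Z.of_nat s)))%C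
                (fun n => a s (IZR j * y)%R y * (K n * wkb_seq (G n) y (j + Z.of_nat s)))%C) by (intros; ring).
              rewrite csum_mult_l. ring.
        - intros s hs. unfold u. rewrite HK by assumption. ring.
        - replace (k0 + Z.of_nat (Z.to_nat (k - k0)))%Z with k by lia. lra. }
      specialize (Lk k (proj1 hk)). replace (k0 + Z.of_nat (Z.to_nat (k - k0)))%Z with k in Z by lia.
      unfold u in Z. transitivity ((v k - csum (S d) (fun n => K n * wkb_seq (G n) y k)) + csum (S d) (fun n => K n * wkb_seq (G n) y k))%C; [ring|].
      rewrite Z. ring.
    (* The piece contains no lattice point. *)
    + exists (fun _ => RtoC 0). intros k hk. exfalso. apply R0.
      specialize (Lk k (proj1 hk)). apply IZR_le in Lk. nra.
Qed.

End Modes.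

(** The chain along the permutation compares any two indices, in a direction that is the same for
    all x of the piece. This fixes the direction of summation for each pair of modes. *)
Lemma permutation_comparable l (i : nat -> nat) (h : nat -> R -> R) (X : R -> Prop) :
  Permutation (map i (seq 1 l)) (seq 1 l) ->
  (forall x, X x -> forall n, (1 <= n < l)%nat -> h (i n) x <= h (i (S n)) x) ->
  forall m n, (1 <= m <= l)%nat -> (1 <= n <= l)%nat ->
  (forall x, X x -> h n x <= h m x) \/ (forall x, X x -> h m x <= h n x).
Proof.
  intros Pm mono m n hm hn.
  assert (pre : forall m, (1 <= m <= l)%nat -> exists b, (1 <= b <= l)%nat /\ i b = m).
  { intros m' h'. assert (J : In m' (map i (seq 1 l))).
    { apply (Permutation_in _ (Permutation_sym Pm)). apply in_seq. lia. }
    apply in_map_iff in J. destruct J as (b & e & J). apply in_seq in J. exists b. split; [lia|exact e]. }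
  assert (chain : forall x, X x -> forall p q, (1 <= p)%nat -> (p <= q)%nat -> (q <= l)%nat -> h (i p) x <= h (i q) x).
  { intros x Hx p q hp hpq. induction hpq as [|q hpq IH]; intros hq; [lra|].
    eapply Rle_trans; [apply IH; lia|]. apply mono; [assumption|lia]. }
  destruct (pre m hm) as (b & hb & <-), (pre n hn) as (b' & hb' & <-).
  destruct (le_dec b b'); [right|left]; intros x Hx; apply chain; auto; lia.
Qed.

Theorem proposition2p1
  (l : nat) (hl : (1 <= l)%nat)
  (lo hi e0 : R) (hI : lo < hi) (he0 : 0 < e0)
  (a : nat -> R -> R -> C)
  (ha : standing_assumptions l lo hi e0 a)
  (lam : nat -> R -> C)
  (hlam_smooth : forall m, (1 <= m <= l)%nat -> smooth_on lo hi (lam m))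
  (hlam_roots : forall x, lo <= x <= hi -> forall z : C,
     char_poly l a x z = RtoC 0 <-> exists m, (1 <= m <= l)%nat /\ z = lam m x)
  (hlam_simple : forall m n, (1 <= m <= l)%nat -> (1 <= n <= l)%nat -> m <> n ->
     Rbar_lt 0 (inf_on lo hi (fun x => Cmod (lam m x - lam n x)%C)))
  (P : nat) (lft rgt : nat -> R)
  (hpieces : forall p, (1 <= p <= P)%nat -> lft p <= rgt p)
  (hcover : forall x, lo <= x <= hi <->
     exists p, (1 <= p <= P)%nat /\ lft p <= x <= rgt p)
  (hnonoverlap : forall p q, (1 <= p <= P)%nat -> (1 <= q <= P)%nat -> p <> q ->
     Rmin (rgt p) (rgt q) <= Rmax (lft p) (lft q))
  (horder : forall p, (1 <= p <= P)%nat ->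
     exists i : nat -> nat, Permutation (map i (seq 1 l)) (seq 1 l) /\
       forall x, lft p <= x <= rgt p ->
       forall n, (1 <= n < l)%nat ->
         Cmod (lam (i n) x) <= Cmod (lam (i (S n)) x)) :
  exists e' : R, 0 < e' <= e0 /\
  exists F : nat -> R -> R -> C,
    (forall m, (1 <= m <= l)%nat -> smooth_on_rect lo hi e' (F m)) /\
    (forall eps, 0 < eps <= e' ->
       fundamental_set l a eps lo hi P lft rgt (fun m => wkb_seq (F m) eps)).
Proof.
  (* With order S d the modes are numbered 0, ..., d, against 1, ..., l in the statement; [S] and
     [pred] translate. *)
  destruct l as [|d]; [lia|]. destruct ha as (Ha & _ & Ha0 & Hal).
  (* Coefficients and roots are replaced by functions smooth on the whole strip that agree with them
     over I. *)
  assert (Ea : forall j, exists b : R -> R -> C, csm b /\ ((j <= S d)%nat ->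
    forall x y, lo <= x <= hi -> 0 <= y <= e0 -> b x y = a j x y)).
  { intros j. destruct (le_dec j (S d)) as [hj|hj].
    - destruct (smooth_on_rect_extend lo hi e0 (a j) hI he0 (Ha j hj)) as (b & Sb & Hb). exists b. auto.
    - exists (fun _ _ => RtoC 0). split; [apply csm_const|]. intros; lia. }
  destruct (choose _ Ea) as [b Hb]. clear Ea.
  assert (Ez : forall n, exists z : R -> C, csm (fun x _ => z x) /\ ((n < S d)%nat ->
    forall x, lo <= x <= hi -> z x = lam (S n) x)).
  { intros n. destruct (lt_dec n (S d)) as [hn|hn].
    - destruct (smooth_on_extend lo hi (lam (S n)) hI (hlam_smooth (S n) ltac:(lia))) as (z & Sz & Hz). exists z. auto.
    - exists (fun _ => RtoC 0). split; [apply csm_const|]. intros; lia. }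
  destruct (choose _ Ez) as [z Hz]. clear Ez.
  assert (Hin : forall p, (1 <= p <= P)%nat -> lo <= lft p /\ lft p <= rgt p /\ rgt p <= hi).
  { intros p hp. specialize (hpieces p hp).
    assert (lo <= lft p <= hi) by (apply hcover; exists p; split; [assumption|lra]).
    assert (lo <= rgt p <= hi) by (apply hcover; exists p; split; [assumption|lra]). lra. }
  assert (bpos : forall (f : R -> C), Rbar_lt 0 (inf_on lo hi (fun x => Cmod (f x))) ->
    forall x, lo <= x <= hi -> f x <> RtoC 0).
  { intros f Hf x Hx e. destruct (inf_on_pos _ _ _ Hf) as (c & c0 & Hc). specialize (Hc x Hx).
    rewrite e, Cmod_0 in Hc. lra. }
  assert (Root : forall x, lo <= x <= hi -> forall n, (n < S d)%nat -> peval (S d) (fun j => b j x 0) (z n x) = RtoC 0).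
  { intros x Hx n hn. transitivity (char_poly (S d) a x (lam (S n) x)).
    - unfold char_poly. rewrite sum_n_csum. apply csum_ext. intros j hj.
      rewrite (proj2 (Hb j)), (proj2 (Hz n)) by (auto; lra || lia). reflexivity.
    - apply hlam_roots; [assumption|]. exists (S n). split; [lia|reflexivity]. }
  destruct (fundamental_modes d b lo hi z hI (fun j => proj1 (Hb j)) (fun n => proj1 (Hz n)) Root) with (P := P) (lft := lft) (rgt := rgt)
    as (G & e & SG & He & HG).
  - intros x Hx m n hm hn ne. rewrite (proj2 (Hz m)), (proj2 (Hz n)) by assumption.
    intros q. apply (bpos _ (hlam_simple (S m) (S n) ltac:(lia) ltac:(lia) ltac:(lia)) x Hx). rewrite q. ring.
  - intros x Hx. rewrite (proj2 (Hb (S d))) by (auto; lra). now apply (bpos (fun x => a (S d) x 0)).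
  (* A root 0 would make a_0(x, 0) vanish. *)
  - intros x Hx n hn q. apply (bpos _ Ha0 x Hx). rewrite <- (proj2 (Hb O)) by (auto; lra || lia).
    rewrite <- (Root x Hx n hn), q. unfold peval. rewrite (csum_single (S (S d)) O); [simpl; ring|lia|].
    intros j _ ne. destruct j as [|j]; [lia|]. rewrite Cpow_S. ring.
  - exact Hin.
  - exact hnonoverlap.
  - intros p hp m n hm hn. destruct (horder p hp) as (i & Pm & mono). destruct (Hin p hp) as (p1 & p2 & p3).
    destruct (permutation_comparable (S d) i (fun m x => Cmod (lam m x)) (fun x => lft p <= x <= rgt p) Pm mono (S m) (S n) ltac:(lia) ltac:(lia))
      as [H|H]; [left|right]; intros x Hx; rewrite (proj2 (Hz m)), (proj2 (Hz n)) by (assumption || lra); auto.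
  (* Halving e turns the strict condition y < e into one valid on the closed range up to e'. *)
  - exists (Rmin e0 (e / 2)). assert (B : Rmin e0 (e / 2) <= e0 /\ 0 < Rmin e0 (e / 2) < e).
    { unfold Rmin. destruct (Rle_dec _ _); lra. }
    split; [lra|]. exists (fun m => G (pred m)). split.
    { intros m hm. apply csm_smooth_on_rect; [lra|apply SG]. }
    intros eps Heps. destruct (HG eps ltac:(lra)) as [H1 H2].
    (* On lattice points of I the extended coefficients are the given ones. *)
    assert (Tr : forall (v : Z -> C) k l' r', lo <= l' -> r' <= hi -> l' <= IZR k * eps <= r' ->
      sum_n (fun j => a j (IZR k * eps)%R eps * v (k + Z.of_nat j)%Z)%C (S d) =
      csum (S (S d)) (fun s => b s (IZR k * eps)%R eps * v (k + Z.of_nat s)%Z)%C).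
    { intros v k l' r' h1 h2 h3. rewrite sum_n_csum. apply csum_ext. intros s hs.
      rewrite (proj2 (Hb s)) by (lia || lra). reflexivity. }
    split.
    + intros m p hm hp k hk. destruct (Hin p hp) as (p1 & p2 & p3).
      pose proof (hk O ltac:(lia)) as k1. rewrite Z.add_0_r in k1. pose proof (hk (S d) ltac:(lia)) as k2.
      rewrite (Tr _ k (lft p) (rgt p)) by lra. apply (H1 (pred m) p); [lia|assumption|lra|lra].
    + intros y Hy.
      assert (A : forall p, exists K : nat -> C, (1 <= p <= P)%nat -> forall k, lft p <= IZR k * eps <= rgt p ->
        y k = csum (S d) (fun n => K n * wkb_seq (G n) eps k)%C).
      { intros p. destruct (excluded_middle_informative (1 <= p <= P)%nat) as [hp|hp]; [|exists (fun _ => RtoC 0); intros; contradiction].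
        destruct (Hin p hp) as (p1 & p2 & p3). destruct (H2 y p hp) as [K HK]; [|exists K; auto].
        intros k k1 k2.
        assert (In : forall j, (j <= S d)%nat -> lft p <= IZR (k + Z.of_nat j) * eps <= rgt p).
        { intros j hj. split.
          - eapply Rle_trans; [exact k1|]. apply Rmult_le_compat_r; [lra|]. apply IZR_le. lia.
          - eapply Rle_trans; [|exact k2]. apply Rmult_le_compat_r; [lra|]. apply IZR_le. lia. }
        pose proof (In O ltac:(lia)) as I0. rewrite Z.add_0_r in I0.
        rewrite <- (Tr y k (lft p) (rgt p)) by lra. apply Hy. intros j hj. specialize (In j hj). lra. }
      destruct (choose _ A) as [K HK]. exists (fun p m => K p (pred m)). intros p k hp hk.
      rewrite sum_n_m_csum. now apply HK.
Qed.
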